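(* Let $r_2,r_4\in\mathbb{Q}$ satisfy $$0\le-2r_2-5r_4<8,\qquad 0\le-r_4<8,\qquad(-2r_2-5r_4)+(-r_4)>8.$$ Let $D\in\mathbb{Z}_{\ge1}$ with $Dr_2,Dr_4\in2\mathbb{Z}$, let $\chi:\widetilde{\Gamma_0(4)}^D\to\mathbb{C}^\times$ be the character of $\eta(\tau)^{-2r_2-4r_4}\eta(2\tau)^{r_2}\eta(4\tau)^{r_4}$, $k=\frac12(-r_2-3r_4)$, and $$E_{I,k}(\tau;r_2,r_4)=\sum_{\gamma\in\langle\widetilde T\rangle\backslash\widetilde{\Gamma_0(4)}^D}\chi(\gamma)^{-1}\cdot(1|_k\gamma)(\tau).$$ Then $$\eta(\tau)^{-2r_2-4r_4}\eta(2\tau)^{r_2}\eta(4\tau)^{r_4}=\frac1{2D}E_{I,k}(\tau;r_2,r_4).$$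
   Context: $e(x)=\exp(2\pi ix)$, $q=e(\tau)$; $z^r=\exp(r\log z)$ with $-\pi<\operatorname{Im}\log z\le\pi$. $\widetilde{\Gamma_0(4)}^D$ is the group of pairs $(\gamma,\varepsilon(c\tau+d)^{1/D})$, $\gamma=\begin{pmatrix}a&b\\c&d\end{pmatrix}\in\Gamma_0(4)$, $\varepsilon^D=1$, with product $(\gamma_1,\phi_1)(\gamma_2,\phi_2)=(\gamma_1\gamma_2,\phi_1(\gamma_2\tau)\phi_2(\tau))$; $\widetilde\gamma=(\gamma,(c\tau+d)^{1/D})$; $T=\begin{pmatrix}1&1\\0&1\end{pmatrix}$; $(f|_k(\gamma,\phi))(\tau)=\phi(\tau)^{-Dk}f(\gamma\tau)$, so $1|_k(\gamma,\phi)=\phi^{-Dk}$. $\eta(\tau)=q^{1/24}\prod(1-q^n)$, $\eta(n\tau)^r=\exp(r\log\eta(n\tau))$ with $\log\eta(\tau)=\log\eta(i)+\int_i^\tau\eta'/\eta$, $\log\eta(i)$ real. Dedekind sum $s(h,c)=\sum_{r\bmod c}((r/c))((hr/c))$, $((x))=x-\lfloor x\rfloor-\frac12$ ($x\notin\mathbb{Z}$), $0$ otherwise; $\Psi\begin{pmatrix}a&b\\c&d\end{pmatrix}=\frac{a+d}c+12s(-d,c)-3$ ($c>0$), $\frac{a+d}c+12s(d,-c)+3$ ($c<0$), $b$ ($c=0,a>0$), $-b-6$ ($c=0,a<0$). Character of $\prod_{n\mid N}\eta(n\tau)^{r_n}$ ($Dr_n\in 2\mathbb{Z}$, $k_0=\frac12\sum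 r_n$): $\chi(\gamma,\varepsilon(c\tau+d)^{1/D})=\varepsilon^{-Dk_0}e\big(\frac1{24}\sum_{n\mid N}r_n\Psi\begin{pmatrix}a&bn\\c/n&d\end{pmatrix}\big)$. *)

(* Defs.v *)
From Stdlib Require Import Reals ZArith QArith Qreals List.
From Coquelicot Require Import Coquelicot.
Open Scope R_scope.

Definition cexp (z : C) : C :=
  (exp (Re z) * cos (Im z), exp (Re z) * sin (Im z)).

(* principal argument in (-pi, pi]  (atan2) *)
Definition carg (z : C) : R :=
  let x := Re z in let y := Im z in
  match Rlt_dec 0 x with
  | left _ => atan (y / x)
  | right _ =>
    match Rlt_dec x 0 with
    | left _ => match Rle_dec 0 y with
                | left _ => atan (y / x) + PI
                | right _ => atan (y / x) - PI
                end
    | right _ =>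
      match Rlt_dec 0 y with
      | left _ => PI / 2
      | right _ => match Rlt_dec y 0 with
                   | left _ => - (PI / 2)
                   | right _ => 0
                   end
      end
    end
  end.

Definition clog (z : C) : C := (ln (Cmod z), carg z).

Definition cpowr (z r : C) : C := cexp (r * clog z)%C.

Definition ee (x : C) : C := cexp (2 * PI * Ci * x)%C.

Definition upper (tau : C) : Prop := 0 < Im tau.

Definition cseries (a : nat -> C) : C :=
  (Series (fun n => Re (a n)), Series (fun n => Im (a n))).

(* log eta(tau) = 2 pi i tau/24 + sum_{n>=1} log(1 - q^n), the branch of
   log eta that is holomorphic on H and real at tau = i *)
Definition logeta (tau : C) : C :=
  (2 * PI * Ci * tau / 24 + cseries (fun n => clog (1 - Cpow (ee tau) (S n))))%C.

Definition etapow (n : R) (r : R) (tau : C) : C :=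
  cexp (RtoC r * logeta (RtoC n * tau))%C.

Definition sawZ (r c : Z) : R :=
  if Z.eqb (r mod c)%Z 0%Z then 0
  else IZR r / IZR c - IZR (r / c)%Z - / 2.

Definition dedekind_sum (h c : Z) : R :=
  fold_right Rplus 0
    (map (fun n : nat => sawZ (Z.of_nat n) c * sawZ (h * Z.of_nat n)%Z c)
         (seq 0 (Z.to_nat c))).

Definition Psi (a b c d : Z) : R :=
  if Z.ltb 0%Z c then IZR (a + d)%Z / IZR c + 12 * dedekind_sum (- d)%Z c - 3
  else if Z.ltb c 0%Z then IZR (a + d)%Z / IZR c + 12 * dedekind_sum d (- c)%Z + 3
  else if Z.ltb 0%Z a then IZR b
  else - IZR b - 6.

(* a pair (gamma, phi) with gamma = [[a b][c d]] and phi a function on H *)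
Record GElt := mkG { ga : Z; gb : Z; gc : Z; gd : Z; gphi : C -> C }.

Definition mobius (a b c d : Z) (tau : C) : C :=
  ((IZR a * tau + IZR b) / (IZR c * tau + IZR d))%C.

Definition gmul (g1 g2 : GElt) : GElt :=
  mkG (ga g1 * ga g2 + gb g1 * gc g2)%Z (ga g1 * gb g2 + gb g1 * gd g2)%Z
      (gc g1 * ga g2 + gd g1 * gc g2)%Z (gc g1 * gb g2 + gd g1 * gd g2)%Z
      (fun tau => (gphi g1 (mobius (ga g2) (gb g2) (gc g2) (gd g2) tau)
                   * gphi g2 tau)%C).

Definition gtilde (D : nat) (a b c d : Z) : GElt :=
  mkG a b c d (fun tau => cpowr (IZR c * tau + IZR d)%C (RtoC (/ INR D))).

(* T~^n = (T^n)~ , T^n = [[1 n][0 1]] *)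
Definition Tpow (D : nat) (n : Z) : GElt := gtilde D 1%Z n 0%Z 1%Z.

Definition inGt (D : nat) (g : GElt) : Prop :=
  (ga g * gd g - gb g * gc g = 1)%Z /\ Z.divide 4 (gc g) /\
  exists eps : C, Cpow eps D = 1%C /\
    forall tau, upper tau ->
      gphi g tau = (eps * cpowr (IZR (gc g) * tau + IZR (gd g))%C (RtoC (/ INR D)))%C.

Definition geq (g h : GElt) : Prop :=
  ga g = ga h /\ gb g = gb h /\ gc g = gc h /\ gd g = gd h /\
  forall tau, upper tau -> gphi g tau = gphi h tau.

Definition same_coset (D : nat) (g h : GElt) : Prop :=
  exists n : Z, geq h (gmul (Tpow D n) g).

Definition coset_reps (D : nat) (S : GElt -> Prop) : Prop :=
  (forall g, S g -> inGt D g) /\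
  (forall g, inGt D g -> exists h, S h /\ same_coset D g h) /\
  (forall g h, S g -> S h -> same_coset D g h -> g = h).

Definition lsum (f : GElt -> C) (L : list GElt) : C :=
  fold_right Cplus 0%C (map f L).

Definition is_usum (S : GElt -> Prop) (f : GElt -> C) (l : C) : Prop :=
  forall eps : R, 0 < eps ->
    exists L0 : list GElt, NoDup L0 /\ (forall g, In g L0 -> S g) /\
      forall L : list GElt, NoDup L -> (forall g, In g L -> S g) ->
        (forall g, In g L0 -> In g L) ->
        Cmod (lsum f L - l)%C < eps.

Definition r1R (r2 r4 : Q) : R := -2 * Q2R r2 - 4 * Q2R r4.

Definition eta_quot (r2 r4 : Q) (tau : C) : C :=
  (etapow 1 (r1R r2 r4) tau * etapow 2 (Q2R r2) tau * etapow 4 (Q2R r4) tau)%C.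

Definition k0R (r2 r4 : Q) : R := / 2 * (r1R r2 r4 + Q2R r2 + Q2R r4).

(* the epsilon of g = (gamma, eps (c tau + d)^(1/D)), read off at tau = i *)
Definition eps_of (D : nat) (g : GElt) : C :=
  (gphi g Ci / cpowr (IZR (gc g) * Ci + IZR (gd g))%C (RtoC (/ INR D)))%C.

Definition chi (D : nat) (r2 r4 : Q) (g : GElt) : C :=
  let a := ga g in let b := gb g in let c := gc g in let d := gd g in
  (cpowr (eps_of D g) (RtoC (- (INR D * k0R r2 r4))) *
   ee (RtoC (/ 24 * (r1R r2 r4 * Psi a b c d
                     + Q2R r2 * Psi a (b * 2)%Z (c / 2)%Z d
                     + Q2R r4 * Psi a (b * 4)%Z (c / 4)%Z d))))%C.

Definition slash1 (D : nat) (k : R) (g : GElt) (tau : C) : C :=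
  cpowr (gphi g tau) (RtoC (- (INR D * k))).

Definition eis_term (D : nat) (r2 r4 : Q) (g : GElt) (tau : C) : C :=
  (/ chi D r2 r4 g * slash1 D (/ 2 * (- Q2R r2 - 3 * Q2R r4)) g tau)%C.

(* Main.v *)
Require Import Defs.
From Stdlib Require Import Reals ZArith QArith Qreals List.
From Stdlib Require Import Lra Lia Classical ClassicalEpsilon FunctionalExtensionality PropExtensionality Permutation.
From Coquelicot Require Import Coquelicot.
Open Scope R_scope.

(** Let [f] be the eta quotient. The transformation law of [log eta] turns the term of the Eisenstein
    series at [gamma] into [f(tau) / f(gamma tau)], so the series is [D f(tau) g(tau)], where [g] is the
    sum of [1 / f(gamma tau)] over the coprime rows [(c, d)] with [4 | c]. The hypotheses on [r2, r4]
    say that the weight exceeds 2, so that [g] converges absolutely and is holomorphic and invariant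
    under [Gamma_0(4)], and that at the cusps 0 and 1/2 it grows more slowly than the inverse of the
    local parameter, so that its singularities there are removable. By the maximum principle [g] is
    constant, and its limit 2 at infinity comes from the two rows [(0, 1)] and [(0, -1)].

    For the inversion of [log eta], the logarithmic derivative is written as a double series over the
    lattice, and the two orders of summation are compared through a telescoping correction; the law for
    all of [SL_2(Z)] then follows from the reciprocity of Dedekind sums by descent on [c]. *)

(** * Limits and complex derivatives *)

(** With [x = -2 r2 - 5 r4] and [y = - r4], the numbers [x / 8] and [y / 8] are the orders of [f] at
    the cusps 0 and 1/2 in the local parameters, and [x + y = 4 k]. So [x, y < 8] says that [1 / f]
    has less than a simple pole at either cusp, and [x + y > 8] that [k > 2]. The exponent of
    [eta(tau)] is the one for which [f] has order 0 at infinity. Since the exponents are rational,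
    every statement about [f] is made for a logarithm: the law of [log eta] must hold exactly, not
    modulo [2 pi i], and the Dedekind sums fix the branch. The root of unity in a pair enters
    through its [-D k]-th power, which is multiplicative because [D k] is an integer, and cancels
    against the character; each bottom row is therefore counted [D] times. Contour integrals are
    replaced by means over a period of a 1-periodic function on the upper half-plane, which do not
    depend on the height. The same fact serves a disc, through the covering [s -> z0 + r e(s)], and
    a cusp, where it is used as it stands. *)

Definition tends {X : Type} (F : (X -> Prop) -> Prop) (f : X -> C) (l : C) : Prop :=
  forall eps, 0 < eps -> F (fun x => Cmod (f x - l) < eps).

(** Neighbourhoods contain their centre, so a limit along [nearC z] determines the value at [z], and
    limits compose ([tends_comp]) even where the inner function takes its limit value. *)
Definition nearC (z : C) (P : C -> Prop) : Prop :=
  exists d, 0 < d /\ forall w, Cmod (w - z) < d -> P w.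

(** Neighbourhoods of the cusp at infinity, uniform in the real part. *)
Definition upward (P : C -> Prop) : Prop := exists Y, forall w, Y < Im w -> P w.

Global Instance nearC_filter z : Filter (nearC z).
Proof.
  constructor.
  - exists 1; split; [lra | auto].
  - intros P Q [d [Hd H1]] [e [He H2]]. exists (Rmin d e).
    split; [apply Rmin_pos; auto |]. intros w Hw.
    split; [apply H1 | apply H2]; eapply Rlt_le_trans; eauto; [apply Rmin_l | apply Rmin_r].
  - intros P Q HPQ [d [Hd H1]]. exists d; auto.
Qed.

Global Instance upward_filter : Filter upward.
Proof.
  constructor.
  - exists 0; auto.
  - intros P Q [Y H1] [Z H2]. exists (Rmax Y Z). intros w Hw.
    pose proof (Rmax_l Y Z); pose proof (Rmax_r Y Z). split; [apply H1 | apply H2]; lra.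
  - intros P Q HPQ [Y H1]. exists Y; auto.
Qed.

Lemma Cmod_sub_sym (a b : C) : Cmod (a - b) = Cmod (b - a).
Proof. rewrite <- Cmod_opp. f_equal. ring. Qed.

Lemma Cmod_sub_tri (a b c : C) : Cmod (a - c) <= Cmod (a - b) + Cmod (b - c).
Proof. replace (a - c)%C with ((a - b) + (b - c))%C by ring. apply Cmod_triangle. Qed.

Lemma Cmod_le_sub (a b : C) : Cmod a <= Cmod b + Cmod (a - b).
Proof. replace a with (b + (a - b))%C at 1 by ring. apply Cmod_triangle. Qed.

Lemma Cmod_sub_0 (a b : C) : Cmod (a - b) = 0 -> a = b.
Proof. intros H. apply Cmod_eq_0 in H. replace a with ((a - b) + b)%C by ring. rewrite H; ring. Qed.

Lemma Cmod_small_eq (a b : C) : (forall eps, 0 < eps -> Cmod (a - b) < eps) -> a = b.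
Proof.
  intros H. apply Cmod_sub_0. destruct (Req_dec (Cmod (a - b)) 0) as [E | E]; auto.
  pose proof (Cmod_ge_0 (a - b)). specialize (H (Cmod (a - b))). lra.
Qed.

Lemma Im_le_Cmod (c : C) : Rabs (Im c) <= Cmod c.
Proof. eapply Rle_trans; [apply Rmax_r | apply Rmax_Cmod]. Qed.

Lemma Cmod_le_abs (c : C) : Cmod c <= Rabs (Re c) + Rabs (Im c).
Proof.
  replace c with (RtoC (Re c) + Ci * RtoC (Im c))%C at 1.
  - eapply Rle_trans; [apply Cmod_triangle |]. rewrite Cmod_mult, Cmod_Ci, !Cmod_R. lra.
  - destruct c; apply injective_projections; simpl; ring.
Qed.

Lemma Re_Cplus (a b : C) : Re (a + b) = Re a + Re b. Proof. reflexivity. Qed.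
Lemma Im_Cplus (a b : C) : Im (a + b) = Im a + Im b. Proof. reflexivity. Qed.
Lemma Re_Cminus (a b : C) : Re (a - b) = Re a - Re b. Proof. reflexivity. Qed.
Lemma Im_Cminus (a b : C) : Im (a - b) = Im a - Im b. Proof. reflexivity. Qed.
Section Limits.
Context {X : Type} (F : (X -> Prop) -> Prop) {FF : Filter F}.

Lemma tends_const (c : C) : tends F (fun _ => c) c.
Proof.
  intros e He. apply filter_imp with (fun _ => True); [| apply filter_true].
  intros _ _. replace (c - c)%C with (RtoC 0) by ring. rewrite Cmod_0; auto.
Qed.

Lemma tends_ext (f g : X -> C) l : F (fun x => f x = g x) -> tends F f l -> tends F g l.
Proof.
  intros H1 H2 e He. generalize (filter_and _ _ H1 (H2 e He)). apply filter_imp.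
  intros x [-> ?]; auto.
Qed.

Lemma tends_plus f g l m : tends F f l -> tends F g m -> tends F (fun x => f x + g x)%C (l + m)%C.
Proof.
  intros H1 H2 e He. assert (He2 : 0 < e / 2) by lra.
  generalize (filter_and _ _ (H1 _ He2) (H2 _ He2)). apply filter_imp.
  intros x [A B]. replace (f x + g x - (l + m))%C with ((f x - l) + (g x - m))%C by ring.
  eapply Rle_lt_trans; [apply Cmod_triangle | lra].
Qed.

Lemma tends_bounded f l : tends F f l -> F (fun x => Cmod (f x) <= Cmod l + 1).
Proof.
  intros H. generalize (H 1 ltac:(lra)). apply filter_imp. intros x Hx.
  pose proof (Cmod_le_sub (f x) l). lra.
Qed.

Lemma tends_mult f g l m : tends F f l -> tends F g m -> tends F (fun x => f x * g x)%C (l * m)%C.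
Proof.
  intros H1 H2 e He.
  set (B := Cmod l + Cmod m + 1).
  assert (HB : 1 <= B) by (unfold B; pose proof (Cmod_ge_0 l); pose proof (Cmod_ge_0 m); lra).
  assert (He2 : 0 < e / (2 * B)) by (apply Rdiv_lt_0_compat; lra).
  generalize (filter_and _ _ (tends_bounded f l H1) (filter_and _ _ (H1 _ He2) (H2 _ He2))).
  apply filter_imp. intros x [A [P Q]].
  replace (f x * g x - l * m)%C with (f x * (g x - m) + (f x - l) * m)%C by ring.
  eapply Rle_lt_trans; [apply Cmod_triangle |]. rewrite !Cmod_mult.
  assert (Cmod (f x) * Cmod (g x - m) <= B * Cmod (g x - m)).
  { apply Rmult_le_compat_r; [apply Cmod_ge_0 | unfold B; pose proof (Cmod_ge_0 m); lra]. }
  assert (Cmod (f x - l) * Cmod m <= Cmod (f x - l) * B).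
  { apply Rmult_le_compat_l; [apply Cmod_ge_0 | unfold B; pose proof (Cmod_ge_0 l); lra]. }
  assert (E : e = B * (e / (2 * B)) + (e / (2 * B)) * B) by (field; lra).
  assert (B * Cmod (g x - m) < B * (e / (2 * B))) by (apply Rmult_lt_compat_l; lra).
  assert (Cmod (f x - l) * B <= (e / (2 * B)) * B) by (apply Rmult_le_compat_r; lra).
  lra.
Qed.

Lemma tends_opp f l : tends F f l -> tends F (fun x => - f x)%C (- l)%C.
Proof.
  intros H e He. generalize (H e He). apply filter_imp. intros x Hx.
  replace (- f x - - l)%C with (- (f x - l))%C by ring. rewrite Cmod_opp; auto.
Qed.

Lemma tends_minus f g l m : tends F f l -> tends F g m -> tends F (fun x => f x - g x)%C (l - m)%C.
Proof. intros H1 H2. apply tends_plus; auto. apply tends_opp; auto. Qed.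

Lemma tends_neq_0 f l : tends F f l -> l <> 0%C -> F (fun x => Cmod l / 2 < Cmod (f x)).
Proof.
  intros H Hl. apply Cmod_gt_0 in Hl. generalize (H (Cmod l / 2) ltac:(lra)). apply filter_imp.
  intros x Hx. pose proof (Cmod_le_sub l (f x)). rewrite Cmod_sub_sym in H0. lra.
Qed.

Lemma tends_inv f l : tends F f l -> l <> 0%C -> tends F (fun x => / f x)%C (/ l)%C.
Proof.
  intros H Hl e He. pose proof (tends_neq_0 f l H Hl) as H0. apply Cmod_gt_0 in Hl as Hp.
  assert (He2 : 0 < e * (Cmod l * Cmod l / 2)) by (apply Rmult_lt_0_compat; nra).
  generalize (filter_and _ _ H0 (H _ He2)). apply filter_imp. intros x [A B].
  assert (Hx : f x <> 0%C) by (apply Cmod_gt_0; lra).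
  replace (/ f x - / l)%C with (- (f x - l) / (f x * l))%C by (field; auto).
  rewrite Cmod_div, Cmod_opp, Cmod_mult by (apply Cmult_neq_0; auto).
  apply Rmult_lt_reg_r with (Cmod (f x) * Cmod l); [nra |].
  unfold Rdiv. rewrite Rmult_assoc, Rinv_l by nra.
  assert (Cmod l / 2 * Cmod l <= Cmod (f x) * Cmod l) by nra. nra.
Qed.

Lemma tends_comp (f : X -> C) (h : C -> C) l m :
  tends F f l -> tends (nearC l) h m -> tends F (fun x => h (f x)) m.
Proof.
  intros H1 H2 e He. destruct (H2 e He) as [d [Hd Hw]].
  generalize (H1 d Hd). apply filter_imp. intros x Hx. apply Hw, Hx.
Qed.

Lemma tends_squeeze (f : X -> C) (g : X -> C) l :
  F (fun x => Cmod (f x - l) <= Cmod (g x)) -> tends F g 0%C -> tends F f l.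
Proof.
  intros H1 H2 e He. generalize (filter_and _ _ H1 (H2 e He)). apply filter_imp.
  intros x [A B]. replace (g x - 0)%C with (g x) in B by ring. lra.
Qed.

Lemma tends_unique f l m : (F (fun _ => False) -> False) -> tends F f l -> tends F f m -> l = m.
Proof.
  intros HF H1 H2. apply Cmod_small_eq. intros e He. apply NNPP. intros Hn. apply HF.
  assert (He2 : 0 < e / 2) by lra.
  generalize (filter_and _ _ (H1 _ He2) (H2 _ He2)).
  apply filter_imp. intros x [A B]. apply Hn.
  pose proof (Cmod_sub_tri l (f x) m). rewrite (Cmod_sub_sym (f x) l) in A. lra.
Qed.

Lemma tends_eq f l m : tends F f l -> l = m -> tends F f m.
Proof. intros H <-; auto. Qed.
End Limits.

Lemma tends_id (z : C) : tends (nearC z) (fun w => w) z.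
Proof. intros e He. exists e; auto. Qed.

Lemma tends_near_at (z : C) f l : tends (nearC z) f l -> f z = l.
Proof.
  intros H. apply Cmod_small_eq. intros e He. destruct (H e He) as [d [Hd Hw]].
  apply Hw. replace (z - z)%C with (RtoC 0) by ring. rewrite Cmod_0; auto.
Qed.

Lemma nearC_upper (z : C) (y : R) : y < Im z -> nearC z (fun w => y < Im w).
Proof.
  intros H. exists (Im z - y). split; [lra |]. intros w Hw.
  pose proof (Im_le_Cmod (w - z)). rewrite Im_Cminus in H0. apply Rabs_le_between in H0. lra.
Qed.

Lemma nearC_neq (z a : C) : z <> a -> nearC z (fun w => w <> a).
Proof.
  intros H. exists (Cmod (z - a)). split.
  - apply Cmod_gt_0. intro E. apply H. apply Cmod_sub_0. rewrite E. apply Cmod_0.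
  - intros w Hw E. subst. rewrite Cmod_sub_sym in Hw. lra.
Qed.

(* Caratheodory's form of differentiability; it makes the chain rule a composition of limits. *)
Definition Cd (F : C -> C) (z l : C) : Prop :=
  exists phi, nearC z (fun w => F w = F z + phi w * (w - z))%C /\ tends (nearC z) phi l.

Definition cts (F : C -> C) (z : C) : Prop := tends (nearC z) F (F z).

Lemma Cd_cts F z l : Cd F z l -> cts F z.
Proof.
  intros [phi [H1 H2]]. apply tends_ext with (fun w => F z + phi w * (w - z))%C; [apply nearC_filter | |].
  - generalize H1. apply filter_imp. auto.
  - apply tends_eq with (F z + l * (z - z))%C; [| ring].
    apply tends_plus; [apply nearC_filter | apply tends_const, nearC_filter |].
    apply tends_mult; [apply nearC_filter | auto |].
    apply tends_minus; [apply nearC_filter | apply tends_id | apply tends_const, nearC_filter].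
Qed.

Lemma Cd_ext F G z l : nearC z (fun w => F w = G w) -> Cd F z l -> Cd G z l.
Proof.
  intros H [phi [H1 H2]]. exists phi. split; auto.
  assert (E : F z = G z).
  { destruct H as [d [Hd Hw]]. apply Hw. replace (z - z)%C with (RtoC 0) by ring. rewrite Cmod_0; auto. }
  generalize (filter_and _ _ H H1). apply filter_imp. intros w [A B]. rewrite <- A, <- E; auto.
Qed.

Lemma Cd_const c z : Cd (fun _ => c) z 0%C.
Proof.
  exists (fun _ => 0%C). split; [| apply tends_const, nearC_filter].
  exists 1; split; [lra | intros; ring].
Qed.

Lemma Cd_id z : Cd (fun w => w) z 1%C.
Proof.
  exists (fun _ => 1%C). split; [| apply tends_const, nearC_filter].
  exists 1; split; [lra | intros; ring].
Qed.

Lemma Cd_plus F G z l m : Cd F z l -> Cd G z m -> Cd (fun w => F w + G w)%C z (l + m)%C.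
Proof.
  intros [p [H1 H2]] [q [H3 H4]]. exists (fun w => p w + q w)%C.
  split; [| apply tends_plus; auto; apply nearC_filter].
  generalize (filter_and _ _ H1 H3). apply filter_imp. intros w [-> ->]. ring.
Qed.

Lemma Cd_mult F G z l m :
  Cd F z l -> Cd G z m -> Cd (fun w => F w * G w)%C z (l * G z + F z * m)%C.
Proof.
  intros HF HG. pose proof (Cd_cts _ _ _ HG) as CG.
  destruct HF as [p [H1 H2]]. destruct HG as [q [H3 H4]].
  exists (fun w => p w * G w + F z * q w)%C. split.
  - generalize (filter_and _ _ H1 H3). apply filter_imp. intros w [A B].
    rewrite A. replace (p w * G w + F z * q w)%C with (p w * G w + F z * q w)%C by ring.
    rewrite B at 1. rewrite B. ring.
  - pose proof (nearC_filter z). apply tends_plus; auto; apply tends_mult; auto. apply tends_const; auto.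
Qed.

Lemma Cd_comp F G z l m : Cd F z l -> Cd G (F z) m -> Cd (fun w => G (F w)) z (m * l)%C.
Proof.
  intros HF [q [H3 H4]]. pose proof (Cd_cts _ _ _ HF) as CF.
  destruct HF as [p [H1 H2]]. pose proof (nearC_filter z).
  exists (fun w => q (F w) * p w)%C. split.
  - destruct H3 as [e [He H3]]. generalize (filter_and _ _ (CF e He) H1).
    apply filter_imp. intros w [A B]. rewrite (H3 _ A). rewrite B at 2. ring.
  - apply tends_mult; auto. apply tends_comp with (F z); auto.
Qed.

Lemma Cd_inv (z : C) : z <> 0%C -> Cd (fun w => / w)%C z (- / (z * z))%C.
Proof.
  intros Hz. exists (fun w => - / (w * z))%C. pose proof (nearC_filter z). split.
  - generalize (nearC_neq z 0%C Hz). apply filter_imp. intros w Hw. field; auto.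
  - apply tends_opp; auto. apply tends_inv; auto.
    + apply tends_mult; auto; [apply tends_id | apply tends_const; auto].
    + apply Cmult_neq_0; auto.
Qed.

Lemma Cd_opp F z l : Cd F z l -> Cd (fun w => - F w)%C z (- l)%C.
Proof.
  intros [p [H1 H2]]. exists (fun w => - p w)%C. pose proof (nearC_filter z). split; [| apply tends_opp; auto].
  revert H1. apply filter_imp. intros w ->. ring.
Qed.

Lemma Cd_minus F G z l m : Cd F z l -> Cd G z m -> Cd (fun w => F w - G w)%C z (l - m)%C.
Proof. intros. apply Cd_plus; auto. apply Cd_opp; auto. Qed.

Lemma Cd_scal c F z l : Cd F z l -> Cd (fun w => c * F w)%C z (c * l)%C.
Proof.
  intros H. replace (c * l)%C with (0 * F z + c * l)%C by ring.
  apply (Cd_mult (fun _ => c)); auto. apply Cd_const.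
Qed.

Lemma Cd_unique F z l m : Cd F z l -> Cd F z m -> l = m.
Proof.
  intros [p [H1 H2]] [q [H3 H4]]. apply Cmod_small_eq. intros e He.
  assert (He2 : 0 < e / 2) by lra.
  destruct (filter_and _ _ (filter_and _ _ H1 H3)
     (filter_and _ _ (H2 _ He2) (H4 _ He2))) as [d [Hd H]].
  (* A point different from [z]: only there does the defining equation determine the slope. *)
  destruct (H (z + RtoC (d / 2))%C) as [[A B] [P Q]].
  { replace (z + RtoC (d / 2) - z)%C with (RtoC (d / 2)) by ring.
    rewrite Cmod_R, Rabs_right; lra. }
  set (w := (z + RtoC (d / 2))%C) in *.
  assert (E : p w = q w).
  { assert (Hd2 : RtoC (d / 2) <> 0%C) by (intro E; apply RtoC_inj in E; lra).
    rewrite A in B.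
    replace (w - z)%C with (RtoC (d / 2)) in B by (unfold w; ring).
    apply (f_equal (fun u => (u - F z) / RtoC (d / 2))%C) in B.
    replace (p w) with ((F z + p w * RtoC (d / 2) - F z) / RtoC (d / 2))%C by (field; auto).
    rewrite B. field; auto. }
  rewrite E in P. pose proof (Cmod_sub_tri l (q w) m). rewrite (Cmod_sub_sym (q w) l) in P. lra.
Qed.

(** * Exponential and logarithm *)

Lemma cexp_add (a b : C) : cexp (a + b) = (cexp a * cexp b)%C.
Proof.
  unfold cexp. rewrite Re_Cplus, Im_Cplus, exp_plus, cos_plus, sin_plus.
  apply injective_projections; simpl; ring.
Qed.

Lemma cexp_0 : cexp 0 = 1%C.
Proof. unfold cexp; simpl. rewrite exp_0, cos_0, sin_0. apply injective_projections; simpl; ring. Qed.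

Lemma Cmod_cexp (z : C) : Cmod (cexp z) = exp (Re z).
Proof.
  assert (Cmod (cexp z) ^ 2 = exp (Re z) ^ 2).
  { rewrite Cmod2_alt. unfold cexp; simpl. pose proof (sin2_cos2 (Im z)). unfold Rsqr in H.
    replace (exp (Re z) * cos (Im z) * (exp (Re z) * cos (Im z) * 1) +
      exp (Re z) * sin (Im z) * (exp (Re z) * sin (Im z) * 1)) with
      (exp (Re z) * exp (Re z) * (sin (Im z) * sin (Im z) + cos (Im z) * cos (Im z))) by ring.
    rewrite H. ring. }
  pose proof (Cmod_ge_0 (cexp z)). pose proof (exp_pos (Re z)). nra.
Qed.

Lemma cexp_neq_0 (z : C) : cexp z <> 0%C.
Proof. apply Cmod_gt_0. rewrite Cmod_cexp. apply exp_pos. Qed.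

Lemma cexp_opp (z : C) : cexp (- z) = (/ cexp z)%C.
Proof.
  assert (cexp (- z) * cexp z = 1)%C.
  { rewrite <- cexp_add. replace (- z + z)%C with (RtoC 0) by ring. apply cexp_0. }
  replace (/ cexp z)%C with (cexp (- z) * cexp z / cexp z)%C.
  - field. apply cexp_neq_0.
  - rewrite H. field. apply cexp_neq_0.
Qed.

Lemma cexp_minus (a b : C) : cexp (a - b) = (cexp a / cexp b)%C.
Proof. unfold Cminus. rewrite cexp_add, cexp_opp. reflexivity. Qed.

(** Both sides come from [1 + x <= exp x], applied to [x] and to [- x]. *)
Lemma exp_bound (x : R) : Rabs x <= 1 / 2 -> Rabs (exp x - 1 - x) <= 2 * x ^ 2.
Proof.
  intros H. apply Rabs_le_between in H. pose proof (exp_ineq1_le x).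
  pose proof (exp_ineq1_le (- x)). rewrite exp_Ropp in H1.
  pose proof (exp_pos x).
  assert (exp x * (1 - x) <= 1).
  { apply Rmult_le_reg_l with (/ exp x); [apply Rinv_0_lt_compat; auto |].
    rewrite <- Rmult_assoc, Rinv_l; lra. }
  apply Rabs_le. split; nra.
Qed.

Lemma Rabs_sin_le (x : R) : Rabs (sin x) <= Rabs x.
Proof.
  destruct (Rtotal_order x 0) as [H | [-> | H]].
  - rewrite (Rabs_left x) by auto. pose proof (sin_gt_x x H).
    pose proof (sin_lt_x (- x) ltac:(lra)). pose proof (SIN_bound x).
    rewrite sin_neg in H1. destruct (Rle_dec x (-1)).
    + apply Rabs_le; lra.
    + apply Rabs_le. split; [lra |]. pose proof (sin_gt_0 (- x) ltac:(lra)).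
      pose proof PI2_3_2. rewrite sin_neg in H3. specialize (H3 ltac:(lra)). lra.
  - rewrite sin_0; lra.
  - rewrite (Rabs_right x) by lra. pose proof (sin_lt_x x H). pose proof (SIN_bound x).
    destruct (Rle_dec 1 x).
    + apply Rabs_le; lra.
    + apply Rabs_le. split; [| lra]. pose proof (sin_gt_0 x H). pose proof PI2_3_2.
      specialize (H2 ltac:(lra)). lra.
Qed.

Lemma cos_bound (x : R) : Rabs (cos x - 1) <= x ^ 2.
Proof.
  replace x with (2 * (x / 2)) at 1 by field. rewrite cos_2a_sin.
  pose proof (Rabs_sin_le (x / 2)). apply Rsqr_le_abs_1 in H. unfold Rsqr in H.
  apply Rabs_le. split; nra.
Qed.

Lemma sin_bound2 (x : R) : Rabs x <= 1 -> Rabs (sin x - x) <= x ^ 2.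
Proof.
  intros H. destruct (MVT_gen (fun t => sin t - t) 0 x (fun t => cos t - 1)) as [c [Hc E]].
  - intros t _. auto_derive; auto. ring.
  - intros t _. apply derivable_continuous_pt. apply derivable_pt_minus; [apply derivable_pt_sin | apply derivable_pt_id].
  - rewrite sin_0 in E. replace (sin x - x) with ((cos c - 1) * x) by lra.
    rewrite Rabs_mult. pose proof (cos_bound c). pose proof (Rabs_pos x).
    assert (Hcx : c ^ 2 <= x ^ 2).
    { destruct (Rle_dec 0 x); [rewrite Rmin_left, Rmax_right in Hc by lra | rewrite Rmin_right, Rmax_left in Hc by lra]; nra. }
    assert (Rabs (cos c - 1) * Rabs x <= x ^ 2 * 1) by (apply Rmult_le_compat; auto; [apply Rabs_pos | lra]).
    lra.
Qed.

Lemma Rabs_sq (x : R) : x ^ 2 = Rabs x * Rabs x.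
Proof. unfold Rabs. destruct (Rcase_abs x); ring. Qed.

(** The constant 10 is generous; only the quadratic order matters for the derivative of [cexp]. *)
Lemma cexp_bound (z : C) : Cmod z <= 1 / 2 -> Cmod (cexp z - 1 - z) <= 10 * Cmod z ^ 2.
Proof.
  intros H. pose proof (re_le_Cmod z) as Hx. pose proof (Im_le_Cmod z) as Hy.
  eapply Rle_trans; [apply Cmod_le_abs |].
  assert (E2 : Cmod z ^ 2 = Re z ^ 2 + Im z ^ 2) by apply Cmod2_alt.
  set (x := Re z) in *. set (y := Im z) in *.
  replace (Re (cexp z - 1 - z)) with ((exp x - 1 - x) + exp x * (cos y - 1)) by (unfold cexp, x, y; rewrite !Re_Cminus; simpl; ring).
  replace (Im (cexp z - 1 - z)) with ((exp x - 1) * sin y + (sin y - y)) by (unfold cexp, x, y; rewrite !Im_Cminus; simpl; ring).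
  pose proof (exp_bound x ltac:(lra)) as B1. pose proof (cos_bound y) as B2.
  pose proof (Rabs_sin_le y) as B3. pose proof (sin_bound2 y ltac:(lra)) as B4.
  assert (B5 : Rabs (exp x - 1) <= 2 * Rabs x).
  { replace (exp x - 1) with ((exp x - 1 - x) + x) by ring.
    eapply Rle_trans; [apply Rabs_triang |].
    assert (x ^ 2 = Rabs x * Rabs x) by apply Rabs_sq.
    pose proof (Rabs_pos x). nra. }
  assert (B6 : exp x <= 2).
  { apply Rabs_le_between in B5. assert (2 * Rabs x <= 1) by lra. lra. }
  pose proof (exp_pos x). pose proof (Rabs_pos (cos y - 1)).
  eapply Rle_trans; [apply Rplus_le_compat; apply Rabs_triang |].
  rewrite !Rabs_mult, (Rabs_right (exp x)) by lra.
  pose proof (Rabs_pos x). pose proof (Rabs_pos y). pose proof (Rabs_pos (sin y)). pose proof (Rabs_pos (exp x - 1)).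
  assert (Rabs (exp x - 1) * Rabs (sin y) <= 2 * Rabs x * Rabs y) by (apply Rmult_le_compat; auto).
  assert (2 * Rabs x * Rabs y <= x ^ 2 + y ^ 2).
  { assert (x ^ 2 = Rabs x * Rabs x) by apply Rabs_sq.
    assert (y ^ 2 = Rabs y * Rabs y) by apply Rabs_sq.
    pose proof (Rle_0_sqr (Rabs x - Rabs y)) as Q. unfold Rsqr in Q. lra. }
  assert (exp x * Rabs (cos y - 1) <= 2 * y ^ 2) by (apply Rmult_le_compat; auto; lra).
  rewrite E2. nra.
Qed.

Lemma Cd_cexp (z : C) : Cd cexp z (cexp z).
Proof.
  (* The slope needs the right value at [w = z] as well, since [nearC z] contains [z]. *)
  exists (fun w => match excluded_middle_informative (w = z) with
    | left _ => cexp z | right _ => (cexp w - cexp z) / (w - z) end)%C.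
  split.
  - exists 1. split; [lra |]. intros w _. destruct (excluded_middle_informative (w = z)) as [-> | H].
    + ring.
    + field. intro E. apply H. apply Cmod_sub_0. rewrite E. apply Cmod_0.
  - intros e He. pose proof (exp_pos (Re z)).
    exists (Rmin (1 / 2) (e / (11 * exp (Re z)))). split.
    { apply Rmin_pos; [lra |]. apply Rdiv_lt_0_compat; lra. }
    intros w Hw. destruct (excluded_middle_informative (w = z)) as [-> | Hn].
    { replace (cexp z - cexp z)%C with (RtoC 0) by ring. rewrite Cmod_0; auto. }
    assert (Hnz : (w - z)%C <> 0%C).
    { intro E. apply Hn. apply Cmod_sub_0. rewrite E. apply Cmod_0. }
    set (h := (w - z)%C) in *.
    assert (E : cexp w = (cexp z * cexp h)%C).
    { rewrite <- cexp_add. f_equal. unfold h; ring. }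
    rewrite E. replace ((cexp z * cexp h - cexp z) / h - cexp z)%C
      with (cexp z * (cexp h - 1 - h) / h)%C by (field; auto).
    rewrite Cmod_div, Cmod_mult, Cmod_cexp by auto.
    apply Cmod_gt_0 in Hnz. pose proof (Rmin_l (1/2) (e / (11 * exp (Re z)))).
    pose proof (Rmin_r (1/2) (e / (11 * exp (Re z)))).
    pose proof (cexp_bound h ltac:(lra)) as B.
    apply Rmult_lt_reg_r with (Cmod h); auto. unfold Rdiv. rewrite Rmult_assoc, Rinv_l by lra.
    assert (Cmod h < e / (11 * exp (Re z))) by lra.
    assert (Cmod h * (11 * exp (Re z)) < e).
    { apply Rmult_lt_reg_r with (/ (11 * exp (Re z))); [apply Rinv_0_lt_compat; lra |].
      rewrite Rmult_assoc, Rinv_r by lra. unfold Rdiv in H2. lra. }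
    assert (exp (Re z) * Cmod (cexp h - 1 - h) <= exp (Re z) * (10 * Cmod h ^ 2)).
    { apply Rmult_le_compat_l; lra. }
    nra.
Qed.

Lemma Cd_ee (z : C) : Cd ee z (2 * PI * Ci * ee z)%C.
Proof.
  replace (2 * PI * Ci * ee z)%C with (ee z * (2 * PI * Ci * 1))%C by ring.
  apply (Cd_comp (fun w => 2 * PI * Ci * w)%C cexp); [apply Cd_scal, Cd_id | apply Cd_cexp].
Qed.

Lemma ee_add (a b : C) : ee (a + b) = (ee a * ee b)%C.
Proof. unfold ee. rewrite <- cexp_add. f_equal. ring. Qed.

Lemma ee_0 : ee 0 = 1%C.
Proof. unfold ee. replace (2 * PI * Ci * 0)%C with (RtoC 0) by ring. apply cexp_0. Qed.

Lemma ee_opp (z : C) : ee (- z) = (/ ee z)%C.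
Proof. unfold ee. rewrite <- cexp_opp. f_equal. ring. Qed.

Lemma ee_minus (a b : C) : ee (a - b) = (ee a / ee b)%C.
Proof. unfold Cminus. rewrite ee_add, ee_opp. reflexivity. Qed.

Lemma ee_neq_0 (z : C) : ee z <> 0%C. Proof. apply cexp_neq_0. Qed.

Lemma Cmod_ee (z : C) : Cmod (ee z) = exp (- (2 * PI * Im z)).
Proof. unfold ee. rewrite Cmod_cexp. f_equal. unfold Re, Im. simpl. ring. Qed.

Lemma ee_INR (n : nat) : ee (RtoC (INR n)) = 1%C.
Proof.
  unfold ee, cexp. replace (Re (2 * PI * Ci * RtoC (INR n))) with 0 by (simpl; ring).
  replace (Im (2 * PI * Ci * RtoC (INR n))) with (0 + 2 * INR n * PI) by (simpl; ring).
  rewrite exp_0, cos_period, sin_period, cos_0, sin_0. apply injective_projections; simpl; ring.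
Qed.

Lemma ee_IZR (n : Z) : ee (RtoC (IZR n)) = 1%C.
Proof.
  destruct (Z_le_gt_dec 0 n).
  - rewrite <- (Z2Nat.id n), <- INR_IZR_INZ by auto. apply ee_INR.
  - replace (RtoC (IZR n)) with (- RtoC (IZR (- n)))%C by (rewrite opp_IZR, RtoC_opp; ring).
    rewrite ee_opp. rewrite <- (Z2Nat.id (- n)), <- INR_IZR_INZ by lia. rewrite ee_INR. field.
Qed.

Lemma ee_period (z : C) (n : Z) : ee (z + RtoC (IZR n)) = ee z.
Proof. rewrite ee_add, ee_IZR. ring. Qed.

Lemma ee_nat_mult (z : C) (n : nat) : ee (RtoC (INR n) * z) = (ee z ^ n)%C.
Proof.
  induction n as [| n IH].
  - simpl. replace (0 * z)%C with (RtoC 0) by ring. apply ee_0.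
  - rewrite S_INR, RtoC_plus, Cpow_S, <- IH, <- ee_add. f_equal. ring.
Qed.

Lemma Cmod_ee_lt_1 (z : C) : 0 < Im z -> Cmod (ee z) < 1.
Proof.
  intros H. rewrite Cmod_ee, <- exp_0. apply exp_increasing. pose proof PI_RGT_0. nra.
Qed.

Lemma tends_up_ee : tends upward ee 0%C.
Proof.
  intros e He. exists (- ln e / (2 * PI)). intros w Hw.
  replace (ee w - 0)%C with (ee w) by ring. rewrite Cmod_ee. pose proof PI_RGT_0.
  rewrite <- (exp_ln e) by auto. apply exp_increasing.
  apply (Rmult_lt_compat_r (2 * PI)) in Hw; [| lra]. unfold Rdiv in Hw.
  rewrite Rmult_assoc, Rinv_l in Hw by lra. lra.
Qed.

Lemma Cmod_pos_Re (z : C) : 0 < Re z -> 0 < Cmod z.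
Proof. intros. pose proof (re_le_Cmod z). rewrite Rabs_right in H0 by lra. lra. Qed.

Lemma carg_spec (z : C) : z <> 0%C ->
  Re z = Cmod z * cos (carg z) /\ Im z = Cmod z * sin (carg z) /\ - PI < carg z <= PI.
Proof.
  intros Hz. apply Cmod_gt_0 in Hz as Hp.
  assert (E2 : Cmod z ^ 2 = Re z ^ 2 + Im z ^ 2) by apply Cmod2_alt.
  unfold carg. set (x := Re z) in *. set (y := Im z) in *. set (r := Cmod z) in *.
  pose proof PI_RGT_0.
  (* Off the imaginary axis [carg] is this arctangent shifted by 0 or by [PI] up or down, so these
     two values serve all quadrants. *)
  assert (AT : x <> 0 -> cos (atan (y / x)) = Rabs x / r /\ sin (atan (y / x)) = (y / x) * (Rabs x / r)).
  { intros Hx. assert (HA : 0 < Rabs x) by (apply Rabs_pos_lt; auto).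
    assert (Hs : sqrt (1 + (y / x)²) = r / Rabs x).
    { apply Rsqr_inj; [apply sqrt_pos | apply Rlt_le, Rdiv_lt_0_compat; auto |].
      rewrite Rsqr_sqrt by (pose proof (Rle_0_sqr (y / x)); lra).
      unfold Rsqr. replace (r / Rabs x * (r / Rabs x)) with (r ^ 2 / (Rabs x * Rabs x)) by (field; lra).
      rewrite E2. replace (Rabs x * Rabs x) with (x * x); [field; auto |].
      rewrite <- Rabs_mult, Rabs_right; nra. }
    rewrite cos_atan, sin_atan, Hs. split; field; split; lra. }
  destruct (Rlt_dec 0 x) as [H1 | H1].
  - destruct (AT ltac:(lra)) as [-> ->]. rewrite Rabs_right by lra. pose proof (atan_bound (y / x)).
    repeat split; try lra; field; lra.
  - destruct (Rlt_dec x 0) as [H2 | H2].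
    + destruct (AT ltac:(lra)) as [Ac As]. rewrite Rabs_left in Ac, As by lra. pose proof (atan_bound (y / x)).
      destruct (Rle_dec 0 y) as [H3 | H3].
      * rewrite neg_cos, neg_sin, Ac, As. repeat split; try lra; try (field; lra).
        assert (y / x <= 0). { unfold Rdiv. assert (/ x < 0) by (apply Rinv_lt_0_compat; auto). nra. }
        assert (atan (y / x) <= 0). { rewrite <- atan_0. destruct H4 as [H4 | ->]; [left; apply atan_increasing; auto | lra]. }
        lra.
      * assert (Ec : cos (atan (y / x) - PI) = - cos (atan (y / x))) by (rewrite cos_minus, cos_PI, sin_PI; ring).
        assert (Es : sin (atan (y / x) - PI) = - sin (atan (y / x))) by (rewrite sin_minus, cos_PI, sin_PI; ring).
        rewrite Ec, Es, Ac, As. repeat split; try lra; try (field; lra).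
        assert (0 < y / x). { unfold Rdiv. assert (/ x < 0) by (apply Rinv_lt_0_compat; auto). nra. }
        assert (0 < atan (y / x)). { rewrite <- atan_0. apply atan_increasing; auto. }
        lra.
    + assert (x = 0) by lra. destruct (Rlt_dec 0 y).
      * rewrite cos_PI2, sin_PI2. repeat split; try lra; nra.
      * destruct (Rlt_dec y 0).
        -- rewrite cos_neg, sin_neg, cos_PI2, sin_PI2. repeat split; try lra; nra.
        -- exfalso. assert (y = 0) by lra. nra.
Qed.

Lemma cexp_clog (z : C) : z <> 0%C -> cexp (clog z) = z.
Proof.
  intros Hz. destruct (carg_spec z Hz) as [A [B _]]. unfold cexp, clog; simpl.
  rewrite exp_ln by (apply Cmod_gt_0; auto). apply injective_projections; simpl; symmetry; auto.
Qed.

Lemma cexp_eq_1 (w : C) : cexp w = 1%C -> exists n : Z, w = (2 * PI * Ci * RtoC (IZR n))%C.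
Proof.
  intros H. assert (E : exp (Re w) = 1) by (rewrite <- Cmod_cexp, H; apply Cmod_1).
  unfold cexp in H. rewrite E in H. injection H as Hc Hs.
  assert (Hr : Re w = 0) by (apply exp_inv; rewrite E, exp_0; auto).
  assert (Hs2 : sin (Im w / 2) = 0).
  { assert (cos (Im w) = 1) by lra. replace (Im w) with (2 * (Im w / 2)) in H by field.
    rewrite cos_2a_sin in H. nra. }
  destruct (sin_eq_0_0 _ Hs2) as [k Hk]. exists k.
  destruct w as [x y]; simpl in *. apply injective_projections; simpl; [rewrite Hr; ring |].
  assert (y = 2 * (y / 2)) by field. rewrite H, Hk. ring.
Qed.

(** The way identities between logarithms are proved below: exponentiate, then check that the
    imaginary parts are less than one period apart. *)
Lemma cexp_inj_Im (a b : C) : cexp a = cexp b -> Rabs (Im a - Im b) < 2 * PI -> a = b.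
Proof.
  intros H Hi. destruct (cexp_eq_1 (a - b)) as [n Hn].
  { rewrite cexp_minus, H. field. apply cexp_neq_0. }
  assert (E : Im a - Im b = 2 * PI * IZR n).
  { rewrite <- Im_Cminus, Hn. simpl. ring. }
  rewrite E in Hi. pose proof PI_RGT_0. rewrite Rabs_mult, Rabs_right in Hi by lra.
  assert (Rabs (IZR n) < 1) by (apply Rmult_lt_reg_l with (2 * PI); lra).
  rewrite <- abs_IZR in H1. apply lt_IZR in H1. assert (n = 0)%Z by lia. subst n.
  replace a with ((a - b) + b)%C by ring. rewrite Hn. ring.
Qed.

Lemma clog_unique (z w : C) : cexp w = z -> - PI < Im w <= PI -> clog z = w.
Proof.
  intros H Hi. assert (Hz : z <> 0%C) by (rewrite <- H; apply cexp_neq_0).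
  apply cexp_inj_Im; [rewrite cexp_clog, H; auto |].
  destruct (carg_spec z Hz) as [_ [_ ?]]. change (Im (clog z)) with (carg z).
  apply Rabs_lt_between. lra.
Qed.

Lemma clog_Re_pos (z : C) : 0 < Re z -> clog z = (ln (Cmod z), atan (Im z / Re z)).
Proof. intros H. unfold clog, carg. destruct (Rlt_dec 0 (Re z)); [auto | lra]. Qed.

Lemma cts_clog (z : C) : 0 < Re z -> cts clog z.
Proof.
  intros Hz. assert (Hm := Cmod_pos_Re z Hz).
  assert (C1 : continuity_pt ln (Cmod z)) by (apply derivable_continuous_pt; exists (/ Cmod z); apply derivable_pt_lim_ln; auto).
  assert (C2 : continuity_pt atan (Im z / Re z)) by (apply derivable_continuous_pt, derivable_pt_atan).
  intros e He.
  destruct (C1 (e / 2) ltac:(lra)) as [d1 [Hd1 D1]]. destruct (C2 (e / 2) ltac:(lra)) as [d2 [Hd2 D2]].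
  assert (L1 : nearC z (fun w => Rabs (Cmod w - Cmod z) < d1)).
  { exists d1. split; auto. intros w Hw. pose proof (Cmod_le_sub w z). pose proof (Cmod_le_sub z w).
    rewrite (Cmod_sub_sym z w) in H0. apply Rabs_lt_between. lra. }
  assert (L2 : nearC z (fun w => Rabs (Im w / Re w - Im z / Re z) < d2)).
  { assert (LL : tends (nearC z) (fun w => RtoC (Im w) / RtoC (Re w))%C (RtoC (Im z) / RtoC (Re z))%C).
    { pose proof (nearC_filter z). apply tends_mult; auto.
      - intros ee0 He0. exists ee0; split; auto. intros w Hw. rewrite <- RtoC_minus, Cmod_R, <- Im_Cminus.
        eapply Rle_lt_trans; [apply Im_le_Cmod | auto].
      - apply tends_inv; auto; [| intro E; apply RtoC_inj in E; lra].
        intros ee0 He0. exists ee0; split; auto. intros w Hw. rewrite <- RtoC_minus, Cmod_R, <- Re_Cminus.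
        eapply Rle_lt_trans; [apply re_le_Cmod | auto]. }
    assert (LR : nearC z (fun w => 0 < Re w)).
    { exists (Re z). split; auto. intros w Hw. pose proof (re_le_Cmod (w - z)). rewrite Re_Cminus in H.
      apply Rabs_le_between in H. lra. }
    generalize (filter_and _ _ LR (LL d2 Hd2)). apply filter_imp. intros w [A B].
    rewrite <- !RtoC_div, <- RtoC_minus, Cmod_R in B by lra. auto. }
  assert (LR : nearC z (fun w => 0 < Re w)).
  { exists (Re z). split; auto. intros w Hw. pose proof (re_le_Cmod (w - z)). rewrite Re_Cminus in H.
    apply Rabs_le_between in H. lra. }
  generalize (filter_and _ _ LR (filter_and _ _ L1 L2)). apply filter_imp. intros w [A [B D]].
  rewrite !clog_Re_pos by auto. eapply Rle_lt_trans; [apply Cmod_le_abs |]. simpl.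
  assert (Rabs (ln (Cmod w) - ln (Cmod z)) < e / 2).
  { destruct (Req_dec (Cmod w) (Cmod z)) as [-> | Hn]; [rewrite Rminus_diag_eq, Rabs_R0 by auto; lra |].
    apply D1. split; [split; [exact I | auto] | auto]. }
  assert (Rabs (atan (Im w / Re w) - atan (Im z / Re z)) < e / 2).
  { destruct (Req_dec (Im w / Re w) (Im z / Re z)) as [-> | Hn]; [rewrite Rminus_diag_eq, Rabs_R0 by auto; lra |].
    apply D2. split; [split; [exact I | auto] | auto]. }
  unfold Rminus in *. lra.
Qed.

(** Derivative of an inverse function: the slope of [cexp] at [clog z], evaluated at [clog w], is
    inverted. *)
Lemma Cd_clog (z : C) : 0 < Re z -> Cd clog z (/ z)%C.
Proof.
  intros Hz. assert (Hm := Cmod_pos_Re z Hz). assert (Hz0 : z <> 0%C) by (apply Cmod_gt_0; auto).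
  pose proof (nearC_filter z).
  destruct (Cd_cexp (clog z)) as [psi [[d [Hd H1]] H2]]. rewrite cexp_clog in H2 by auto.
  assert (L : tends (nearC z) (fun w => psi (clog w)) z) by (apply tends_comp with (clog z); auto; apply cts_clog; auto).
  exists (fun w => / psi (clog w))%C. split; [| apply tends_inv; auto].
  generalize (filter_and _ _ (nearC_neq z 0%C Hz0) (filter_and _ _ (cts_clog z Hz d Hd) (tends_neq_0 _ _ _ L Hz0))).
  apply filter_imp. intros w [A [B D]].
  specialize (H1 _ B). rewrite !cexp_clog in H1 by auto.
  assert (psi (clog w) <> 0%C) by (apply Cmod_gt_0; lra).
  assert (E : (w - z = psi (clog w) * (clog w - clog z))%C).
  { transitivity ((z + psi (clog w) * (clog w - clog z)) - z)%C; [rewrite <- H1; auto | ring]. }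
  rewrite E. field; auto.
Qed.

(** * Mean values of periodic holomorphic functions *)

Lemma Re_mult_le (u z : C) : Rabs (Re (u * z)) <= Cmod u * Cmod z.
Proof. rewrite <- Cmod_mult. apply re_le_Cmod. Qed.

Lemma Re_conj_mult (z : C) : Re (Cconj z * z) = Cmod z ^ 2.
Proof. rewrite Cmod2_alt. unfold Cconj, Re, Im. simpl. ring. Qed.

(** Mean value arguments and integrals are carried out on the real functions [Re (u * F)] along a
    line; letting [u] vary, or choosing it well, recovers the complex statement. *)
Lemma Cd_line F (u v z l : C) (t : R) :
  Cd F (z + RtoC t * v)%C l ->
  is_derive (fun s : R => Re (u * F (z + RtoC s * v)%C)) t (Re (u * (l * v))).
Proof.
  intros [phi [[d [Hd H1]] H2]]. apply is_derive_Reals. intros e He.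
  assert (Hb : 0 < Cmod u * Cmod v + 1) by (pose proof (Cmod_ge_0 u); pose proof (Cmod_ge_0 v); nra).
  destruct (H2 (e / (Cmod u * Cmod v + 1)) ltac:(apply Rdiv_lt_0_compat; auto)) as [d2 [Hd2 H3]].
  assert (Hv : 0 < Cmod v + 1) by (pose proof (Cmod_ge_0 v); lra).
  assert (Hmin : 0 < Rmin d d2 / (Cmod v + 1)) by (apply Rdiv_lt_0_compat; auto; apply Rmin_pos; auto).
  exists (mkposreal _ Hmin). intros h Hh0 Hh. simpl in Hh.
  set (p := (z + RtoC t * v)%C) in *.
  assert (E : (z + RtoC (t + h) * v - p)%C = (RtoC h * v)%C).
  { unfold p. rewrite RtoC_plus. ring. }
  assert (B : Cmod (z + RtoC (t + h) * v - p) < Rmin d d2).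
  { rewrite E, Cmod_mult, Cmod_R. pose proof (Cmod_ge_0 v). pose proof (Rabs_pos h).
    apply Rle_lt_trans with (Rabs h * (Cmod v + 1)); [nra |].
    apply (Rmult_lt_compat_r (Cmod v + 1)) in Hh; auto. unfold Rdiv in Hh.
    rewrite Rmult_assoc, Rinv_l in Hh by lra. lra. }
  pose proof (Rmin_l d d2). pose proof (Rmin_r d d2).
  set (w := (z + RtoC (t + h) * v)%C) in *.
  rewrite (H1 w) by lra. specialize (H3 w ltac:(lra)). rewrite E.
  replace ((Re (u * (F p + phi w * (RtoC h * v))) - Re (u * F p)) / h - Re (u * (l * v)))
    with (Re (u * ((phi w - l) * v))).
  2:{ unfold Re, Im; simpl. field; auto. }
  eapply Rle_lt_trans; [apply Re_mult_le |]. rewrite Cmod_mult.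
  pose proof (Cmod_ge_0 u). pose proof (Cmod_ge_0 v). pose proof (Cmod_ge_0 (phi w - l)).
  apply Rle_lt_trans with ((Cmod u * Cmod v + 1) * Cmod (phi w - l)); [nra |].
  apply (Rmult_lt_compat_l (Cmod u * Cmod v + 1)) in H3; auto.
  replace ((Cmod u * Cmod v + 1) * (e / (Cmod u * Cmod v + 1))) with e in H3 by (field; lra). lra.
Qed.

Lemma cts_2d (F : C -> C) (u : C) (x y : R) :
  cts F (x, y) -> continuity_2d_pt (fun a b => Re (u * F (a, b))) x y.
Proof.
  intros H e. destruct e as [e He].
  assert (Hu : 0 < Cmod u + 1) by (pose proof (Cmod_ge_0 u); lra).
  destruct (H (e / (Cmod u + 1)) ltac:(apply Rdiv_lt_0_compat; auto)) as [d [Hd H1]].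
  assert (Hd2 : 0 < d / 2) by lra. exists (mkposreal _ Hd2). cbn [pos]. intros a b Ha Hb.
  assert (B : Cmod ((a, b) - (x, y)) < d).
  { eapply Rle_lt_trans; [apply Cmod_le_abs |]. simpl. unfold Rminus in *. lra. }
  specialize (H1 _ B). rewrite <- Re_Cminus.
  replace (u * F (a, b) - u * F (x, y))%C with (u * (F (a, b) - F (x, y)))%C by ring.
  eapply Rle_lt_trans; [apply Re_mult_le |]. pose proof (Cmod_ge_0 u). pose proof (Cmod_ge_0 (F (a, b) - F (x, y))).
  apply (Rmult_lt_compat_l (Cmod u + 1)) in H1; auto.
  replace ((Cmod u + 1) * (e / (Cmod u + 1))) with e in H1 by (field; lra). nra.
Qed.

Lemma cts_line (F : C -> C) (u : C) (x y : R) :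
  cts F (x, y) -> continuous (fun a => Re (u * F (a, y))) x.
Proof.
  intros H. apply continuity_pt_filterlim.
  pose proof (cts_2d F u x y H) as H2. intros e He. destruct (H2 (mkposreal e He)) as [d Hd].
  exists d. split; [apply cond_pos |]. intros a [_ Ha]. cbn in Ha. unfold R_dist in *.
  apply Hd; auto. rewrite Rminus_diag_eq, Rabs_R0 by auto. apply cond_pos.
Qed.

(** The mean over a horizontal period, paired with [u]: the values for all [u] determine the complex
    mean, while only real integrals occur. *)
Definition hmean (Phi : C -> C) (u : C) (y : R) : R := RInt (fun x => Re (u * Phi (x, y))) 0 1.

Lemma hmean_ex (Phi : C -> C) (u : C) y :
  (forall x, cts Phi (x, y)) -> ex_RInt (fun x => Re (u * Phi (x, y))) 0 1.
Proof. intros H. apply (ex_RInt_continuous (V := R_CompleteNormedModule)). intros x _. apply cts_line; auto. Qed.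

Lemma hmean_le (Phi : C -> C) (u : C) y B :
  (forall x, cts Phi (x, y)) -> (forall x, 0 <= x <= 1 -> Cmod (Phi (x, y)) <= B) ->
  Rabs (hmean Phi u y) <= Cmod u * B.
Proof.
  intros H1 H2. unfold hmean.
  replace (Cmod u * B) with ((1 - 0) * (Cmod u * B)) by ring.
  apply abs_RInt_le_const; [lra | apply hmean_ex; auto |].
  intros t Ht. eapply Rle_trans; [apply Re_mult_le |].
  apply Rmult_le_compat_l; [apply Cmod_ge_0 | auto].
Qed.

Lemma hmean_minus (Phi Psi : C -> C) (u : C) y :
  (forall x, cts Phi (x, y)) -> (forall x, cts Psi (x, y)) ->
  hmean (fun s => Phi s - Psi s)%C u y = hmean Phi u y - hmean Psi u y.
Proof.
  intros H1 H2. unfold hmean. rewrite <- (RInt_minus (V := R_CompleteNormedModule)) by (apply hmean_ex; auto).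
  apply RInt_ext. intros x _. unfold minus, plus, opp; simpl. ring.
Qed.

Lemma Cpair (x y : R) : (x, y) = (RtoC x + Ci * RtoC y)%C.
Proof. apply injective_projections; simpl; ring. Qed.

Lemma periodic_Z (Phi : C -> C) : (forall s, 0 < Im s -> Phi (s + 1)%C = Phi s) ->
  forall (k : Z) s, 0 < Im s -> Phi (s + RtoC (IZR k))%C = Phi s.
Proof.
  intros Hper.
  assert (Hn : forall (k : nat) p, 0 < Im p -> Phi (p + RtoC (INR k))%C = Phi p).
  { induction k as [| k IH]; intros p Hp.
    - simpl. f_equal. apply injective_projections; simpl; ring.
    - rewrite S_INR, RtoC_plus. replace (p + (RtoC (INR k) + RtoC 1))%C with ((p + RtoC (INR k)) + 1)%C by ring.
      rewrite Hper by (simpl; rewrite Rplus_0_r; auto). auto. }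
  intros k s Hs. destruct (Z_le_gt_dec 0 k).
  - rewrite <- (Z2Nat.id k), <- INR_IZR_INZ by auto. auto.
  - rewrite <- (Hn (Z.to_nat (- k)) (s + RtoC (IZR k))%C) by (simpl; rewrite Rplus_0_r; auto). f_equal.
    rewrite INR_IZR_INZ, Z2Nat.id, opp_IZR, RtoC_opp by lia. ring.
Qed.

Section Mean.
Variables (Phi Phi' : C -> C) (y0 : R).
Hypothesis Hper : forall s, 0 < Im s -> Phi (s + 1)%C = Phi s.
Hypothesis Hcts : forall s, 0 < Im s -> cts Phi s.
(** One height [y0] is exempt from differentiability: in the removable singularity argument the
    function is only known to be continuous at the height of the removed poles. With [y0 = -1] no
    height is exempt. *)
Hypothesis Hhol : forall s, 0 < Im s -> Im s <> y0 -> Cd Phi s (Phi' s) /\ cts Phi' s.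

Lemma hmean_continuity (u : C) y : 0 < y -> continuity_pt (hmean Phi u) y.
Proof.
  intros Hy e He.
  assert (He2 : 0 < e / 2) by lra.
  destruct (uniform_continuity_2d_1d (fun a b => Re (u * Phi (a, b))) 0 1 y) with (eps := mkposreal _ He2) as [d Hd].
  { intros x _. apply cts_2d, Hcts. auto. }
  cbn [pos] in Hd. pose proof (cond_pos d).
  exists (Rmin d y). split; [apply Rmin_pos; lra |]. intros v [_ Hv]. cbn in Hv. unfold R_dist in Hv. change (Rabs (hmean Phi u v - hmean Phi u y) < e).
  pose proof (Rmin_l d y); pose proof (Rmin_r d y). apply Rabs_lt_between in Hv.
  assert (E : hmean Phi u v - hmean Phi u y = RInt (fun x => minus (Re (u * Phi (x, v))) (Re (u * Phi (x, y)))) 0 1).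
  { rewrite (RInt_minus (V := R_CompleteNormedModule)); auto; apply hmean_ex; intros; apply Hcts; simpl; lra. }
  rewrite E. apply Rle_lt_trans with ((1 - 0) * (e / 2)); [| lra].
  apply abs_RInt_le_const; [lra | |].
  - apply (ex_RInt_minus (V := R_NormedModule)); apply hmean_ex; intros; apply Hcts; simpl; lra.
  - intros x Hx. left. apply (Hd x y x v); try lra. rewrite Rminus_diag_eq, Rabs_R0; auto.
Qed.

(** By the Cauchy-Riemann equations the derivative in the height is the integral of a derivative
    along the period, which vanishes by periodicity. *)
Lemma hmean_derive (u : C) y : 0 < y -> y <> y0 -> is_derive (hmean Phi u) y 0.
Proof.
  intros Hy Hy0.
  set (f := fun (b a : R) => Re (u * Phi (a, b))).
  assert (D : forall a b, 0 < b -> b <> y0 -> is_derive (fun z => f z a) b (Re (u * (Phi' (a, b) * Ci)))).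
  { intros a b Hb Hb0. unfold f.
    apply is_derive_ext with (fun s : R => Re (u * Phi (RtoC a + RtoC s * Ci)%C)).
    - intros t. rewrite (Cpair a t). do 3 f_equal. ring.
    - apply Cd_line. replace (RtoC a + RtoC b * Ci)%C with ((a, b) : C) by (rewrite Cpair; ring).
      apply Hhol; auto. }
  set (dl := Rmin y (Rabs (y - y0))).
  assert (Hdl : 0 < dl).
  { apply Rmin_pos; auto. apply Rabs_pos_lt. lra. }
  assert (Near : forall b, Rabs (b - y) < dl -> 0 < b /\ b <> y0).
  { intros b Hb. pose proof (Rmin_l y (Rabs (y - y0))). pose proof (Rmin_r y (Rabs (y - y0))). fold dl in H, H0.
    split.
    - apply Rabs_lt_between in Hb. lra.
    - intros ->. rewrite Rabs_minus_sym in Hb. lra. }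
  assert (E : RInt (fun t => Derive (fun z => f z t) y) 0 1 = 0).
  { rewrite (RInt_ext _ (fun t => Re (u * Ci * Phi' (t, y)))).
    2:{ intros t _. transitivity (Re (u * (Phi' (t, y) * Ci))); [| f_equal; ring].
      apply is_derive_unique. apply (D t y Hy Hy0). }
    assert (I : is_RInt (fun t => Re (u * Ci * Phi' (t, y))) 0 1 (minus (Re (u * Ci * Phi (1, y))) (Re (u * Ci * Phi (0, y))))).
    { apply (is_RInt_derive (V := R_CompleteNormedModule) (fun t => Re (u * Ci * Phi (t, y)))).
      - intros t _. apply is_derive_ext with (fun s : R => Re (u * Ci * Phi (Ci * RtoC y + RtoC s * 1)%C)).
        + intros s. rewrite (Cpair s y). do 3 f_equal. ring.
        + replace (Re (u * Ci * Phi' (t, y))) with (Re (u * Ci * (Phi' (t, y) * 1))) by (f_equal; ring).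
          apply Cd_line. replace (Ci * RtoC y + RtoC t * 1)%C with ((t, y) : C) by (rewrite Cpair; ring).
          apply Hhol; auto.
      - intros t _. apply cts_line, Hhol; auto. }
    rewrite (is_RInt_unique (V := R_CompleteNormedModule) _ _ _ _ I).
    replace ((1, y) : C) with ((0, y) + 1)%C by (apply injective_projections; simpl; ring).
    rewrite Hper by auto. apply Rminus_diag_eq. auto. }
  rewrite <- E. apply (is_derive_RInt_param f 0 1 y).
  - exists (mkposreal _ Hdl). intros b Hb t _. destruct (Near b Hb).
    eexists. apply D; auto.
  - intros t _. apply continuity_2d_pt_ext_loc with (fun b a => Re (u * Ci * Phi' (a, b))).
    + exists (mkposreal _ Hdl). intros b a Hb _. destruct (Near b Hb).
      transitivity (Re (u * (Phi' (a, b) * Ci))); [f_equal; ring |].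
      symmetry. apply is_derive_unique. apply D; auto.
    + pose proof (cts_2d Phi' (u * Ci) t y ltac:(apply Hhol; auto)) as H. intros e. destruct (H e) as [d Hd].
      exists d. intros b a Hb Ha. apply Hd; auto.
  - exists (mkposreal _ Hdl). intros b Hb. destruct (Near b Hb). apply hmean_ex. intros; apply Hcts; auto.
Qed.

Lemma hmean_const_aux (u : C) a b : 0 < a < b -> (y0 <= a \/ b <= y0) -> hmean Phi u a = hmean Phi u b.
Proof.
  intros [Ha Hab] Hy. destruct (MVT_gen (hmean Phi u) a b (fun _ => 0)) as [c [_ E]].
  - intros x Hx. rewrite Rmin_left, Rmax_right in Hx by lra. apply hmean_derive; lra.
  - intros x Hx. rewrite Rmin_left, Rmax_right in Hx by lra. apply hmean_continuity; lra.
  - lra.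
Qed.

(** The exempt height is crossed by continuity of the mean. *)
Lemma hmean_const (u : C) a b : 0 < a -> 0 < b -> hmean Phi u a = hmean Phi u b.
Proof.
  assert (W : forall a b, 0 < a < b -> hmean Phi u a = hmean Phi u b).
  { intros c d H. destruct (Rle_dec y0 c) as [H1 | H1]; [apply hmean_const_aux; auto |].
    destruct (Rle_dec d y0) as [H2 | H2]; [apply hmean_const_aux; auto |].
    rewrite (hmean_const_aux u c y0), (hmean_const_aux u y0 d); auto; lra. }
  intros Ha Hb. destruct (Rtotal_order a b) as [H | [-> | H]]; auto. symmetry; apply W; auto.
Qed.

(** The mean is the zeroth Fourier coefficient; being constant in the height, it equals its limit at
    the cusp. *)
Lemma hmean_lim (a0 : C) : tends upward Phi a0 -> forall u y, 0 < y -> hmean Phi u y = Re (u * a0).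
Proof.
  intros HL u y Hy. apply Rminus_diag_uniq.
  destruct (Req_dec (hmean Phi u y - Re (u * a0)) 0) as [E | Hn]; auto. exfalso.
  apply Rabs_pos_lt in Hn. set (D := Rabs (hmean Phi u y - Re (u * a0))) in *.
  pose proof (Cmod_ge_0 u). assert (Hu : 0 < Cmod u + 1) by lra.
  destruct (HL (D / (Cmod u + 1)) ltac:(apply Rdiv_lt_0_compat; auto)) as [Y HY].
  set (z := Rmax 0 Y + 1). assert (Hz : 0 < z /\ Y < z).
  { unfold z. pose proof (Rmax_l 0 Y); pose proof (Rmax_r 0 Y). lra. }
  assert (E : hmean Phi u y - Re (u * a0) = hmean (fun s => Phi s - a0)%C u z).
  { rewrite (hmean_minus Phi (fun _ => a0)).
    - rewrite (hmean_const u y z) by lra. f_equal. unfold hmean. rewrite RInt_const. unfold scal, Rminus; simpl. unfold mult; simpl. ring.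
    - intros; apply Hcts; simpl; lra.
    - intros; apply tends_const, nearC_filter. }
  assert (B : D <= Cmod u * (D / (Cmod u + 1))).
  { unfold D at 1. rewrite E. apply hmean_le.
    - intros x. apply tends_minus; [apply nearC_filter | apply Hcts; simpl; lra | apply tends_const, nearC_filter].
    - intros x _. left. apply HY. simpl. lra. }
  assert (D = (Cmod u + 1) * (D / (Cmod u + 1))) by (field; lra).
  assert (0 < D / (Cmod u + 1)) by (apply Rdiv_lt_0_compat; auto). nra.
Qed.

(** Taking for [u] the conjugate of [a0] turns the mean into [|a0|^2]. *)
Lemma mean_limit_le (a0 : C) (y B : R) :
  tends upward Phi a0 -> 0 < y -> (forall x, 0 <= x <= 1 -> Cmod (Phi (x, y)) <= B) -> Cmod a0 <= B.
Proof.
  intros HL Hy HB. pose proof (hmean_lim a0 HL (Cconj a0) y Hy) as E. rewrite Re_conj_mult in E.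
  pose proof (hmean_le Phi (Cconj a0) y B (fun x => Hcts (x, y) Hy) HB) as L. rewrite E, Cmod_conj in L.
  pose proof (Cmod_ge_0 a0). rewrite Rabs_right in L by nra.
  destruct (Req_dec (Cmod a0) 0) as [E0 | E0].
  - rewrite E0. eapply Rle_trans; [apply Cmod_ge_0 | apply (HB 0); lra].
  - nra.
Qed.

(** The maximum principle at the cusp. The continuous function [h = |a0|^2 - Re (conj a0 * Phi)] is
    nonnegative with mean 0 over a period, so it vanishes, and together with [|Phi| <= |a0|] this
    leaves only [Phi = a0]. *)
Lemma mean_max (a0 : C) :
  tends upward Phi a0 -> (forall s, 0 < Im s -> Cmod (Phi s) <= Cmod a0) ->
  forall s, 0 < Im s -> Phi s = a0.
Proof.
  intros HL HB.
  assert (W : forall x y, 0 < y -> 0 < x < 1 -> Phi (x, y) = a0).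
  { intros x y Hy Hx.
    set (h := fun t => Cmod a0 ^ 2 - Re (Cconj a0 * Phi (t, y))).
    assert (Hh : forall t, 0 <= h t).
    { intros t. unfold h. pose proof (Re_mult_le (Cconj a0) (Phi (t, y))). rewrite Cmod_conj in H.
      apply Rabs_le_between in H. pose proof (HB (t, y) Hy). pose proof (Cmod_ge_0 a0). nra. }
    assert (Hc : forall t, continuous h t).
    { intros t. unfold h. apply (continuous_minus (V := R_NormedModule)); [apply continuous_const | apply cts_line, Hcts; auto]. }
    assert (HI : forall a b, ex_RInt h a b) by (intros; apply (ex_RInt_continuous (V := R_CompleteNormedModule)); intros; apply Hc).
    assert (I0 : RInt h 0 1 = 0).
    { unfold h. rewrite (RInt_minus (V := R_CompleteNormedModule)); [| apply ex_RInt_const | apply hmean_ex; intros; apply Hcts; auto].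
      rewrite RInt_const. pose proof (hmean_lim a0 HL (Cconj a0) y Hy) as E. unfold hmean in E. rewrite Re_conj_mult in E.
      rewrite E. unfold minus, plus, opp, scal; simpl. unfold mult; simpl. ring. }
    assert (Z : h x = 0).
    { destruct (Req_dec (h x) 0) as [E | Hn]; auto. exfalso.
      assert (Hp : 0 < h x) by (specialize (Hh x); lra).
      pose proof (Hc x) as Cx. apply continuity_pt_filterlim in Cx. destruct (Cx (h x) Hp) as [d [Hd HD]].
      set (e := Rmin (d / 2) (Rmin (x / 2) ((1 - x) / 2))).
      assert (He : 0 < e /\ e <= d / 2 /\ e <= x / 2 /\ e <= (1 - x) / 2).
      { unfold e. repeat split; [repeat apply Rmin_pos; lra | apply Rmin_l | | ].
        - eapply Rle_trans; [apply Rmin_r | apply Rmin_l].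
        - eapply Rle_trans; [apply Rmin_r | apply Rmin_r]. }
      assert (P : 0 < RInt h (x - e) (x + e)).
      { apply RInt_gt_0; [lra | | intros; apply Hc]. intros t Ht.
        destruct (Req_dec t x) as [-> | Htx]; auto.
        assert (Rabs (h t - h x) < h x).
        { apply HD. split; [split; [exact I | auto] |]. simpl. unfold R_dist. apply Rabs_lt_between. lra. }
        apply Rabs_lt_between in H. lra. }
      assert (Q1 : 0 <= RInt h 0 (x - e)) by (apply RInt_ge_0; auto; lra).
      assert (Q2 : 0 <= RInt h (x + e) 1) by (apply RInt_ge_0; auto; lra).
      pose proof (RInt_Chasles h 0 (x - e) (x + e) (HI _ _) (HI _ _)) as C1.
      pose proof (RInt_Chasles h 0 (x + e) 1 (HI _ _) (HI _ _)) as C2.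
      unfold plus in C1, C2; simpl in C1, C2. lra. }
    unfold h in Z. assert (B := HB (x, y) Hy).
    set (w := Phi (x, y)) in *. apply Cmod_sub_0.
    assert (E : Cmod (w - a0) ^ 2 = Cmod w ^ 2 + Cmod a0 ^ 2 - 2 * Re (Cconj a0 * w)).
    { rewrite !Cmod2_alt. unfold Cconj, Re, Im; simpl. ring. }
    pose proof (Cmod_ge_0 w). pose proof (Cmod_ge_0 (w - a0)). nra. }
  intros s Hs. destruct s as [x y]. simpl in Hs.
  apply Cmod_small_eq. intros e He.
  destruct (Hcts (x, y) Hs e He) as [d [Hd HD]].
  (* The mean value argument covers [0 < x < 1] only: perturb [x] off the integers and translate. *)
  assert (Ex : exists x', Rabs (x' - x) < d /\ exists k : Z, 0 < x' - IZR k < 1).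
  { destruct (archimed x) as [A1 A2]. set (m := Rmin (d / 2) (1 / 4)).
    assert (Hm : 0 < m /\ m <= d / 2 /\ m <= 1 / 4).
    { unfold m. repeat split; [apply Rmin_pos; lra | apply Rmin_l | apply Rmin_r]. }
    destruct (Rlt_dec (x + m) (IZR (up x))) as [L | L].
    - exists (x + m). split; [rewrite Rabs_right; lra |]. exists (up x - 1)%Z. rewrite minus_IZR. lra.
    - exists (x - m). split; [rewrite Rabs_left; lra |]. exists (up x - 1)%Z. rewrite minus_IZR. pose proof Hm. split; lra. }
  destruct Ex as [x' [Hx' [k Hk]]].
  assert (E : Phi (x', y) = a0).
  { rewrite <- (W (x' - IZR k) y Hs Hk). rewrite <- (periodic_Z Phi Hper k (x' - IZR k, y)) by auto. f_equal.
    apply injective_projections; simpl; ring. }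
  rewrite <- E, Cmod_sub_sym. apply HD. eapply Rle_lt_trans; [apply Cmod_le_abs |]. simpl.
  replace (y + - y) with 0 by ring. rewrite Rabs_R0. unfold Rminus in Hx'. lra.
Qed.
End Mean.

(** * Unordered sums *)

Definition fsum {T} (f : T -> C) (L : list T) : C := fold_right Cplus 0%C (map f L).
Definition rsum {T} (b : T -> R) (L : list T) : R := fold_right Rplus 0 (map b L).

(** Convergence along the directed set of finite subsets, represented by lists without repetition.
    No enumeration is involved, which is what reindexing and exchanging sums require. *)
Definition has_sum {T} (f : T -> C) (l : C) : Prop :=
  forall eps, 0 < eps -> exists L0, forall L, NoDup L -> incl L0 L -> Cmod (fsum f L - l) < eps.

Definition summable {T} (b : T -> R) : Prop :=
  (forall t, 0 <= b t) /\ exists B, forall L, NoDup L -> rsum b L <= B.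

Definition eq_dec {T} (x y : T) : {x = y} + {x <> y} := excluded_middle_informative (x = y).

(** Total by choice: the value is arbitrary when there is no sum. *)
Definition csum {T} (f : T -> C) : C := epsilon (inhabits (RtoC 0)) (fun l => has_sum f l).

Section Sums.
Context {T : Type}.
Implicit Types (f g : T -> C) (b : T -> R) (L : list T).

Lemma fsum_app f L1 L2 : fsum f (L1 ++ L2) = (fsum f L1 + fsum f L2)%C.
Proof. induction L1 as [| x L1 IH]; unfold fsum in *; simpl; [ring | rewrite IH; ring]. Qed.

Lemma rsum_app b L1 L2 : rsum b (L1 ++ L2) = rsum b L1 + rsum b L2.
Proof. induction L1 as [| x L1 IH]; unfold rsum in *; simpl; [ring | rewrite IH; ring]. Qed.

Lemma fsum_perm f L1 L2 : Permutation L1 L2 -> fsum f L1 = fsum f L2.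
Proof.
  induction 1; unfold fsum in *; simpl; auto; [rewrite IHPermutation; auto | ring | congruence].
Qed.

Lemma rsum_perm b L1 L2 : Permutation L1 L2 -> rsum b L1 = rsum b L2.
Proof.
  induction 1; unfold rsum in *; simpl; auto; [rewrite IHPermutation; auto | ring | congruence].
Qed.

Lemma fsum_le f b L : (forall t, In t L -> Cmod (f t) <= b t) -> Cmod (fsum f L) <= rsum b L.
Proof.
  induction L as [| x L IH]; intros H; unfold fsum, rsum in *; simpl; [rewrite Cmod_0; lra |].
  eapply Rle_trans; [apply Cmod_triangle |]. apply Rplus_le_compat; [apply H | apply IH]; simpl; auto.
  intros; apply H; simpl; auto.
Qed.

Lemma rsum_nonneg b L : (forall t, 0 <= b t) -> 0 <= rsum b L.
Proof. intros H. induction L as [| x L IH]; unfold rsum in *; simpl; [lra | specialize (H x); lra]. Qed.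

Lemma rsum_le b b' L : (forall t, b t <= b' t) -> rsum b L <= rsum b' L.
Proof. intros H. induction L as [| x L IH]; unfold rsum in *; simpl; [lra | specialize (H x); lra]. Qed.

Lemma rsum_scal c b L : rsum (fun t => c * b t) L = c * rsum b L.
Proof. induction L as [| x L IH]; unfold rsum in *; simpl; [ring | rewrite IH; ring]. Qed.

Lemma fsum_ext f g L : (forall t, In t L -> f t = g t) -> fsum f L = fsum g L.
Proof. intros H. unfold fsum. f_equal. apply map_ext_in. auto. Qed.

Lemma fsum_plus f g L : fsum (fun t => f t + g t)%C L = (fsum f L + fsum g L)%C.
Proof. induction L as [| x L IH]; unfold fsum in *; simpl; [ring | rewrite IH; ring]. Qed.

Lemma fsum_scal c f L : fsum (fun t => c * f t)%C L = (c * fsum f L)%C.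
Proof. induction L as [| x L IH]; unfold fsum in *; simpl; [ring | rewrite IH; ring]. Qed.

Lemma incl_split L0 L : NoDup L -> NoDup L0 -> incl L0 L ->
  exists L', Permutation L (L0 ++ L') /\ NoDup L' /\ (forall t, In t L' -> ~ In t L0).
Proof.
  intros H1 H2 H3.
  exists (filter (fun t => if in_dec eq_dec t L0 then false else true) L).
  split; [| split].
  - apply NoDup_Permutation; auto.
    + apply NoDup_app; auto; [apply NoDup_filter; auto |].
      intros t Ha Hb. apply filter_In in Hb. destruct Hb as [_ Hb]. destruct (in_dec eq_dec t L0); [discriminate | tauto].
    + intros t. rewrite in_app_iff, filter_In. destruct (in_dec eq_dec t L0) as [Hi | Hi]; split; auto.
      intros [Hq | [Hq _]]; auto.
  - apply NoDup_filter; auto.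
  - intros t Ht. apply filter_In in Ht. destruct Ht as [_ Ht]. destruct (in_dec eq_dec t L0); [discriminate | auto].
Qed.

Lemma rsum_incl b L L' : (forall t, 0 <= b t) -> NoDup L -> incl L L' -> rsum b L <= rsum b L'.
Proof.
  intros Hb HL Hi.
  assert (E : rsum b (nodup eq_dec L') <= rsum b L').
  { clear - Hb. induction L' as [| x L' IH]; simpl; [lra |].
    destruct (in_dec eq_dec x L'); unfold rsum in *; simpl; specialize (Hb x); lra. }
  eapply Rle_trans; [| exact E].
  destruct (incl_split L (nodup eq_dec L')) as [M [HP _]]; auto; [apply NoDup_nodup | |].
  { intros t Ht. apply nodup_In; auto. }
  rewrite (rsum_perm _ _ _ HP), rsum_app. pose proof (rsum_nonneg b M Hb). lra.
Qed.

Lemma summable_le b b' : (forall t, 0 <= b t <= b' t) -> summable b' -> summable b.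
Proof.
  intros H [H1 [B HB]]. split; [intros; apply H |]. exists B. intros L HL.
  eapply Rle_trans; [apply rsum_le; intros; apply H | auto].
Qed.

Lemma summable_scal c b : 0 <= c -> summable b -> summable (fun t => c * b t).
Proof.
  intros Hc [H [B HB]]. split; [intros; apply Rmult_le_pos; auto |].
  exists (c * B). intros L HL. rewrite rsum_scal. apply Rmult_le_compat_l; auto.
Qed.

(** A list that comes within [eps] of the supremum of all finite sums leaves less than [eps]
    outside. *)
Lemma summable_tail b : summable b -> forall eps, 0 < eps ->
  exists L0, NoDup L0 /\ forall L, NoDup L -> (forall t, In t L -> ~ In t L0) -> rsum b L < eps.
Proof.
  intros [Hb [B HB]] eps He.
  destruct (completeness (fun s => exists L, NoDup L /\ s = rsum b L)) as [S [S1 S2]].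
  { exists B. intros s [L [HL ->]]; auto. }
  { exists (rsum b nil), nil. split; [constructor | auto]. }
  assert (HL0 : exists L0, NoDup L0 /\ S - eps < rsum b L0).
  { apply NNPP. intros Hn. assert (S <= S - eps); [| lra]. apply S2. intros s [L [HL ->]].
    apply Rnot_lt_le. intros Hlt. apply Hn. exists L; auto. }
  destruct HL0 as [L0 [N0 H0]]. exists L0. split; auto. intros L HL HD.
  assert (rsum b (L0 ++ L) <= S).
  { apply S1. exists (L0 ++ L). split; auto. apply NoDup_app; auto. intros t A D. apply (HD t D A). }
  rewrite rsum_app in H. lra.
Qed.

Lemma has_sum_unique f l m : has_sum f l -> has_sum f m -> l = m.
Proof.
  intros H1 H2. apply Cmod_small_eq. intros e He.
  destruct (H1 (e / 2) ltac:(lra)) as [L1 A1]. destruct (H2 (e / 2) ltac:(lra)) as [L2 A2].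
  set (L := nodup eq_dec (L1 ++ L2)).
  assert (N : NoDup L) by apply NoDup_nodup.
  specialize (A1 L N). specialize (A2 L N).
  assert (incl L1 L) by (intros t Ht; apply nodup_In, in_app_iff; auto).
  assert (incl L2 L) by (intros t Ht; apply nodup_In, in_app_iff; auto).
  pose proof (Cmod_sub_tri l (fsum f L) m) as Q. rewrite (Cmod_sub_sym l (fsum f L)) in Q.
  specialize (A1 H). specialize (A2 H0). lra.
Qed.

Lemma has_sum_ext f g l : (forall t, f t = g t) -> has_sum f l -> has_sum g l.
Proof.
  intros H H1 e He. destruct (H1 e He) as [L0 HL0]. exists L0. intros L A B.
  rewrite <- (fsum_ext f g) by auto. auto.
Qed.

Lemma has_sum_plus f g l m : has_sum f l -> has_sum g m -> has_sum (fun t => f t + g t)%C (l + m)%C.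
Proof.
  intros H1 H2 e He. destruct (H1 (e / 2) ltac:(lra)) as [L1 A1]. destruct (H2 (e / 2) ltac:(lra)) as [L2 A2].
  exists (L1 ++ L2). intros L HL HI. rewrite fsum_plus.
  replace (fsum f L + fsum g L - (l + m))%C with ((fsum f L - l) + (fsum g L - m))%C by ring.
  eapply Rle_lt_trans; [apply Cmod_triangle |].
  specialize (A1 L HL (fun t Ht => HI t (in_or_app _ _ _ (or_introl Ht)))).
  specialize (A2 L HL (fun t Ht => HI t (in_or_app _ _ _ (or_intror Ht)))). lra.
Qed.

Lemma has_sum_scal c f l : has_sum f l -> has_sum (fun t => c * f t)%C (c * l)%C.
Proof.
  intros H e He. pose proof (Cmod_ge_0 c).
  destruct (H (e / (Cmod c + 1)) ltac:(apply Rdiv_lt_0_compat; lra)) as [L0 A]. exists L0. intros L HL HI.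
  rewrite fsum_scal. replace (c * fsum f L - c * l)%C with (c * (fsum f L - l))%C by ring.
  rewrite Cmod_mult. specialize (A L HL HI). pose proof (Cmod_ge_0 (fsum f L - l)).
  apply (Rmult_lt_compat_l (Cmod c + 1)) in A; [| lra].
  replace ((Cmod c + 1) * (e / (Cmod c + 1))) with e in A by (field; lra). nra.
Qed.

Lemma has_sum_minus f g l m : has_sum f l -> has_sum g m -> has_sum (fun t => f t - g t)%C (l - m)%C.
Proof.
  intros H1 H2. apply has_sum_ext with (fun t => f t + (-1) * g t)%C; [intros; ring |].
  replace (l - m)%C with (l + (-1) * m)%C by ring. apply has_sum_plus, has_sum_scal; auto.
Qed.

Lemma has_sum_nonneg b : summable b -> exists l, has_sum (fun t => RtoC (b t)) l.
Proof.
  intros Hs. destruct Hs as [Hb [B HB]].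
  destruct (completeness (fun s => exists L, NoDup L /\ s = rsum b L)) as [S [S1 S2]].
  { exists B. intros s [L [HL ->]]; auto. }
  { exists (rsum b nil), nil. split; [constructor | auto]. }
  exists (RtoC S). intros e He.
  assert (HL0 : exists L0, NoDup L0 /\ S - e < rsum b L0).
  { apply NNPP. intros Hn. assert (S <= S - e); [| lra]. apply S2. intros s [L [HL ->]].
    apply Rnot_lt_le. intros Hlt. apply Hn. exists L; auto. }
  destruct HL0 as [L0 [N0 H0]]. exists L0. intros L HL HI.
  assert (E : fsum (fun t => RtoC (b t)) L = RtoC (rsum b L)).
  { clear. induction L as [| x L IH]; unfold fsum, rsum in *; simpl; auto. rewrite IH, RtoC_plus; auto. }
  rewrite E, <- RtoC_minus, Cmod_R.
  assert (rsum b L <= S) by (apply S1; exists L; auto).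
  pose proof (rsum_incl b L0 L Hb N0 HI). apply Rabs_lt_between. lra.
Qed.

(** Real and imaginary parts [h] are written as [(b + h) - b], a difference of nonnegative summable
    families. *)
Lemma has_sum_exists f b : summable b -> (forall t, Cmod (f t) <= b t) -> exists l, has_sum f l.
Proof.
  intros Hb Hf.
  assert (W : forall h : T -> R, (forall t, Rabs (h t) <= b t) -> exists l, has_sum (fun t => RtoC (h t)) l).
  { intros h Hh. destruct (has_sum_nonneg (fun t => b t + h t)) as [l1 H1].
    { apply summable_le with (fun t => 2 * b t); [| apply summable_scal; auto; lra].
      intros t. specialize (Hh t). apply Rabs_le_between in Hh. lra. }
    destruct (has_sum_nonneg b Hb) as [l2 H2]. exists (l1 - l2)%C.
    apply has_sum_ext with (fun t => RtoC (b t + h t) - RtoC (b t))%C; [intros; rewrite RtoC_plus; ring |].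
    apply has_sum_minus; auto. }
  destruct (W (fun t => Re (f t))) as [l1 H1].
  { intros t. eapply Rle_trans; [apply re_le_Cmod | auto]. }
  destruct (W (fun t => Im (f t))) as [l2 H2].
  { intros t. eapply Rle_trans; [apply Im_le_Cmod | auto]. }
  exists (l1 + Ci * l2)%C.
  apply has_sum_ext with (fun t => RtoC (Re (f t)) + Ci * RtoC (Im (f t)))%C.
  - intros t. destruct (f t). symmetry. apply Cpair.
  - apply has_sum_plus, has_sum_scal; auto.
Qed.

Lemma csum_spec f b : summable b -> (forall t, Cmod (f t) <= b t) -> has_sum f (csum f).
Proof. intros Hb Hf. unfold csum. apply epsilon_spec. apply has_sum_exists with b; auto. Qed.

Lemma csum_has_sum f l : has_sum f l -> csum f = l.
Proof. intros H. apply has_sum_unique with f; auto. unfold csum. apply epsilon_spec. exists l; auto. Qed.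

Lemma csum_ext f g : (forall t, f t = g t) -> csum f = csum g.
Proof.
  intros H. destruct (classic (exists l, has_sum f l)) as [[l Hl] | Hn].
  - rewrite (csum_has_sum f l Hl). symmetry. apply csum_has_sum. apply has_sum_ext with f; auto.
  (* Without a sum both sides are still the choice from one and the same predicate. *)
  - unfold csum. f_equal. apply functional_extensionality. intros l. apply propositional_extensionality.
    split; apply has_sum_ext; auto.
Qed.

Lemma has_sum_tail_bound f b l L0 eps :
  (forall t, Cmod (f t) <= b t) -> has_sum f l -> NoDup L0 ->
  (forall L, NoDup L -> (forall t, In t L -> ~ In t L0) -> rsum b L < eps) ->
  Cmod (fsum f L0 - l) <= eps.
Proof.
  intros Hf Hl N0 Ht. apply Rle_plus_epsilon. intros e He.
  destruct (Hl e He) as [L1 H1]. set (L := nodup eq_dec (L0 ++ L1)).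
  assert (N : NoDup L) by apply NoDup_nodup.
  destruct (incl_split L0 L) as [L' [P [N' D']]]; auto.
  { intros t Hi. apply nodup_In, in_app_iff; auto. }
  assert (A : Cmod (fsum f L - l) < e).
  { apply H1; auto. intros t Hi. apply nodup_In, in_app_iff; auto. }
  rewrite (fsum_perm _ _ _ P), fsum_app in A. pose proof (fsum_le f b L' (fun t _ => Hf t)) as Bd.
  specialize (Ht L' N' D').
  replace (fsum f L0 - l)%C with ((fsum f L0 + fsum f L' - l) - fsum f L')%C by ring.
  unfold Cminus at 1. eapply Rle_trans; [apply Cmod_triangle |]. rewrite Cmod_opp. lra.
Qed.

Lemma csum_bound f b B : summable b -> (forall t, Cmod (f t) <= b t) ->
  (forall L, NoDup L -> rsum b L <= B) -> Cmod (csum f) <= B.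
Proof.
  intros Hb Hf HB. apply Rle_plus_epsilon. intros e He.
  destruct (csum_spec f b Hb Hf e He) as [L0 H].
  specialize (H (nodup eq_dec L0) (NoDup_nodup _ _) (fun t Ht => proj2 (nodup_In _ _ _) Ht)).
  pose proof (fsum_le f b (nodup eq_dec L0) (fun t _ => Hf t)). specialize (HB _ (NoDup_nodup eq_dec L0)).
  pose proof (Cmod_le_sub (csum f) (fsum f (nodup eq_dec L0))).
  rewrite (Cmod_sub_sym (csum f)) in H1. lra.
Qed.

Lemma tends_fsum {X} (F : (X -> Prop) -> Prop) {FF : Filter F} (f : X -> T -> C) (g : T -> C) L :
  (forall t, tends F (fun x => f x t) (g t)) -> tends F (fun x => fsum (f x) L) (fsum g L).
Proof.
  intros H. induction L as [| t L IH]; [apply (tends_const F (RtoC 0)) |].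
  unfold fsum in *; simpl. apply tends_plus; auto.
Qed.

(* Tannery's theorem *)
Lemma tends_csum {X} (F : (X -> Prop) -> Prop) {FF : Filter F} (f : X -> T -> C) (g : T -> C) b :
  summable b -> F (fun x => forall t, Cmod (f x t) <= b t) ->
  (forall t, tends F (fun x => f x t) (g t)) ->
  tends F (fun x => csum (f x)) (csum g).
Proof.
  (* On an improper filter the claim is empty; otherwise the bound [b] passes to the limits [g]. *)
  intros Hb Hd Hl. destruct (classic (F (fun _ => False))) as [Hf | Hp].
  { intros e He. revert Hf. apply filter_imp. tauto. }
  assert (Hg : forall t, Cmod (g t) <= b t).
  { intros t. apply Rle_plus_epsilon. intros e He. apply Rnot_lt_le. intros Hlt. apply Hp.
    generalize (filter_and _ _ Hd (Hl t e He)). apply filter_imp. intros x [A B].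
    pose proof (Cmod_le_sub (g t) (f x t)). rewrite (Cmod_sub_sym (g t)) in H. specialize (A t). lra. }
  intros e He. destruct (summable_tail b Hb (e / 3) ltac:(lra)) as [L0 [N0 HT]].
  assert (He3 : 0 < e / 3) by lra.
  generalize (filter_and _ _ Hd (tends_fsum F f g L0 Hl (e / 3) He3)). apply filter_imp. intros x [A B].
  pose proof (has_sum_tail_bound (f x) b _ L0 _ A (csum_spec _ b Hb A) N0 HT) as P.
  pose proof (has_sum_tail_bound g b _ L0 _ Hg (csum_spec _ b Hb Hg) N0 HT) as Q.
  pose proof (Cmod_sub_tri (csum (f x)) (fsum (f x) L0) (csum g)).
  pose proof (Cmod_sub_tri (fsum (f x) L0) (fsum g L0) (csum g)).
  rewrite (Cmod_sub_sym (csum (f x)) (fsum (f x) L0)) in H. lra.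
Qed.
End Sums.

Lemma fsum_map {T T'} (f : T -> C) (phi : T' -> T) L : fsum f (map phi L) = fsum (fun t => f (phi t)) L.
Proof. unfold fsum. rewrite map_map. auto. Qed.

Lemma rsum_map {T T'} (b : T -> R) (phi : T' -> T) L : rsum b (map phi L) = rsum (fun t => b (phi t)) L.
Proof. unfold rsum. rewrite map_map. auto. Qed.

Lemma NoDup_map_inj {T T'} (phi : T' -> T) L :
  (forall x y, In x L -> In y L -> phi x = phi y -> x = y) -> NoDup L -> NoDup (map phi L).
Proof.
  intros H. induction 1 as [| x L Hx HL IH]; simpl; constructor.
  - intros Hi. apply in_map_iff in Hi. destruct Hi as [y [E Hy]]. apply Hx.
    rewrite (H x y); simpl; auto.
  - apply IH. intros; apply H; simpl; auto.
Qed.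

Lemma has_sum_reindex {T T'} (f : T -> C) l (phi : T' -> T) (psi : T -> T') :
  (forall x, psi (phi x) = x) -> (forall y, phi (psi y) = y) -> has_sum f l -> has_sum (fun t => f (phi t)) l.
Proof.
  intros H1 H2 H e He. destruct (H e He) as [L0 HL0]. exists (map psi L0). intros L HL HI.
  rewrite <- (fsum_map f phi). apply HL0.
  - apply NoDup_map_inj; auto. intros x y _ _ E. rewrite <- (H1 x), <- (H1 y), E; auto.
  - intros t Ht. rewrite <- (H2 t). apply in_map, HI, in_map; auto.
Qed.

Lemma csum_reindex {T T'} (f : T -> C) b (phi : T' -> T) (psi : T -> T') :
  (forall x, psi (phi x) = x) -> (forall y, phi (psi y) = y) ->
  summable b -> (forall t, Cmod (f t) <= b t) -> csum (fun t => f (phi t)) = csum f.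
Proof.
  intros H1 H2 Hb Hf. apply csum_has_sum. apply has_sum_reindex with psi; auto. apply csum_spec with b; auto.
Qed.

Lemma summable_inj {T T'} (b : T -> R) (phi : T' -> T) :
  (forall x y, phi x = phi y -> x = y) -> summable b -> summable (fun t => b (phi t)).
Proof.
  intros Hi [Hb [B HB]]. split; auto. exists B. intros L HL.
  rewrite <- (rsum_map b phi). apply HB. apply NoDup_map_inj; auto.
Qed.

(** For a finite list [M] of outer indices, enough inner indices are taken over each [a] in [M] to
    come within [d] of [g a] and to include all pairs of [L0] above [M]. The total error is then
    [length M * d], and [d] is chosen last. *)
Lemma fubini {A B} (f : A * B -> C) l (g : A -> C) :
  has_sum f l -> (forall a, has_sum (fun b => f (a, b)) (g a)) -> has_sum g l.
Proof.
  intros Hf Hg e He. destruct (Hf (e / 2) ltac:(lra)) as [L0 H0].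
  exists (map fst L0). intros L HL HI.
  assert (W : forall d M, 0 < d -> NoDup M -> exists P, NoDup P /\ (forall p, In p P -> In (fst p) M) /\
     (forall p, In p L0 -> In (fst p) M -> In p P) /\ Cmod (fsum f P - fsum g M) <= INR (length M) * d).
  { intros d M Hd. induction M as [| a M IH]; intros HM.
    - exists nil. split; [constructor |]. split; [simpl; tauto |]. split; [simpl; tauto |].
      unfold fsum; simpl. replace (0 - 0)%C with (RtoC 0) by ring. rewrite Cmod_0. lra.
    - apply NoDup_cons_iff in HM. destruct HM as [Ha HM]. destruct (IH HM) as [P [P1 [P2 [P3 P4]]]].
      destruct (Hg a d Hd) as [N HN].
      set (N' := nodup eq_dec (N ++ map snd L0)).
      assert (NN : NoDup N') by apply NoDup_nodup.
      specialize (HN N' NN). assert (incl N N') by (intros t Ht; apply nodup_In, in_app_iff; auto). specialize (HN H).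
      exists (map (fun b => (a, b)) N' ++ P). split; [| split; [| split]].
      + apply NoDup_app; auto.
        * apply NoDup_map_inj; auto. intros x y _ _ E. congruence.
        * intros p Hp Hq. apply in_map_iff in Hp. destruct Hp as [b [<- _]]. apply P2 in Hq. auto.
      + intros p Hp. apply in_app_iff in Hp. destruct Hp as [Hp | Hp].
        * apply in_map_iff in Hp. destruct Hp as [b [<- _]]. simpl; auto.
        * simpl; auto.
      + intros p Hp Hq. apply in_app_iff. destruct Hq as [Hq | Hq]; [left | right; auto].
        apply in_map_iff. exists (snd p). split; [rewrite Hq; destruct p; auto |].
        apply nodup_In, in_app_iff. right. apply in_map; auto.
      + rewrite fsum_app, fsum_map.
        replace (fsum g (a :: M)) with (g a + fsum g M)%C by reflexivity.
        replace (fsum (fun t => f (a, t)) N' + fsum f P - (g a + fsum g M))%C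
          with ((fsum (fun t => f (a, t)) N' - g a) + (fsum f P - fsum g M))%C by ring.
        eapply Rle_trans; [apply Cmod_triangle |]. change (length (a :: M)) with (S (length M)). rewrite S_INR. lra. }
  pose proof (pos_INR (length L)).
  destruct (W (e / (2 * (INR (length L) + 1))) L) as [P [P1 [P2 [P3 P4]]]]; auto.
  { apply Rdiv_lt_0_compat; lra. }
  assert (A1 : Cmod (fsum f P - l) < e / 2).
  { apply H0; auto. intros p Hp. apply P3; auto. apply HI, in_map; auto. }
  pose proof (Cmod_sub_tri (fsum g L) (fsum f P) l). rewrite (Cmod_sub_sym (fsum g L) (fsum f P)) in H1.
  assert (INR (length L) * (e / (2 * (INR (length L) + 1))) <= e / 2).
  { apply Rmult_le_reg_r with (2 * (INR (length L) + 1)); [lra |].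
    replace (INR (length L) * (e / (2 * (INR (length L) + 1))) * (2 * (INR (length L) + 1)))
      with (INR (length L) * e) by (field; lra). nra. }
  lra.
Qed.

Lemma summable_prod {A B} (b1 : A -> R) (b2 : B -> R) :
  summable b1 -> summable b2 -> summable (fun p => b1 (fst p) * b2 (snd p)).
Proof.
  intros [H1 [B1 HB1]] [H2 [B2 HB2]]. split; [intros; apply Rmult_le_pos; auto |].
  exists (B1 * B2). intros L HL.
  set (LA := nodup eq_dec (map fst L)). set (LB := nodup eq_dec (map snd L)).
  apply Rle_trans with (rsum (fun p => b1 (fst p) * b2 (snd p)) (list_prod LA LB)).
  - apply rsum_incl; auto; [intros; apply Rmult_le_pos; auto |].
    intros [x y] Hp. apply in_prod; apply nodup_In; [apply (in_map fst) in Hp | apply (in_map snd) in Hp]; auto.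
  - assert (E : forall M, rsum (fun p => b1 (fst p) * b2 (snd p)) (list_prod M LB) = rsum b1 M * rsum b2 LB).
    { induction M as [| x M IH]; [unfold rsum; simpl; ring |].
      simpl. rewrite rsum_app, IH, rsum_map. simpl. rewrite rsum_scal.
      change (rsum b1 (x :: M)) with (b1 x + rsum b1 M). ring. }
    rewrite E. apply Rmult_le_compat; try apply rsum_nonneg; auto; [apply HB1 | apply HB2]; apply NoDup_nodup.
Qed.

Lemma summable_series (b : nat -> R) : (forall n, 0 <= b n) -> ex_series b -> summable b.
Proof.
  intros Hb [S HS]. split; auto. exists S. intros L HL.
  assert (exists N, forall n, In n L -> (n < N)%nat).
  { clear. induction L as [| x L [N IH]]; [exists 0%nat; simpl; tauto |].
    exists (Nat.max (Datatypes.S x) N). intros n [-> | Hn]; [lia | specialize (IH n Hn); lia]. }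
  destruct H as [N HN].
  apply Rle_trans with (rsum b (seq 0 (Datatypes.S N))).
  { apply rsum_incl; auto. intros n Hn. apply in_seq. specialize (HN n Hn). lia. }
  assert (E : forall n, rsum b (seq 0 (Datatypes.S n)) = sum_n b n).
  { induction n as [| n IH]; [rewrite sum_O; unfold rsum; simpl; ring |].
    rewrite seq_S, rsum_app, IH, sum_Sn. unfold rsum; simpl. rewrite Rplus_0_r. reflexivity. }
  rewrite E. apply is_lim_seq_incr_compare; [exact HS |].
  intros n. rewrite sum_Sn. unfold plus; simpl. specialize (Hb (Datatypes.S n)). lra.
Qed.

(** The bridge to the ordered series in the definition of [logeta]. *)
Lemma has_sum_series (a : nat -> C) l : has_sum a l -> cseries a = l.
Proof.
  intros H.
  assert (E : forall n, fsum a (seq 0 (S n)) = (sum_n (fun k => Re (a k)) n, sum_n (fun k => Im (a k)) n)).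
  { induction n as [| n IH]; [rewrite !sum_O; unfold fsum; simpl; destruct (a 0%nat); apply injective_projections; simpl; ring |].
    rewrite seq_S, fsum_app, IH, !sum_Sn. unfold fsum, plus; simpl. apply injective_projections; simpl; unfold Re, Im; ring. }
  assert (W : forall eps, 0 < eps -> exists N, forall n, (N <= n)%nat ->
     Cmod ((sum_n (fun k => Re (a k)) n, sum_n (fun k => Im (a k)) n) - l) < eps).
  { intros e He. destruct (H e He) as [L0 HL0].
    assert (exists N, forall n, In n L0 -> (n < N)%nat) as [N HN].
    { clear. induction L0 as [| x L [N IH]]; [exists 0%nat; simpl; tauto |].
      exists (Nat.max (S x) N). intros n [-> | Hn]; [lia | specialize (IH n Hn); lia]. }
    exists N. intros n Hn. rewrite <- E. apply HL0; [apply seq_NoDup |].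
    intros t Ht. apply in_seq. specialize (HN t Ht). lia. }
  unfold cseries. apply injective_projections; simpl; apply is_series_unique;
    apply is_lim_seq_Reals; intros e He; destruct (W e He) as [N HN]; exists N; intros n Hn;
    specialize (HN n Hn); unfold R_dist; (eapply Rle_lt_trans; [| exact HN]).
  - apply (re_le_Cmod ((sum_n (fun k => Re (a k)) n, sum_n (fun k => Im (a k)) n) - l)).
  - apply (Im_le_Cmod ((sum_n (fun k => Re (a k)) n, sum_n (fun k => Im (a k)) n) - l)).
Qed.

(** [Z.abs_nat] is injective on the nonnegative and on the negative integers, hence the bound
    [B + B]. *)
Lemma summable_Z (b : nat -> R) : summable b -> summable (fun z : Z => b (Z.abs_nat z)).
Proof.
  intros [Hb [B HB]]. split; auto. exists (B + B). intros L HL.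
  assert (E : forall M, rsum (fun z => b (Z.abs_nat z)) M =
     rsum (fun z => b (Z.abs_nat z)) (filter (fun z => Z.leb 0 z) M)
     + rsum (fun z => b (Z.abs_nat z)) (filter (fun z => negb (Z.leb 0 z)) M)).
  { induction M as [| x M IH]; [unfold rsum; simpl; ring |].
    simpl. destruct (Z.leb 0 x); simpl; unfold rsum in *; simpl; rewrite IH; ring. }
  rewrite E. apply Rplus_le_compat; rewrite <- (rsum_map b Z.abs_nat); apply HB; apply NoDup_map_inj.
  2, 4: apply NoDup_filter; auto.
  - intros x y Hx Hy Exy. apply filter_In in Hx, Hy. destruct Hx as [_ Hx], Hy as [_ Hy].
    apply Z.leb_le in Hx, Hy. lia.
  - intros x y Hx Hy Exy. apply filter_In in Hx, Hy. destruct Hx as [_ Hx], Hy as [_ Hy].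
    apply Bool.negb_true_iff, Z.leb_gt in Hx, Hy. lia.
Qed.

(* [(n+1)^-p <= C (n^(1-p) - (n+1)^(1-p))] telescopes, up to an index shift. *)
Lemma summable_pseries (p : R) : 1 < p -> summable (fun n => Rpower (INR n + 1) (- p)).
Proof.
  intros Hp. set (h := fun n : nat => Rpower (INR n + 1) (1 - p)).
  assert (Hpos : forall x y, 0 < Rpower x y) by (intros; apply exp_pos).
  assert (St : forall n : nat, (p - 1) * Rpower (INR n + 2) (- p) <= h n - h (S n)).
  { intros n. pose proof (pos_INR n). unfold h. rewrite S_INR.
    destruct (MVT_gen (fun x => Rpower x (1 - p)) (INR n + 1) (INR n + 2) (fun x => (1 - p) * Rpower x (- p))) as [c [Hc E]].
    - intros x Hx. rewrite Rmin_left, Rmax_right in Hx by lra. apply is_derive_Reals.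
      replace (- p) with (1 - p - 1) by ring. apply derivable_pt_lim_power. lra.
    - intros x Hx. rewrite Rmin_left, Rmax_right in Hx by lra. apply derivable_continuous_pt.
      eexists. apply derivable_pt_lim_power. lra.
    - rewrite Rmin_left, Rmax_right in Hc by lra.
      replace (INR n + 1 + 1) with (INR n + 2) by ring.
      assert (Rpower (INR n + 2) (- p) <= Rpower c (- p)).
      { rewrite !Rpower_Ropp. apply Rinv_le_contravar; [apply Hpos |]. apply Rle_Rpower_l; lra. }
      nra. }
  split; [intros; left; apply Hpos |].
  exists (Rpower 1 (- p) + Rpower 1 (1 - p) / (p - 1)). intros L HL.
  assert (exists N, forall n, In n L -> (n < N)%nat) as [N HN].
  { clear. induction L as [| x L [N IH]]; [exists 0%nat; simpl; tauto |].
    exists (Nat.max (S x) N). intros n [-> | Hn]; [lia | specialize (IH n Hn); lia]. }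
  apply Rle_trans with (rsum (fun n => Rpower (INR n + 1) (- p)) (seq 0 (S N))).
  { apply rsum_incl; auto; [intros; left; apply Hpos |]. intros n Hn. apply in_seq. specialize (HN n Hn). lia. }
  assert (W : forall n, (p - 1) * rsum (fun n => Rpower (INR n + 1) (- p)) (seq 0 (S n)) <=
     (p - 1) * Rpower 1 (- p) + (h 0%nat - h n)).
  { induction n as [| n IH].
    - unfold rsum; simpl. replace (0 + 1) with 1 by ring. lra.
    - rewrite seq_S, rsum_app. unfold rsum at 2. cbn [map fold_right]. change (0 + S n)%nat with (S n). rewrite S_INR.
      replace (INR n + 1 + 1) with (INR n + 2) by ring. specialize (St n). rewrite Rplus_0_r. nra. }
  specialize (W N). specialize (Hpos (INR N + 1) (1 - p)). unfold h in W. simpl (INR 0) in W. rewrite Rplus_0_l in W.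
  apply Rmult_le_reg_l with (p - 1); [lra |].
  replace ((p - 1) * (Rpower 1 (- p) + Rpower 1 (1 - p) / (p - 1))) with ((p - 1) * Rpower 1 (- p) + Rpower 1 (1 - p)) by (field; lra).
  lra.
Qed.

(** * Holomorphic functions *)

(** Continuity of the derivative is part of the notion, because derivatives are integrated over
    periods. *)
Definition hol (U : C -> Prop) (F F' : C -> C) : Prop :=
  forall z, U z -> Cd F z (F' z) /\ cts F' z.

Definition disc (z0 : C) (rho : R) (w : C) : Prop := Cmod (w - z0) < rho.

Lemma cts_comp (F G : C -> C) z : cts G z -> cts F (G z) -> cts (fun w => F (G w)) z.
Proof. intros H1 H2. apply tends_comp with (G z); auto. apply nearC_filter. Qed.

Lemma cts_ee z : cts ee z. Proof. eapply Cd_cts, Cd_ee. Qed.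

Ltac ctac := unfold cts; repeat first
  [ assumption | apply nearC_filter | apply tends_const | apply tends_id | apply tends_plus
  | apply tends_minus | apply tends_mult | apply tends_opp | apply cts_ee ].

Lemma ee_surj (w : C) : w <> 0%C -> exists s, ee s = w /\ Im s = - ln (Cmod w) / (2 * PI).
Proof.
  intros Hw. pose proof PI_RGT_0. exists (carg w / (2 * PI), - ln (Cmod w) / (2 * PI)). split; [| auto].
  rewrite <- (cexp_clog w Hw) at 3. unfold ee. f_equal. unfold clog. apply injective_projections; simpl; field; lra.
Qed.

Lemma Cmod_sub_pos (a b : C) : a <> b -> 0 < Cmod (a - b).
Proof. intros H. apply Cmod_gt_0. intro E. apply H. apply Cmod_sub_0. rewrite E; apply Cmod_0. Qed.

Section Curve.
Variables (G G' : C -> C) (z0 : C) (rho r : R).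
Hypothesis Hr : 0 < r <= rho.
Hypothesis HG : forall w, w <> z0 -> disc z0 rho w -> Cd G w (G' w) /\ cts G' w.

(** The map [s -> z0 + r * ee s] covers the punctured disc of radius [r] by the upper half-plane and
    sends the cusp to the centre; means over a period become means over circles. *)
Lemma curve_in s : 0 < Im s -> (z0 + RtoC r * ee s)%C <> z0 /\ disc z0 rho (z0 + RtoC r * ee s)%C
  /\ Cmod (z0 + RtoC r * ee s - z0) = r * Cmod (ee s).
Proof.
  intros Hs. assert (E : (z0 + RtoC r * ee s - z0)%C = (RtoC r * ee s)%C) by ring.
  assert (M : Cmod (z0 + RtoC r * ee s - z0) = r * Cmod (ee s)).
  { rewrite E, Cmod_mult, Cmod_R, Rabs_right; lra. }
  pose proof (Cmod_ee_lt_1 s Hs). assert (0 < Cmod (ee s)) by (apply Cmod_gt_0, ee_neq_0).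
  split; [| split; auto].
  - intro H1. rewrite H1 in M. replace (z0 - z0)%C with (RtoC 0) in M by ring. rewrite Cmod_0 in M. nra.
  - unfold disc. rewrite M. nra.
Qed.

Lemma curve_per s : 0 < Im s -> G (z0 + RtoC r * ee (s + 1))%C = G (z0 + RtoC r * ee s)%C.
Proof. intros. rewrite (ee_period s 1). auto. Qed.

Lemma curve_hol s : 0 < Im s ->
  Cd (fun s => G (z0 + RtoC r * ee s)%C) s (G' (z0 + RtoC r * ee s) * (0 + RtoC r * (2 * PI * Ci * ee s)))%C
  /\ cts (fun s => G' (z0 + RtoC r * ee s) * (0 + RtoC r * (2 * PI * Ci * ee s)))%C s.
Proof.
  intros Hs. destruct (curve_in s Hs) as [A [B _]]. destruct (HG _ A B) as [H1 H2]. split.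
  - apply (Cd_comp (fun s => z0 + RtoC r * ee s)%C G); auto.
    apply Cd_plus; [apply Cd_const | apply Cd_scal, Cd_ee].
  - apply tends_mult; [apply nearC_filter | | ctac].
    apply (cts_comp G' (fun s => z0 + RtoC r * ee s)%C); auto. ctac.
Qed.

Lemma curve_up : tends upward (fun s => z0 + RtoC r * ee s)%C z0.
Proof.
  apply tends_eq with (z0 + RtoC r * 0)%C; [| ring]. apply tends_plus; [apply upward_filter | apply tends_const, upward_filter |].
  apply tends_mult; [apply upward_filter | apply tends_const, upward_filter | apply tends_up_ee].
Qed.
End Curve.

(** [mean_max] carried over by this covering, with the centre of the disc in the role of the
    cusp. *)
Lemma disc_max (F F' : C -> C) z0 rho :
  0 < rho -> hol (disc z0 rho) F F' -> (forall w, disc z0 rho w -> Cmod (F w) <= Cmod (F z0)) ->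
  forall w, disc z0 rho w -> F w = F z0.
Proof.
  intros HR HF HB w Hw. destruct (classic (w = z0)) as [-> | Hn]; auto.
  pose proof (Cmod_sub_pos w z0 Hn) as Hp. unfold disc in Hw.
  assert (Hnz : ((w - z0) / RtoC rho)%C <> 0%C).
  { apply Cmod_gt_0. rewrite Cmod_div, Cmod_R, Rabs_right by (try lra; intro E; apply RtoC_inj in E; lra).
    apply Rdiv_lt_0_compat; auto. }
  destruct (ee_surj _ Hnz) as [s [Es Is]].
  assert (Hs : 0 < Im s).
  { rewrite Is, Cmod_div, Cmod_R, Rabs_right by (try lra; intro E; apply RtoC_inj in E; lra).
    pose proof PI_RGT_0. apply Rdiv_lt_0_compat; [| lra].
    assert (ln (Cmod (w - z0) / rho) < ln 1); [| rewrite ln_1 in H0; lra].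
    apply ln_increasing; [apply Rdiv_lt_0_compat; auto |].
    apply Rmult_lt_reg_r with rho; auto. unfold Rdiv. rewrite Rmult_assoc, Rinv_l; lra. }
  assert (H0 : forall v, v <> z0 -> disc z0 rho v -> Cd F v (F' v) /\ cts F' v) by auto.
  assert (HR2 : 0 < rho <= rho) by lra.
  assert (Ez : cts F z0).
  { eapply Cd_cts, HF. unfold disc. replace (z0 - z0)%C with (RtoC 0) by ring. rewrite Cmod_0; auto. }
  pose proof (mean_max (fun s => F (z0 + RtoC rho * ee s)%C) _ (-1)
    (fun s Hs => curve_per F z0 rho s Hs)
    (fun s Hs => Cd_cts _ _ _ (proj1 (curve_hol F F' z0 rho rho HR2 H0 s Hs)))
    (fun s Hs _ => curve_hol F F' z0 rho rho HR2 H0 s Hs) (F z0)) as MM.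
  rewrite <- (MM (tends_comp _ _ _ _ _ (curve_up z0 rho) Ez)) with s; auto.
  - f_equal. rewrite Es. field. intro E; apply RtoC_inj in E; lra.
  - intros t Ht. apply HB. apply (curve_in z0 rho rho HR2 t Ht).
Qed.

(** The difference quotient [Q] at [z0] tends to [F' z0] at the centre, so its mean over a circle
    bounds the derivative. On the circle of radius [rho / 2] the bound is [2 B / (rho / 2)]. *)
Lemma cauchy_est (F F' : C -> C) z0 rho B :
  0 < rho -> hol (disc z0 rho) F F' -> (forall w, disc z0 rho w -> Cmod (F w) <= B) ->
  Cmod (F' z0) <= 4 * B / rho.
Proof.
  intros HR HF HB.
  set (Q := fun w => ((F w - F z0) * / (w - z0))%C).
  set (Q' := fun w => ((F' w - 0) * / (w - z0) + (F w - F z0) * (- / ((w - z0) * (w - z0)) * (1 - 0)))%C).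
  assert (Dz : disc z0 rho z0). { unfold disc. replace (z0 - z0)%C with (RtoC 0) by ring. rewrite Cmod_0; auto. }
  assert (HQ : forall w, w <> z0 -> disc z0 rho w -> Cd Q w (Q' w) /\ cts Q' w).
  { intros w Hn Hw. destruct (HF w Hw) as [H1 H2].
    assert (Hnz : (w - z0)%C <> 0%C) by (apply Cmod_gt_0, Cmod_sub_pos; auto).
    assert (D0 : Cd (fun w => w - z0)%C w (1 - 0)%C) by (apply Cd_minus; [apply Cd_id | apply Cd_const]).
    pose proof (Cd_cts _ _ _ H1) as H3.
    split.
    - apply (Cd_mult (fun w => F w - F z0)%C (fun w => / (w - z0))%C).
      + apply Cd_minus; [auto | apply Cd_const].
      + apply (Cd_comp (fun w => w - z0)%C (fun v => / v)%C); auto. apply Cd_inv; auto.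
    - unfold Q'. ctac; apply tends_inv; try apply nearC_filter; ctac; auto.
      apply Cmult_neq_0; auto. }
  assert (HR2 : 0 < rho <= rho) by lra.
  assert (LQ : tends upward (fun s => Q (z0 + RtoC rho * ee s)%C) (F' z0)).
  { destruct (proj1 (HF z0 Dz)) as [phi [[d [Hd H1]] H2]].
    pose proof upward_filter. pose proof (curve_up z0 rho) as CU.
    apply tends_ext with (fun s => phi (z0 + RtoC rho * ee s)%C); auto.
    - destruct (CU d Hd) as [Y HY]. exists (Rmax 0 Y). intros s Hs.
      pose proof (Rmax_l 0 Y); pose proof (Rmax_r 0 Y).
      destruct (curve_in z0 rho rho HR2 s ltac:(lra)) as [A _].
      unfold Q. rewrite (H1 _ (HY s ltac:(lra))).
      assert ((z0 + RtoC rho * ee s - z0)%C <> 0%C) by (apply Cmod_gt_0, Cmod_sub_pos; auto).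
      field; auto.
    - apply tends_comp with z0; auto. }
  pose proof PI_RGT_0.
  assert (Hl2 : 0 < ln 2) by (rewrite <- ln_1; apply ln_increasing; lra).
  (* The height at which [|ee s| = 1/2]. *)
  set (y := ln 2 / (2 * PI)). assert (Hy : 0 < y) by (apply Rdiv_lt_0_compat; lra).
  apply (mean_limit_le (fun s => Q (z0 + RtoC rho * ee s)%C) _ (-1)
    (fun s Hs => curve_per Q z0 rho s Hs)
    (fun s Hs => Cd_cts _ _ _ (proj1 (curve_hol Q Q' z0 rho rho HR2 HQ s Hs)))
    (fun s Hs _ => curve_hol Q Q' z0 rho rho HR2 HQ s Hs) (F' z0) y); auto.
  intros x _. assert (Hs : 0 < Im (x, y)) by auto.
  destruct (curve_in z0 rho rho HR2 (x, y) Hs) as [A [B1 M]].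
  assert (M2 : Cmod (ee (x, y)) = / 2).
  { rewrite Cmod_ee. replace (- (2 * PI * Im (x, y))) with (- ln 2) by (unfold y; simpl; field; lra).
    rewrite exp_Ropp, exp_ln; lra. }
  rewrite M2 in M. unfold Q.
  pose proof (Cmod_sub_pos _ _ A).
  rewrite Cmod_mult, Cmod_inv, M by (apply Cmod_gt_0; auto).
  pose proof (HB _ B1). pose proof (HB _ Dz).
  assert (Cmod (F (z0 + RtoC rho * ee (x, y))%C - F z0) <= 2 * B).
  { unfold Cminus. eapply Rle_trans; [apply Cmod_triangle |]. rewrite Cmod_opp. lra. }
  replace (4 * B / rho) with (2 * B * / (rho * / 2)) by (field; lra).
  apply Rmult_le_compat_r; auto. left. apply Rinv_0_lt_compat. lra.
Qed.

(** Pairing with the conjugate of [F w - F z] reduces this to the real mean value theorem on the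
    segment. *)
Lemma mean_value_ineq (F F' : C -> C) z w B :
  (forall t, 0 <= t <= 1 -> Cd F (z + RtoC t * (w - z))%C (F' (z + RtoC t * (w - z))%C)
     /\ Cmod (F' (z + RtoC t * (w - z))%C) <= B) ->
  Cmod (F w - F z) <= B * Cmod (w - z).
Proof.
  intros H. set (u := Cconj (F w - F z)).
  assert (DD : forall t, 0 <= t <= 1 -> is_derive (fun s : R => Re (u * F (z + RtoC s * (w - z))%C)) t
     (Re (u * (F' (z + RtoC t * (w - z))%C * (w - z))))).
  { intros t Ht. apply Cd_line, H; auto. }
  destruct (MVT_gen (fun s : R => Re (u * F (z + RtoC s * (w - z))%C)) 0 1
     (fun t => Re (u * (F' (z + RtoC t * (w - z))%C * (w - z))))) as [c [Hc E]].
  - intros t Ht. rewrite Rmin_left, Rmax_right in Ht by lra. apply DD. lra.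
  - intros t Ht. rewrite Rmin_left, Rmax_right in Ht by lra. apply continuity_pt_filterlim.
    apply (ex_derive_continuous (V := R_NormedModule)). eexists. apply DD; auto.
  - rewrite Rmin_left, Rmax_right in Hc by lra.
    replace (z + RtoC 1 * (w - z))%C with w in E by ring. replace (z + RtoC 0 * (w - z))%C with z in E by ring.
    rewrite <- Re_Cminus in E. replace (u * F w - u * F z)%C with (u * (F w - F z))%C in E by ring.
    unfold u at 1 in E. rewrite Re_conj_mult in E.
    pose proof (Re_mult_le u (F' (z + RtoC c * (w - z))%C * (w - z))) as L.
    rewrite Cmod_mult in L. unfold u in L at 2. rewrite Cmod_conj in L.
    destruct (H c Hc) as [_ Hb]. apply Rabs_le_between in L.
    pose proof (Cmod_ge_0 (F w - F z)). pose proof (Cmod_ge_0 (w - z)).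
    set (X := Cmod (F w - F z)) in *.
    assert (X * (Cmod (F' (z + RtoC c * (w - z))%C) * Cmod (w - z)) <= X * (B * Cmod (w - z))).
    { apply Rmult_le_compat_l; auto. apply Rmult_le_compat_r; auto. }
    assert (0 <= B * Cmod (w - z)).
    { apply Rmult_le_pos; auto. eapply Rle_trans; [apply Cmod_ge_0 | apply Hb]. }
    destruct (Req_dec X 0) as [-> | Hx]; auto.
    apply Rmult_le_reg_l with X; [lra |]. nra.
Qed.

(* Weierstrass: Cauchy's estimate makes the derivatives summable as well. *)
Lemma weierstrass {T} (f f' : T -> C -> C) (b : T -> R) z0 rho :
  0 < rho -> summable b -> (forall t, hol (disc z0 rho) (f t) (f' t)) ->
  (forall t w, disc z0 rho w -> Cmod (f t w) <= b t) ->
  Cd (fun w => csum (fun t => f t w)) z0 (csum (fun t => f' t z0))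
  /\ cts (fun w => csum (fun t => f' t w)) z0 /\ has_sum (fun t => f' t z0) (csum (fun t => f' t z0)).
Proof.
  intros HR Hb Hf HB.
  (* Cauchy's estimate on discs of radius [rho / 2] around the points of the disc of half size:
     [4 / (rho / 2) = 8 / rho]. *)
  set (b' := fun t => 8 / rho * b t).
  assert (Hb' : summable b') by (apply summable_scal; auto; apply Rlt_le, Rdiv_lt_0_compat; lra).
  assert (Sub : forall w v, Cmod (w - z0) < rho / 2 -> disc w (rho / 2) v -> disc z0 rho v).
  { intros w v Hw Hv. unfold disc in *. pose proof (Cmod_sub_tri v w z0). lra. }
  assert (Bd : forall t w, Cmod (w - z0) < rho / 2 -> Cmod (f' t w) <= b' t).
  { intros t w Hw. unfold b'. replace (8 / rho * b t) with (4 * b t / (rho / 2)) by (field; lra).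
    apply cauchy_est with (f t); [lra | |].
    - intros v Hv. apply Hf. apply Sub with w; auto.
    - intros v Hv. apply HB. apply Sub with w; auto. }
  assert (Z0 : Cmod (z0 - z0) = 0) by (replace (z0 - z0)%C with (RtoC 0) by ring; apply Cmod_0).
  split; [| split].
  (* The difference quotients are dominated by [b'] through [mean_value_ineq]; Tannery's theorem
     gives the limit of their sum, which is the slope of the summed function. *)
  - set (phi := fun w t => match excluded_middle_informative (w = z0) with
      | left _ => f' t z0 | right _ => ((f t w - f t z0) / (w - z0))%C end).
    assert (Bp : forall w t, Cmod (w - z0) < rho / 2 -> Cmod (phi w t) <= b' t).
    { intros w t Hw. unfold phi. destruct (excluded_middle_informative (w = z0)) as [-> | Hn]; [apply Bd; lra |].
      pose proof (Cmod_sub_pos w z0 Hn). rewrite Cmod_div by (apply Cmod_gt_0; auto).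
      apply Rmult_le_reg_r with (Cmod (w - z0)); auto. unfold Rdiv. rewrite Rmult_assoc, Rinv_l, Rmult_1_r by lra.
      apply mean_value_ineq with (f' t). intros s Hs.
      assert (Hd : Cmod (z0 + RtoC s * (w - z0) - z0) < rho / 2).
      { replace (z0 + RtoC s * (w - z0) - z0)%C with (RtoC s * (w - z0))%C by ring.
        rewrite Cmod_mult, Cmod_R, Rabs_right by lra. nra. }
      split; [apply Hf; unfold disc; lra | apply Bd; auto]. }
    exists (fun w => csum (phi w)). split.
    + exists (rho / 2). split; [lra |]. intros w Hw. apply csum_has_sum.
      apply has_sum_ext with (fun t => f t z0 + (w - z0) * phi w t)%C.
      * intros t. unfold phi. destruct (excluded_middle_informative (w = z0)) as [-> | Hn]; [ring |].
        field. apply Cmod_gt_0, Cmod_sub_pos; auto.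
      * replace (csum (phi w) * (w - z0))%C with ((w - z0) * csum (phi w))%C by ring.
        apply has_sum_plus; [apply csum_spec with b; auto; intros; apply HB; unfold disc; lra |].
        apply has_sum_scal. apply csum_spec with b'; auto.
    + apply (tends_csum (nearC z0) phi (fun t => f' t z0) b'); auto.
      * exists (rho / 2). split; [lra |]. auto.
      * intros t. destruct (proj1 (Hf t z0 ltac:(unfold disc; lra))) as [p [H1 H2]].
        apply tends_ext with p; auto; [apply nearC_filter |].
        revert H1. apply filter_imp. intros w E. unfold phi.
        destruct (excluded_middle_informative (w = z0)) as [-> | Hn]; [apply tends_near_at; auto |].
        rewrite E. field. apply Cmod_gt_0, Cmod_sub_pos; auto.
  - apply (tends_csum (nearC z0) (fun w t => f' t w) (fun t => f' t z0) b'); auto.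
    + exists (rho / 2). split; [lra |]. auto.
    + intros t. apply Hf. unfold disc; lra.
  - apply csum_spec with b'; auto. intros; apply Bd; lra.
Qed.

Lemma hol_periodic_derivative (Phi Phi' : C -> C) :
  (forall s, 0 < Im s -> Phi (s + 1)%C = Phi s) -> hol upper Phi Phi' ->
  forall s, 0 < Im s -> Phi' (s + 1)%C = Phi' s.
Proof.
  intros Hper HP s Hs. apply Cd_unique with Phi s; [| apply HP; auto].
  apply Cd_ext with (fun w => Phi (w + 1)%C).
  - generalize (nearC_upper s 0 Hs). apply filter_imp. auto.
  - replace (Phi' (s + 1)%C) with (Phi' (s + 1)%C * (1 + 0))%C by ring.
    apply (Cd_comp (fun w => w + 1)%C Phi).
    + apply Cd_plus; [apply Cd_id | apply Cd_const].
    + apply HP. unfold upper. simpl. rewrite Rplus_0_r; auto.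
Qed.

Lemma bounded_segment (Phi : C -> C) y : (forall x, cts Phi (x, y)) ->
  exists B, forall x, 0 <= x <= 1 -> Cmod (Phi (x, y)) <= B.
Proof.
  intros H. destruct (continuity_ab_maj (fun x => Cmod (Phi (x, y))) 0 1) as [m [Hm _]]; [lra | |].
  - intros x _ e He. destruct (H x e He) as [d [Hd HD]]. exists d. split; auto.
    intros t [_ Ht]. cbn in *. unfold R_dist in *.
    specialize (HD (t, y)).
    assert (B : Cmod ((t, y) - (x, y)) < d).
    { eapply Rle_lt_trans; [apply Cmod_le_abs |]. simpl. replace (y + - y) with 0 by ring.
      rewrite Rabs_R0. unfold Rminus in Ht. lra. }
    specialize (HD B). pose proof (Cmod_le_sub (Phi (t, y)) (Phi (x, y))).
    pose proof (Cmod_le_sub (Phi (x, y)) (Phi (t, y))). rewrite (Cmod_sub_sym (Phi (x, y))) in H1.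
    apply Rabs_lt_between. lra.
  - exists (Cmod (Phi (m, y))). auto.
Qed.

(* Riemann's removable singularity theorem at a cusp. With [w = 1/(1-e(s0-s))], the function
   [(Phi - Phi(s0)) w] has mean value 0 at every height, and [w - 1] is small below [s0]. *)
Lemma cusp_limit (Phi Phi' : C -> C) :
  (forall s, 0 < Im s -> Phi (s + 1)%C = Phi s) -> hol upper Phi Phi' ->
  tends upward (fun s => Phi s * ee s)%C 0%C -> exists a, tends upward Phi a.
Proof.
  intros Hper HP HL. pose proof PI_RGT_0 as HPI. pose proof upward_filter as FU.
  assert (CP : forall s, 0 < Im s -> cts Phi s) by (intros s Hs; eapply Cd_cts, HP; auto).
  destruct (bounded_segment Phi 1) as [B HB].
  { intros x; apply CP, Rlt_0_1. }
  (* The complex mean of [Phi] at height 1 and the candidate for the limit; [Re (Ci * z)] is minus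
     the imaginary part of [z]. *)
  set (A := (hmean Phi 1 1, - hmean Phi Ci 1) : C).
  assert (HA : forall u, hmean Phi u 1 = Re (u * A)).
  { intros u. unfold A, hmean.
    assert (I1 := hmean_ex Phi 1 1 (fun x => CP (x, 1) Rlt_0_1)).
    assert (I2 := hmean_ex Phi Ci 1 (fun x => CP (x, 1) Rlt_0_1)).
    transitivity (plus (scal (Re u) (RInt (fun x => Re (1 * Phi (x, 1))) 0 1)) (scal (Im u) (RInt (fun x => Re (Ci * Phi (x, 1))) 0 1))).
    - rewrite <- !(RInt_scal (V := R_CompleteNormedModule)) by auto.
      rewrite <- (RInt_plus (V := R_CompleteNormedModule)) by (apply (ex_RInt_scal (V := R_NormedModule)); auto).
      apply RInt_ext. intros x _. unfold plus, scal, Re, Im; simpl. unfold mult; simpl. ring.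
    - unfold plus, scal; simpl. unfold mult; simpl. unfold Re, Im; simpl. ring. }
  assert (B0 : 0 <= B) by (eapply Rle_trans; [apply Cmod_ge_0 | apply (HB 0); lra]).
  exists A.
  (* The value at [s0] differs from the mean at height 1 by an amount of the order of
     [ee (s0 - Ci)], which is the size of [w - 1] at height 1. *)
  assert (Key : forall s0, 1 < Im s0 -> Cmod (ee (s0 - Ci)) <= / 4 ->
     Cmod (Phi s0 - A) <= (4 * B + 4 * Cmod A) * Cmod (ee (s0 - Ci))).
  { intros s0 H0 Hsm. set (c := Phi s0).
    set (E := fun s => (1 - ee (s0 - s))%C).
    set (E' := fun s => (0 - 2 * PI * Ci * ee (s0 - s) * (0 - 1))%C).
    assert (HE : forall s, Cd E s (E' s)).
    { intros s. apply Cd_minus; [apply Cd_const |].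
      apply (Cd_comp (fun s => s0 - s)%C ee); [apply Cd_minus; [apply Cd_const | apply Cd_id] | apply Cd_ee]. }
    assert (CE' : forall s, cts E' s).
    { intros s. unfold E'. ctac. apply (cts_comp ee (fun s => s0 - s)%C); [ctac | apply cts_ee]. }
    (* At the zeros of [E], the integer translates of [s0], the derivative [E'] is [2 * PI * Ci] and
       the numerator vanishes; the quotient is given its limit value there. *)
    set (K := fun s => match excluded_middle_informative (E s = 0%C) with
       | left _ => (Phi' s * / (2 * PI * Ci))%C | right _ => ((Phi s - c) * / E s)%C end).
    set (K' := fun s => ((Phi' s - 0) * / E s + (Phi s - c) * (- / (E s * E s) * E' s))%C).
    assert (KE : forall s, E s <> 0%C -> K s = ((Phi s - c) * / E s)%C).
    { intros s Hs. unfold K. destruct (excluded_middle_informative (E s = 0%C)); tauto. }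
    assert (NE : forall s, Im s <> Im s0 -> E s <> 0%C).
    { intros s Hs Hz. apply Hs. assert (ee (s0 - s) = 1%C).
      { replace (ee (s0 - s)) with (1 - E s)%C by (unfold E; ring). rewrite Hz. ring. }
      pose proof (Cmod_ee (s0 - s)) as M. rewrite H, Cmod_1, <- exp_0 in M. apply exp_inv in M.
      rewrite Im_Cminus in M. nra. }
    assert (Eper : forall s, E (s + 1)%C = E s).
    { intros s. unfold E. replace (s0 - (s + 1))%C with ((s0 - s) + RtoC (IZR (-1)))%C by ring.
      rewrite ee_period. auto. }
    assert (KH : forall s, 0 < Im s -> E s <> 0%C -> Cd K s (K' s) /\ cts K' s).
    { intros s Hs Hz. destruct (HP s Hs) as [H1 H2]. pose proof (Cd_cts _ _ _ (HE s)) as CE.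
      pose proof (CP s Hs) as C1. split.
      - apply Cd_ext with (fun s => ((Phi s - c) * / E s)%C).
        + pose proof (nearC_filter s). generalize (tends_neq_0 _ _ _ CE Hz). apply filter_imp. intros w Hw. symmetry. apply KE.
          apply Cmod_gt_0. pose proof (Cmod_ge_0 (E s)). lra.
        + apply (Cd_mult (fun s => Phi s - c)%C (fun s => / E s)%C).
          * apply Cd_minus; [auto | apply Cd_const].
          * apply (Cd_comp E (fun v => / v)%C); auto. apply Cd_inv; auto.
      - pose proof (CE' s) as CE1. unfold K'. ctac; (apply tends_inv; try apply nearC_filter; ctac; auto; apply Cmult_neq_0; auto). }
    assert (KC : forall s, 0 < Im s -> cts K s).
    { intros s Hs. destruct (classic (E s = 0%C)) as [Hz | Hz]; [| eapply Cd_cts, KH; auto].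
      destruct (HP s Hs) as [[p [H1 H2]] _]. destruct (HE s) as [q [H3 H4]].
      assert (Ep : c = Phi s).
      { assert (E1 : ee (s0 - s) = 1%C).
        { replace (ee (s0 - s)) with (1 - E s)%C by (unfold E; ring). rewrite Hz. ring. }
        unfold ee in E1. apply cexp_eq_1 in E1. destruct E1 as [n Hn].
        assert (En : (s0 - s)%C = RtoC (IZR n)).
        { assert (Hc : (2 * PI * Ci)%C <> 0%C).
          { apply Cmod_gt_0. rewrite !Cmod_mult, Cmod_Ci, !Cmod_R, !Rabs_right; lra. }
          transitivity (2 * PI * Ci * (s0 - s) / (2 * PI * Ci))%C; [field; split; intro HH; apply Hc; rewrite HH; ring |].
          rewrite Hn. field. split; intro HH; apply Hc; rewrite HH; ring. }
        unfold c. rewrite <- (periodic_Z Phi Hper n s Hs). f_equal. rewrite <- En. ring. }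
      assert (E2 : E' s = (2 * PI * Ci)%C).
      { unfold E'. replace (ee (s0 - s)) with (1 - E s)%C by (unfold E; ring). rewrite Hz. ring. }
      rewrite E2 in H4.
      assert (Hc : (2 * PI * Ci)%C <> 0%C).
      { apply Cmod_gt_0. rewrite !Cmod_mult, Cmod_Ci, !Cmod_R, !Rabs_right; lra. }
      assert (L : tends (nearC s) (fun w => p w * / q w)%C (Phi' s * / (2 * PI * Ci))%C).
      { pose proof (nearC_filter s). apply tends_mult; auto. apply tends_inv; auto. }
      assert (Ks : K s = (Phi' s * / (2 * PI * Ci))%C).
      { unfold K. destruct (excluded_middle_informative (E s = 0%C)); tauto. }
      unfold cts. rewrite Ks. apply tends_ext with (fun w => p w * / q w)%C; auto; [apply nearC_filter |].
      pose proof (nearC_filter s).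
      generalize (filter_and _ _ (filter_and _ _ H1 H3) (tends_neq_0 _ _ _ H4 Hc)). apply filter_imp.
      intros w [[W1 W2] W3]. destruct (classic (w = s)) as [-> | Hn].
      - rewrite Ks. rewrite (tends_near_at _ _ _ H2), (tends_near_at _ _ _ H4). auto.
      - assert (q w <> 0%C) by (apply Cmod_gt_0; pose proof (Cmod_ge_0 (2 * PI * Ci)); lra).
        assert ((w - s)%C <> 0%C) by (apply Cmod_gt_0, Cmod_sub_pos; auto).
        rewrite Hz in W2. rewrite KE by (rewrite W2; replace (0 + q w * (w - s))%C with (q w * (w - s))%C by ring; apply Cmult_neq_0; auto).
        rewrite W1, W2, Ep. field; auto. }
    assert (KP : forall s, 0 < Im s -> K (s + 1)%C = K s).
    { intros s Hs. unfold K. rewrite Eper, Hper, (hol_periodic_derivative Phi Phi') by auto. auto. }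
    (* The growth hypothesis enters here: [K] is [(Phi - c) * ee s / (ee s - ee s0)], whose
       denominator tends to [- ee s0]. *)
    assert (KL : tends upward K 0%C).
    { apply tends_ext with (fun s => (Phi s * ee s - c * ee s) * / (ee s - ee s0))%C; auto.
      - exists (Im s0). intros s Hs. rewrite KE by (apply NE; lra).
        assert (Ee : (E s = (ee s - ee s0) / ee s)%C).
        { unfold E. rewrite ee_minus. field. apply ee_neq_0. }
        assert (ee s - ee s0 <> 0)%C.
        { intro Hz. apply (NE s); [lra |]. rewrite Ee, Hz. field. apply ee_neq_0. }
        rewrite Ee. field. split; auto. apply ee_neq_0.
      - apply tends_eq with ((0 - c * 0) * / (0 - ee s0))%C.
        + apply tends_mult; auto.
          * apply tends_minus; auto. apply tends_mult; auto; [apply tends_const; auto | apply tends_up_ee].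
          * apply tends_inv; auto; [apply tends_minus; auto; [apply tends_up_ee | apply tends_const; auto] |].
            replace (0 - ee s0)%C with (- ee s0)%C by ring. intro Hz. apply (ee_neq_0 s0).
            replace (ee s0) with (- - ee s0)%C by ring. rewrite Hz. ring.
        + ring. }
    pose proof (fun u => hmean_lim K K' (Im s0) KP KC (fun s Hs Hn => KH s Hs (NE s Hn)) 0%C KL u 1 Rlt_0_1) as MK.
    (* [K] has mean 0 at height 1, and [Phi - c] has mean [A - c]. *)
    assert (MK2 : forall u, Re (u * (c - A)) = hmean (fun s => K s - (Phi s - c))%C u 1).
    { intros u. rewrite (hmean_minus K (fun s => Phi s - c)%C).
      - rewrite MK, (hmean_minus Phi (fun _ => c)), HA.
        + unfold hmean. rewrite RInt_const. unfold scal; simpl. unfold mult, Re, Im; simpl. ring.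
        + intros; apply CP, Rlt_0_1.
        + intros; ctac.
      - intros; apply KC, Rlt_0_1.
      - intros x. assert (cts Phi (x, 1)) by (apply CP, Rlt_0_1). ctac. }
    set (t := Cmod (ee (s0 - Ci))) in *. assert (Ht : 0 <= t) by apply Cmod_ge_0.
    assert (Bd : forall x, 0 <= x <= 1 -> Cmod (K (x, 1) - (Phi (x, 1) - c)) <= (B + Cmod c) * (4 / 3 * t)).
    { intros x Hx. rewrite KE by (apply NE; simpl; lra).
      assert (Et : Cmod (ee (s0 - (x, 1))) = t).
      { unfold t. rewrite !Cmod_ee. reflexivity. }
      assert (Hn : E (x, 1) <> 0%C) by (apply NE; simpl; lra).
      replace ((Phi (x, 1) - c) * / E (x, 1) - (Phi (x, 1) - c))%C with ((Phi (x, 1) - c) * (ee (s0 - (x, 1)) / E (x, 1)))%C.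
      2:{ replace (ee (s0 - (x, 1))) with (1 - E (x, 1))%C by (unfold E; ring). field; auto. }
      rewrite Cmod_mult, Cmod_div, Et by auto.
      assert (L1 : Cmod (Phi (x, 1) - c) <= B + Cmod c).
      { unfold Cminus. eapply Rle_trans; [apply Cmod_triangle |]. rewrite Cmod_opp. specialize (HB x Hx). lra. }
      assert (L2 : 3 / 4 <= Cmod (E (x, 1))).
      { pose proof (Cmod_le_sub 1 (E (x, 1))). rewrite Cmod_1 in H.
        replace (1 - E (x, 1))%C with (ee (s0 - (x, 1))) in H by (unfold E; ring). lra. }
      apply Rmult_le_compat; auto; [apply Cmod_ge_0 | apply Rmult_le_pos; auto; left; apply Rinv_0_lt_compat; lra |].
      unfold Rdiv at 1. rewrite Rmult_comm. apply Rmult_le_compat_r; auto.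
      replace (4 / 3) with (/ (3 / 4)) by field. apply Rinv_le_contravar; lra. }
    assert (L : Cmod (c - A) <= (B + Cmod c) * (4 / 3 * t)).
    { pose proof (hmean_le (fun s => K s - (Phi s - c))%C (Cconj (c - A)) 1 ((B + Cmod c) * (4 / 3 * t))) as HH.
      rewrite <- MK2, Re_conj_mult, Cmod_conj in HH.
      pose proof (Cmod_ge_0 (c - A)). pose proof (Cmod_ge_0 c). rewrite Rabs_right in HH by nra.
      assert (HX : Cmod (c - A) ^ 2 <= Cmod (c - A) * ((B + Cmod c) * (4 / 3 * t))).
      { apply HH; auto. intros x. assert (cts Phi (x, 1)) by (apply CP, Rlt_0_1).
        assert (cts K (x, 1)) by (apply KC, Rlt_0_1). ctac. }
      destruct (Req_dec (Cmod (c - A)) 0) as [-> | Hx]; [apply Rmult_le_pos; nra |].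
      apply Rmult_le_reg_l with (Cmod (c - A)); lra. }
    (* The bound just obtained contains [c] itself; as [t <= 1/4], that part can be absorbed, and
       [c] is bounded in terms of [A] and [B]. *)
    pose proof (Cmod_le_sub c A). pose proof (Cmod_ge_0 c). pose proof (Cmod_ge_0 A).
    assert ((B + Cmod c) * (4 / 3 * t) <= (B + Cmod c) * (1 / 3)) by (apply Rmult_le_compat_l; lra).
    assert (Hc : Cmod c <= 3 / 2 * Cmod A + B / 2) by lra.
    assert (0 <= (4 * B + 4 * Cmod A - 4 / 3 * (B + Cmod c)) * t) by (apply Rmult_le_pos; lra). fold c. lra. }
  intros e He.
  assert (He2 : 0 < Rmin (/ 4) (e / (4 * B + 4 * Cmod A + 1))).
  { apply Rmin_pos; [lra |]. apply Rdiv_lt_0_compat; auto. pose proof (Cmod_ge_0 A). lra. }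
  destruct (tends_up_ee _ He2) as [Y HY]. exists (Rmax 1 (Y + 1)). intros s Hs.
  pose proof (Rmax_l 1 (Y + 1)); pose proof (Rmax_r 1 (Y + 1)).
  pose proof (Rmin_l (/ 4) (e / (4 * B + 4 * Cmod A + 1))). pose proof (Rmin_r (/ 4) (e / (4 * B + 4 * Cmod A + 1))).
  specialize (HY (s - Ci)%C). replace (ee (s - Ci) - 0)%C with (ee (s - Ci)) in HY by ring.
  assert (Hy : Cmod (ee (s - Ci)) < Rmin (/ 4) (e / (4 * B + 4 * Cmod A + 1))) by (apply HY; rewrite Im_Cminus; change (Im Ci) with 1; lra).
  pose proof (Key s ltac:(lra) ltac:(lra)). pose proof (Cmod_ge_0 A). pose proof (Cmod_ge_0 (ee (s - Ci))).
  assert (Q : Cmod (ee (s - Ci)) < e / (4 * B + 4 * Cmod A + 1)) by lra.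
  apply (Rmult_lt_compat_l (4 * B + 4 * Cmod A + 1)) in Q; [| lra].
  replace ((4 * B + 4 * Cmod A + 1) * (e / (4 * B + 4 * Cmod A + 1))) with e in Q by (field; lra). nra.
Qed.

(** [disc_max] spreads the maximal value over the disc of radius [Im p] about any point [p] where it
    is attained. Climbing the vertical line through [z0], one reaches a point whose disc contains
    the given [w]. *)
Lemma chain_max (F F' : C -> C) z0 : upper z0 -> hol upper F F' ->
  (forall w, upper w -> Cmod (F w) <= Cmod (F z0)) -> forall w, upper w -> F w = F z0.
Proof.
  intros H0 HF HB.
  assert (St : forall p, upper p -> F p = F z0 -> forall w, disc p (Im p) w -> F w = F z0).
  { intros p Hp E w Hw. rewrite <- E.
    assert (Sub : forall v, disc p (Im p) v -> upper v).
    { intros v Hv. unfold disc in Hv. pose proof (Im_le_Cmod (v - p)). rewrite Im_Cminus in H.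
      apply Rabs_le_between in H. unfold upper. lra. }
    apply (disc_max F F' p (Im p)); auto.
    - intros v Hv. apply HF; auto.
    - intros v Hv. rewrite E. auto. }
  destruct z0 as [x0 y0]. unfold upper in H0. simpl in H0.
  (* Multiplying the height by 3/2 moves by half the radius of the disc. *)
  assert (Up : forall n : nat, F (x0, y0 * (1 + / 2) ^ n) = F (x0, y0)).
  { induction n as [| n IH]; [simpl; rewrite Rmult_1_r; auto |].
    assert (0 < (1 + / 2) ^ n) by (apply pow_lt; lra).
    assert (0 < y0 * (1 + / 2) ^ n) by (apply Rmult_lt_0_compat; auto).
    apply (St (x0, y0 * (1 + / 2) ^ n)); auto.
    unfold disc. eapply Rle_lt_trans; [apply Cmod_le_abs |]. cbn [Im Re fst snd Cminus Cplus Copp].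
    replace (x0 + - x0) with 0 by ring. rewrite Rabs_R0.
    replace (y0 * (1 + / 2) ^ S n + - (y0 * (1 + / 2) ^ n)) with (/ 2 * (y0 * (1 + / 2) ^ n)) by (simpl; field).
    rewrite Rabs_right; lra. }
  intros [x y] Hw. unfold upper in Hw. simpl in Hw.
  (* The point [(x, y)] lies in the disc about [(x0, Y)] of radius [Y] exactly when [Y] exceeds this
     number. *)
  set (Q := ((x - x0) ^ 2 + y ^ 2) / (2 * y)).
  destruct (archimed (2 * Q / y0)) as [A _].
  set (N := Z.to_nat (Z.max 0 (up (2 * Q / y0)))).
  assert (HN : 2 * Q / y0 < INR N).
  { unfold N. rewrite INR_IZR_INZ, Z2Nat.id by lia.
    eapply Rlt_le_trans; [exact A |]. apply IZR_le. lia. }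
  pose proof (poly N (/ 2) ltac:(lra)) as Hpoly.
  set (Y := y0 * (1 + / 2) ^ N) in *.
  assert (HY : Q < Y).
  { unfold Y. apply Rlt_le_trans with (y0 * (1 + INR N * / 2)); [| apply Rmult_le_compat_l; lra].
    apply (Rmult_lt_compat_r y0) in HN; auto. unfold Rdiv in HN. rewrite Rmult_assoc, Rinv_l in HN by lra. lra. }
  assert (HQ : (x - x0) ^ 2 + y ^ 2 < 2 * y * Y).
  { apply (Rmult_lt_compat_l (2 * y)) in HY; [| lra]. unfold Q in HY.
    replace (2 * y * (((x - x0) ^ 2 + y ^ 2) / (2 * y))) with ((x - x0) ^ 2 + y ^ 2) in HY by (field; lra). auto. }
  assert (HYp : 0 < Y) by (unfold Y; apply Rmult_lt_0_compat; auto; apply pow_lt; lra).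
  apply (St (x0, Y)); [exact HYp | apply Up |].
  unfold disc. simpl (Im (x0, Y)).
  assert (E : Cmod ((x, y) - (x0, Y)) ^ 2 = (x - x0) ^ 2 + (y - Y) ^ 2) by (rewrite Cmod2_alt; simpl; ring).
  pose proof (Cmod_ge_0 ((x, y) - (x0, Y))). nra.
Qed.

Lemma Cmod_cts_2d (F : C -> C) x y : cts F (x, y) -> continuity_2d_pt (fun a b => Cmod (F (a, b))) x y.
Proof.
  intros H [e He]. destruct (H e He) as [d [Hd HD]].
  assert (Hd2 : 0 < d / 2) by lra. exists (mkposreal _ Hd2). cbn [pos]. intros a b Ha Hb.
  assert (B : Cmod ((a, b) - (x, y)) < d).
  { eapply Rle_lt_trans; [apply Cmod_le_abs |]. simpl. unfold Rminus in *. lra. }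
  specialize (HD _ B). pose proof (Cmod_le_sub (F (a, b)) (F (x, y))).
  pose proof (Cmod_le_sub (F (x, y)) (F (a, b))). rewrite (Cmod_sub_sym (F (x, y))) in H1.
  apply Rabs_lt_between. lra.
Qed.

(** The maximum is taken over [y] first and then over [x]. The inner maximum is continuous in [x] by
    uniform continuity, even if the maximising [Y x] is not. *)
Lemma rect_max (F : C -> C) c d : 0 < c <= d -> (forall z, 0 < Im z -> cts F z) ->
  exists x y, 0 <= x <= 1 /\ c <= y <= d /\
    forall x' y', 0 <= x' <= 1 -> c <= y' <= d -> Cmod (F (x', y')) <= Cmod (F (x, y)).
Proof.
  intros Hcd HF. set (u := fun a b => Cmod (F (a, b))).
  assert (CU : forall a b, 0 < b -> continuity_2d_pt u a b) by (intros; apply Cmod_cts_2d, HF; auto).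
  assert (Hy : forall x, exists y, c <= y <= d /\ forall y', c <= y' <= d -> u x y' <= u x y).
  { intros x. destruct (continuity_ab_maj (fun b => u x b) c d) as [m [Hm Hi]]; [lra | |].
    - intros b Hb e He. destruct (CU x b ltac:(lra) (mkposreal e He)) as [dd Hdd]. exists dd.
      split; [apply cond_pos |]. intros t [_ Ht]. apply Hdd; auto.
      rewrite Rminus_diag_eq, Rabs_R0 by auto. apply cond_pos.
    - exists m; auto. }
  set (Y := fun x => proj1_sig (constructive_indefinite_description _ (Hy x))).
  assert (HY : forall x, c <= Y x <= d /\ forall y', c <= y' <= d -> u x y' <= u x (Y x)).
  { intros x. unfold Y. apply (proj2_sig (constructive_indefinite_description _ (Hy x))). }
  destruct (continuity_ab_maj (fun x => u x (Y x)) 0 1) as [m [Hm Hi]]; [lra | |].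
  - intros x Hx e He. assert (He2 : 0 < e / 2) by lra.
    destruct (uniform_continuity_2d u (-1) 2 c d) with (eps := mkposreal _ He2) as [dd Hdd].
    { intros; apply CU; lra. }
    cbn [pos] in Hdd. pose proof (cond_pos dd). exists (Rmin dd 1). split; [apply Rmin_pos; lra |].
    intros t [_ Ht]. cbn in Ht. unfold R_dist in Ht. pose proof (Rmin_l dd 1); pose proof (Rmin_r dd 1).
    change (Rabs (u t (Y t) - u x (Y x)) < e).
    destruct (HY t) as [T1 T2]. destruct (HY x) as [X1 X2].
    assert (Ht1 : Rabs (t - x) < 1) by lra. apply Rabs_lt_between in Ht1.
    assert (Z : forall v, Rabs (v - v) < dd) by (intros; rewrite Rminus_diag_eq, Rabs_R0 by auto; auto).
    pose proof (Hdd x (Y x) t (Y x) ltac:(lra) X1 ltac:(lra) X1 ltac:(lra) (Z _)) as P1.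
    pose proof (Hdd x (Y t) t (Y t) ltac:(lra) T1 ltac:(lra) T1 ltac:(lra) (Z _)) as P2.
    apply Rabs_lt_between in P1. apply Rabs_lt_between in P2.
    specialize (T2 (Y x) X1). specialize (X2 (Y t) T1). apply Rabs_lt_between. lra.
  - exists m, (Y m). split; auto. split; [apply HY |]. intros x' y' Hx' Hy'.
    eapply Rle_trans; [apply (proj2 (HY x') y' Hy') | apply Hm; auto].
Qed.

Lemma argmax3 (h : nat -> R) : exists m, (m <= 2)%nat /\ forall i, (i <= 2)%nat -> h i <= h m.
Proof.
  assert (W : forall i, (i <= 2)%nat -> i = 0%nat \/ i = 1%nat \/ i = 2%nat) by (intros; lia).
  destruct (Rle_dec (h 0%nat) (h 1%nat)); [destruct (Rle_dec (h 1%nat) (h 2%nat)) | destruct (Rle_dec (h 0%nat) (h 2%nat))].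
  1, 3: exists 2%nat. 3: exists 1%nat. 4: exists 0%nat.
  all: split; [lia |]; intros i Hi; destruct (W i Hi) as [-> | [-> | ->]]; lra.
Qed.

(** [G i] stands for one function seen from three cusps. Either no value exceeds the largest cusp
    value, and [mean_max] applies at that cusp; or some value does, and then the supremum is
    attained in a compact rectangle and the interior maximum principle applies. *)
Lemma liouville3 (G G' : nat -> C -> C) (a : nat -> C) (c0 : R) : 0 < c0 ->
  (forall i, (i <= 2)%nat -> hol upper (G i) (G' i)) ->
  (forall i s, (i <= 2)%nat -> 0 < Im s -> G i (s + 1)%C = G i s) ->
  (forall i, (i <= 2)%nat -> tends upward (G i) (a i)) ->
  (forall i s, (i <= 2)%nat -> upper s -> exists j t, (j <= 2)%nat /\ c0 <= Im t /\ G i s = G j t) ->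
  exists i c, (i <= 2)%nat /\ forall s, upper s -> G i s = c.
Proof.
  intros Hc0 HG Hper Hlim Hred.
  assert (HC : forall i z, (i <= 2)%nat -> 0 < Im z -> cts (G i) z) by (intros i z Hi Hz; eapply Cd_cts, (HG i Hi); auto).
  destruct (argmax3 (fun i => Cmod (a i))) as [m [Hm Hmax]].
  destruct (classic (forall i s, (i <= 2)%nat -> upper s -> Cmod (G i s) <= Cmod (a m))) as [HA | HB].
  - exists m, (a m). split; auto. intros s Hs.
    apply (mean_max (G m) (G' m) (-1)); auto. intros t Ht _. apply HG; auto.
  - assert (exists i1 s1, (i1 <= 2)%nat /\ upper s1 /\ Cmod (a m) < Cmod (G i1 s1)) as [i1 [s1 [Hi1 [Hs1 Hb]]]].
    { apply NNPP. intros Hn. apply HB. intros i s Hi Hs. apply Rnot_lt_le. intros Hlt. apply Hn. exists i, s; auto. }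
    set (beta := Cmod (G i1 s1)) in *.
    (* Above some height all three functions stay below [beta], so the maximum is found in [[0, 1] x
       [c0, Y]]. *)
    assert (HY : forall i, (i <= 2)%nat -> exists Y, forall s, Y < Im s -> Cmod (G i s) < beta).
    { intros i Hi. destruct (Hlim i Hi (beta - Cmod (a m)) ltac:(lra)) as [Y HY]. exists Y. intros s Hs.
      specialize (HY s Hs). pose proof (Cmod_le_sub (G i s) (a i)). specialize (Hmax i Hi). simpl in Hmax. lra. }
    assert (exists Y, c0 <= Y /\ forall i s, (i <= 2)%nat -> Y < Im s -> Cmod (G i s) < beta) as [Y [HYc HYb]].
    { destruct (HY 0%nat ltac:(lia)) as [Y0 H0]. destruct (HY 1%nat ltac:(lia)) as [Y1 H1]. destruct (HY 2%nat ltac:(lia)) as [Y2 H2].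
      exists (Rmax c0 (Rmax Y0 (Rmax Y1 Y2))). split; [apply Rmax_l |]. intros i s Hi Hs.
      pose proof (Rmax_r c0 (Rmax Y0 (Rmax Y1 Y2))). pose proof (Rmax_l Y0 (Rmax Y1 Y2)). pose proof (Rmax_r Y0 (Rmax Y1 Y2)).
      pose proof (Rmax_l Y1 Y2). pose proof (Rmax_r Y1 Y2).
      assert (i = 0 \/ i = 1 \/ i = 2)%nat as [-> | [-> | ->]] by lia; [apply H0 | apply H1 | apply H2]; lra. }
    assert (HP : forall i, exists p, (i <= 2)%nat -> upper p /\ forall x y, 0 <= x <= 1 -> c0 <= y <= Y -> Cmod (G i (x, y)) <= Cmod (G i p)).
    { intros i. destruct (le_gt_dec i 2) as [Hi | Hi]; [| exists (RtoC 0); lia].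
      destruct (rect_max (G i) c0 Y) as [x [y [Hx [Hy HM]]]]; auto.
      exists (x, y). intros _. split; auto. unfold upper; simpl; lra. }
    set (p := fun i => proj1_sig (constructive_indefinite_description _ (HP i))).
    assert (Hp : forall i, (i <= 2)%nat -> upper (p i) /\ forall x y, 0 <= x <= 1 -> c0 <= y <= Y -> Cmod (G i (x, y)) <= Cmod (G i (p i))).
    { intros i. apply (proj2_sig (constructive_indefinite_description _ (HP i))). }
    destruct (argmax3 (fun i => Cmod (G i (p i)))) as [k [Hk Hkm]]. simpl in Hkm.
    assert (Rect : forall j t, (j <= 2)%nat -> c0 <= Im t <= Y -> Cmod (G j t) <= Cmod (G k (p k))).
    { intros j [x y] Hj Ht. simpl in Ht. destruct (archimed x) as [A1 A2].
      rewrite <- (periodic_Z (G j) (fun s => Hper j s Hj) (1 - up x)) by (simpl; lra).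
      replace ((x, y) + RtoC (IZR (1 - up x)))%C with ((x + 1 - IZR (up x), y) : C)
        by (rewrite minus_IZR; apply injective_projections; simpl; ring).
      eapply Rle_trans; [apply (proj2 (Hp j Hj)); lra | apply Hkm; auto]. }
    assert (Beta : beta <= Cmod (G k (p k))).
    { destruct (Hred i1 s1 Hi1 Hs1) as [j [t [Hj [Ht E]]]]. unfold beta. rewrite E. apply Rect; auto.
      split; auto. apply Rnot_lt_le. intros Hlt. specialize (HYb j t Hj Hlt). unfold beta in HYb. rewrite E in HYb. lra. }
    exists k, (G k (p k)). split; auto. apply (chain_max (G k) (G' k)); auto; [apply Hp; auto |].
    intros w Hw. destruct (Hred k w Hk Hw) as [j [t [Hj [Ht E]]]]. rewrite E.
    destruct (Rle_dec (Im t) Y) as [L | L]; [apply Rect; auto |].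
    specialize (HYb j t Hj ltac:(lra)). lra.
Qed.

(** * Moebius transformations *)

Lemma cz_Im (c d : Z) (tau : C) : Im (IZR c * tau + IZR d)%C = IZR c * Im tau.
Proof. unfold Im; simpl. ring. Qed.

Lemma cz_Re (c d : Z) (tau : C) : Re (IZR c * tau + IZR d)%C = IZR c * Re tau + IZR d.
Proof. unfold Re; simpl. ring. Qed.

Lemma cz_neq_0 (c d : Z) (tau : C) : upper tau -> (c <> 0 \/ d <> 0)%Z -> (IZR c * tau + IZR d)%C <> 0%C.
Proof.
  intros Ht H E. unfold upper in Ht. pose proof (f_equal Im E) as E1. pose proof (f_equal Re E) as E2.
  rewrite cz_Im in E1. rewrite cz_Re in E2. simpl in E1, E2.
  apply Rmult_integral in E1. destruct E1 as [E1 | E1]; [| lra].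
  rewrite E1 in E2. rewrite Rmult_0_l, Rplus_0_l in E2. apply eq_IZR in E1, E2. lia.
Qed.

Lemma det_row (a b c d : Z) : (a * d - b * c = 1)%Z -> (c <> 0 \/ d <> 0)%Z.
Proof. intros H. destruct (Z.eq_dec c 0) as [-> | ?]; [right; intro; subst; lia | auto]. Qed.

Lemma Im_mobius (a b c d : Z) (tau : C) : (a * d - b * c = 1)%Z -> upper tau ->
  Im (mobius a b c d tau) = Im tau / Cmod (IZR c * tau + IZR d) ^ 2.
Proof.
  intros H Ht. pose proof (cz_neq_0 c d tau Ht (det_row a b c d H)) as Hn.
  apply Cmod_gt_0 in Hn as Hp.
  assert (E2 : Cmod (IZR c * tau + IZR d) ^ 2 = (IZR c * Re tau + IZR d) ^ 2 + (IZR c * Im tau) ^ 2).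
  { rewrite Cmod2_alt, cz_Im, cz_Re. auto. }
  assert (HZ : IZR a * IZR d - IZR b * IZR c = 1) by (rewrite <- !mult_IZR, <- minus_IZR, H; auto).
  assert (Hq : 0 < Cmod (IZR c * tau + IZR d) ^ 2) by (apply pow_lt; auto).
  rewrite E2 in *. unfold mobius. destruct tau as [x y]. unfold Cdiv, Cinv, Im, Re in *. simpl in *.
  transitivity (y * (IZR a * IZR d - IZR b * IZR c) / ((IZR c * x + IZR d) ^ 2 + (IZR c * y) ^ 2)); [| rewrite HZ; simpl; field; lra].
  field. intro E. lra.
Qed.

Lemma upper_mobius (a b c d : Z) (tau : C) : (a * d - b * c = 1)%Z -> upper tau -> upper (mobius a b c d tau).
Proof.
  intros H Ht. unfold upper. rewrite Im_mobius by auto. apply Rdiv_lt_0_compat; auto.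
  apply pow_lt, Cmod_gt_0, cz_neq_0; auto. apply (det_row a b); auto.
Qed.

Lemma cz_mobius (a b c d m n : Z) (tau : C) : (a * d - b * c = 1)%Z -> upper tau ->
  (IZR m * mobius a b c d tau + IZR n)%C =
  ((IZR (m * a + n * c) * tau + IZR (m * b + n * d)) / (IZR c * tau + IZR d))%C.
Proof.
  intros H Ht. pose proof (cz_neq_0 c d tau Ht (det_row a b c d H)) as Hn. unfold mobius.
  rewrite !plus_IZR, !mult_IZR, !RtoC_plus, !RtoC_mult. field; auto.
Qed.

Lemma mobius_comp (a b c d a' b' c' d' : Z) (tau : C) :
  (a' * d' - b' * c' = 1)%Z -> (a * d - b * c = 1)%Z -> upper tau ->
  mobius a b c d (mobius a' b' c' d' tau) =
  mobius (a * a' + b * c') (a * b' + b * d') (c * a' + d * c') (c * b' + d * d') tau.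
Proof.
  intros H1 H2 Ht. unfold mobius at 1. rewrite !cz_mobius by auto.
  pose proof (cz_neq_0 c' d' tau Ht (det_row a' b' c' d' H1)) as Hn.
  assert (Hn2 : (IZR (c * a' + d * c') * tau + IZR (c * b' + d * d'))%C <> 0%C).
  { apply cz_neq_0; auto. apply (det_row (a * a' + b * c') (a * b' + b * d')).
    transitivity ((a * d - b * c) * (a' * d' - b' * c'))%Z; [ring | rewrite H1, H2; auto]. }
  unfold mobius. field; auto.
Qed.

Lemma mobius_inv (a b c d : Z) (tau : C) : (a * d - b * c = 1)%Z -> upper tau ->
  mobius a b c d (mobius d (- b) (- c) a tau) = tau.
Proof.
  intros H Ht. rewrite mobius_comp by (auto; lia).
  replace (a * d + b * - c)%Z with 1%Z by lia. replace (a * - b + b * a)%Z with 0%Z by lia.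
  replace (c * d + d * - c)%Z with 0%Z by lia. replace (c * - b + d * a)%Z with 1%Z by lia.
  unfold mobius. field.
Qed.

Lemma hol_mobius (a b c d : Z) : (a * d - b * c = 1)%Z ->
  hol upper (mobius a b c d) (fun z => / ((IZR c * z + IZR d) * (IZR c * z + IZR d)))%C.
Proof.
  intros H z Hz. pose proof (cz_neq_0 c d z Hz (det_row a b c d H)) as Hn.
  assert (HZ : (RtoC (IZR a) * RtoC (IZR d) - RtoC (IZR b) * RtoC (IZR c))%C = 1%C).
  { rewrite <- !RtoC_mult, <- RtoC_minus, <- !mult_IZR, <- minus_IZR, H. auto. }
  split.
  - assert (L : forall m n : Z, Cd (fun z => IZR m * z + IZR n)%C z (IZR m * 1 + 0)%C).
    { intros m n. apply Cd_plus; [apply Cd_scal, Cd_id | apply Cd_const]. }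
    replace (/ ((IZR c * z + IZR d) * (IZR c * z + IZR d)))%C with
      ((IZR a * 1 + 0) * / (IZR c * z + IZR d) + (IZR a * z + IZR b) * (- / ((IZR c * z + IZR d) * (IZR c * z + IZR d)) * (IZR c * 1 + 0)))%C.
    + apply (Cd_mult (fun z => IZR a * z + IZR b)%C (fun z => / (IZR c * z + IZR d))%C); auto.
      apply (Cd_comp (fun z => IZR c * z + IZR d)%C (fun v => / v)%C); auto. apply Cd_inv; auto.
    + transitivity ((RtoC (IZR a) * RtoC (IZR d) - RtoC (IZR b) * RtoC (IZR c)) / ((IZR c * z + IZR d) * (IZR c * z + IZR d)))%C; [field; auto |].
      rewrite HZ. field; auto.
  - apply tends_inv; [apply nearC_filter | ctac | apply Cmult_neq_0; auto].
Qed.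

Lemma hol_comp (U V : C -> Prop) (F F' G G' : C -> C) :
  (forall z, U z -> V (G z)) -> hol V F F' -> hol U G G' ->
  hol U (fun z => F (G z)) (fun z => F' (G z) * G' z)%C.
Proof.
  intros HUV HF HG z Hz. destruct (HG z Hz) as [H1 H2]. destruct (HF _ (HUV z Hz)) as [H3 H4]. split.
  - apply Cd_comp; auto.
  - apply tends_mult; [apply nearC_filter | | auto]. apply cts_comp; auto. eapply Cd_cts; eauto.
Qed.

(** * Reduction theory for SL_2(Z) *)

Lemma argmin_list {T} (h : T -> R) (L : list T) t0 : In t0 L -> exists t, In t L /\ forall x, In x L -> h t <= h x.
Proof.
  revert t0. induction L as [| x L IH]; intros t0 H; [destruct H |].
  destruct L as [| y L].
  - exists x. split; [left; auto |]. intros z [-> | []]; lra.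
  - destruct (IH y ltac:(left; auto)) as [t [Ht HM]]. destruct (Rle_dec (h x) (h t)).
    + exists x. split; [left; auto |]. intros z [-> | Hz]; [lra | specialize (HM z Hz); lra].
    + exists t. split; [right; auto |]. intros z [-> | Hz]; [lra | auto].
Qed.

(** A vector no longer than the one for [(0, 1)], which has modulus 1, satisfies [|m| <= 1 / Im tau]
    and [|n| <= 1 + |tau| / Im tau]; the minimum is over a finite box. *)
Lemma lattice_min (tau : C) : upper tau -> exists c d : Z, (c <> 0 \/ d <> 0)%Z /\
  forall m n : Z, (m <> 0 \/ n <> 0)%Z -> Cmod (IZR c * tau + IZR d) <= Cmod (IZR m * tau + IZR n).
Proof.
  intros Ht. unfold upper in Ht.
  set (M := 1 + Cmod tau / Im tau + / Im tau). set (N := up M).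
  destruct (archimed M) as [HN _]. fold N in HN.
  assert (HM : 0 < M).
  { unfold M. assert (0 < / Im tau) by (apply Rinv_0_lt_compat; auto). pose proof (Cmod_ge_0 tau).
    assert (0 <= Cmod tau / Im tau) by (apply Rmult_le_pos; lra). lra. }
  assert (HNp : (0 < N)%Z) by (apply lt_IZR; simpl; lra).
  set (R0 := map (fun k => (Z.of_nat k - N)%Z) (seq 0 (Z.to_nat (2 * N + 1)))).
  assert (HR : forall z, (- N <= z <= N)%Z -> In z R0).
  { intros z Hz. apply in_map_iff. exists (Z.to_nat (z + N)). split; [lia |]. apply in_seq. lia. }
  set (L := filter (fun p => negb ((fst p =? 0)%Z && (snd p =? 0)%Z)) (list_prod R0 R0)).
  assert (HL : forall c d, (- N <= c <= N)%Z -> (- N <= d <= N)%Z -> (c <> 0 \/ d <> 0)%Z -> In (c, d) L).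
  { intros c d Hc Hd H. apply filter_In. split; [apply in_prod; auto |]. cbn [fst snd].
    destruct (c =? 0)%Z eqn:E1; destruct (d =? 0)%Z eqn:E2; auto. apply Z.eqb_eq in E1, E2. lia. }
  assert (H01 : In (0, 1)%Z L) by (apply HL; lia).
  destruct (argmin_list (fun p => Cmod (IZR (fst p) * tau + IZR (snd p))) L (0, 1)%Z H01) as [[c d] [Hcd Hmin]].
  cbn [fst snd] in Hmin. exists c, d. split.
  { apply filter_In in Hcd. destruct Hcd as [_ Hcd]. cbn [fst snd] in Hcd.
    destruct (Z.eq_dec c 0) as [-> |]; [| auto]. destruct (Z.eq_dec d 0) as [-> |]; [discriminate | auto]. }
  intros m n Hmn. destruct (Rle_dec (Cmod (IZR m * tau + IZR n)) 1) as [Hle | Hgt].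
  - apply (Hmin (m, n)). pose proof (Im_le_Cmod (IZR m * tau + IZR n)%C) as Hi. rewrite cz_Im in Hi.
    assert (Hm : Rabs (IZR m) <= / Im tau).
    { rewrite Rabs_mult, (Rabs_right (Im tau)) in Hi by lra. apply Rmult_le_reg_r with (Im tau); auto. rewrite Rinv_l by lra. lra. }
    assert (Hn : Rabs (IZR n) <= 1 + Cmod tau / Im tau).
    { rewrite <- Cmod_R. replace (RtoC (IZR n)) with ((IZR m * tau + IZR n) - IZR m * tau)%C by ring.
      unfold Cminus. eapply Rle_trans; [apply Cmod_triangle |]. rewrite Cmod_opp, Cmod_mult, Cmod_R.
      apply Rplus_le_compat; auto. unfold Rdiv. rewrite Rmult_comm. apply Rmult_le_compat_l; auto. apply Cmod_ge_0. }
    assert (0 < / Im tau) by (apply Rinv_0_lt_compat; auto).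
    assert (0 <= Cmod tau / Im tau) by (apply Rmult_le_pos; [apply Cmod_ge_0 | lra]).
    apply Rabs_le_between in Hm. apply Rabs_le_between in Hn. unfold M in HN.
    apply HL; auto; split; apply le_IZR; rewrite ?opp_IZR; lra.
  - specialize (Hmin (0, 1)%Z H01). simpl in Hmin.
    replace (0 * tau + 1)%C with (RtoC 1) in Hmin by ring. rewrite Cmod_1 in Hmin. lra.
Qed.

(** The shortest [c tau + d] has a coprime row. After translating the real part of the image into
    [[-1/2, 1/2]], minimality forces modulus at least 1, hence height at least [sqrt 3 / 2], of
    which 1/2 is kept. *)
Lemma sl2_reduce (tau : C) : upper tau ->
  exists a b c d : Z, (a * d - b * c = 1)%Z /\ 1 / 2 <= Im (mobius a b c d tau).
Proof.
  intros Ht. destruct (lattice_min tau Ht) as [c [d [Hcd Hmin]]].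
  assert (Hg : Z.gcd c d = 1%Z).
  { set (g := Z.gcd c d). pose proof (Z.gcd_nonneg c d). fold g in H.
    assert (g <> 0%Z) by (intro E; apply Z.gcd_eq_0 in E; lia).
    destruct (Z.gcd_divide_l c d) as [c1 E1]. destruct (Z.gcd_divide_r c d) as [d1 E2]. fold g in E1, E2.
    assert (H1 : (c1 <> 0 \/ d1 <> 0)%Z) by (apply NNPP; intro HX; assert (c1 = 0 /\ d1 = 0)%Z as [X1 X2] by lia; rewrite X1 in E1; rewrite X2 in E2; lia).
    specialize (Hmin c1 d1 H1).
    replace (IZR c * tau + IZR d)%C with (RtoC (IZR g) * (IZR c1 * tau + IZR d1))%C in Hmin
      by (rewrite E1, E2, !mult_IZR, !RtoC_mult; ring).
    rewrite Cmod_mult, Cmod_R in Hmin. pose proof (cz_neq_0 c1 d1 tau Ht H1) as Hn. apply Cmod_gt_0 in Hn.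
    rewrite Rabs_right in Hmin by (apply Rle_ge, IZR_le; auto).
    assert (IZR g <= 1) by nra. apply le_IZR in H2. lia. }
  destruct (Z.gcd_bezout c d 1 Hg) as [u [v Huv]].
  exists v, (- u)%Z, c, d. assert (Hdet : (v * d - - u * c = 1)%Z) by lia. split; auto.
  set (t := mobius v (- u) c d tau).
  assert (Hut : upper t) by (apply upper_mobius; auto).
  set (n := (1 - up (Re t + 1 / 2))%Z).
  destruct (archimed (Re t + 1 / 2)) as [A1 A2].
  assert (Hn : Rabs (Re t + IZR n) <= 1 / 2) by (unfold n; rewrite minus_IZR; apply Rabs_le; lra).
  assert (H1 : 1 <= Cmod (IZR 1 * t + IZR n)).
  { unfold t. rewrite cz_mobius by auto. pose proof (cz_neq_0 c d tau Ht Hcd) as Hz.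
    rewrite Cmod_div by auto. apply Cmod_gt_0 in Hz. apply Rmult_le_reg_r with (Cmod (IZR c * tau + IZR d)); auto.
    unfold Rdiv. rewrite Rmult_assoc, Rinv_l, Rmult_1_r, Rmult_1_l by lra. apply Hmin.
    destruct (Z.eq_dec (1 * v + n * c) 0) as [E | E]; [right | left; auto]. intro E'.
    assert ((1 * v + n * c) * d - (1 * - u + n * d) * c = 1)%Z by lia. rewrite E, E' in H. lia. }
  assert (E2 : Cmod (IZR 1 * t + IZR n) ^ 2 = (Re t + IZR n) ^ 2 + Im t ^ 2).
  { rewrite Cmod2_alt, cz_Re, cz_Im. ring. }
  rewrite (Rabs_sq (Re t + IZR n)) in E2. pose proof (Rabs_pos (Re t + IZR n)). unfold upper in Hut. nra.
Qed.

(** * Limits in a half-strip and the cusps of Gamma_0(4) *)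

Lemma Im_real_mult (r : R) (s : C) : Im (RtoC r * s) = r * Im s.
Proof. unfold Im; simpl. ring. Qed.

(** The series for [g] is dominated uniformly only for bounded real part; periodicity then extends
    the limits, by [strip_upward]. *)
Definition strip (P : C -> Prop) : Prop := exists Y, forall w, 0 <= Re w <= 1 -> Y < Im w -> P w.

Global Instance strip_filter : Filter strip.
Proof.
  constructor.
  - exists 0; auto.
  - intros P Q [Y H1] [Z H2]. exists (Rmax Y Z). intros w Hw Hi.
    pose proof (Rmax_l Y Z); pose proof (Rmax_r Y Z). split; [apply H1 | apply H2]; auto; lra.
  - intros P Q HPQ [Y H1]. exists Y; auto.
Qed.

Lemma strip_upward (Phi : C -> C) l : (forall s, 0 < Im s -> Phi (s + 1)%C = Phi s) ->
  tends strip Phi l -> tends upward Phi l.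
Proof.
  intros Hper H e He. destruct (H e He) as [Y HY]. exists (Rmax 0 Y). intros w Hw.
  pose proof (Rmax_l 0 Y); pose proof (Rmax_r 0 Y). destruct (archimed (Re w)) as [A1 A2].
  rewrite <- (periodic_Z Phi Hper (1 - up (Re w)) w) by lra. apply HY.
  - rewrite Re_Cplus. change (Re (RtoC (IZR (1 - up (Re w))))) with (IZR (1 - up (Re w))). rewrite minus_IZR. lra.
  - rewrite Im_Cplus. change (Im (RtoC (IZR (1 - up (Re w))))) with 0. lra.
Qed.

(** The cusps are infinity, 0 of width 4 and 1/2 of width 1. The factors 4 and 1 make [ee s] the
    local parameter, and the last two limits say that [g] has less than a simple pole at 0 and at
    1/2. *)
Lemma liouville_gamma04 (g g' : C -> C) (l : C) :
  hol upper g g' ->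
  (forall a b c d tau, (a * d - b * c = 1)%Z -> Z.divide 4 c -> upper tau -> g (mobius a b c d tau) = g tau) ->
  tends strip g l ->
  tends strip (fun s => g (mobius 0 (-1) 1 0 (RtoC 4 * s)) * ee s)%C 0%C ->
  tends strip (fun s => g (mobius 1 0 2 1 (RtoC 1 * s)) * ee s)%C 0%C ->
  forall tau, upper tau -> g tau = l.
Proof.
  intros Hg Hinv Hl H0 H2.
  set (S4 := fun s => mobius 0 (-1) 1 0 (RtoC 4 * s)).
  set (V := mobius 1 0 2 1).
  assert (U4 : forall s, upper s -> upper (RtoC 4 * s)) by (intros s Hs; unfold upper in *; rewrite Im_real_mult; lra).
  assert (h4 : hol upper (fun s => RtoC 4 * s)%C (fun _ => RtoC 4 * 1)%C).
  { intros z Hz. split; [apply Cd_scal, Cd_id | ctac]. }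
  assert (hS : hol upper S4 (fun z => / ((IZR 1 * (RtoC 4 * z) + IZR 0) * (IZR 1 * (RtoC 4 * z) + IZR 0)) * (RtoC 4 * 1))%C).
  { apply (hol_comp upper upper (mobius 0 (-1) 1 0) (fun z => / ((IZR 1 * z + IZR 0) * (IZR 1 * z + IZR 0)))%C (fun s => RtoC 4 * s)%C (fun _ => RtoC 4 * 1)%C); auto. apply hol_mobius; auto. }
  assert (US : forall s, upper s -> upper (S4 s)) by (intros; apply upper_mobius; auto).
  assert (UV : forall s, upper s -> upper (V s)) by (intros; apply upper_mobius; auto).
  pose proof (hol_comp upper upper g g' S4 _ US Hg hS) as HG1.
  pose proof (hol_comp upper upper g g' V _ UV Hg (hol_mobius 1 0 2 1 eq_refl)) as HG2.
  assert (P0 : forall s, 0 < Im s -> g (s + 1)%C = g s).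
  { intros s Hs. rewrite <- (Hinv 1 1 0 1 s)%Z; auto; [| exists 0%Z; auto]. f_equal. unfold mobius. field. }
  (* [(1, 0; -4, 1)] here and [(-1, 1; -4, 3)] below are parabolic elements of Gamma_0(4) fixing the
     cusps 0 and 1/2. *)
  assert (P1 : forall s, 0 < Im s -> g (S4 (s + 1)%C) = g (S4 s)).
  { intros s Hs. rewrite <- (Hinv 1 0 (-4) 1 (S4 s))%Z; [| auto | exists (-1)%Z; auto | apply US; auto].
    f_equal. unfold S4. rewrite mobius_comp by (auto; apply U4; auto). unfold mobius. simpl.
    f_equal; ring. }
  assert (P2 : forall s, 0 < Im s -> g (V (s + 1)%C) = g (V s)).
  { intros s Hs. rewrite <- (Hinv (-1) 1 (-4) 3 (V s))%Z; [| auto | exists (-1)%Z; auto | apply UV; auto].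
    f_equal. unfold V. rewrite mobius_comp by auto. unfold mobius. simpl.
    f_equal; ring. }
  apply (strip_upward g l P0) in Hl.
  apply strip_upward in H0.
  2:{ intros s Hs. rewrite (ee_period s 1). f_equal. apply P1; auto. }
  apply strip_upward in H2.
  2:{ intros s Hs. rewrite (ee_period s 1). f_equal. rewrite !Cmult_1_l. apply P2; auto. }
  apply (tends_ext upward _ (fun s => g (V s) * ee s)%C) in H2.
  2:{ exists 0. intros s _. rewrite Cmult_1_l. auto. }
  destruct (cusp_limit _ _ P1 HG1 H0) as [a1 L1]. destruct (cusp_limit _ _ P2 HG2 H2) as [a2 L2].
  assert (Cst : exists c, forall s, upper s -> g s = c).
  { set (G := fun i : nat => match i with 0%nat => g | 1%nat => fun s => g (S4 s) | _ => fun s => g (V s) end).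
    set (G' := fun i : nat => match i with 0%nat => g'
       | 1%nat => fun z => (g' (S4 z) * (/ ((IZR 1 * (RtoC 4 * z) + IZR 0) * (IZR 1 * (RtoC 4 * z) + IZR 0)) * (RtoC 4 * 1)))%C
       | _ => fun z => (g' (V z) * / ((IZR 2 * z + IZR 1) * (IZR 2 * z + IZR 1)))%C end).
    (* 1/8 is the height 1/2 from [sl2_reduce] divided by the width 4 of the cusp 0. *)
    assert (Red : forall w, upper w -> exists j t, (j <= 2)%nat /\ 1 / 8 <= Im t /\ g w = G j t).
    { intros w Hw. destruct (sl2_reduce w Hw) as [a [b [c [d [Hdet Hi]]]]].
      set (t := mobius a b c d w) in *.
      assert (Ht : upper t) by (apply upper_mobius; auto).
      assert (Ew : mobius d (- b) (- c) a t = w).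
      { unfold t. rewrite <- (mobius_inv d (- b) (- c) a w) at 2 by (auto; lia).
        f_equal. rewrite !Z.opp_involutive. auto. }
      (* The residue of [c] modulo 4 decides near which cusp [w] lies: infinity for 0, the cusp 1/2
         for 2, the cusp 0 for odd [c]. *)
      assert (Hc4 : ((exists q, c = 4 * q) \/ (exists q, c = 4 * q + 2) \/ (exists q, c = 2 * q + 1))%Z).
      { pose proof (Z.div_mod c 4 ltac:(lia)). pose proof (Z.mod_pos_bound c 4 ltac:(lia)).
        assert (c mod 4 = 0 \/ c mod 4 = 1 \/ c mod 4 = 2 \/ c mod 4 = 3)%Z as [E | [E | [E | E]]] by lia.
        - left. exists (c / 4)%Z. lia.
        - right; right. exists (2 * (c / 4))%Z. lia.
        - right; left. exists (c / 4)%Z. lia.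
        - right; right. exists (2 * (c / 4) + 1)%Z. lia. }
      destruct Hc4 as [[q Hq] | [[q Hq] | [q Hq]]].
      - exists 0%nat, t. split; [lia |]. split; [lra |]. simpl. rewrite <- Ew. apply Hinv; auto; [lia |].
        exists (- q)%Z. lia.
      - exists 2%nat, t. split; [lia |]. split; [lra |]. simpl. rewrite <- Ew.
        (* This is the inverse of the reducing matrix times the inverse of [V]; [- c - 2 * a] is
           divisible by 4 because [a] is odd and [c] is 2 modulo 4. *)
        rewrite <- (Hinv (d + 2 * b) (- b) (- c - 2 * a) a (V t))%Z; [| lia | | apply UV; auto].
        + f_equal. unfold V. rewrite mobius_comp by (auto; lia). f_equal; lia.
        + assert (exists r, a = 2 * r + 1)%Z as [r Hr].
          { pose proof (Z.div_mod a 2 ltac:(lia)). pose proof (Z.mod_pos_bound a 2 ltac:(lia)).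
            assert (a mod 2 = 0 \/ a mod 2 = 1)%Z as [E | E] by lia; [exfalso | exists (a / 2)%Z; lia].
            assert (2 * (a / 2 * d - b * (2 * q + 1)) = 1)%Z by lia. lia. }
          exists (- q - r - 1)%Z. lia.
      - (* [w = gamma S T^j t] with [4 | a + j c] *)
        assert (exists j, Z.divide 4 (a + j * c)) as [j Hj].
        { assert (exists r, q * (q + 1) = 2 * r)%Z as [r Hr].
          { pose proof (Z.div_mod q 2 ltac:(lia)) as Hd. pose proof (Z.mod_pos_bound q 2 ltac:(lia)).
            assert (q mod 2 = 0 \/ q mod 2 = 1)%Z as [E | E] by lia; rewrite E in Hd.
            - exists (q / 2 * (q + 1))%Z. rewrite Hd at 1. ring.
            - exists (q * (q / 2 + 1))%Z. rewrite Hd at 2. ring. }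
          (* Then [a + j c = a (1 - c^2)], and the square of an odd number is 1 modulo 8. *)
          exists (- a * c)%Z. exists (- 2 * a * r)%Z.
          transitivity (- 4 * a * (q * (q + 1)))%Z; [rewrite Hq | rewrite Hr]; ring. }
        set (t' := (t + RtoC (IZR j))%C).
        assert (Ht' : upper t') by (unfold upper, t'; rewrite Im_Cplus; change (Im (RtoC (IZR j))) with 0; unfold upper in Ht; lra).
        exists 1%nat, (RtoC (/ 4) * t')%C. split; [lia |]. split.
        { rewrite Im_real_mult. unfold t'. rewrite Im_Cplus. change (Im (RtoC (IZR j))) with 0. lra. }
        simpl. rewrite <- Ew. unfold S4.
        replace (RtoC 4 * (RtoC (/ 4) * t'))%C with t' by (rewrite Cmult_assoc, <- RtoC_mult; replace (4 * / 4) with 1 by field; ring).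
        rewrite <- (Hinv (- b - j * d) (- d) (a + j * c) (c))%Z with (tau := mobius 0 (-1) 1 0 t'); auto; [| lia | apply upper_mobius; auto].
        f_equal. rewrite mobius_comp by (auto; lia).
        replace t with (mobius 1 (- j) 0 1 t') by (unfold mobius, t'; rewrite opp_IZR, RtoC_opp; field).
        rewrite mobius_comp by (auto; lia).
        assert (Neg : forall a b c d z, mobius (- a) (- b) (- c) (- d) z = mobius a b c d z).
        { intros. unfold mobius. rewrite !opp_IZR, !RtoC_opp.
          replace (- IZR a0 * z + - IZR b0)%C with (- (IZR a0 * z + IZR b0))%C by ring.
          replace (- IZR c0 * z + - IZR d0)%C with (- (IZR c0 * z + IZR d0))%C by ring.
          (* Where the denominator vanishes, both sides are 0 by the convention [/ 0 = 0]. *)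
          destruct (classic ((IZR c0 * z + IZR d0)%C = 0%C)) as [E | E]; [rewrite E | field; auto].
          replace (- 0)%C with (RtoC 0) by ring. unfold Cdiv. replace (/ 0)%C with (RtoC 0); [ring |].
          apply injective_projections; simpl; unfold Rdiv; ring. }
        rewrite <- Neg. f_equal; lia. }
    destruct (liouville3 G G' (fun i => match i with 0%nat => l | 1%nat => a1 | _ => a2 end) (1 / 8)) as [i [c [Hi Hc]]].
    - lra.
    - intros i Hi. assert (i = 0 \/ i = 1 \/ i = 2)%nat as [-> | [-> | ->]] by lia; auto.
    - intros i s Hi. assert (i = 0 \/ i = 1 \/ i = 2)%nat as [-> | [-> | ->]] by lia; simpl; auto.
    - intros i Hi. assert (i = 0 \/ i = 1 \/ i = 2)%nat as [-> | [-> | ->]] by lia; auto.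
    - intros i s Hi Hs. assert (i = 0 \/ i = 1 \/ i = 2)%nat as [-> | [-> | ->]] by lia; simpl; apply Red; auto.
    - exists c. intros w Hw. assert (i = 0 \/ i = 1 \/ i = 2)%nat as [-> | [-> | ->]] by lia; simpl in Hc; auto.
      + rewrite <- (Hc (RtoC (/ 4) * mobius 0 1 (-1) 0 w)%C).
        * f_equal. unfold S4. rewrite Cmult_assoc, <- RtoC_mult. replace (4 * / 4) with 1 by field.
          replace (RtoC 1 * mobius 0 1 (-1) 0 w)%C with (mobius 0 1 (-1) 0 w) by ring.
          symmetry. apply (mobius_inv 0 (-1) 1 0); auto.
        * unfold upper. rewrite Im_real_mult. assert (upper (mobius 0 1 (-1) 0 w)) by (apply upper_mobius; auto). unfold upper in H. lra.
      + rewrite <- (Hc (mobius 1 0 (-2) 1 w)); [| apply upper_mobius; auto].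
        f_equal. symmetry. apply (mobius_inv 1 0 2 1); auto. }
  destruct Cst as [c Hc]. intros tau Ht. rewrite Hc by auto.
  apply (tends_unique upward g c l); auto.
  - intros [Y HY]. apply (HY (0, Y + 1)). simpl. lra.
  - intros e He. exists 0. intros w Hw. rewrite Hc by auto. replace (c - c)%C with (RtoC 0) by ring. rewrite Cmod_0; auto.
Qed.

(** * Dedekind sums *)

(* The sum starts at index 1. *)
Fixpoint zsum (F : Z -> Z) (m : nat) : Z :=
  match m with O => 0%Z | S n => (zsum F n + F (Z.of_nat (S n)))%Z end.

Lemma zsum_ext F G m : (forall i, (1 <= i <= Z.of_nat m)%Z -> F i = G i) -> zsum F m = zsum G m.
Proof.
  induction m as [| m IH]; intros H; auto. cbn [zsum]. rewrite IH, H by (intros; try apply H; lia). auto.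
Qed.

Lemma zsum_lin (a b : Z) F G m : zsum (fun i => a * F i + b * G i)%Z m = (a * zsum F m + b * zsum G m)%Z.
Proof. induction m as [| m IH]; cbn [zsum]; [ring | rewrite IH; ring]. Qed.

Lemma zsum_exchange F l m : zsum (fun n => zsum (fun j => F n j) m) l = zsum (fun j => zsum (fun n => F n j) l) m.
Proof.
  induction l as [| l IH]; cbn [zsum].
  - induction m as [| m IH]; cbn [zsum]; auto. rewrite <- IH. auto.
  - rewrite IH. rewrite <- (Z.mul_1_l (zsum (fun j => zsum (fun n => F n j) l) m)), <- (Z.mul_1_l (zsum (fun j => F (Z.of_nat (S l)) j) m)).
    rewrite <- zsum_lin. apply zsum_ext. intros. ring.
Qed.

Lemma zsum_id m : (2 * zsum (fun i => i) m = Z.of_nat m * (Z.of_nat m + 1))%Z.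
Proof. induction m as [| m IH]; auto. cbn [zsum]. rewrite Z.mul_add_distr_l, IH. lia. Qed.

Lemma zsum_sq m : (6 * zsum (fun i => i * i) m = Z.of_nat m * (Z.of_nat m + 1) * (2 * Z.of_nat m + 1))%Z.
Proof. induction m as [| m IH]; auto. cbn [zsum]. rewrite Z.mul_add_distr_l, IH. rewrite Nat2Z.inj_succ. ring. Qed.

(** The weight [2 j] is chosen so that a column of lattice points of height [t] contributes
    [t (t + 1)]. *)
Lemma zsum_ind_le t m : (0 <= t)%Z ->
  zsum (fun j => if (j <=? t)%Z then 2 * j else 0)%Z m = (Z.min t (Z.of_nat m) * (Z.min t (Z.of_nat m) + 1))%Z.
Proof.
  intros Ht. induction m as [| m IH]; [simpl; rewrite Z.min_r by lia; auto |].
  cbn [zsum]. rewrite IH. destruct (Z.leb_spec (Z.of_nat (S m)) t).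
  - rewrite !Z.min_r by lia. rewrite Nat2Z.inj_succ. ring.
  - rewrite !Z.min_l by lia. ring.
Qed.

Lemma zsum_ind_gt g m : (0 <= g)%Z ->
  zsum (fun n => if (g <? n)%Z then 1 else 0)%Z m = (Z.of_nat m - Z.min g (Z.of_nat m))%Z.
Proof.
  intros Ht. induction m as [| m IH]; [simpl; rewrite Z.min_r by lia; auto |].
  cbn [zsum]. rewrite IH. destruct (Z.ltb_spec g (Z.of_nat (S m))); lia.
Qed.

Lemma zsum_list F m : zsum F m = fold_right Z.add 0%Z (map F (map Z.of_nat (seq 1 m))).
Proof.
  induction m as [| m IH]; auto. cbn [zsum]. rewrite IH, seq_S, !map_app, fold_right_app. cbn [map fold_right].
  change (1 + m)%nat with (S m). generalize (map F (map Z.of_nat (seq 1 m))). intros L. generalize (F (Z.of_nat (S m))). intros x.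
  rewrite Z.add_0_r. induction L as [| y L IHL]; simpl; [lia | rewrite <- IHL; lia].
Qed.

Lemma fold_add_perm L M : Permutation L M -> fold_right Z.add 0%Z L = fold_right Z.add 0%Z M.
Proof. induction 1; simpl; lia. Qed.

Lemma coprime_residue (h k n : Z) : (0 < k)%Z -> Z.gcd h k = 1%Z -> ((h * n) mod k = 0)%Z -> Z.divide k n.
Proof.
  intros Hk Hg H. apply Z.mod_divide in H; [| lia]. apply Z.gauss with h; auto. rewrite Z.gcd_comm; auto.
Qed.

(** Multiplication by a unit permutes the nonzero residues modulo [S m], which are 1 to [m]. *)
Lemma zsum_residues (phi : Z -> Z) (h : Z) (m : nat) : Z.gcd h (Z.of_nat (S m)) = 1%Z ->
  zsum (fun n => phi ((h * n) mod (Z.of_nat (S m)))%Z) m = zsum phi m.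
Proof.
  intros Hg. set (k := Z.of_nat (S m)) in *. assert (Hk : (0 < k)%Z) by lia.
  rewrite !zsum_list. rewrite <- (map_map (fun n => (h * n) mod k)%Z phi). apply fold_add_perm, Permutation_map.
  set (L := map Z.of_nat (seq 1 m)).
  assert (HL : forall z, In z L <-> (1 <= z < k)%Z).
  { intros z. unfold L. rewrite in_map_iff. split.
    - intros [n [<- Hn]]. apply in_seq in Hn. lia.
    - intros Hz. exists (Z.to_nat z). split; [lia |]. apply in_seq. lia. }
  assert (NL : NoDup L) by (apply NoDup_map_inj; [intros; lia | apply seq_NoDup]).
  apply NoDup_Permutation_bis.
  - apply NoDup_map_inj; auto. intros x y Hx Hy E. apply HL in Hx, Hy.
    assert (D : Z.divide k (x - y)).
    { apply coprime_residue with h; auto. rewrite Z.mul_sub_distr_l, Zminus_mod, E, Z.sub_diag. apply Z.mod_0_l; lia. }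
    destruct D as [q Hq]. assert (q = 0)%Z by nia. subst q. lia.
  - rewrite length_map. auto.
  - intros z Hz. apply in_map_iff in Hz. destruct Hz as [n [<- Hn]]. apply HL in Hn. apply HL.
    pose proof (Z.mod_pos_bound (h * n) k Hk).
    assert ((h * n) mod k <> 0)%Z; [| lia]. intros E. apply coprime_residue in E; auto.
    apply Z.divide_pos_le in E; lia.
Qed.

(* Counting the lattice points [(n, j)] with weight [2 j] below the line of slope [h / k]. *)
Lemma zsum_floor_reciprocity (h k : nat) : Z.gcd (Z.of_nat (S h)) (Z.of_nat (S k)) = 1%Z ->
  let H := Z.of_nat (S h) in let K := Z.of_nat (S k) in
  zsum (fun n => (H * n / K) * (H * n / K + 1))%Z k = zsum (fun j => 2 * j * (Z.of_nat k - K * j / H))%Z h.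
Proof.
  intros Hg H K.
  assert (HH : (0 < H)%Z) by lia. assert (HK : (0 < K)%Z) by lia.
  transitivity (zsum (fun n => zsum (fun j => if (j <=? H * n / K)%Z then 2 * j else 0)%Z h) k).
  - apply zsum_ext. intros n Hn. rewrite zsum_ind_le by (apply Z.div_pos; lia).
    assert (H * n / K <= Z.of_nat h)%Z.
    { assert (H * n / K < H)%Z; [| lia]. apply Z.div_lt_upper_bound; nia. }
    rewrite Z.min_l by auto. auto.
  - rewrite zsum_exchange. apply zsum_ext. intros j Hj.
    transitivity (zsum (fun n => 2 * j * (if (K * j / H <? n)%Z then 1 else 0) + 0 * 0)%Z k).
    + apply zsum_ext. intros n Hn.
      assert (Hne : (H * n <> K * j)%Z).
      { intros E. assert (D : Z.divide H j).
        { apply Z.gauss with K; [exists n; lia | exact Hg]. }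
        apply Z.divide_pos_le in D; lia. }
      pose proof (Z.div_mod (H * n) K ltac:(lia)). pose proof (Z.mod_pos_bound (H * n) K HK).
      pose proof (Z.div_mod (K * j) H ltac:(lia)). pose proof (Z.mod_pos_bound (K * j) H HH).
      set (u := (H * n / K)%Z) in *. set (v := (K * j / H)%Z) in *.
      destruct (Z.leb_spec j u); destruct (Z.ltb_spec v n); try lia.
      * exfalso. assert (K * j <= H * n)%Z by nia. assert (H * n <= K * j)%Z by nia. lia.
      * exfalso. assert (H * n <= K * j)%Z by nia. assert (K * j <= H * n)%Z by nia. lia.
    + rewrite (zsum_lin (2 * j) 0 (fun n => if (K * j / H <? n)%Z then 1 else 0)%Z (fun _ => 0%Z)).
      rewrite zsum_ind_gt by (apply Z.div_pos; lia).
      assert (K * j / H <= Z.of_nat k)%Z.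
      { assert (K * j / H < K)%Z; [| lia]. apply Z.div_lt_upper_bound; nia. }
      rewrite Z.min_l by auto. ring.
Qed.

Lemma sawZ_mod (r c : Z) : (0 < c)%Z -> (r mod c <> 0)%Z -> sawZ r c = IZR (r mod c) / IZR c - / 2.
Proof.
  intros Hc Hr. unfold sawZ. destruct (Z.eqb_spec (r mod c) 0); [tauto |].
  rewrite (Z.div_mod r c) at 1 by lia. rewrite plus_IZR, mult_IZR. field. apply IZR_neq. lia.
Qed.

Lemma sawZ_0 (r c : Z) : (r mod c = 0)%Z -> sawZ r c = 0.
Proof. intros E. unfold sawZ. rewrite E. auto. Qed.

Lemma sawZ_congr (r s c : Z) : (0 < c)%Z -> (r mod c = s mod c)%Z -> sawZ r c = sawZ s c.
Proof.
  intros Hc E. destruct (Z.eq_dec (r mod c) 0) as [E0 | E0].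
  - rewrite !sawZ_0; congruence.
  - rewrite !sawZ_mod by congruence. rewrite E. auto.
Qed.

Lemma sawZ_opp (r c : Z) : (0 < c)%Z -> sawZ (- r) c = - sawZ r c.
Proof.
  intros Hc. destruct (Z.eq_dec (r mod c) 0) as [E0 | E0].
  - rewrite !sawZ_0; auto; [ring |]. apply Z.mod_opp_l_z; lia.
  - rewrite !sawZ_mod; auto.
    + rewrite Z.mod_opp_l_nz by lia. rewrite minus_IZR. field. apply IZR_neq. lia.
    + rewrite Z.mod_opp_l_nz by lia. pose proof (Z.mod_pos_bound r c Hc). lia.
Qed.

Lemma dedekind_sum_congr (h h' c : Z) : (0 < c)%Z -> (h mod c = h' mod c)%Z -> dedekind_sum h c = dedekind_sum h' c.
Proof.
  intros Hc E. unfold dedekind_sum. f_equal. apply map_ext. intros n. f_equal. apply sawZ_congr; auto.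
  rewrite <- Z.mul_mod_idemp_l, E, Z.mul_mod_idemp_l by lia. auto.
Qed.

Lemma dedekind_sum_opp (h c : Z) : (0 < c)%Z -> dedekind_sum (- h) c = - dedekind_sum h c.
Proof.
  intros Hc. unfold dedekind_sum. induction (seq 0 (Z.to_nat c)) as [| n L IH]; simpl; [ring |].
  rewrite IH. rewrite Z.mul_opp_l, sawZ_opp by auto. ring.
Qed.

(** The product of two values [x - 1/2] is expanded. By coprimality none of the indices 1 to [m]
    meets the zero case of the sawtooth, and index 0 contributes nothing. *)
Lemma dedekind_sum_zsum (h : Z) (m : nat) : let k := Z.of_nat (S m) in Z.gcd h k = 1%Z ->
  dedekind_sum h k = IZR (zsum (fun n => n * ((h * n) mod k))%Z m) / IZR k ^ 2
    - IZR (zsum (fun n => n) m) / (2 * IZR k) - IZR (zsum (fun n => (h * n) mod k)%Z m) / (2 * IZR k) + INR m / 4.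
Proof.
  intros k Hg. assert (Hk : (0 < k)%Z) by lia. assert (HkR : IZR k <> 0) by (apply IZR_neq; lia).
  unfold dedekind_sum. replace (Z.to_nat k) with (S m) by lia.
  assert (W : forall l, (l <= m)%nat ->
    fold_right Rplus 0 (map (fun n : nat => sawZ (Z.of_nat n) k * sawZ (h * Z.of_nat n)%Z k) (seq 0 (S l))) =
    IZR (zsum (fun n => n * ((h * n) mod k))%Z l) / IZR k ^ 2
    - IZR (zsum (fun n => n) l) / (2 * IZR k) - IZR (zsum (fun n => (h * n) mod k)%Z l) / (2 * IZR k) + INR l / 4).
  { induction l as [| l IH]; intros Hl.
    - simpl. rewrite sawZ_0 by (apply Z.mod_0_l; lia). field. auto.
    - rewrite seq_S, map_app, fold_right_app. cbn [map fold_right].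
      assert (FA : forall L x, fold_right Rplus x L = fold_right Rplus 0 L + x).
      { clear. induction L as [| y L IH]; intros x; simpl; [ring | rewrite IH; ring]. }
      rewrite FA, IH by lia. change (0 + S l)%nat with (S l). set (n := Z.of_nat (S l)).
      rewrite (sawZ_mod n k), (sawZ_mod (h * n) k); auto.
      + rewrite Z.mod_small by lia. cbn [zsum]. fold n. rewrite !plus_IZR, mult_IZR, S_INR. field. auto.
      + intros E. apply coprime_residue in E; auto. apply Z.divide_pos_le in E; lia.
      + rewrite Z.mod_small; lia. }
  apply W. lia.
Qed.

Ltac izr H := apply (f_equal IZR) in H;
  repeat first [rewrite plus_IZR in H | rewrite minus_IZR in H | rewrite mult_IZR in H].

(** Writing a residue as [h n - k floor(h n / k)], the permutation of residues gives a linear and a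
    quadratic relation among the floor sums [F], [A], [B]. The count of lattice points relates
    [B + F] to the sum [A'] with [h] and [k] exchanged. Once [F], [B] and [A] are solved for, [A']
    cancels. *)
Lemma dedekind_reciprocity (h k : Z) : (0 < h)%Z -> (0 < k)%Z -> Z.gcd h k = 1%Z ->
  12 * (dedekind_sum h k + dedekind_sum k h) = -3 + IZR h / IZR k + IZR k / IZR h + 1 / (IZR h * IZR k).
Proof.
  intros Hh Hk Hg.
  set (h1 := Z.to_nat (h - 1)). set (k1 := Z.to_nat (k - 1)).
  assert (Eh : h = Z.of_nat (S h1)) by lia. assert (Ek : k = Z.of_nat (S k1)) by lia.
  assert (Hg2 : Z.gcd k h = 1%Z) by (rewrite Z.gcd_comm; auto).
  assert (Gen : forall a b (b1 : nat), b = Z.of_nat (S b1) -> (0 < a)%Z -> Z.gcd a b = 1%Z ->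
     let A := zsum (fun n => n * (a * n / b))%Z b1 in let F := zsum (fun n => a * n / b)%Z b1 in
     let B := zsum (fun n => (a * n / b) * (a * n / b))%Z b1 in
     let S1 := zsum (fun n => n)%Z b1 in let S2 := zsum (fun n => n * n)%Z b1 in
     (a * S1 - b * F = S1)%Z /\ (a * a * S2 - 2 * a * b * A + b * b * B = S2)%Z /\
     dedekind_sum a b = IZR (a * S2 - b * A) / IZR b ^ 2 - IZR S1 / IZR b + INR b1 / 4).
  { intros a b b1 Eb Ha Hab A F B S1 S2.
    assert (Hb : (0 < b)%Z) by lia.
    assert (Md : forall n, ((a * n) mod b = a * n - b * (a * n / b))%Z) by (intros n; pose proof (Z.div_mod (a * n) b ltac:(lia)); lia).
    assert (R1 : zsum (fun n => (a * n) mod b)%Z b1 = S1) by (rewrite Eb; apply (zsum_residues (fun x => x)); rewrite <- Eb; auto).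
    assert (R2 : zsum (fun n => ((a * n) mod b) * ((a * n) mod b))%Z b1 = S2) by (rewrite Eb; apply (zsum_residues (fun x => x * x)%Z); rewrite <- Eb; auto).
    split; [| split].
    - rewrite <- R1 at 2. unfold S1, F.
      replace (a * zsum (fun n => n) b1 - b * zsum (fun n => (a * n / b)%Z) b1)%Z with (a * zsum (fun n => n) b1 + (- b) * zsum (fun n => (a * n / b)%Z) b1)%Z by ring.
      rewrite <- zsum_lin. apply zsum_ext. intros i _. rewrite Md. ring.
    - rewrite <- R2 at 2. unfold S2, A, B.
      replace (a * a * zsum (fun n => (n * n)%Z) b1 - 2 * a * b * zsum (fun n => (n * (a * n / b))%Z) b1 + b * b * zsum (fun n => (a * n / b * (a * n / b))%Z) b1)%Z
        with (1 * (a * a * zsum (fun n => (n * n)%Z) b1 + (- (2 * a * b)) * zsum (fun n => (n * (a * n / b))%Z) b1) + b * b * zsum (fun n => (a * n / b * (a * n / b))%Z) b1)%Z by ring.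
      rewrite <- !zsum_lin. apply zsum_ext. intros i _. rewrite Md. ring.
    - rewrite Eb at 1. rewrite dedekind_sum_zsum by (rewrite <- Eb; auto). rewrite <- Eb. rewrite R1.
      assert (R3 : zsum (fun n => n * ((a * n) mod b))%Z b1 = (a * S2 - b * A)%Z).
      { unfold S2, A. replace (a * zsum (fun n => (n * n)%Z) b1 - b * zsum (fun n => (n * (a * n / b))%Z) b1)%Z
          with (a * zsum (fun n => (n * n)%Z) b1 + (- b) * zsum (fun n => (n * (a * n / b))%Z) b1)%Z by ring.
        rewrite <- zsum_lin. apply zsum_ext. intros i _. rewrite Md. ring. }
      rewrite R3. unfold S1. field. apply IZR_neq. lia. }
  destruct (Gen h k k1 Ek Hh Hg) as [P1 [P2 P3]]. destruct (Gen k h h1 Eh Hk Hg2) as [Q1 [Q2 Q3]].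
  pose proof (zsum_floor_reciprocity h1 k1) as FR. cbv zeta in FR. rewrite <- Eh, <- Ek in FR. specialize (FR Hg).
  set (A := zsum (fun n => n * (h * n / k))%Z k1) in *. set (F := zsum (fun n => h * n / k)%Z k1) in *.
  set (B := zsum (fun n => (h * n / k) * (h * n / k))%Z k1) in *.
  set (A' := zsum (fun n => n * (k * n / h))%Z h1) in *.
  assert (FR2 : (B + F = 2 * Z.of_nat k1 * zsum (fun n => n) h1 - 2 * A')%Z).
  { transitivity (zsum (fun n => (h * n / k * (h * n / k + 1))%Z) k1).
    - unfold B, F. rewrite <- (Z.mul_1_l (zsum _ k1)) at 1. rewrite <- (Z.mul_1_l (zsum (fun n => (h * n / k)%Z) k1)).
      rewrite <- zsum_lin. apply zsum_ext. intros; ring.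
    - rewrite FR. unfold A'.
      replace (2 * Z.of_nat k1 * zsum (fun n => n) h1 - 2 * zsum (fun n => (n * (k * n / h))%Z) h1)%Z
        with (2 * Z.of_nat k1 * zsum (fun n => n) h1 + (- 2) * zsum (fun n => (n * (k * n / h))%Z) h1)%Z by ring.
      rewrite <- zsum_lin. apply zsum_ext. intros; ring. }
  pose proof (zsum_id k1) as I1. pose proof (zsum_id h1) as I2. pose proof (zsum_sq k1) as I3. pose proof (zsum_sq h1) as I4.
  assert (Ek1 : Z.of_nat k1 = (k - 1)%Z) by lia. assert (Eh1 : Z.of_nat h1 = (h - 1)%Z) by lia.
  rewrite Ek1 in *. rewrite Eh1 in *.
  set (S1 := zsum (fun n => n) k1) in *. set (S2 := zsum (fun n => n * n)%Z k1) in *.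
  set (T1 := zsum (fun n => n) h1) in *. set (T2 := zsum (fun n => n * n)%Z h1) in *.
  rewrite P3, Q3, !INR_IZR_INZ, Ek1, Eh1. rewrite !minus_IZR, !mult_IZR.
  izr P1; izr P2; izr FR2; izr I1; izr I2; izr I3; izr I4.
  set (x := IZR h) in *. set (y := IZR k) in *.
  assert (Hx : x <> 0) by (apply IZR_neq; lia). assert (Hy : y <> 0) by (apply IZR_neq; lia).
  assert (ES1 : IZR S1 = (y - 1) * y / 2) by lra.
  assert (ET1 : IZR T1 = (x - 1) * x / 2) by lra.
  assert (ES2 : IZR S2 = (y - 1) * y * (2 * y - 1) / 6) by lra.
  assert (ET2 : IZR T2 = (x - 1) * x * (2 * x - 1) / 6) by lra.
  assert (EF : IZR F = (x - 1) * IZR S1 / y) by (apply Rmult_eq_reg_l with y; auto; field_simplify; auto; lra).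
  assert (EB : IZR B = 2 * (y - 1) * IZR T1 - 2 * IZR A' - IZR F) by lra.
  assert (EA : IZR A = ((x * x - 1) * IZR S2 + y * y * IZR B) / (2 * x * y)).
  { apply Rmult_eq_reg_l with (2 * x * y); [| repeat apply Rmult_integral_contrapositive_currified; lra].
    field_simplify; auto. lra. }
  rewrite EA, EB, EF, ES1, ET1, ES2, ET2. field. auto.
Qed.

(** * The transformation law of log eta *)

Lemma clog_upper (z : C) : upper z -> 0 < Im (clog z) < PI.
Proof.
  intros H. unfold upper in H. assert (Hz : z <> 0%C) by (intros ->; simpl in H; lra).
  destruct (carg_spec z Hz) as [_ [E B]]. change (Im (clog z)) with (carg z).
  apply Cmod_gt_0 in Hz. pose proof PI_RGT_0.
  assert (Hs : 0 < sin (carg z)) by nra.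
  split.
  - apply Rnot_le_lt. intros Hl. assert (sin (- carg z) = - sin (carg z)) by apply sin_neg.
    assert (0 <= sin (- carg z)) by (apply sin_ge_0; lra). lra.
  - apply Rnot_le_lt. intros Hl. assert (E1 : carg z = PI) by lra. rewrite E1, sin_PI in Hs. lra.
Qed.

Lemma upper_neq_0 (z : C) : upper z -> z <> 0%C.
Proof. intros H ->. unfold upper in H; simpl in H; lra. Qed.

Lemma cexp_Ipi2 : cexp (Ci * RtoC (PI / 2)) = Ci.
Proof.
  unfold cexp. replace (Re (Ci * RtoC (PI / 2))) with 0 by (simpl; ring).
  replace (Im (Ci * RtoC (PI / 2))) with (PI / 2) by (simpl; ring).
  rewrite exp_0, cos_PI2, sin_PI2. apply injective_projections; simpl; ring.
Qed.

Lemma cexp_Ipi : cexp (Ci * RtoC PI) = (-1)%C.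
Proof.
  unfold cexp. replace (Re (Ci * RtoC PI)) with 0 by (simpl; ring).
  replace (Im (Ci * RtoC PI)) with PI by (simpl; ring).
  rewrite exp_0, cos_PI, sin_PI. apply injective_projections; simpl; ring.
Qed.

Lemma Ci_sq : (Ci * Ci = -1)%C.
Proof. apply injective_projections; simpl; ring. Qed.

Lemma clog_mI (z : C) : upper z -> clog (- Ci * z) = (clog z - Ci * RtoC (PI / 2))%C.
Proof.
  intros H. pose proof (clog_upper z H). pose proof PI_RGT_0. apply clog_unique.
  - rewrite cexp_minus, cexp_clog, cexp_Ipi2 by (apply upper_neq_0; auto).
    transitivity (z * (- (Ci * Ci)) / Ci)%C; [rewrite Ci_sq; field | field]; intro E; apply (f_equal Im) in E; simpl in E; lra.
  - rewrite Im_Cminus. replace (Im (Ci * RtoC (PI / 2))) with (PI / 2) by (simpl; ring). lra.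
Qed.

Lemma clog_opp (z : C) : upper z -> clog (- z) = (clog z - Ci * RtoC PI)%C.
Proof.
  intros H. pose proof (clog_upper z H). pose proof PI_RGT_0. apply clog_unique.
  - rewrite cexp_minus, cexp_clog, cexp_Ipi by (apply upper_neq_0; auto). field.
  - rewrite Im_Cminus. replace (Im (Ci * RtoC PI)) with PI by (simpl; ring). lra.
Qed.

Section EtaLaw.
Hypothesis logeta_T : forall tau, upper tau -> logeta (tau + 1) = (logeta tau + 2 * PI * Ci / 24)%C.
Hypothesis logeta_S : forall tau, upper tau -> logeta (- / tau) = (logeta tau + / 2 * clog (- Ci * tau))%C.

(** An identity between logarithms, without ambiguity modulo [2 pi i], because real powers of eta
    are taken afterwards. *)
Definition eta_law (a b c d : Z) : Prop := forall tau, upper tau ->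
  logeta (mobius a b c d tau) =
  (logeta tau + / 2 * clog (IZR c * tau + IZR d) + 2 * PI * Ci / 24 * RtoC (Psi a b c d))%C.

Lemma logeta_Tn (n : Z) tau : upper tau -> logeta (tau + IZR n) = (logeta tau + 2 * PI * Ci / 24 * IZR n)%C.
Proof.
  assert (W : forall (m : nat) t, upper t -> logeta (t + RtoC (INR m)) = (logeta t + 2 * PI * Ci / 24 * RtoC (INR m))%C).
  { induction m as [| m IH]; intros t Ht.
    - simpl. replace (t + 0)%C with t by ring. ring.
    - rewrite S_INR, RtoC_plus. replace (t + (RtoC (INR m) + RtoC 1))%C with ((t + RtoC (INR m)) + 1)%C by ring.
      rewrite logeta_T, IH by (auto; unfold upper; simpl; rewrite Rplus_0_r; auto). ring. }
  intros Ht. destruct (Z_le_gt_dec 0 n).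
  - rewrite <- (Z2Nat.id n), <- INR_IZR_INZ by auto. auto.
  - assert (Ht2 : upper (tau + IZR n)) by (unfold upper; simpl; rewrite Rplus_0_r; auto).
    pose proof (W (Z.to_nat (- n)) _ Ht2) as E. rewrite INR_IZR_INZ, Z2Nat.id, opp_IZR, RtoC_opp in E by lia.
    replace (tau + IZR n + - IZR n)%C with tau in E by ring. rewrite E. ring.
Qed.

(** Right multiplication by [T^n]. The Dedekind sum depends only on [d] modulo [c], so [Psi] grows
    by [n], in step with [logeta_Tn]. *)
Lemma eta_law_shift (a b c d n : Z) : (a * d - b * c = 1)%Z -> (0 < c)%Z ->
  eta_law a b c d -> eta_law a (b + n * a) c (d + n * c).
Proof.
  intros Hdet Hc H tau Ht.
  assert (Ht2 : upper (tau + IZR n)) by (unfold upper; simpl; rewrite Rplus_0_r; auto).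
  assert (HcR : IZR c <> 0) by (apply IZR_neq; lia).
  replace (mobius a (b + n * a) c (d + n * c) tau) with (mobius a b c d (tau + IZR n)).
  2:{ unfold mobius. rewrite !plus_IZR, !mult_IZR, !RtoC_plus, !RtoC_mult. f_equal; ring. }
  rewrite H, logeta_Tn by auto.
  replace (IZR c * (tau + IZR n) + IZR d)%C with (IZR c * tau + IZR (d + n * c))%C by (rewrite plus_IZR, mult_IZR, RtoC_plus, RtoC_mult; ring).
  assert (E : Psi a (b + n * a) c (d + n * c) = Psi a b c d + IZR n).
  { unfold Psi. destruct (Z.ltb_spec 0 c); [| lia].
    rewrite (dedekind_sum_congr (- (d + n * c)) (- d) c) by (auto; rewrite Z.opp_add_distr, <- Z.mul_opp_l; apply Z_mod_plus_full).
    rewrite !plus_IZR, mult_IZR. field. auto. }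
  rewrite E, RtoC_plus. ring.
Qed.

(** The matrix is [T^a S], where the descent ends. *)
Lemma eta_law_base (a : Z) : eta_law a (-1) 1 0.
Proof.
  intros tau Ht. pose proof (upper_neq_0 tau Ht) as Hz.
  assert (Hi : upper (- / tau)).
  { replace (- / tau)%C with (mobius 0 (-1) 1 0 tau) by (unfold mobius; field; auto). apply upper_mobius; auto. }
  replace (mobius a (-1) 1 0 tau) with (- / tau + IZR a)%C by (unfold mobius; field; auto).
  rewrite logeta_Tn, logeta_S, clog_mI by auto.
  replace (IZR 1 * tau + IZR 0)%C with tau by ring.
  assert (E : Psi a (-1) 1 0 = IZR a - 3).
  { unfold Psi. simpl. unfold dedekind_sum. simpl. rewrite (sawZ_0 0 1) by auto. rewrite Z.add_0_r. field. }
  rewrite E, RtoC_minus, RtoC_div by lra. field.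
Qed.

(** Up to sign, the matrix is [(b, -a; d, -c)] times [S], so the lower left entry drops from [c] to
    [d]. Reciprocity changes [Psi] by 3, which amounts to [i pi / 4], half the discrepancy
    [i pi / 2] between the logarithms. *)
Lemma eta_law_step (a b c d : Z) : (a * d - b * c = 1)%Z -> (0 < d < c)%Z -> eta_law b (- a) d (- c) -> eta_law a b c d.
Proof.
  intros Hdet Hd H tau Ht. pose proof (upper_neq_0 tau Ht) as Hz. pose proof PI_RGT_0 as HPI.
  assert (Hi : upper (- / tau)).
  { replace (- / tau)%C with (mobius 0 (-1) 1 0 tau) by (unfold mobius; field; auto). apply upper_mobius; auto. }
  assert (Hcd : upper (IZR c * tau + IZR d)).
  { unfold upper. rewrite cz_Im. apply Rmult_lt_0_compat; auto. apply IZR_lt; lia. }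
  assert (Hdc : upper (IZR d * - / tau + IZR (- c))).
  { unfold upper. rewrite cz_Im. apply Rmult_lt_0_compat; auto. apply IZR_lt; lia. }
  pose proof (upper_neq_0 _ Hcd) as Hz2. pose proof (upper_neq_0 _ Hdc) as Hz3.
  replace (mobius a b c d tau) with (mobius b (- a) d (- c) (- / tau)).
  2:{ unfold mobius. rewrite !opp_IZR, !RtoC_opp in *.
      replace (IZR d * - / tau + - IZR c)%C with (- (IZR c * tau + IZR d) / tau)%C by (field; auto).
      field; auto. }
  rewrite H, logeta_S by auto.
  (* Both sides are logarithms of [Ci * (c tau + d)], with imaginary parts less than one period
     apart. *)
  assert (EL : (clog (- Ci * tau) + clog (IZR d * - / tau + IZR (- c)))%C = (clog (IZR c * tau + IZR d) + Ci * RtoC (PI / 2))%C).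
  { apply cexp_inj_Im.
    - rewrite !cexp_add, !cexp_clog, cexp_Ipi2; auto.
      + rewrite opp_IZR, RtoC_opp. field; auto.
      + apply Cmult_neq_0; auto. intro E; apply (f_equal Im) in E; simpl in E; lra.
    - rewrite clog_mI by auto. rewrite !Im_Cplus, Im_Cminus.
      replace (Im (Ci * RtoC (PI / 2))) with (PI / 2) by (simpl; ring).
      pose proof (clog_upper _ Ht). pose proof (clog_upper _ Hcd). pose proof (clog_upper _ Hdc).
      apply Rabs_lt_between. lra. }
  assert (EP : Psi b (- a) d (- c) = Psi a b c d - 3).
  { unfold Psi. destruct (Z.ltb_spec 0 d); [| lia]. destruct (Z.ltb_spec 0 c); [| lia].
    rewrite Z.opp_involutive, dedekind_sum_opp by auto.
    assert (Hg : Z.gcd d c = 1%Z) by (apply Z.bezout_1_gcd; exists a, (- b)%Z; lia).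
    pose proof (dedekind_reciprocity d c ltac:(lia) ltac:(lia) Hg) as R.
    rewrite !plus_IZR, !opp_IZR.
    assert (HZ : IZR a * IZR d - IZR b * IZR c = 1) by (rewrite <- !mult_IZR, <- minus_IZR, Hdet; auto).
    assert (Hc0 : IZR c <> 0) by (apply IZR_neq; lia). assert (Hd0 : IZR d <> 0) by (apply IZR_neq; lia).
    assert (X : (IZR b + - IZR c) / IZR d - (IZR a + IZR d) / IZR c + (IZR d / IZR c + IZR c / IZR d + 1 / (IZR d * IZR c)) = 0).
    { rewrite <- HZ. field. auto. }
    lra. }
  rewrite EP, RtoC_minus.
  transitivity (logeta tau + / 2 * (clog (- Ci * tau) + clog (IZR d * - / tau + IZR (- c))) + 2 * PI * Ci / 24 * (RtoC (Psi a b c d) - 3))%C; [ring |].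
  rewrite EL, RtoC_div by lra. field.
Qed.

(** The Euclidean algorithm on the bottom row: [d] is reduced modulo [c], then the two are
    exchanged. *)
Lemma eta_law_pos : forall (n : nat) (a b c d : Z), Z.to_nat c = n -> (0 < c)%Z -> (a * d - b * c = 1)%Z -> eta_law a b c d.
Proof.
  induction n as [n IH] using lt_wf_ind. intros a b c d Hn Hc Hdet.
  pose proof (Z.div_mod d c ltac:(lia)) as HD. pose proof (Z.mod_pos_bound d c Hc) as HM.
  set (q := (d / c)%Z) in *. set (d0 := (d mod c)%Z) in *.
  replace b with ((b - q * a) + q * a)%Z by ring. replace d with (d0 + q * c)%Z by lia.
  assert (Hdet0 : (a * d0 - (b - q * a) * c = 1)%Z) by (rewrite HD in Hdet; lia).
  apply eta_law_shift; auto.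
  destruct (Z.eq_dec d0 0) as [E | E].
  - rewrite E in *. assert (H : ((q * a - b) * c = 1)%Z) by lia.
    assert (c = 1 /\ b - q * a = -1)%Z as [-> ->]; [| apply eta_law_base].
    destruct (Z.mul_eq_1 _ _ H) as [X | X]; rewrite X in H; lia.
  - apply eta_law_step; auto; [lia |]. apply (IH (Z.to_nat d0)); lia.
Qed.

Lemma clog_1 : clog 1 = 0%C.
Proof. apply clog_unique; [apply cexp_0 | simpl; pose proof PI_RGT_0; lra]. Qed.

Lemma eta_transformation (a b c d : Z) : (a * d - b * c = 1)%Z -> eta_law a b c d.
Proof.
  intros Hdet. pose proof PI_RGT_0 as HPI. destruct (Z.lt_trichotomy c 0) as [Hc | [-> | Hc]].
  - intros tau Ht. pose proof (eta_law_pos _ (- a) (- b) (- c) (- d) eq_refl ltac:(lia) ltac:(lia) tau Ht) as H.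
    assert (Hu : upper (IZR (- c) * tau + IZR (- d))).
    { unfold upper. rewrite cz_Im. apply Rmult_lt_0_compat; auto. apply IZR_lt; lia. }
    pose proof (upper_neq_0 _ Hu) as Hz.
    assert (EM : mobius (- a) (- b) (- c) (- d) tau = mobius a b c d tau).
    { pose proof (cz_neq_0 c d tau Ht ltac:(lia)). unfold mobius in *. rewrite !opp_IZR, !RtoC_opp in *. field. split; auto.  }
    rewrite EM in H. rewrite H.
    replace (IZR c * tau + IZR d)%C with (- (IZR (- c) * tau + IZR (- d)))%C by (rewrite !opp_IZR, !RtoC_opp; ring).
    rewrite clog_opp by auto.
    (* The difference 6 amounts to [i pi / 2] and compensates half of the [i pi] in [clog_opp]. *)
    assert (EP : Psi a b c d = Psi (- a) (- b) (- c) (- d) + 6).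
    { unfold Psi. destruct (Z.ltb_spec 0 c); [lia |]. destruct (Z.ltb_spec c 0); [| lia]. destruct (Z.ltb_spec 0 (- c)); [| lia].
      rewrite Z.opp_involutive, !plus_IZR, !opp_IZR. field. apply IZR_neq; lia. }
    rewrite EP, RtoC_plus. field.
  - intros tau Ht. assert ((a = 1 /\ d = 1) \/ (a = -1 /\ d = -1))%Z as [[-> ->] | [-> ->]].
    { rewrite Z.mul_0_r, Z.sub_0_r in Hdet. apply Z.mul_eq_1 in Hdet as Ha. destruct Ha as [-> | ->]; lia. }
    + replace (mobius 1 b 0 1 tau) with (tau + IZR b)%C by (unfold mobius; field).
      rewrite logeta_Tn by auto. replace (IZR 0 * tau + IZR 1)%C with (RtoC 1) by ring. rewrite clog_1. unfold Psi; simpl. ring.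
    + replace (mobius (-1) b 0 (-1) tau) with (tau + IZR (- b))%C by (rewrite opp_IZR, RtoC_opp; unfold mobius; field).
      rewrite logeta_Tn by auto. replace (IZR 0 * tau + IZR (-1))%C with (RtoC (-1)) by ring.
      assert (E : clog (-1) = (Ci * RtoC PI)%C).
      { apply clog_unique; [apply cexp_Ipi |]. replace (Im (Ci * RtoC PI)) with PI by (simpl; ring). lra. }
      rewrite E. unfold Psi; simpl. rewrite opp_IZR, RtoC_minus, !RtoC_opp. field.
  - apply (eta_law_pos _ a b c d eq_refl); auto.
Qed.
End EtaLaw.

(** * Partial fractions of the cotangent *)

Lemma has_sum_finite {T} (f : T -> C) L : NoDup L -> (forall t, ~ In t L -> f t = 0%C) -> has_sum f (fsum f L).
Proof.
  intros HN Hf e He. exists L. intros M HM HI. destruct (incl_split L M HM HN HI) as [L' [HP [_ HD]]].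
  rewrite (fsum_perm _ _ _ HP), fsum_app.
  assert (E : fsum f L' = 0%C).
  { clear HP. induction L' as [| x L' IH]; [reflexivity |]. unfold fsum in *; simpl.
    rewrite IH by (intros; apply HD; simpl; auto). rewrite Hf by (apply HD; simpl; auto). ring. }
  rewrite E. replace (fsum f L + 0 - fsum f L)%C with (RtoC 0) by ring. rewrite Cmod_0; auto.
Qed.

Lemma list_bound (L : list nat) : exists N, forall n, In n L -> (n < N)%nat.
Proof.
  induction L as [| x L [N IH]]; [exists 0%nat; simpl; tauto |].
  exists (Nat.max (S x) N). intros n [-> | Hn]; [lia | specialize (IH n Hn); lia].
Qed.

Lemma tends_seq (f : nat -> C) l : has_sum f l -> tends eventually (fun N => fsum f (seq 0 N)) l.
Proof.
  intros H e He. destruct (H e He) as [L0 HL0]. destruct (list_bound L0) as [N HN].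
  exists N. intros n Hn. apply HL0; [apply seq_NoDup |].
  intros t Ht. apply in_seq. specialize (HN t Ht). lia.
Qed.

(** Half open, from [- N] to [N - 1]: for [N = 2^n] this is a complete residue system modulo
    [2^(n+1)]. *)
Definition zrange (N : nat) : list Z := map (fun k => (Z.of_nat k - Z.of_nat N)%Z) (seq 0 (2 * N)).

Lemma in_zrange N z : In z (zrange N) <-> (- Z.of_nat N <= z < Z.of_nat N)%Z.
Proof.
  unfold zrange. rewrite in_map_iff. split.
  - intros [k [<- Hk]]. apply in_seq in Hk. lia.
  - intros Hz. exists (Z.to_nat (z + Z.of_nat N)). split; [lia |]. apply in_seq. lia.
Qed.

Lemma zrange_NoDup N : NoDup (zrange N).
Proof. apply NoDup_map_inj; [intros; lia | apply seq_NoDup]. Qed.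

Lemma tends_zrange (f : Z -> C) l : has_sum f l -> tends eventually (fun N => fsum f (zrange N)) l.
Proof.
  intros H e He. destruct (H e He) as [L0 HL0]. destruct (list_bound (map Z.abs_nat L0)) as [N HN].
  exists N. intros n Hn. apply HL0; [apply zrange_NoDup |].
  intros t Ht. apply in_zrange. specialize (HN _ (in_map _ _ _ Ht)). lia.
Qed.

Lemma zrange_S (f : Z -> C) N :
  fsum f (zrange (S N)) = (f (- Z.of_nat (S N))%Z + (f (Z.of_nat N) + fsum f (zrange N)))%C.
Proof.
  rewrite (fsum_perm f (zrange (S N)) ((- Z.of_nat (S N))%Z :: Z.of_nat N :: zrange N)); [reflexivity |].
  apply NoDup_Permutation; [apply zrange_NoDup | |].
  - constructor; [| constructor; [| apply zrange_NoDup]].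
    + intros [H | H]; [lia | apply in_zrange in H; lia].
    + intros H. apply in_zrange in H. lia.
  - intros z. cbn [In]. rewrite !in_zrange. lia.
Qed.

Lemma summable_inv_sq_nat : summable (fun n : nat => / (INR n + 1) ^ 2).
Proof.
  apply summable_le with (fun n => Rpower (INR n + 1) (Ropp 2)); [| apply (summable_pseries 2); lra].
  intros n. pose proof (pos_INR n). assert (0 < (INR n + 1) ^ 2) by (apply pow_lt; lra). split.
  - left. apply Rinv_0_lt_compat; auto.
  - rewrite Rpower_Ropp. right. f_equal. rewrite <- (Rpower_pow 2) by lra. f_equal; simpl; ring.
Qed.

Lemma summable_inv_sq : summable (fun k : Z => / (1 + Rabs (IZR k)) ^ 2).
Proof.
  apply summable_le with (fun z => / (INR (Z.abs_nat z) + 1) ^ 2); [| apply (summable_Z (fun n => / (INR n + 1) ^ 2)), summable_inv_sq_nat].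
  intros k. rewrite INR_IZR_INZ, Zabs2Nat.id_abs, abs_IZR, Rplus_comm. pose proof (Rabs_pos (IZR k)).
  split; [| lra]. left. apply Rinv_0_lt_compat, pow_lt. lra.
Qed.

(** Large [k] are handled by the triangle inequality, the finitely many others by a minimum. *)
Lemma shift_lower (z : C) : (forall k : Z, (z + IZR k)%C <> 0%C) ->
  exists d, 0 < d <= 1 /\ forall k : Z, d * (1 + Rabs (IZR k)) <= Cmod (z + IZR k).
Proof.
  intros H. destruct (archimed (2 * Cmod z + 1)) as [A _]. set (N := Z.to_nat (up (2 * Cmod z + 1))).
  pose proof (Cmod_ge_0 z).
  assert (HN : 2 * Cmod z + 1 < INR N).
  { unfold N. rewrite INR_IZR_INZ, Z2Nat.id; auto. apply le_IZR. lra. }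
  assert (HN0 : (0 < N)%nat) by (apply INR_lt; simpl; lra).
  destruct (argmin_list (fun k => Cmod (z + IZR k)) (zrange (S N)) 0%Z) as [k0 [_ Hm]]; [apply in_zrange; lia |].
  set (d := Cmod (z + IZR k0)). assert (Hd : 0 < d) by (apply Cmod_gt_0; auto).
  exists (Rmin (1 / 2) (d / (INR N + 2))). split.
  { split; [apply Rmin_pos; [lra | apply Rdiv_lt_0_compat; lra] |]. eapply Rle_trans; [apply Rmin_l | lra]. }
  intros k. pose proof (Rmin_l (1 / 2) (d / (INR N + 2))). pose proof (Rmin_r (1 / 2) (d / (INR N + 2))).
  pose proof (Rabs_pos (IZR k)).
  destruct (Z_le_gt_dec (Z.abs k) (Z.of_nat N)) as [L | L].
  - apply Rle_trans with (d / (INR N + 2) * (INR N + 2)).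
    + apply Rmult_le_compat; try lra; [apply Rlt_le, Rmin_pos; [lra | apply Rdiv_lt_0_compat; lra] |].
      rewrite <- abs_IZR. apply IZR_le in L. rewrite <- INR_IZR_INZ in L. lra.
    + replace (d / (INR N + 2) * (INR N + 2)) with d by (field; lra). apply (Hm k). apply in_zrange. lia.
  - apply Rle_trans with (1 / 2 * (1 + Rabs (IZR k))); [apply Rmult_le_compat_r; lra |].
    assert (INR N < Rabs (IZR k)) by (rewrite <- abs_IZR, INR_IZR_INZ; apply IZR_lt; lia).
    pose proof (Cmod_triangle (z + IZR k) (- z)). replace (z + IZR k + - z)%C with (RtoC (IZR k)) in H5 by ring.
    rewrite Cmod_opp, Cmod_R in H5. lra.
Qed.

(** The function [pi^2 / sin(pi z)^2], written in [ee z]. *)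
Definition Pc (z : C) : C := (-4 * PI * PI * ee z / ((1 - ee z) * (1 - ee z)))%C.

Lemma ee_half : ee (RtoC (/ 2)) = (-1)%C.
Proof.
  unfold ee. replace (2 * PI * Ci * RtoC (/ 2))%C with (Ci * RtoC PI)%C; [apply cexp_Ipi |].
  apply injective_projections; simpl; field.
Qed.

Lemma Pc_period (z : C) (k : Z) : Pc (z + IZR k) = Pc z.
Proof. unfold Pc. rewrite ee_period. auto. Qed.

(** Iterated, this duplication formula writes [Pc z] as an average over residues modulo [2^m], whose
    limit is the partial fraction expansion. *)
Lemma Pc_dup (z : C) : ee z <> 1%C -> (Pc (RtoC (/ 2) * z) + Pc (RtoC (/ 2) * (z + 1)))%C = (4 * Pc z)%C.
Proof.
  intros H. unfold Pc. set (w := ee (RtoC (/ 2) * z)).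
  assert (E1 : ee z = (w * w)%C).
  { unfold w. rewrite <- ee_add. f_equal. rewrite <- Cmult_plus_distr_r, <- RtoC_plus. replace (/ 2 + / 2) with 1 by field. ring. }
  assert (E2 : ee (RtoC (/ 2) * (z + 1)) = (- w)%C).
  { replace (RtoC (/ 2) * (z + 1))%C with (RtoC (/ 2) * z + RtoC (/ 2))%C by ring. rewrite ee_add, ee_half. fold w. ring. }
  rewrite E2, E1 in *.
  assert (N1 : (1 - w)%C <> 0%C).
  { intro E. apply H. replace w with (1 - (1 - w))%C by ring. rewrite E. ring. }
  assert (N2 : (1 + w)%C <> 0%C).
  { intro E. apply H. replace w with ((1 + w) - 1)%C by ring. rewrite E. ring. }
  replace (1 - w * w)%C with ((1 - w) * (1 + w))%C by ring. replace (1 - - w)%C with (1 + w)%C by ring. field. auto.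
Qed.

Lemma seq_from (a n : nat) : seq a n = map (fun k => (a + k)%nat) (seq 0 n).
Proof.
  induction n as [| n IH]; auto. rewrite !seq_S, IH, map_app. auto.
Qed.

Lemma pow2_neq_0 (m : nat) : RtoC (2 ^ m) <> 0%C.
Proof. intro E. apply RtoC_inj in E. revert E. apply pow_nonzero. lra. Qed.

Lemma Pc_iter (z : C) (m : nat) : ee z <> 1%C ->
  fsum (fun k : nat => Pc ((z + RtoC (INR k)) / RtoC (2 ^ m))) (seq 0 (2 ^ m)) = (RtoC (4 ^ m) * Pc z)%C.
Proof.
  intros Hz. induction m as [| m IH].
  - unfold fsum; simpl. replace ((z + RtoC 0) / RtoC 1)%C with z by field. ring.
  - replace (2 ^ S m)%nat with (2 ^ m + 2 ^ m)%nat by (simpl; lia). rewrite seq_app, fsum_app.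
    rewrite (seq_from (0 + 2 ^ m)), fsum_map, <- fsum_plus. simpl (0 + 2 ^ m)%nat.
    pose proof (pow2_neq_0 m) as Hm.
    rewrite (fsum_ext _ (fun k => RtoC 4 * Pc ((z + RtoC (INR k)) / RtoC (2 ^ m)))%C).
    + rewrite fsum_scal, IH. simpl (4 ^ S m). rewrite RtoC_mult. ring.
    + intros k _. set (u := ((z + RtoC (INR k)) / RtoC (2 ^ m))%C).
      rewrite <- Pc_dup.
      * assert (E2 : RtoC (/ 2) = (/ 2)%C) by (rewrite RtoC_inv; auto; lra).
        f_equal; f_equal; unfold u; rewrite E2; simpl (2 ^ S m); rewrite RtoC_mult.
        -- field. auto.
        -- rewrite plus_INR, pow_INR, RtoC_plus. replace (INR 2) with 2 by (simpl; ring). field. auto.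
      * intro E. apply Hz. rewrite <- (ee_period z (Z.of_nat k)), <- INR_IZR_INZ.
        replace (z + RtoC (INR k))%C with (RtoC (INR (2 ^ m)) * u)%C.
        -- rewrite ee_nat_mult, E. apply Cpow_1_l.
        -- unfold u. rewrite pow_INR. replace (INR 2) with 2 by (simpl; ring). field. auto.
Qed.

Lemma Pc_zrange (z : C) (n : nat) : ee z <> 1%C ->
  fsum (fun k : Z => Pc ((z + IZR k) / RtoC (2 ^ S n))) (zrange (2 ^ n)) = (RtoC (4 ^ S n) * Pc z)%C.
Proof.
  intros Hz. unfold zrange. rewrite fsum_map.
  rewrite <- (Pc_period z (- Z.of_nat (2 ^ n))), <- Pc_iter by (rewrite ee_period; auto).
  replace (2 * 2 ^ n)%nat with (2 ^ S n)%nat by (simpl; lia). apply fsum_ext. intros k _. f_equal. f_equal.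
  rewrite minus_IZR, opp_IZR, RtoC_minus, RtoC_opp, (INR_IZR_INZ k). ring.
Qed.

(** A weak form of Jordan's inequality: on [[0, 1]] the cosine is at least 1/2, and beyond 1 the
    sine keeps increasing. *)
Lemma sin_lower (t : R) : 0 <= t <= PI / 2 -> t / 4 <= sin t.
Proof.
  intros Ht. pose proof PI_4. pose proof PI2_3_2.
  assert (W : forall s, 0 <= s <= 1 -> s / 2 <= sin s).
  { intros s Hs. destruct (MVT_gen sin 0 s cos) as [c [Hc E]].
    - intros x _. apply is_derive_Reals, derivable_pt_lim_sin.
    - intros x _. apply continuity_sin.
    - rewrite Rmin_left, Rmax_right in Hc by lra. rewrite sin_0 in E.
      assert (1 / 2 <= cos c).
      { replace c with (2 * (c / 2)) by field. rewrite cos_2a_sin. pose proof (Rabs_sin_le (c / 2)).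
        apply Rsqr_le_abs_1 in H1. unfold Rsqr in H1. nra. }
      nra. }
  destruct (Rle_dec t 1) as [L | L]; [specialize (W t ltac:(lra)); lra |].
  pose proof (W 1 ltac:(lra)). assert (sin 1 < sin t) by (apply sin_increasing_1; lra). lra.
Qed.

(** Since [|1 - e(u)|^2 = 4 |e(u)| |sin(pi u)|^2], this is [|sin(pi u)| >= pi |u| / 4] on a
    half-strip; it yields the dominating series for [Pc_series]. *)
Lemma Cmod_1_ee (u : C) : Rabs (Re u) <= 1 / 2 -> 0 <= Im u ->
  Cmod (ee u) * (PI ^ 2 / 4) * Cmod u ^ 2 <= Cmod (1 - ee u) ^ 2.
Proof.
  intros Ha Hb. rewrite !Cmod2_alt, Cmod_ee. set (a := Re u) in *. set (b := Im u) in *.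
  pose proof PI_RGT_0 as HP. set (r := exp (- (2 * PI * b))).
  assert (E1 : Re (1 - ee u) = 1 - r * cos (2 * PI * a)).
  { unfold ee, cexp, r. rewrite Re_Cminus. cbn [Re fst]. f_equal. f_equal; [f_equal | f_equal]; unfold a, b, Re, Im; simpl; ring. }
  assert (E2 : Im (1 - ee u) = - (r * sin (2 * PI * a))).
  { unfold ee, cexp, r. rewrite Im_Cminus. cbn [Im snd]. rewrite Rminus_0_l. f_equal. f_equal; [f_equal | f_equal]; unfold a, b, Re, Im; simpl; ring. }
  rewrite E1, E2.
  replace ((1 - r * cos (2 * PI * a)) ^ 2 + (- (r * sin (2 * PI * a))) ^ 2)
    with ((1 - r) ^ 2 + 2 * r * (1 - cos (2 * PI * a)) + r ^ 2 * (sin (2 * PI * a) * sin (2 * PI * a) + cos (2 * PI * a) * cos (2 * PI * a) - 1)) by ring.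
  pose proof (sin2_cos2 (2 * PI * a)) as SC. unfold Rsqr in SC. rewrite SC.
  replace (2 * PI * a) with (2 * (PI * a)) by ring. rewrite cos_2a_sin.
  assert (Hs : (PI * a / 4) ^ 2 <= sin (PI * a) ^ 2).
  { apply Rabs_le_between in Ha.
    destruct (Rle_dec 0 a).
    - pose proof (sin_lower (PI * a) ltac:(split; nra)). assert (0 <= PI * a) by nra. nra.
    - pose proof (sin_lower (PI * - a) ltac:(split; nra)) as W. replace (PI * - a) with (- (PI * a)) in W by ring.
      rewrite sin_neg in W. assert (PI * a <= 0) by nra. nra. }
  assert (Hr : 0 < r) by apply exp_pos.
  assert (Hr2 : r * (PI * b) ^ 2 <= (1 - r) ^ 2).
  { set (s := exp (- (PI * b))). assert (Hs0 : 0 < s) by apply exp_pos.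
    assert (Er : r = s * s) by (unfold r, s; rewrite <- exp_plus; f_equal; ring).
    assert (Hpb : 0 <= PI * b) by nra.
    pose proof (exp_ineq1_le (PI * b)) as Q1.
    assert (Es : s * exp (PI * b) = 1) by (unfold s; rewrite <- exp_plus, Rplus_opp_l; apply exp_0).
    assert (s * (1 + PI * b) <= 1) by (rewrite <- Es; apply Rmult_le_compat_l; lra).
    assert (s <= 1) by nra.
    assert (s * (PI * b) <= 1 - s * s) by nra.
    assert ((s * (PI * b)) ^ 2 <= (1 - s * s) ^ 2) by (apply pow_incr; split; [nra | auto]).
    rewrite Er. replace (s * s * (PI * b) ^ 2) with ((s * (PI * b)) ^ 2) by ring. auto. }
  assert (r * (PI * a / 4) ^ 2 <= r * sin (PI * a) ^ 2) by (apply Rmult_le_compat_l; lra).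
  assert (0 <= r * (PI * b) ^ 2) by (apply Rmult_le_pos; [lra | apply pow2_ge_0]).
  lra.
Qed.

Lemma ee_neq_1 (u : C) : Rabs (Re u) <= 1 / 2 -> 0 <= Im u -> u <> 0%C -> ee u <> 1%C.
Proof.
  intros Ha Hb Hu E. pose proof (Cmod_1_ee u Ha Hb) as H. rewrite E in H.
  replace (1 - 1)%C with (RtoC 0) in H by ring. rewrite Cmod_0, Cmod_1 in H.
  apply Cmod_gt_0 in Hu. pose proof PI_RGT_0. assert (0 < PI ^ 2 * Cmod u ^ 2) by (apply Rmult_lt_0_compat; apply pow_lt; auto). nra.
Qed.

Lemma Pc_bound (u : C) : Rabs (Re u) <= 1 / 2 -> 0 <= Im u -> u <> 0%C -> Cmod (Pc u) <= 16 / Cmod u ^ 2.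
Proof.
  intros Ha Hb Hu. pose proof (Cmod_1_ee u Ha Hb) as H. pose proof (ee_neq_1 u Ha Hb Hu) as Hn.
  assert (Hn1 : (1 - ee u)%C <> 0%C).
  { intro E. apply Hn. replace (ee u) with (1 - (1 - ee u))%C by ring. rewrite E. ring. }
  unfold Pc. rewrite Cmod_div by (apply Cmult_neq_0; auto). rewrite !Cmod_mult, !Cmod_R, !(Rabs_right PI) by (pose proof PI_RGT_0; lra).
  rewrite Rabs_left by lra. apply Cmod_gt_0 in Hu. apply Cmod_gt_0 in Hn1.
  assert (0 < Cmod u ^ 2) by (apply pow_lt; auto). assert (0 < Cmod (1 - ee u) ^ 2) by (apply pow_lt; auto).
  apply Rmult_le_reg_r with (Cmod (1 - ee u) ^ 2 * Cmod u ^ 2); [apply Rmult_lt_0_compat; auto |].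
  replace (- -4 * PI * PI * Cmod (ee u) / (Cmod (1 - ee u) * Cmod (1 - ee u)) * (Cmod (1 - ee u) ^ 2 * Cmod u ^ 2))
    with (16 * (Cmod (ee u) * (PI ^ 2 / 4) * Cmod u ^ 2)) by (field; lra).
  replace (16 / Cmod u ^ 2 * (Cmod (1 - ee u) ^ 2 * Cmod u ^ 2)) with (16 * Cmod (1 - ee u) ^ 2) by (field; lra).
  lra.
Qed.

Lemma twoPiI_neq_0 : (2 * PI * Ci)%C <> 0%C.
Proof. pose proof PI_RGT_0. apply Cmod_gt_0. rewrite !Cmod_mult, Cmod_Ci, !Cmod_R, !Rabs_right; lra. Qed.

Lemma shift_neq_0 (z : C) : ee z <> 1%C -> forall k : Z, (z + IZR k)%C <> 0%C.
Proof.
  intros H k E. apply H. rewrite <- (ee_period z k), E. apply ee_0.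
Qed.

(** Tannery's theorem applied to the iterated duplication formula. Real [z] off the integers are
    included, since the point 1/2 is used below. *)
Lemma Pc_series (z : C) : 0 <= Im z -> ee z <> 1%C -> has_sum (fun k : Z => / ((z + IZR k) * (z + IZR k)))%C (Pc z).
Proof.
  (* For such [z] and [k] in [zrange (2 ^ n)], the quotient [(z + k) / 2^(n+1)] has real part in
     [[-1/2, 1/2]], where [Pc_bound] applies. *)
  assert (W : forall z, 0 <= Re z < 1 -> 0 <= Im z -> ee z <> 1%C -> has_sum (fun k : Z => / ((z + IZR k) * (z + IZR k)))%C (Pc z)).
  { clear z. intros z Hr Hi Hz. pose proof (shift_neq_0 z Hz) as Hk.
    destruct (shift_lower z Hk) as [d [Hd HD]].
    set (g := fun k : Z => (/ ((z + IZR k) * (z + IZR k)))%C).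
    set (b := fun k : Z => 16 / d ^ 2 * / (1 + Rabs (IZR k)) ^ 2).
    assert (Sb : summable b) by (apply summable_scal; [apply Rlt_le, Rdiv_lt_0_compat; [lra | apply pow_lt; lra] | apply summable_inv_sq]).
    assert (Low : forall k, 16 / Cmod (z + IZR k) ^ 2 <= b k).
    { intros k. unfold b. pose proof (Rabs_pos (IZR k)).
      replace (16 / d ^ 2 * / (1 + Rabs (IZR k)) ^ 2) with (16 * / (d * (1 + Rabs (IZR k))) ^ 2) by (field; lra).
      apply Rmult_le_compat_l; [lra |]. apply Rinv_le_contravar; [apply pow_lt, Rmult_lt_0_compat; lra |].
      apply pow_incr. split; [apply Rmult_le_pos; lra | auto]. }
    assert (Gb : forall k, Cmod (g k) <= b k).
    { intros k. unfold g. rewrite Cmod_inv, Cmod_mult by (apply Cmult_neq_0; auto). specialize (Low k).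
      assert (0 < Cmod (z + IZR k)) by (apply Cmod_gt_0; auto).
      eapply Rle_trans; [| exact Low]. unfold Rdiv. replace (Cmod (z + IZR k) ^ 2) with (Cmod (z + IZR k) * Cmod (z + IZR k)) by ring.
      assert (0 < / (Cmod (z + IZR k) * Cmod (z + IZR k))) by (apply Rinv_0_lt_compat; nra). lra. }
    set (f := fun (n : nat) (k : Z) => if in_dec Z.eq_dec k (zrange (2 ^ n)) then (RtoC (/ 4 ^ S n) * Pc ((z + IZR k) / RtoC (2 ^ S n)))%C else RtoC 0).
    assert (P4 : forall n, (RtoC (2 ^ S n) * RtoC (2 ^ S n))%C = RtoC (4 ^ S n)).
    { intros n. rewrite <- RtoC_mult. f_equal. rewrite <- Rpow_mult_distr. f_equal; ring. }
    assert (L : tends eventually (fun n => csum (f n)) (csum g)).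
    { apply (tends_csum eventually f g b); auto.
      - exists 0%nat. intros n _ k. unfold f. destruct (in_dec Z.eq_dec k (zrange (2 ^ n))) as [Hin | Hin].
        + apply in_zrange in Hin. rewrite Nat2Z.inj_pow in Hin. change (Z.of_nat 2) with 2%Z in Hin.
          set (p := 2 ^ S n). assert (Hp : 0 < p) by (apply pow_lt; lra).
          assert (Hin2 : - (p / 2) <= IZR k <= p / 2 - 1).
          { assert (Ep : p / 2 = IZR (2 ^ Z.of_nat n)) by (unfold p; rewrite <- pow_IZR; simpl; field).
            rewrite Ep, <- opp_IZR, <- minus_IZR. split; apply IZR_le; lia. }
          set (u := ((z + IZR k) / RtoC p)%C).
          assert (Eu : u = (RtoC (/ p) * (z + IZR k))%C) by (unfold u; rewrite RtoC_inv by lra; unfold Cdiv; ring).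
          assert (Ru : Re u = / p * (Re z + IZR k)) by (rewrite Eu; unfold Re; simpl; ring).
          assert (Iu : Im u = / p * Im z) by (rewrite Eu; unfold Im; simpl; ring).
          assert (0 < / p) by (apply Rinv_0_lt_compat; auto).
          assert (Hun : u <> 0%C).
          { rewrite Eu. apply Cmult_neq_0; auto. intro E; apply RtoC_inj in E; lra. }
          pose proof (Pc_bound u) as PB.
          assert (PB2 : Cmod (Pc u) <= 16 / Cmod u ^ 2).
          { apply PB; auto.
            - rewrite Ru. apply Rabs_le. split; apply Rmult_le_reg_l with p; auto; rewrite <- Rmult_assoc, Rinv_r, Rmult_1_l by lra; lra.
            - rewrite Iu. apply Rmult_le_pos; lra. }
          rewrite Cmod_mult, Cmod_R, Rabs_right by (apply Rle_ge, Rlt_le, Rinv_0_lt_compat, pow_lt; lra).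
          eapply Rle_trans; [| apply (Low k)]. assert (Hz0 : 0 < Cmod (z + IZR k)) by (apply Cmod_gt_0; auto).
          rewrite Eu, Cmod_mult, Cmod_R, (Rabs_right (/ p)) in PB2 by lra. fold u.
          assert (E4 : 4 ^ S n = p ^ 2) by (unfold p; rewrite <- pow_mult, Nat.mul_comm, pow_mult; f_equal; ring).
          rewrite <- Eu in PB2. rewrite E4.
          replace (16 / Cmod (z + IZR k) ^ 2) with (/ p ^ 2 * (16 / (/ p * Cmod (z + IZR k)) ^ 2)) by (field; lra).
          apply Rmult_le_compat_l; auto. left. apply Rinv_0_lt_compat, pow_lt; auto.
        + rewrite Cmod_0. apply Sb.
      (* The slope [phi] of [ee] at 0 gives [1 - ee u = - phi u * u]; as [phi] tends to
         [2 * PI * Ci], the rescaled [Pc] tends to [/ (z + k)^2]. *)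
      - intros k. destruct (Cd_ee 0%C) as [phi [[e0 [He0 H1]] H2]]. rewrite ee_0 in H2.
        set (u := fun n : nat => ((z + IZR k) / RtoC (2 ^ S n))%C).
        assert (Lu : tends eventually u 0%C).
        { intros e He. destruct (Pow_x_infinity 2 ltac:(rewrite Rabs_right; lra) (Cmod (z + IZR k) / e + 1)) as [N HN].
          exists N. intros n Hn. specialize (HN (S n) ltac:(lia)). rewrite Rabs_right in HN by (apply Rle_ge, pow_le; lra).
          replace (u n - 0)%C with (u n) by ring. unfold u.
          rewrite Cmod_div, Cmod_R, Rabs_right by (try apply pow2_neq_0; apply Rle_ge, pow_le; lra).
          assert (0 < 2 ^ S n) by (apply pow_lt; lra).
          apply Rmult_lt_reg_r with (2 ^ S n); auto. unfold Rdiv. rewrite Rmult_assoc, Rinv_l, Rmult_1_r by lra.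
          assert (HN2 : Cmod (z + IZR k) / e < 2 ^ S n) by lra. apply (Rmult_lt_compat_l e) in HN2; auto.
          replace (e * (Cmod (z + IZR k) / e)) with (Cmod (z + IZR k)) in HN2 by (field; lra). lra. }
        pose proof twoPiI_neq_0 as TP.
        assert (Lp : tends eventually (fun n => phi (u n)) (2 * PI * Ci * 1)%C) by (apply tends_comp with (RtoC 0); auto; apply eventually_filter).
        apply tends_eq with ((-4 * PI * PI * 1 * / ((2 * PI * Ci * 1) * (2 * PI * Ci * 1))) * g k)%C.
        2:{ replace ((2 * PI * Ci * 1) * (2 * PI * Ci * 1))%C with (4 * PI * PI * (Ci * Ci))%C by ring. rewrite Ci_sq.
            field. intro E; apply RtoC_inj in E; pose proof PI_RGT_0; lra. }
        apply tends_ext with (fun n => (-4 * PI * PI * ee (u n) * / (phi (u n) * phi (u n))) * g k)%C; [apply eventually_filter | |].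
        + assert (Hne : (2 * PI * Ci * 1)%C <> 0%C) by (replace (2 * PI * Ci * 1)%C with (2 * PI * Ci)%C by ring; auto).
          assert (Rg : eventually (fun n => In k (zrange (2 ^ n)))).
          { exists (Z.abs_nat k). intros n Hn. apply in_zrange. pose proof (Nat.pow_gt_lin_r 2 n ltac:(lia)). lia. }
          generalize (filter_and _ _ Rg (filter_and _ _ (Lu e0 He0) (tends_neq_0 _ _ _ Lp Hne))). apply filter_imp.
          intros n [R1 [R2 R3]]. unfold f. destruct (in_dec Z.eq_dec k (zrange (2 ^ n))); [| tauto].
          assert (Hph : phi (u n) <> 0%C) by (apply Cmod_gt_0; pose proof (Cmod_ge_0 (2 * PI * Ci * 1)); lra).
          pose proof (H1 (u n) R2) as Eu. rewrite ee_0 in Eu. fold (u n). unfold Pc.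
          assert (E1 : (1 - ee (u n))%C = (- (phi (u n) * u n))%C) by (rewrite Eu; ring). rewrite E1. unfold g.
          assert (Hzk := Hk k). pose proof (pow2_neq_0 (S n)).
          rewrite RtoC_inv by (apply pow_nonzero; lra). rewrite <- (P4 n). unfold u. field. repeat split; auto.
        + assert (EF : Filter eventually) by apply eventually_filter. apply tends_mult; auto; [| apply tends_const; auto].
          apply tends_mult; auto.
          * apply tends_mult; auto; [apply tends_const; auto |]. apply tends_comp with (RtoC 0); auto.
            apply tends_eq with (ee 0); [apply cts_ee | apply ee_0].
          * apply tends_inv; auto; [apply tends_mult; auto |].
            replace (2 * PI * Ci * 1)%C with (2 * PI * Ci)%C by ring. apply Cmult_neq_0; auto. }
    assert (E : csum g = Pc z).
    { apply (tends_unique eventually (fun n => csum (f n))); auto.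
      - intros [N HN]. apply (HN N). lia.
      - apply tends_ext with (fun _ : nat => Pc z); [apply eventually_filter | | apply tends_const, eventually_filter].
        exists 0%nat. intros n _. symmetry. apply csum_has_sum.
        replace (Pc z) with (fsum (f n) (zrange (2 ^ n))).
        + apply has_sum_finite; [apply zrange_NoDup |]. intros k Hk2. unfold f. destruct (in_dec Z.eq_dec k (zrange (2 ^ n))); tauto.
        + rewrite (fsum_ext _ (fun k => RtoC (/ 4 ^ S n) * Pc ((z + IZR k) / RtoC (2 ^ S n)))%C).
          * rewrite fsum_scal, Pc_zrange by auto. rewrite RtoC_inv by (apply pow_nonzero; lra). field.
            intro E; apply RtoC_inj in E; revert E; apply pow_nonzero; lra.
          * intros k Hk2. unfold f. destruct (in_dec Z.eq_dec k (zrange (2 ^ n))); tauto. }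
    rewrite <- E. apply csum_spec with b; auto. }
  intros Hi Hz. destruct (archimed (Re z)) as [A1 A2]. set (m := (1 - up (Re z))%Z).
  assert (Hm : has_sum (fun k : Z => / ((z + IZR m + IZR k) * (z + IZR m + IZR k)))%C (Pc z)).
  { rewrite <- (Pc_period z m). apply W.
    - rewrite Re_Cplus. change (Re (RtoC (IZR m))) with (IZR m). unfold m. rewrite minus_IZR. lra.
    - rewrite Im_Cplus. change (Im (RtoC (IZR m))) with 0. lra.
    - rewrite ee_period. auto. }
  apply (has_sum_reindex _ _ (fun k => (k - m)%Z) (fun k => (k + m)%Z)) in Hm; [| intros; lia | intros; lia].
  revert Hm. apply has_sum_ext. intros k. rewrite minus_IZR, RtoC_minus. f_equal. f_equal; ring.
Qed.

(** Pairing [n] with [- (n + 1)] exhausts the integers with nothing left over. *)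
Lemma has_sum_Z_pairs (f : Z -> C) l : has_sum f l -> has_sum (fun n : nat => f (Z.of_nat n) + f (- Z.of_nat (S n))%Z)%C l.
Proof.
  intros H.
  apply (has_sum_reindex f l (fun p : nat * bool => if snd p then Z.of_nat (fst p) else (- Z.of_nat (S (fst p)))%Z)
    (fun z => if (0 <=? z)%Z then (Z.to_nat z, true) else (Z.to_nat (- z - 1), false))) in H.
  - apply fubini with (1 := H). intros n.
    pose proof (has_sum_finite (fun b : bool => f (if snd (n, b) then Z.of_nat (fst (n, b)) else (- Z.of_nat (S (fst (n, b))))%Z)) (true :: false :: nil)) as HF.
    unfold fsum in HF. simpl in HF. rewrite Cplus_0_r in HF. apply HF.
    + repeat constructor; simpl; intuition discriminate.
    + intros [|] Hb; exfalso; apply Hb; simpl; auto.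
  - intros [n [|]]; cbn [fst snd].
    + destruct (Z.leb_spec 0 (Z.of_nat n)); [| lia]. f_equal. lia.
    + destruct (Z.leb_spec 0 (- Z.of_nat (S n))); [lia |]. f_equal. lia.
  - intros z. destruct (Z.leb_spec 0 z); cbn [fst snd]; lia.
Qed.

Lemma has_sum_Z_sym (f : Z -> C) l : has_sum f l ->
  has_sum (fun n : nat => f (Z.of_nat (S n)) + f (- Z.of_nat (S n))%Z)%C (l - f 0%Z)%C.
Proof.
  intros Hc. set (g := fun m => if Z.eq_dec m 0 then RtoC 0 else f m).
  assert (Hg : has_sum g (l - f 0%Z)%C).
  { pose proof (has_sum_finite (fun m => if Z.eq_dec m 0 then f 0%Z else RtoC 0) (0%Z :: nil)) as HF.
    assert (E : fsum (fun m => if Z.eq_dec m 0 then f 0%Z else RtoC 0) (0%Z :: nil) = f 0%Z).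
    { unfold fsum; simpl. ring. }
    rewrite E in HF. apply has_sum_ext with (fun m => f m - (if Z.eq_dec m 0 then f 0%Z else RtoC 0))%C.
    - intros m. unfold g. destruct (Z.eq_dec m 0) as [-> |]; ring.
    - apply has_sum_minus; auto. apply HF.
      + repeat constructor; simpl; tauto.
      + intros m Hm. destruct (Z.eq_dec m 0) as [-> |]; auto. exfalso. apply Hm. simpl; auto. }
  (* Moving the nonnegative integers up by one skips 0, where [g] vanishes, and turns the pairing of
     [has_sum_Z_pairs] into the symmetric one. *)
  assert (Hsh : has_sum (fun m : Z => g (if (0 <=? m)%Z then m + 1 else m)%Z) (l - f 0%Z)%C).
  { intros e He2. destruct (Hg e He2) as [L0 HL0].
    exists (map (fun m => if (0 <? m)%Z then m - 1 else m)%Z L0). intros L HL HI.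
    rewrite <- (fsum_map g (fun m => if (0 <=? m)%Z then m + 1 else m)%Z).
    set (L1 := map (fun m => if (0 <=? m)%Z then m + 1 else m)%Z L).
    assert (N1 : ~ In 0%Z L1).
    { unfold L1. rewrite in_map_iff. intros [m [Em _]]. destruct (Z.leb_spec 0 m); lia. }
    replace (fsum g L1) with (fsum g (0%Z :: L1)) by (unfold fsum, g; simpl; ring).
    apply HL0.
    - constructor; auto. apply NoDup_map_inj; auto. intros x y _ _ Exy. destruct (Z.leb_spec 0 x); destruct (Z.leb_spec 0 y); lia.
    - intros m Hm. destruct (Z.eq_dec m 0) as [-> | Hm0]; [left; auto | right].
      apply in_map_iff. exists (if (0 <? m)%Z then m - 1 else m)%Z. split.
      + destruct (Z.ltb_spec 0 m); [destruct (Z.leb_spec 0 (m - 1)) | destruct (Z.leb_spec 0 m)]; lia.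
      + apply HI, in_map_iff. exists m; auto. }
  apply has_sum_Z_pairs in Hsh. revert Hsh. apply has_sum_ext. intros n. unfold g.
  destruct (Z.leb_spec 0 (Z.of_nat n)); [| lia]. destruct (Z.leb_spec 0 (- Z.of_nat (S n))); [lia |].
  replace (Z.of_nat n + 1)%Z with (Z.of_nat (S n)) by lia.
  destruct (Z.eq_dec (Z.of_nat (S n)) 0); [lia |]. destruct (Z.eq_dec (- Z.of_nat (S n)) 0); [lia |]. auto.
Qed.

(** The series of [/ (z + k)] over all integers is not absolutely convergent, so [k = n] and
    [k = - (n + 1)] are taken together. With this pairing every term vanishes at 1/2. *)
Definition kt (n : nat) (z : C) : C := (/ (z + INR n) + / (z - INR (S n)))%C.
Definition kt' (n : nat) (z : C) : C := (- / ((z + INR n) * (z + INR n)) + - / ((z - INR (S n)) * (z - INR (S n))))%C.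
(** The function [pi cot(pi z)]. *)
Definition cotpi (z : C) : C := (PI * Ci * ((ee z + 1) * / (ee z - 1)))%C.

Lemma kt_sum_bound (z0 : C) : ee z0 <> 1%C -> exists d B, 0 < d /\ 0 <= B /\
  (forall w, disc z0 d w -> forall k : Z, (w + IZR k)%C <> 0%C) /\
  forall n w, disc z0 d w -> Cmod (kt n w) <= B * / (INR n + 1) ^ 2.
Proof.
  intros H. destruct (shift_lower z0 (shift_neq_0 z0 H)) as [d [Hd HD]].
  assert (Low : forall w, disc z0 (d / 2) w -> forall k : Z, d / 2 * (1 + Rabs (IZR k)) <= Cmod (w + IZR k)).
  { intros w Hw k. unfold disc in Hw. specialize (HD k). pose proof (Rabs_pos (IZR k)).
    pose proof (Cmod_le_sub (z0 + IZR k) (w + IZR k)).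
    replace (z0 + IZR k - (w + IZR k))%C with (z0 - w)%C in H1 by ring. rewrite Cmod_sub_sym in H1. nra. }
  assert (Nz : forall w, disc z0 (d / 2) w -> forall k : Z, (w + IZR k)%C <> 0%C).
  { intros w Hw k. apply Cmod_gt_0. specialize (Low w Hw k). pose proof (Rabs_pos (IZR k)). nra. }
  pose proof (Cmod_ge_0 z0).
  exists (d / 2), ((2 * Cmod z0 + 2) * (4 / d ^ 2)). split; [lra |]. split.
  { apply Rmult_le_pos; [lra |]. apply Rlt_le, Rdiv_lt_0_compat; [lra | apply pow_lt; lra]. }
  split; auto. intros n w Hw. pose proof (pos_INR n).
  pose proof (Nz w Hw (Z.of_nat n)) as N1. pose proof (Nz w Hw (- Z.of_nat (S n))%Z) as N2.
  pose proof (Low w Hw (Z.of_nat n)) as L1. pose proof (Low w Hw (- Z.of_nat (S n))%Z) as L2.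
  rewrite opp_IZR, RtoC_opp in N2, L2. rewrite <- !INR_IZR_INZ in *.
  rewrite Rabs_right in L1 by lra. rewrite Rabs_Ropp, Rabs_right, S_INR in L2 by (apply Rle_ge, pos_INR).
  replace (w + - RtoC (INR (S n)))%C with (w - INR (S n))%C in N2 by ring.
  replace (w + - RtoC (INR n + 1))%C with (w - RtoC (INR n + 1))%C in L2 by ring. rewrite <- S_INR in L2 at 2.
  unfold kt. replace (/ (w + INR n) + / (w - INR (S n)))%C with ((2 * w - 1) / ((w + INR n) * (w - INR (S n))))%C.
  2:{ rewrite S_INR, RtoC_plus in *. field. auto. }
  rewrite Cmod_div, Cmod_mult by (apply Cmult_neq_0; auto).
  assert (B1 : Cmod (2 * w - 1) <= 2 * Cmod z0 + 2).
  { unfold disc in Hw. replace (2 * w - 1)%C with (2 * z0 + 2 * (w - z0) + (-1))%C by ring.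
    eapply Rle_trans; [apply Cmod_triangle |]. eapply Rle_trans; [apply Rplus_le_compat_r, Cmod_triangle |].
    rewrite !Cmod_mult, !Cmod_R, Rabs_right, Rabs_left by lra. lra. }
  apply Rle_trans with ((2 * Cmod z0 + 2) * / ((d / 2 * (1 + INR n)) * (d / 2 * (1 + INR n)))).
  - apply Rmult_le_compat; auto; [apply Cmod_ge_0 | left; apply Rinv_0_lt_compat, Rmult_lt_0_compat; apply Cmod_gt_0; auto |].
    apply Rinv_le_contravar; [nra |]. apply Rmult_le_compat; nra.
  - right. field. lra.
Qed.

Lemma kt_hol (z0 : C) : ee z0 <> 1%C -> 0 <= Im z0 ->
  has_sum (fun n => kt n z0) (csum (fun n => kt n z0)) /\ Cd (fun w => csum (fun n => kt n w)) z0 (- Pc z0)%C.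
Proof.
  intros H Hi. destruct (kt_sum_bound z0 H) as [d [B [Hd [HB [Nz Bd]]]]].
  assert (Sb : summable (fun n : nat => B * / (INR n + 1) ^ 2)) by (apply summable_scal; auto; apply summable_inv_sq_nat).
  assert (D0 : disc z0 d z0) by (unfold disc; replace (z0 - z0)%C with (RtoC 0) by ring; rewrite Cmod_0; auto).
  split; [apply csum_spec with (fun n : nat => B * / (INR n + 1) ^ 2); auto |].
  destruct (weierstrass kt kt' (fun n : nat => B * / (INR n + 1) ^ 2) z0 d) as [W1 [_ W3]]; auto.
  - intros n w Hw. pose proof (Nz w Hw (Z.of_nat n)) as N1. pose proof (Nz w Hw (- Z.of_nat (S n))%Z) as N2.
    rewrite opp_IZR, RtoC_opp in N2. rewrite <- !INR_IZR_INZ in *.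
    assert (N3 : (w - INR (S n))%C <> 0%C) by exact N2.
    split.
    + unfold kt, kt'.
      replace (- / ((w + INR n) * (w + INR n)) + - / ((w - INR (S n)) * (w - INR (S n))))%C with
        (- / ((w + INR n) * (w + INR n)) * (1 + 0) + - / ((w - INR (S n)) * (w - INR (S n))) * (1 - 0))%C by ring.
      apply Cd_plus.
      * apply (Cd_comp (fun w => w + INR n)%C (fun v => / v)%C); [apply Cd_plus; [apply Cd_id | apply Cd_const] | apply Cd_inv; auto].
      * apply (Cd_comp (fun w => w - INR (S n))%C (fun v => / v)%C); [apply Cd_minus; [apply Cd_id | apply Cd_const] | apply Cd_inv; auto].
    + unfold kt'. ctac; (apply tends_inv; [apply nearC_filter | ctac | apply Cmult_neq_0; auto]).
  - replace (- Pc z0)%C with (csum (fun n => kt' n z0)); auto. apply csum_has_sum.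
    pose proof (has_sum_scal (-1)%C _ _ (has_sum_Z_pairs _ _ (Pc_series z0 Hi H))) as Q.
    replace (- Pc z0)%C with (-1 * Pc z0)%C by ring. revert Q. apply has_sum_ext. intros n. unfold kt'.
    rewrite opp_IZR, RtoC_opp, <- !INR_IZR_INZ. unfold Cminus. ring.
Qed.

Lemma ee_upper_neq_1 (z : C) : upper z -> ee z <> 1%C.
Proof. intros H E. pose proof (Cmod_ee_lt_1 z H). rewrite E, Cmod_1 in H0. lra. Qed.

(** Both sides have derivative [- Pc] along the segment from 1/2 to [z], and both vanish at 1/2. *)
Lemma cot_partial_fractions (z : C) : upper z -> has_sum (fun n => kt n z) (cotpi z).
Proof.
  intros Hz. set (K := fun w => csum (fun n => kt n w)).
  assert (E : (K z - cotpi z = K (RtoC (/ 2)) - cotpi (RtoC (/ 2)))%C).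
  { apply Cmod_sub_0. apply Rle_antisym; [| apply Cmod_ge_0].
    rewrite <- (Rmult_0_l (Cmod (z - RtoC (/ 2)))).
    apply (mean_value_ineq (fun w => K w - cotpi w)%C (fun _ => RtoC 0)).
    intros t Ht. set (w := (RtoC (/ 2) + RtoC t * (z - RtoC (/ 2)))%C). split; [| rewrite Cmod_0; lra].
    assert (Hw : ee w <> 1%C /\ 0 <= Im w).
    { destruct (Req_dec t 0) as [-> | Ht0].
      - replace w with (RtoC (/ 2)) by (unfold w; ring). rewrite ee_half. split; [| simpl; lra].
        intro E. apply RtoC_inj in E. lra.
      - assert (upper w); [| split; [apply ee_upper_neq_1; auto | unfold upper in H; lra]].
        unfold upper, w in *. rewrite Im_Cplus, Im_real_mult, Im_Cminus. simpl. nra. }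
    destruct Hw as [Hw Hi].
    assert (Hn : (ee w - 1)%C <> 0%C).
    { intro E. apply Hw. replace (ee w) with ((ee w - 1) + 1)%C by ring. rewrite E. ring. }
    assert (Hn2 : (1 - ee w)%C <> 0%C).
    { intro E. apply Hw. replace (ee w) with (1 - (1 - ee w))%C by ring. rewrite E. ring. }
    replace (RtoC 0) with (- Pc w - PI * Ci * ((2 * PI * Ci * ee w + 0) * / (ee w - 1) + (ee w + 1) * (- / ((ee w - 1) * (ee w - 1)) * (2 * PI * Ci * ee w - 0))))%C.
    - apply Cd_minus; [apply kt_hol; auto |]. unfold cotpi. apply Cd_scal.
      apply (Cd_mult (fun w => ee w + 1)%C (fun w => / (ee w - 1))%C).
      + apply Cd_plus; [apply Cd_ee | apply Cd_const].
      + apply (Cd_comp (fun w => ee w - 1)%C (fun v => / v)%C); [apply Cd_minus; [apply Cd_ee | apply Cd_const] | apply Cd_inv; auto].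
    - unfold Pc. transitivity ((4 * PI * PI * ee w + 4 * PI * PI * (Ci * Ci) * ee w) / ((ee w - 1) * (ee w - 1)))%C.
      + field. auto.
      + rewrite Ci_sq. field. auto. }
  assert (E0 : K (RtoC (/ 2)) = 0%C).
  { apply csum_has_sum. apply has_sum_ext with (fun _ => RtoC 0).
    - intros n. unfold kt. pose proof (pos_INR n). rewrite S_INR.
      rewrite <- RtoC_plus, <- RtoC_minus, <- !RtoC_inv, <- RtoC_plus by lra. f_equal. field. lra.
    - apply (has_sum_finite (fun _ : nat => RtoC 0) nil); auto. constructor. }
  assert (E1 : cotpi (RtoC (/ 2)) = 0%C) by (unfold cotpi; rewrite ee_half; ring).
  rewrite E0, E1 in E. replace (cotpi z) with (K z).
  - apply kt_hol; [apply ee_upper_neq_1; auto | unfold upper in Hz; lra].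
  - replace (K z) with ((K z - cotpi z) + cotpi z)%C by ring. rewrite E. ring.
Qed.

(* Splitting [Z] by parity; the terms at [0] vanish because [/ 0 = 0]. *)
Lemma zeta2 : has_sum (fun n : nat => / (INR (S n) * INR (S n)))%C (PI * PI / 6)%C.
Proof.
  set (f := fun m : Z => (/ (IZR m * IZR m))%C).
  assert (Hf0 : f 0%Z = 0%C).
  { unfold f. replace (RtoC (IZR 0) * RtoC (IZR 0))%C with (RtoC 0) by ring. apply injective_projections; simpl; unfold Rdiv; ring. }
  assert (Sf : forall m, Cmod (f m) <= 4 * / (1 + Rabs (IZR m)) ^ 2).
  { intros m. pose proof (Rabs_pos (IZR m)). destruct (Z.eq_dec m 0) as [-> | Hm].
    - rewrite Hf0, Cmod_0. apply Rmult_le_pos; [lra |]. left. apply Rinv_0_lt_compat, pow_lt. lra.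
    - assert (H1 : 1 <= Rabs (IZR m)) by (rewrite <- abs_IZR; apply IZR_le; lia).
      assert (Hn : RtoC (IZR m) <> 0%C) by (intro E; apply RtoC_inj in E; apply eq_IZR in E; lia).
      unfold f. rewrite Cmod_inv, Cmod_mult, Cmod_R by (apply Cmult_neq_0; auto).
      replace (4 * / (1 + Rabs (IZR m)) ^ 2) with (/ ((1 + Rabs (IZR m)) / 2 * ((1 + Rabs (IZR m)) / 2))) by (field; lra).
      apply Rinv_le_contravar; nra. }
  assert (Hc : has_sum f (csum f)) by (apply csum_spec with (fun m => 4 * / (1 + Rabs (IZR m)) ^ 2); auto; apply summable_scal; [lra | apply summable_inv_sq]).
  set (c := csum f) in *.
  assert (Hh : has_sum (fun k : Z => f (2 * k)%Z + f (2 * k + 1)%Z)%C c).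
  { assert (H2 := Hc).
    apply (has_sum_reindex f c (fun p : Z * bool => (2 * fst p + (if snd p then 1 else 0))%Z) (fun m => (m / 2, Z.odd m)%Z)) in H2.
    - apply fubini with (1 := H2). intros k.
      pose proof (has_sum_finite (fun b : bool => f (2 * fst (k, b) + (if snd (k, b) then 1 else 0))%Z) (false :: true :: nil)) as HF.
      unfold fsum in HF. simpl map in HF. simpl fold_right in HF. rewrite Cplus_0_r in HF. cbn [fst snd] in HF. rewrite Z.add_0_r in HF.
      apply HF.
      + repeat constructor; simpl; intuition discriminate.
      + intros [|] Hb; exfalso; apply Hb; simpl; auto.
    - intros [k [|]]; cbn [fst snd].
      + f_equal; [symmetry; apply (Z.div_unique _ _ k 1); lia |]. rewrite Z.add_comm, Z.odd_add_mul_2. auto.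
      + f_equal; [symmetry; apply (Z.div_unique _ _ k 0); lia |]. rewrite Z.add_comm, Z.odd_add_mul_2. auto.
    - intros m. cbn [fst snd]. pose proof (Z.div_mod m 2 ltac:(lia)) as Hd. rewrite Zmod_odd in Hd. destruct (Z.odd m); lia. }
  (* The odd terms are a quarter of the partial fraction series of [Pc] at 1/2, where [Pc] is
     [pi^2]. *)
  assert (Ho : has_sum (fun k : Z => f (2 * k + 1)%Z) (PI * PI / 4)%C).
  { pose proof (Pc_series (RtoC (/ 2))) as PS. rewrite ee_half in PS.
    assert (PS2 : has_sum (fun k : Z => / ((RtoC (/ 2) + IZR k) * (RtoC (/ 2) + IZR k)))%C (Pc (RtoC (/ 2)))).
    { apply PS; [simpl; lra | intro E; apply RtoC_inj in E; lra]. }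
    apply (has_sum_scal (/ 4)%C) in PS2.
    replace (/ 4 * Pc (RtoC (/ 2)))%C with (PI * PI / 4)%C in PS2 by (unfold Pc; rewrite ee_half; field).
    revert PS2. apply has_sum_ext. intros k. unfold f. rewrite plus_IZR, mult_IZR, RtoC_plus, RtoC_mult, RtoC_inv by lra.
    field. intro E. rewrite <- !RtoC_mult, <- RtoC_plus in E. apply RtoC_inj in E.
    assert (E2 : IZR (1 + 2 * k) = 0) by (rewrite plus_IZR, mult_IZR; lra). apply eq_IZR in E2. lia. }
  assert (He : has_sum (fun k : Z => f (2 * k)%Z) (/ 4 * c)%C).
  { apply has_sum_ext with (fun k => / 4 * f k)%C; [| apply has_sum_scal; auto]. intros k. unfold f. rewrite mult_IZR, RtoC_mult.
    destruct (Z.eq_dec k 0) as [-> | Hk].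
    - replace (RtoC (IZR 0)) with (RtoC 0) by auto. replace (2 * 0 * (2 * 0))%C with (RtoC 0 * RtoC 0)%C by ring. fold (f 0%Z).
      change (/ (0 * 0))%C with (f 0%Z). rewrite Hf0. ring.
    - field. intro E; apply RtoC_inj in E; apply eq_IZR in E; lia. }
  (* From [c = c / 4 + pi^2 / 4]. *)
  assert (Ec : c = (PI * PI / 3)%C).
  { pose proof (has_sum_unique _ _ _ Hh (has_sum_plus _ _ _ _ He Ho)) as E.
    replace c with (4 / 3 * (c - / 4 * c))%C by field. rewrite E at 1. field. }
  assert (Hsh := has_sum_Z_sym f c Hc). rewrite Hf0 in Hsh. replace (c - 0)%C with c in Hsh by ring.
  apply (has_sum_scal (/ 2)%C) in Hsh. rewrite Ec in Hsh.
  replace (PI * PI / 6)%C with (/ 2 * (PI * PI / 3))%C by field. revert Hsh. apply has_sum_ext. intros n.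
  unfold f. rewrite opp_IZR, RtoC_opp, <- INR_IZR_INZ.
  field. intro E; apply RtoC_inj in E. rewrite S_INR in E. pose proof (pos_INR n). lra.
Qed.

(** * The logarithm of the eta function *)

(** On the segment from 0 to [w] the derivative of [clog (1 - v)] has modulus at most
    [/ (1 - |w|)]. *)
Lemma clog_1m_bound (w : C) : Cmod w < 1 -> Cmod (clog (1 - w)) <= / (1 - Cmod w) * Cmod w.
Proof.
  intros Hw.
  assert (H : Cmod (clog (1 - w) - clog (1 - 0)) <= / (1 - Cmod w) * Cmod (w - 0)).
  { apply (mean_value_ineq (fun v => clog (1 - v)) (fun v => / (1 - v) * (0 - 1))%C).
    intros t Ht. replace (0 + RtoC t * (w - 0))%C with (RtoC t * w)%C by ring.
    assert (M : Cmod (RtoC t * w) <= Cmod w).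
    { rewrite Cmod_mult, Cmod_R, Rabs_right by lra. pose proof (Cmod_ge_0 w). nra. }
    assert (Hre : 0 < Re (1 - RtoC t * w)).
    { rewrite Re_Cminus. pose proof (re_le_Cmod (RtoC t * w)) as Q. apply Rabs_le_between in Q. change (Re 1) with 1. lra. }
    split.
    - apply (Cd_comp (fun v => 1 - v)%C clog); [apply Cd_minus; [apply Cd_const | apply Cd_id] | apply Cd_clog; auto].
    - pose proof (Cmod_pos_Re _ Hre) as Hp. rewrite Cmod_mult, Cmod_inv by (apply Cmod_gt_0; auto).
      replace (0 - 1)%C with (RtoC (-1)) by (rewrite <- RtoC_minus; f_equal; ring). rewrite Cmod_R. replace (Rabs (-1)) with 1 by (rewrite Rabs_left; lra). rewrite Rmult_1_r.
      apply Rinv_le_contravar; [lra |]. pose proof (Cmod_le_sub 1 (1 - RtoC t * w)) as Q. rewrite Cmod_1 in Q.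
      replace (1 - (1 - RtoC t * w))%C with (RtoC t * w)%C in Q by ring. lra. }
  replace (1 - 0)%C with (RtoC 1) in H by ring. rewrite clog_1 in H.
  replace (clog (1 - w) - 0)%C with (clog (1 - w)) in H by ring. replace (w - 0)%C with w in H by ring. auto.
Qed.

Lemma Cmod_ee_S (n : nat) (t : C) : Cmod (ee (RtoC (INR (S n)) * t)) = Cmod (ee t) ^ S n.
Proof. rewrite ee_nat_mult, Cmod_pow. auto. Qed.

Lemma summable_geom (r : R) : 0 <= r < 1 -> summable (fun n => r ^ n).
Proof.
  intros Hr. apply summable_series; [intros; apply pow_le; lra |]. apply ex_series_geom. rewrite Rabs_right; lra.
Qed.

Lemma pow_S_le (r : R) n : 0 <= r <= 1 -> r ^ S n <= r.
Proof.
  intros Hr. simpl. assert (r ^ n <= 1) by (rewrite <- (pow1 n); apply pow_incr; lra).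
  assert (0 <= r ^ n) by (apply pow_le; lra). nra.
Qed.

Definition logterm (n : nat) (t : C) : C := clog (1 - ee (RtoC (INR (S n)) * t)).
Definition logterm' (n : nat) (t : C) : C :=
  (/ (1 - ee (RtoC (INR (S n)) * t)) * (0 - 2 * PI * Ci * ee (RtoC (INR (S n)) * t) * (RtoC (INR (S n)) * 1)))%C.
Definition Lsum (t : C) : C := csum (fun n => logterm n t).
Definition Lsum' (t : C) : C := csum (fun n => logterm' n t).

Lemma logterm_bound (r : R) (n : nat) (t : C) : 0 <= r < 1 -> Cmod (ee t) <= r -> Cmod (logterm n t) <= r / (1 - r) * r ^ n.
Proof.
  intros Hr Ht. pose proof (Cmod_ge_0 (ee t)). unfold logterm.
  assert (M : Cmod (ee (RtoC (INR (S n)) * t)) <= r ^ S n) by (rewrite Cmod_ee_S; apply pow_incr; auto).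
  assert (M2 : r ^ S n <= r) by (apply pow_S_le; lra).
  eapply Rle_trans; [apply clog_1m_bound; lra |].
  replace (r / (1 - r) * r ^ n) with (/ (1 - r) * r ^ S n) by (simpl; field; lra).
  apply Rmult_le_compat; auto; [left; apply Rinv_0_lt_compat; lra | apply Cmod_ge_0 | apply Rinv_le_contravar; lra].
Qed.

Lemma upper_ee_ratio (t : C) : upper t -> 0 <= Cmod (ee t) < 1.
Proof. intros H. split; [apply Cmod_ge_0 | apply Cmod_ee_lt_1; auto]. Qed.

Lemma logterm_hol (n : nat) : hol upper (logterm n) (logterm' n).
Proof.
  intros t Ht. set (w := ee (RtoC (INR (S n)) * t)).
  assert (Hw : Cmod w < 1).
  { unfold w. rewrite Cmod_ee_S. pose proof (upper_ee_ratio t Ht). eapply Rle_lt_trans; [apply pow_S_le; lra | lra]. }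
  assert (Hre : 0 < Re (1 - w)).
  { rewrite Re_Cminus. pose proof (re_le_Cmod w) as Q. apply Rabs_le_between in Q. change (Re 1) with 1. lra. }
  assert (D1 : Cd (fun t => ee (RtoC (INR (S n)) * t)) t (2 * PI * Ci * w * (RtoC (INR (S n)) * 1))%C).
  { apply (Cd_comp (fun t => RtoC (INR (S n)) * t)%C ee); [apply Cd_scal, Cd_id | apply Cd_ee]. }
  split.
  - unfold logterm, logterm'. apply (Cd_comp (fun t => 1 - ee (RtoC (INR (S n)) * t))%C clog); [| apply Cd_clog; auto].
    apply Cd_minus; [apply Cd_const | auto].
  - pose proof (Cd_cts _ _ _ D1) as C1. unfold logterm'. ctac.
    apply tends_inv; [apply nearC_filter | ctac |]. apply Cmod_gt_0, Cmod_pos_Re; auto.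
Qed.

Lemma ee_disc_ratio (t : C) : upper t -> exists d r, 0 < d /\ 0 <= r < 1 /\
  forall w, disc t d w -> upper w /\ Cmod (ee w) <= r.
Proof.
  intros Ht. unfold upper in Ht. pose proof PI_RGT_0.
  exists (Im t / 2), (exp (- (2 * PI * (Im t / 2)))). split; [lra |]. split.
  { split; [left; apply exp_pos |]. rewrite <- exp_0. apply exp_increasing. nra. }
  intros w Hw. unfold disc in Hw. pose proof (Im_le_Cmod (w - t)) as Q. rewrite Im_Cminus in Q. apply Rabs_le_between in Q.
  split; [unfold upper; lra |]. rewrite Cmod_ee. left. apply exp_increasing. nra.
Qed.

Lemma Lsum_spec (t : C) : upper t -> has_sum (fun n => logterm n t) (Lsum t).
Proof.
  intros Ht. pose proof (upper_ee_ratio t Ht) as Hr. set (r := Cmod (ee t)) in *.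
  apply csum_spec with (fun n => r / (1 - r) * r ^ n).
  - apply summable_scal; [| apply summable_geom; auto]. apply Rmult_le_pos; [lra |]. left. apply Rinv_0_lt_compat. lra.
  - intros n. apply logterm_bound; auto. unfold r; lra.
Qed.

Lemma Lsum_hol_has_sum (t : C) : upper t ->
  Cd Lsum t (Lsum' t) /\ cts Lsum' t /\ has_sum (fun n => logterm' n t) (Lsum' t).
Proof.
  intros Ht. destruct (ee_disc_ratio t Ht) as [d [r [Hd [Hr HD]]]].
  apply (weierstrass logterm logterm' (fun n => r / (1 - r) * r ^ n) t d); auto.
  - apply summable_scal; [| apply summable_geom; auto]. apply Rmult_le_pos; [lra |]. left. apply Rinv_0_lt_compat. lra.
  - intros n w Hw. apply logterm_hol, HD; auto.
  - intros n w Hw. apply logterm_bound; auto. apply HD; auto.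
Qed.

Lemma logeta_Lsum (t : C) : upper t -> logeta t = (2 * PI * Ci * t / 24 + Lsum t)%C.
Proof.
  intros Ht. unfold logeta. f_equal. apply has_sum_series. pose proof (Lsum_spec t Ht) as H. revert H. apply has_sum_ext.
  intros n. unfold logterm. rewrite ee_nat_mult. auto.
Qed.

Lemma logeta_hol : hol upper logeta (fun t => 2 * PI * Ci / 24 + Lsum' t)%C.
Proof.
  intros t Ht. destruct (Lsum_hol_has_sum t Ht) as [H1 [H2 _]]. split; [| ctac].
  apply Cd_ext with (fun t => 2 * PI * Ci / 24 * t + Lsum t)%C.
  - generalize (nearC_upper t 0 Ht). apply filter_imp. intros w Hw. rewrite logeta_Lsum by auto. field.
  - apply Cd_plus; auto. replace (2 * PI * Ci / 24)%C with (2 * PI * Ci / 24 * 1)%C at 2 by field. apply Cd_scal, Cd_id.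
Qed.

Lemma logeta_T (t : C) : upper t -> logeta (t + 1) = (logeta t + 2 * PI * Ci / 24)%C.
Proof.
  intros Ht. assert (Ht1 : upper (t + 1)) by (unfold upper; rewrite Im_Cplus; simpl; rewrite Rplus_0_r; auto).
  rewrite !logeta_Lsum by auto.
  assert (E : Lsum (t + 1) = Lsum t).
  { apply csum_ext. intros n. unfold logterm. do 2 f_equal.
    replace (RtoC (INR (S n)) * (t + 1))%C with (RtoC (INR (S n)) * t + RtoC (IZR (Z.of_nat (S n))))%C by (rewrite <- INR_IZR_INZ; ring).
    apply ee_period. }
  rewrite E. field.
Qed.

Lemma Lsum_up : tends upward Lsum 0%C.
Proof.
  pose proof upward_filter as FU.
  assert (E0 : csum (fun _ : nat => RtoC 0) = 0%C).
  { apply csum_has_sum. apply (has_sum_finite (fun _ : nat => RtoC 0) nil); auto. constructor. }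
  destruct (tends_up_ee (/ 2) ltac:(lra)) as [Y HY].
  assert (Half : forall t, Y < Im t -> Cmod (ee t) <= / 2).
  { intros t Ht. specialize (HY t Ht). replace (ee t - 0)%C with (ee t) in HY by ring. lra. }
  rewrite <- E0. apply (tends_csum upward (fun t n => logterm n t) (fun _ => RtoC 0) (fun n => / 2 / (1 - / 2) * (/ 2) ^ n)).
  - apply summable_scal; [lra | apply summable_geom; lra].
  - exists Y. intros t Ht n. apply logterm_bound; [lra | auto].
  - intros n. apply tends_squeeze with (fun t => 2 * ee t)%C; auto.
    + exists Y. intros t Ht. replace (logterm n t - RtoC 0)%C with (logterm n t) by ring.
      specialize (Half t Ht). unfold logterm. assert (M : Cmod (ee (RtoC (INR (S n)) * t)) <= Cmod (ee t)).
      { rewrite Cmod_ee_S. apply pow_S_le. pose proof (Cmod_ge_0 (ee t)). lra. }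
      eapply Rle_trans; [apply clog_1m_bound; lra |]. rewrite Cmod_mult, Cmod_R, Rabs_right by lra.
      apply Rmult_le_compat; auto; [left; apply Rinv_0_lt_compat; lra | apply Cmod_ge_0 |].
      rewrite <- (Rinv_inv 2). apply Rinv_le_contravar; lra.
    + apply tends_eq with (2 * 0)%C; [| ring]. apply tends_mult; auto; [apply tends_const; auto | apply tends_up_ee].
Qed.

(** * Lambert series *)

Lemma tends_pow (w : C) : Cmod w < 1 -> tends eventually (fun N => w ^ N)%C 0%C.
Proof.
  intros Hw e He. destruct (pow_lt_1_zero (Cmod w)) with (y := e) as [N HN]; auto.
  { rewrite Rabs_right; auto. apply Rle_ge, Cmod_ge_0. }
  exists N. intros n Hn. replace (w ^ n - 0)%C with (w ^ n)%C by ring. rewrite Cmod_pow. specialize (HN n Hn).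
  eapply Rle_lt_trans; [apply Rle_abs | auto].
Qed.

Lemma one_minus_neq_0 (w : C) : Cmod w < 1 -> (1 - w)%C <> 0%C.
Proof.
  intros Hw E. assert (w = 1%C) by (replace w with (1 - (1 - w))%C by ring; rewrite E; ring).
  subst. rewrite Cmod_1 in Hw. lra.
Qed.

Lemma has_sum_geom (w : C) : Cmod w < 1 -> has_sum (fun n => w ^ S n)%C (w / (1 - w))%C.
Proof.
  intros Hw. pose proof (Cmod_ge_0 w). pose proof (one_minus_neq_0 w Hw) as Hn.
  assert (Hs : has_sum (fun n => w ^ S n)%C (csum (fun n => w ^ S n)%C)).
  { apply csum_spec with (fun n => Cmod w * Cmod w ^ n); [apply summable_scal; auto; apply summable_geom; lra |].
    intros n. rewrite Cmod_pow. simpl. lra. }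
  replace (w / (1 - w))%C with (csum (fun n => w ^ S n)%C); auto.
  assert (EF : Filter eventually) by apply eventually_filter.
  apply (tends_unique eventually (fun N => fsum (fun n => w ^ S n)%C (seq 0 N))).
  - intros [N HN]. apply (HN N). lia.
  - apply tends_seq; auto.
  - apply tends_ext with (fun N => w * (1 - w ^ N) * / (1 - w))%C; auto.
    + exists 0%nat. intros N _. induction N as [| N IH].
      * unfold fsum; simpl. field; auto.
      * rewrite seq_S, fsum_app, <- IH. unfold fsum; simpl. field; auto.
    + apply tends_eq with (w * (1 - 0) * / (1 - w))%C; [| field; auto].
      apply tends_mult; auto; [| apply tends_const; auto]. apply tends_mult; auto; [apply tends_const; auto |].
      apply tends_minus; auto; [apply tends_const; auto | apply tends_pow; auto].
Qed.

Lemma Cd_pow (n : nat) (z : C) : Cd (fun w => w ^ S n)%C z (INR (S n) * z ^ n)%C.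
Proof.
  induction n as [| n IH].
  - apply Cd_ext with (fun w => w); [exists 1; split; [lra | intros; simpl; ring] |].
    replace (INR 1 * z ^ 0)%C with (RtoC 1) by (simpl; ring). apply Cd_id.
  - replace (INR (S (S n)) * z ^ S n)%C with (1 * z ^ S n + z * (INR (S n) * z ^ n))%C by (rewrite (S_INR (S n)), RtoC_plus; simpl; ring).
    apply (Cd_mult (fun w => w) (fun w => w ^ S n)%C); [apply Cd_id | auto].
Qed.

Lemma cts_pow (n : nat) (z : C) : cts (fun w => w ^ n)%C z.
Proof.
  destruct n as [| n]; [| eapply Cd_cts, Cd_pow]. apply (tends_const (nearC z) (RtoC 1)).
Qed.

Lemma has_sum_geom' (w : C) : Cmod w < 1 -> has_sum (fun n => INR (S n) * w ^ n)%C (/ ((1 - w) * (1 - w)))%C.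
Proof.
  intros Hw. pose proof (Cmod_ge_0 w). pose proof (one_minus_neq_0 w Hw) as Hn.
  set (r := (1 + Cmod w) / 2). set (d := (1 - Cmod w) / 2).
  assert (HD : forall v, disc w d v -> Cmod v <= r).
  { intros v Hv. unfold disc in Hv. pose proof (Cmod_le_sub v w). unfold d, r in *. lra. }
  destruct (weierstrass (fun n v => v ^ S n)%C (fun n v => INR (S n) * v ^ n)%C (fun n => r * r ^ n) w d) as [W1 [_ W3]].
  - unfold d; lra.
  - apply summable_scal; [unfold r; lra | apply summable_geom; unfold r; lra].
  - intros n v Hv. split; [apply Cd_pow |]. pose proof (cts_pow n v). ctac.
  - intros n v Hv. rewrite Cmod_pow. change (r * r ^ n) with (r ^ S n). apply pow_incr. split; [apply Cmod_ge_0 | auto].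
  - replace (/ ((1 - w) * (1 - w)))%C with (csum (fun n => INR (S n) * w ^ n)%C); auto.
    apply Cd_unique with (fun v => csum (fun n => v ^ S n)%C) w; auto.
    apply Cd_ext with (fun v => v * / (1 - v))%C.
    + exists d. split; [unfold d; lra |]. intros v Hv. symmetry. apply csum_has_sum. apply has_sum_geom. specialize (HD v Hv). unfold r in HD. lra.
    + replace (/ ((1 - w) * (1 - w)))%C with (1 * / (1 - w) + w * (- / ((1 - w) * (1 - w)) * (0 - 1)))%C by (field; auto).
      apply (Cd_mult (fun v => v) (fun v => / (1 - v))%C); [apply Cd_id |].
      apply (Cd_comp (fun v => 1 - v)%C (fun v => / v)%C); [apply Cd_minus; [apply Cd_const | apply Cd_id] | apply Cd_inv; auto].
Qed.

(** With [s = sqrt r], the factor [(n + 1) s^n] is bounded by [/ (1 - s)], being at most the partial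
    sum of the geometric series; a factor [s^n] is left for convergence. *)
Lemma summable_geom' (r : R) : 0 <= r < 1 -> summable (fun n => (INR n + 1) * r ^ n).
Proof.
  intros Hr. set (s := sqrt r). assert (Es : s * s = r) by (apply sqrt_sqrt; lra).
  assert (Hs : 0 <= s < 1) by (split; [apply sqrt_pos | rewrite <- sqrt_1; apply sqrt_lt_1; lra]).
  assert (K : forall n, (INR n + 1) * s ^ n * (1 - s) <= 1 - s ^ S n).
  { induction n as [| n IH]; [simpl; lra |]. rewrite S_INR.
    assert (0 <= s ^ S n <= 1) by (split; [apply pow_le; lra | pose proof (pow_S_le s n); lra]).
    change (s ^ S (S n)) with (s * s ^ S n). change (s ^ S n) with (s * s ^ n) in *. nra. }
  apply summable_le with (fun n => / (1 - s) * s ^ n).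
  - intros n. pose proof (pos_INR n). assert (Hp : 0 <= s ^ n) by (apply pow_le; lra). split.
    + apply Rmult_le_pos; [lra | apply pow_le; lra].
    + rewrite <- Es, Rpow_mult_distr, <- Rmult_assoc. apply Rmult_le_compat_r; auto.
      apply Rmult_le_reg_r with (1 - s); [lra |]. rewrite Rinv_l by lra. specialize (K n).
      assert (0 <= s ^ S n) by (apply pow_le; lra). lra.
  - apply summable_scal; [left; apply Rinv_0_lt_compat; lra | apply summable_geom; auto].
Qed.

(** The double series [F] of [-2 pi i n q^(n m)] in two orders: over [m] it is geometric and gives
    the derivatives of the logarithms, over [n] it is the derivative of a geometric series and gives
    [Pc] at [m t]. *)
Lemma lambert (t : C) : upper t -> has_sum (fun m => Ci / (2 * PI) * Pc (RtoC (INR (S m)) * t))%C (Lsum' t).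
Proof.
  intros Ht. pose proof (upper_ee_ratio t Ht) as Hr. pose proof PI_RGT_0 as HPI. set (r := Cmod (ee t)) in *.
  set (F := fun p : nat * nat => (-2 * PI * Ci * (INR (S (fst p)) * ee t ^ (S (fst p) * S (snd p))))%C).
  set (b := fun p : nat * nat => 2 * PI * ((INR (fst p) + 1) * r ^ fst p * r ^ snd p)).
  assert (Sb : summable b).
  { apply summable_scal; [lra |]. apply (summable_prod (fun n => (INR n + 1) * r ^ n) (fun m => r ^ m)); [apply summable_geom'; auto | apply summable_geom; auto]. }
  assert (Fb : forall p, Cmod (F p) <= b p).
  { intros [n m]. unfold F, b. cbn [fst snd]. rewrite !Cmod_mult, Cmod_Ci, !Cmod_R, Cmod_pow, (Rabs_left (-2)), (Rabs_right PI), (Rabs_right (INR (S n))), S_INR by (try lra; apply Rle_ge, pos_INR).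
    fold r. pose proof (pos_INR n).
    assert (E : r ^ (S n * S m) <= r ^ n * r ^ m).
    { rewrite <- pow_add. replace (S n * S m)%nat with ((n + m) + (1 + n * m))%nat by lia. rewrite pow_add.
      assert (0 <= r ^ (n + m)) by (apply pow_le; lra).
      assert (r ^ (1 + n * m) <= 1) by (rewrite <- (pow1 (1 + n * m)); apply pow_incr; lra). nra. }
    replace (- -2 * PI * 1 * ((INR n + 1) * r ^ (S n * S m))) with (2 * PI * ((INR n + 1) * r ^ (S n * S m))) by ring.
    apply Rmult_le_compat_l; [lra |]. rewrite Rmult_assoc. apply Rmult_le_compat_l; lra. }
  assert (H1 : has_sum (fun n => logterm' n t) (csum F)).
  { apply fubini with F; [apply csum_spec with b; auto |]. intros n. set (w := ee (RtoC (INR (S n)) * t)).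
    assert (Hw : Cmod w < 1) by (unfold w; rewrite Cmod_ee_S; eapply Rle_lt_trans; [apply pow_S_le; fold r; lra | fold r; lra]).
    unfold logterm'. fold w. replace (/ (1 - w) * (0 - 2 * PI * Ci * w * (RtoC (INR (S n)) * 1)))%C with (-2 * PI * Ci * INR (S n) * (w / (1 - w)))%C
      by (field; apply one_minus_neq_0; auto).
    apply has_sum_ext with (fun m => -2 * PI * Ci * INR (S n) * w ^ S m)%C; [| apply has_sum_scal, has_sum_geom; auto].
    intros m. unfold F, w. cbn [fst snd]. rewrite ee_nat_mult, <- Cpow_mult_r. ring. }
  destruct (Lsum_hol_has_sum t Ht) as [_ [_ H2]]. rewrite (has_sum_unique _ _ _ H2 H1).
  pose proof (csum_spec F b Sb Fb) as H3.
  apply (has_sum_reindex F _ (fun p : nat * nat => (snd p, fst p)) (fun p => (snd p, fst p))) in H3; [| intros []; auto | intros []; auto].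
  apply fubini with (1 := H3). intros m. set (v := ee (RtoC (INR (S m)) * t)).
  assert (Hv : Cmod v < 1) by (unfold v; rewrite Cmod_ee_S; eapply Rle_lt_trans; [apply pow_S_le; fold r; lra | fold r; lra]).
  unfold Pc. fold v.
  replace (Ci / (2 * PI) * (-4 * PI * PI * v / ((1 - v) * (1 - v))))%C with (-2 * PI * Ci * v * (/ ((1 - v) * (1 - v))))%C
    by (field; split; [apply one_minus_neq_0; auto | intro E; apply RtoC_inj in E; lra]).
  apply has_sum_ext with (fun n => -2 * PI * Ci * v * (INR (S n) * v ^ n))%C; [| apply has_sum_scal, has_sum_geom'; auto].
  intros n. unfold F. cbn [fst snd]. rewrite Nat.mul_comm, Cpow_mult_r. rewrite <- ee_nat_mult. fold v. rewrite (Cpow_S v). ring.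
Qed.

(** * The Eisenstein series of weight two and the inversion of eta *)

(** The product form separates [m] and [n] in dominating series; uniformity in [t] is what Tannery's
    theorem and the Weierstrass theorem need. *)
Lemma lattice_lower (X Y : R) : 0 < Y -> exists d, 0 < d /\
  forall (t : C) (m n : Z), Rabs (Re t) <= X -> Y <= Im t -> (m <> 0 \/ n <> 0)%Z ->
    d * ((1 + Rabs (IZR m)) * (1 + Rabs (IZR n))) <= Cmod (IZR m * t + IZR n) ^ 2 /\
    d * (IZR m ^ 2 + IZR n ^ 2) <= Cmod (IZR m * t + IZR n) ^ 2.
Proof.
  intros HY. set (k := / (2 + (1 + 2 * X ^ 2) / Y ^ 2)).
  assert (HX : 0 <= X ^ 2) by apply pow2_ge_0. assert (HY2 : 0 < Y ^ 2) by (apply pow_lt; auto).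
  assert (Hd : 0 < (1 + 2 * X ^ 2) / Y ^ 2) by (apply Rdiv_lt_0_compat; lra).
  assert (Hk : 0 < k) by (apply Rinv_0_lt_compat; lra).
  (* As [|m| + |n| >= 1], the product [(1 + |m|)(1 + |n|)] is at most [9/2 (m^2 + n^2)]. *)
  exists (k * (2 / 9)). split; [lra |]. intros t m n Hx Hy Hmn.
  assert (E : Cmod (IZR m * t + IZR n) ^ 2 = (IZR m * Re t + IZR n) ^ 2 + (IZR m * Im t) ^ 2) by (rewrite Cmod2_alt, cz_Re, cz_Im; auto).
  set (a := IZR m) in *. set (b := IZR n) in *. set (x := Re t) in *. set (y := Im t) in *.
  assert (Hx2 : x ^ 2 <= X ^ 2).
  { rewrite (Rabs_sq x). replace (X ^ 2) with (X * X) by ring. pose proof (Rabs_pos x). nra. }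
  assert (B : k * (a ^ 2 + b ^ 2) <= Cmod (a * t + b) ^ 2).
  { rewrite E. assert (B1 : b ^ 2 <= 2 * (a * x + b) ^ 2 + 2 * a ^ 2 * X ^ 2).
    { assert (0 <= a ^ 2) by apply pow2_ge_0. assert (a ^ 2 * x ^ 2 <= a ^ 2 * X ^ 2) by (apply Rmult_le_compat_l; auto).
      pose proof (pow2_ge_0 (2 * a * x + b)). nra. }
    assert (B2 : a ^ 2 * Y ^ 2 <= (a * y) ^ 2).
    { rewrite Rpow_mult_distr. apply Rmult_le_compat_l; [apply pow2_ge_0 | apply pow_incr; lra]. }
    apply Rmult_le_reg_l with (/ k); [apply Rinv_0_lt_compat; auto |]. rewrite <- Rmult_assoc, Rinv_l, Rmult_1_l by lra.
    unfold k. rewrite Rinv_inv. pose proof (pow2_ge_0 (a * x + b)). pose proof (pow2_ge_0 (a * y)).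
    assert (B3 : (1 + 2 * X ^ 2) * a ^ 2 <= (1 + 2 * X ^ 2) / Y ^ 2 * (a * y) ^ 2).
    { replace ((1 + 2 * X ^ 2) * a ^ 2) with ((1 + 2 * X ^ 2) / Y ^ 2 * (a ^ 2 * Y ^ 2)) by (field; lra). apply Rmult_le_compat_l; lra. }
    assert (0 <= (1 + 2 * X ^ 2) / Y ^ 2 * (a * x + b) ^ 2) by (apply Rmult_le_pos; lra). nra. }
  split.
  - eapply Rle_trans; [| exact B]. rewrite Rmult_assoc. apply Rmult_le_compat_l; [lra |].
    rewrite (Rabs_sq a), (Rabs_sq b). pose proof (Rabs_pos a). pose proof (Rabs_pos b).
    assert (1 <= Rabs a + Rabs b).
    { unfold a, b. rewrite <- !abs_IZR, <- plus_IZR. apply IZR_le. lia. }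
    set (p := Rabs a) in *. set (q := Rabs b) in *.
    assert ((2 + (p + q)) ^ 2 <= (3 * (p + q)) ^ 2) by (apply pow_incr; lra).
    pose proof (pow2_ge_0 (p - q)). lra.
  - eapply Rle_trans; [| exact B]. assert (0 <= a ^ 2 + b ^ 2) by (pose proof (pow2_ge_0 a); pose proof (pow2_ge_0 b); lra). nra.
Qed.

Lemma fsum_tele (u : Z -> C) N :
  fsum (fun d => u d - u (d + 1)%Z)%C (zrange N) = (u (- Z.of_nat N)%Z - u (Z.of_nat N))%C.
Proof.
  induction N as [| N IH]; [unfold fsum; simpl; ring |].
  rewrite zrange_S, IH. replace (- Z.of_nat (S N) + 1)%Z with (- Z.of_nat N)%Z by lia.
  replace (Z.of_nat N + 1)%Z with (Z.of_nat (S N)) by lia. ring.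
Qed.

Lemma tends_invN (c : R) (u : nat -> C) : (forall N, Cmod (u N) <= c / (INR N + 1)) -> tends eventually u 0%C.
Proof.
  intros H e He. destruct (archimed (Rabs c / e)) as [A _]. exists (Z.to_nat (up (Rabs c / e))). intros n Hn.
  replace (u n - 0)%C with (u n) by ring. eapply Rle_lt_trans; [apply H |]. pose proof (pos_INR n). pose proof (Rle_abs c).
  assert (Rabs c / e < INR n + 1).
  { eapply Rlt_le_trans; [exact A |]. apply Rle_trans with (INR n); [| lra]. rewrite INR_IZR_INZ. apply IZR_le. lia. }
  apply (Rmult_lt_compat_r e) in H2; auto. unfold Rdiv in H2. rewrite Rmult_assoc, Rinv_l in H2 by lra.
  apply Rmult_lt_reg_r with (INR n + 1); [lra |]. unfold Rdiv. rewrite Rmult_assoc, Rinv_l by lra. lra.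
Qed.

Lemma inv_shift_bound (z : C) : upper z -> exists d, 0 < d /\ forall k : Z,
  (z + IZR k)%C <> 0%C /\ Cmod (/ (z + IZR k)) <= / d * / (1 + Rabs (IZR k)) /\
  Cmod (/ (z + IZR k) - / (z + IZR (k + 1))) <= 2 / d ^ 2 * / (1 + Rabs (IZR k)) ^ 2.
Proof.
  intros Hz. pose proof (shift_neq_0 z (ee_upper_neq_1 z Hz)) as Nz. destruct (shift_lower z Nz) as [d [Hd HD]].
  exists d. split; [lra |]. intros k. split; auto. pose proof (Rabs_pos (IZR k)).
  assert (0 < d * (1 + Rabs (IZR k))) by (apply Rmult_lt_0_compat; lra). split.
  - rewrite Cmod_inv by auto. rewrite <- Rinv_mult. apply Rinv_le_contravar; auto.
  - pose proof (Nz k) as N1. pose proof (Nz (k + 1)%Z) as N2. pose proof (HD k) as D1. pose proof (HD (k + 1)%Z) as D2.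
    assert (Hab : Rabs (IZR k) <= Rabs (IZR (k + 1)) + 1).
    { rewrite <- !abs_IZR, <- plus_IZR. apply IZR_le. lia. }
    replace (/ (z + IZR k) - / (z + IZR (k + 1)))%C with (/ ((z + IZR k) * (z + IZR (k + 1))))%C.
    2:{ rewrite plus_IZR, RtoC_plus in *. field. split; auto. }
    rewrite Cmod_inv, Cmod_mult by (apply Cmult_neq_0; auto).
    replace (2 / d ^ 2 * / (1 + Rabs (IZR k)) ^ 2) with (/ ((d * (1 + Rabs (IZR k))) * (d * (1 + Rabs (IZR k)) / 2))) by (field; lra).
    apply Rinv_le_contravar; [apply Rmult_lt_0_compat; lra |]. pose proof (Rabs_pos (IZR (k + 1))).
    assert (d * (1 + Rabs (IZR k)) <= d * (2 * (1 + Rabs (IZR (k + 1))))) by (apply Rmult_le_compat_l; lra).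
    apply Rmult_le_compat; lra.
Qed.

Lemma has_sum_tele_Z (z : C) : upper z -> has_sum (fun d : Z => / (z + IZR d) - / (z + IZR (d + 1)))%C 0%C.
Proof.
  intros Hz. destruct (inv_shift_bound z Hz) as [d [Hd HD]].
  set (f := fun k : Z => (/ (z + IZR k) - / (z + IZR (k + 1)))%C).
  assert (Hs : has_sum f (csum f)).
  { apply csum_spec with (fun k => 2 / d ^ 2 * / (1 + Rabs (IZR k)) ^ 2); [| intros k; apply HD].
    apply summable_scal; [apply Rlt_le, Rdiv_lt_0_compat; [lra | apply pow_lt; auto] | apply summable_inv_sq]. }
  replace (RtoC 0) with (csum f); auto. assert (EF : Filter eventually) by apply eventually_filter.
  apply (tends_unique eventually (fun N => fsum f (zrange N))); [intros [N HN]; apply (HN N); lia | apply tends_zrange; auto |].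
  apply tends_ext with (fun N => / (z + IZR (- Z.of_nat N)) - / (z + IZR (Z.of_nat N)))%C; auto.
  { exists 0%nat. intros N _. symmetry. apply (fsum_tele (fun d => / (z + IZR d))%C). }
  apply tends_eq with (0 - 0)%C; [| ring].
  apply tends_minus; auto; apply tends_invN with (/ d); intros N; (eapply Rle_trans; [apply HD |]); unfold Rdiv;
    rewrite <- abs_IZR, ?Z.abs_opp, Z.abs_eq, <- INR_IZR_INZ by lia; rewrite Rplus_comm; lra.
Qed.

Lemma has_sum_tele_nat (z : C) : upper z -> has_sum (fun n : nat => / (z + INR n) - / (z + INR (S n)))%C (/ z)%C.
Proof.
  intros Hz. destruct (inv_shift_bound z Hz) as [d [Hd HD]].
  set (f := fun n : nat => (/ (z + INR n) - / (z + INR (S n)))%C).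
  assert (Hs : has_sum f (csum f)).
  { apply csum_spec with (fun n : nat => 2 / d ^ 2 * / (INR n + 1) ^ 2).
    - apply summable_scal; [apply Rlt_le, Rdiv_lt_0_compat; [lra | apply pow_lt; auto] | apply summable_inv_sq_nat].
    - intros n. destruct (HD (Z.of_nat n)) as [_ [_ B]]. rewrite Rabs_right in B by (apply Rle_ge, IZR_le; lia).
      replace (Z.of_nat n + 1)%Z with (Z.of_nat (S n)) in B by lia. rewrite <- !INR_IZR_INZ in B. rewrite (Rplus_comm (INR n)). auto. }
  replace (/ z)%C with (csum f); auto. assert (EF : Filter eventually) by apply eventually_filter.
  apply (tends_unique eventually (fun N => fsum f (seq 0 N))); [intros [N HN]; apply (HN N); lia | apply tends_seq; auto |].
  apply tends_ext with (fun N => / z - / (z + IZR (Z.of_nat N)))%C; auto.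
  { exists 0%nat. intros N _. rewrite <- INR_IZR_INZ. induction N as [| N IH].
    - unfold fsum; simpl. replace (z + 0)%C with z by ring. ring.
    - rewrite seq_S, fsum_app, <- IH. unfold fsum, f. cbn [map fold_right]. change (0 + N)%nat with N. ring. }
  apply tends_eq with (/ z - 0)%C; [| ring].
  apply tends_minus; auto; [apply tends_const; auto |]. apply tends_invN with (/ d). intros N. eapply Rle_trans; [apply HD |].
  unfold Rdiv. rewrite <- abs_IZR, Z.abs_eq, <- INR_IZR_INZ by lia. rewrite Rplus_comm. lra.
Qed.

Lemma has_sum_fsum {A B} (v : A -> B -> C) (V : A -> C) (L : list A) :
  (forall d, has_sum (v d) (V d)) -> has_sum (fun m => fsum (fun d => v d m) L) (fsum V L).
Proof.
  intros H. induction L as [| d L IH].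
  - apply (has_sum_finite (fun _ : B => RtoC 0) nil); auto. constructor.
  - apply has_sum_ext with (fun m => v d m + fsum (fun d => v d m) L)%C; [reflexivity |].
    change (fsum V (d :: L)) with (V d + fsum V L)%C. apply has_sum_plus; auto.
Qed.

Section E2.
Variable t : C.
Hypothesis Ht : upper t.

Let x (m : nat) (d : Z) : C := (INR (S m) * t + IZR d)%C.
(** The lattice sum of [/ x^2] is only conditionally convergent. Subtracting a term that telescopes
    in [d] leaves [/ (x^2 (x + 1))], which is absolutely summable. [Q] and [V] are the column sums
    of the two parts. *)
Let av (p : nat * Z) : C := (/ (x (fst p) (snd p) * x (fst p) (snd p)) - (/ x (fst p) (snd p) - / x (fst p) (snd p + 1)))%C.
Let S2 (s : C) : C := csum (fun m => Pc (RtoC (INR (S m)) * s)).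
Let Q (d : Z) : C := csum (fun m => / (x m d * x m d))%C.
Let V (d : Z) : C := csum (fun m => / x m d - / x m (d + 1))%C.

Lemma x_bound : exists d, 0 < d /\ forall m n, x m n <> 0%C /\
  d * ((1 + INR m) * (1 + Rabs (IZR n))) <= Cmod (x m n) ^ 2 /\
  d * (INR m + 1) ^ 2 <= Cmod (x m n) ^ 2 /\ d * IZR n ^ 2 <= Cmod (x m n) ^ 2.
Proof.
  destruct (lattice_lower (Rabs (Re t)) (Im t) Ht) as [d [Hd HD]]. exists d. split; auto. intros m n.
  specialize (HD t (Z.of_nat (S m)) n (Rle_refl _) (Rle_refl _) ltac:(lia)).
  pose proof (cz_neq_0 (Z.of_nat (S m)) n t Ht ltac:(lia)) as Hn.
  rewrite <- INR_IZR_INZ in HD, Hn. unfold x. split; auto. destruct HD as [H1 H2]. pose proof (pos_INR m).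
  rewrite S_INR in *. rewrite Rabs_right in H1 by lra. pose proof (Rabs_pos (IZR n)).
  pose proof (pow2_ge_0 (IZR n)). pose proof (pow2_ge_0 (INR m + 1)). repeat split.
  - eapply Rle_trans; [| exact H1]. apply Rmult_le_compat_l; [lra |]. nra.
  - eapply Rle_trans; [| exact H2]. apply Rmult_le_compat_l; lra.
  - eapply Rle_trans; [| exact H2]. apply Rmult_le_compat_l; lra.
Qed.

Lemma x_succ m n : x m (n + 1) = (x m n + 1)%C.
Proof. unfold x. rewrite plus_IZR, RtoC_plus. ring. Qed.

(** Three factors [x], each of modulus at least a constant times [sqrt((1 + m)(1 + |n|))], give the
    exponent [3/2 > 1] in both variables. *)
Lemma av_summable : exists b, summable b /\ forall p, Cmod (av p) <= b p.
Proof.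
  destruct x_bound as [d [Hd HD]].
  set (B := / (d * sqrt (d / 2))). assert (Hsq : 0 < sqrt (d / 2)) by (apply sqrt_lt_R0; lra).
  assert (HB : 0 < B) by (apply Rinv_0_lt_compat, Rmult_lt_0_compat; auto).
  exists (fun p => B * (Rpower (INR (fst p) + 1) (- (3 / 2)) * Rpower (INR (Z.abs_nat (snd p)) + 1) (- (3 / 2)))). split.
  - apply summable_scal; [lra |].
    apply (summable_prod (fun m => Rpower (INR m + 1) (- (3 / 2))) (fun n : Z => Rpower (INR (Z.abs_nat n) + 1) (- (3 / 2)))).
    + apply summable_pseries; lra.
    + apply (summable_Z (fun n => Rpower (INR n + 1) (- (3 / 2)))), summable_pseries; lra.
  - intros [m n]. cbn [fst snd]. destruct (HD m n) as [N1 [L1 _]]. destruct (HD m (n + 1)%Z) as [N2 [L2 _]].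
    assert (E : av (m, n) = (/ (x m n * x m n * x m (n + 1)))%C).
    { unfold av. cbn [fst snd]. rewrite x_succ in *. field. auto. }
    rewrite E, Cmod_inv, !Cmod_mult by (repeat apply Cmult_neq_0; auto).
    pose proof (pos_INR m). pose proof (pos_INR (Z.abs_nat n)).
    rewrite Rpower_mult_distr, Rpower_Ropp by lra.
    assert (EN : INR (Z.abs_nat n) = Rabs (IZR n)) by (rewrite INR_IZR_INZ, Zabs2Nat.id_abs, abs_IZR; auto).
    rewrite EN. set (y := (INR m + 1) * (Rabs (IZR n) + 1)). assert (Hy : 0 < y) by (apply Rmult_lt_0_compat; rewrite <- ?EN; lra).
    assert (Ey : Rpower y (3 / 2) = y * sqrt y).
    { replace (3 / 2) with (1 + / 2) by field. rewrite Rpower_plus, Rpower_1, Rpower_sqrt; auto. }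
    rewrite Ey. unfold B. rewrite <- Rinv_mult.
    assert (Hab : Rabs (IZR n) <= Rabs (IZR (n + 1)) + 1) by (rewrite <- !abs_IZR, <- plus_IZR; apply IZR_le; lia).
    apply Rinv_le_contravar.
    + apply Rmult_lt_0_compat; apply Rmult_lt_0_compat; auto. apply sqrt_lt_R0; auto.
    + replace (d * sqrt (d / 2) * (y * sqrt y)) with ((d * y) * (sqrt (d / 2) * sqrt y)) by ring.
      rewrite <- sqrt_mult by lra. apply Rmult_le_compat; [apply Rmult_le_pos; lra | apply sqrt_pos | |].
      * replace (Cmod (x m n) * Cmod (x m n)) with (Cmod (x m n) ^ 2) by ring. unfold y. lra.
      * apply Rsqr_incr_0; [| apply sqrt_pos | apply Cmod_ge_0]. rewrite Rsqr_sqrt by nra.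
        unfold Rsqr. replace (Cmod (x m (n + 1)) * Cmod (x m (n + 1))) with (Cmod (x m (n + 1)) ^ 2) by ring.
        eapply Rle_trans; [| exact L2]. unfold y. rewrite EN in H0.
        pose proof (Rabs_pos (IZR (n + 1))).
        assert ((INR m + 1) * (Rabs (IZR n) + 1) <= (1 + INR m) * (2 * (1 + Rabs (IZR (n + 1))))) by (rewrite (Rplus_comm (INR m)); apply Rmult_le_compat_l; lra).
        nra.
Qed.

Lemma upper_scale (m : nat) : upper (RtoC (INR (S m)) * t).
Proof. unfold upper in *. rewrite Im_real_mult, S_INR. pose proof (pos_INR m). nra. Qed.

(** Summed over [d] first, the correction telescopes to 0 in every row, so [av] still gives [S2]. *)
Lemma S2_spec : has_sum (fun m => Pc (RtoC (INR (S m)) * t)) (S2 t) /\ S2 t = csum av.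
Proof.
  destruct av_summable as [b [Hb HB]].
  assert (H : has_sum (fun m => Pc (RtoC (INR (S m)) * t)) (csum av)).
  { apply fubini with av; [apply csum_spec with b; auto |]. intros m. pose proof (upper_scale m) as Hu.
    replace (Pc (RtoC (INR (S m)) * t)) with (Pc (RtoC (INR (S m)) * t) - 0)%C by ring.
    apply (has_sum_minus (fun d : Z => / (x m d * x m d))%C (fun d => / x m d - / x m (d + 1))%C).
    - apply Pc_series; [unfold upper in Hu; lra | apply ee_upper_neq_1; auto].
    - apply has_sum_tele_Z; auto. }
  unfold S2. rewrite (csum_has_sum _ _ H). auto.
Qed.

Lemma QV_bounds : exists B, 0 <= B /\ (forall m d, Cmod (/ (x m d * x m d)) <= B * / (INR m + 1) ^ 2)
  /\ (forall m d, Cmod (/ x m d - / x m (d + 1)) <= B * / (INR m + 1) ^ 2)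
  /\ (forall m d, (d <> 0)%Z -> Cmod (/ (x m d * x m d)) <= B * / IZR d ^ 2).
Proof.
  destruct x_bound as [d [Hd HD]]. exists (/ d). split; [left; apply Rinv_0_lt_compat; auto |].
  assert (P : forall m, 0 < INR m + 1) by (intros m; pose proof (pos_INR m); lra).
  split; [| split].
  - intros m n. destruct (HD m n) as [N1 [_ [L _]]]. rewrite Cmod_inv, Cmod_mult by (apply Cmult_neq_0; auto).
    rewrite <- Rinv_mult. apply Rinv_le_contravar; [apply Rmult_lt_0_compat; auto; apply pow_lt; auto |]. lra.
  - intros m n. destruct (HD m n) as [N1 [_ [L _]]]. destruct (HD m (n + 1)%Z) as [N2 [_ [L2 _]]].
    replace (/ x m n - / x m (n + 1))%C with (/ (x m n * x m (n + 1)))%C by (rewrite x_succ in *; field; auto).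
    rewrite Cmod_inv, Cmod_mult by (apply Cmult_neq_0; auto). rewrite <- Rinv_mult.
    apply Rinv_le_contravar; [apply Rmult_lt_0_compat; auto; apply pow_lt; auto |].
    pose proof (Cmod_ge_0 (x m n)). pose proof (Cmod_ge_0 (x m (n + 1))).
    assert (Hpos : 0 <= d * (INR m + 1) ^ 2) by (apply Rmult_le_pos; [lra | apply pow2_ge_0]).
    set (c := d * (INR m + 1) ^ 2) in *. assert (sqrt c <= Cmod (x m n)) by (rewrite <- (sqrt_pow2 (Cmod (x m n))) by auto; apply sqrt_le_1_alt; auto).
    assert (sqrt c <= Cmod (x m (n + 1))) by (rewrite <- (sqrt_pow2 (Cmod (x m (n + 1)))) by auto; apply sqrt_le_1_alt; auto).
    rewrite <- (sqrt_sqrt c) by auto. apply Rmult_le_compat; auto; apply sqrt_pos.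
  - intros m n Hn. destruct (HD m n) as [N1 [_ [_ L]]]. rewrite Cmod_inv, Cmod_mult by (apply Cmult_neq_0; auto).
    assert (0 < IZR n ^ 2) by (assert (IZR n <> 0) by (apply IZR_neq; auto); nra).
    rewrite <- Rinv_mult. apply Rinv_le_contravar; [apply Rmult_lt_0_compat; auto |]. lra.
Qed.

Lemma Q_spec d : has_sum (fun m => / (x m d * x m d))%C (Q d).
Proof.
  destruct QV_bounds as [B [HB [B1 _]]]. apply csum_spec with (fun m => B * / (INR m + 1) ^ 2); auto.
  apply summable_scal; auto. apply summable_inv_sq_nat.
Qed.

Lemma V_spec d : has_sum (fun m => / x m d - / x m (d + 1))%C (V d).
Proof.
  destruct QV_bounds as [B [HB [_ [B2 _]]]]. apply csum_spec with (fun m => B * / (INR m + 1) ^ 2); auto.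
  apply summable_scal; auto. apply summable_inv_sq_nat.
Qed.

(** The same double sum in the other order, [m] first. The limit is taken along finite ranges of
    [d], so that [Q] and [V] can be followed separately. *)
Lemma QV_limit : tends eventually (fun N => fsum (fun d => Q d - V d)%C (zrange N)) (S2 t).
Proof.
  apply tends_zrange. rewrite (proj2 S2_spec). destruct av_summable as [b [Hb HB]].
  pose proof (csum_spec av b Hb HB) as H.
  apply (has_sum_reindex av _ (fun p : Z * nat => (snd p, fst p)) (fun p => (snd p, fst p))) in H; [| intros []; auto | intros []; auto].
  apply fubini with (1 := H). intros d. unfold av. cbn [fst snd]. apply has_sum_minus; [apply Q_spec | apply V_spec].
Qed.

Lemma upper_inv (s : C) : upper s -> upper (- / s).
Proof.
  intros Hs. pose proof (upper_neq_0 s Hs).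
  replace (- / s)%C with (mobius 0 (-1) 1 0 s) by (unfold mobius; field; auto). apply upper_mobius; auto.
Qed.

(** Over a finite range of [d] the sum telescopes; what remains is a cotangent series at
    [- (N + 1) / t], and [cotpi] tends to [- PI * Ci] as its argument moves up. This term is what
    prevents E_2 from being modular and becomes the logarithm in [logeta_S]. *)
Lemma V_limit : tends eventually (fun N => fsum V (zrange (S N))) (- (PI * Ci) / t)%C.
Proof.
  pose proof (upper_neq_0 t Ht) as Hz. assert (EF : Filter eventually) by apply eventually_filter.
  set (z := fun N : nat => (RtoC (INR (S N)) * - / t)%C).
  assert (Uz : forall N, upper (z N)).
  { intros N. unfold z. pose proof (upper_inv t Ht) as Hu. unfold upper in *. rewrite Im_real_mult, S_INR. pose proof (pos_INR N). nra. }
  apply tends_ext with (fun N => / t * (cotpi (z N) - / z N))%C; auto.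
  - exists 0%nat. intros N _.
    apply (has_sum_unique (fun m => fsum (fun d => / x m d - / x m (d + 1))%C (zrange (S N)))); [| apply has_sum_fsum; apply V_spec].
    (* [kt] pairs [m] with [- (m + 1)]; subtracting [/ z] in the form of a telescoping series leaves
       the symmetric pairs of [m + 1] and [- (m + 1)]. *)
    pose proof (has_sum_scal (/ t)%C _ _ (has_sum_minus _ _ _ _ (cot_partial_fractions (z N) (Uz N)) (has_sum_tele_nat (z N) (Uz N)))) as H.
    revert H. apply has_sum_ext. intros m. rewrite (fsum_tele (fun d => / x m d)%C). unfold kt.
    pose proof (cz_neq_0 (Z.of_nat (S m)) (Z.of_nat (S N)) t Ht ltac:(lia)) as N1.
    pose proof (cz_neq_0 (Z.of_nat (S m)) (- Z.of_nat (S N)) t Ht ltac:(lia)) as N2.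
    unfold x. rewrite opp_IZR, RtoC_opp, <- !INR_IZR_INZ in *. unfold z.
    replace (RtoC (INR (S N)) * - / t - INR (S m))%C with (- (INR (S m) * t + INR (S N)) / t)%C by (field; auto).
    replace (RtoC (INR (S N)) * - / t + INR (S m))%C with ((INR (S m) * t + - INR (S N)) / t)%C by (field; auto).
    field. repeat split; auto.
    intro E. pose proof (cz_neq_0 (Z.of_nat m) (- Z.of_nat (S N)) t Ht ltac:(lia)) as N3. apply N3.
    rewrite opp_IZR, RtoC_opp, <- !INR_IZR_INZ. rewrite <- E. ring.
  - apply tends_eq with (/ t * (PI * Ci * ((0 + 1) * / (0 - 1)) - 0))%C; [| field; auto].
    assert (LE : tends eventually (fun N => ee (z N)) 0%C).
    { apply tends_ext with (fun N => ee (- / t) * ee (- / t) ^ N)%C; auto.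
      - exists 0%nat. intros N _. unfold z. rewrite ee_nat_mult, Cpow_S. auto.
      - apply tends_eq with (ee (- / t) * 0)%C; [| ring]. apply tends_mult; auto; [apply tends_const; auto |].
        apply tends_pow, Cmod_ee_lt_1, (upper_inv t Ht). }
    apply tends_mult; auto; [apply tends_const; auto |]. apply tends_minus; auto.
    + unfold cotpi. apply tends_mult; auto; [apply tends_const; auto |]. apply tends_mult; auto.
      * apply tends_plus; auto. apply tends_const; auto.
      * apply tends_inv; auto; [apply tends_minus; auto; apply tends_const; auto |].
        intro E. rewrite <- RtoC_minus in E. apply RtoC_inj in E. lra.
    + apply tends_invN with (Cmod t). intros N. unfold z. pose proof (pos_INR N).
      assert (HN : RtoC (INR (S N)) <> 0%C) by (intro E; apply RtoC_inj in E; rewrite S_INR in E; lra).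
      replace (/ (RtoC (INR (S N)) * - / t))%C with (- t / INR (S N))%C by (field; auto).
      rewrite Cmod_div, Cmod_opp, Cmod_R, Rabs_right, S_INR; auto; [lra | apply Rle_ge, pos_INR].
Qed.

(** Factoring out [t^2], the two columns together run over all nonzero integer translates of
    [- n / t], so they give [Pc] there without its term at 0. *)
Lemma Q_pair (n : nat) : (Q (Z.of_nat (S n)) + Q (- Z.of_nat (S n))%Z)%C =
  (/ (t * t) * Pc (RtoC (INR (S n)) * - / t) - / (INR (S n) * INR (S n)))%C.
Proof.
  pose proof (upper_neq_0 t Ht) as Hz. pose proof (upper_inv t Ht) as Hu. pose proof (pos_INR n).
  assert (HN : RtoC (INR (S n)) <> 0%C) by (intro E; apply RtoC_inj in E; rewrite S_INR in E; lra).
  set (z := (RtoC (INR (S n)) * - / t)%C).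
  assert (Uz : upper z) by (unfold z, upper in *; rewrite Im_real_mult, S_INR; nra).
  pose proof (Pc_series z ltac:(unfold upper in Uz; lra) (ee_upper_neq_1 z Uz)) as PS.
  apply has_sum_Z_sym in PS. apply (has_sum_scal (/ (t * t))%C) in PS.
  replace (/ (t * t) * (Pc z - / ((z + IZR 0) * (z + IZR 0))))%C with (/ (t * t) * Pc z - / (INR (S n) * INR (S n)))%C in PS.
  2:{ replace (z + IZR 0)%C with z by ring. assert (Ez : (z * z = INR (S n) * INR (S n) / (t * t))%C) by (unfold z; field; auto). rewrite Ez. field. auto. }
  apply (has_sum_unique (fun m => / (x m (Z.of_nat (S n)) * x m (Z.of_nat (S n))) + / (x m (- Z.of_nat (S n)) * x m (- Z.of_nat (S n))))%C).
  - apply has_sum_plus; apply Q_spec.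
  - revert PS. apply has_sum_ext. intros m.
    pose proof (cz_neq_0 (Z.of_nat (S m)) (Z.of_nat (S n)) t Ht ltac:(lia)) as N1.
    pose proof (cz_neq_0 (Z.of_nat (S m)) (- Z.of_nat (S n)) t Ht ltac:(lia)) as N2.
    unfold x. rewrite !opp_IZR, !RtoC_opp, <- !INR_IZR_INZ in *. unfold z.
    replace (RtoC (INR (S n)) * - / t + - INR (S m))%C with (- (INR (S m) * t + INR (S n)) / t)%C by (field; auto).
    replace (RtoC (INR (S n)) * - / t + INR (S m))%C with ((INR (S m) * t + - INR (S n)) / t)%C by (field; auto).
    field. auto.
Qed.

Lemma Q_zrange N : fsum Q (zrange (S N)) =
  (Q (- Z.of_nat (S N))%Z + (Q 0%Z + fsum (fun n => Q (Z.of_nat (S n)) + Q (- Z.of_nat (S n))%Z)%C (seq 0 N)))%C.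
Proof.
  induction N as [| N IH]; [unfold fsum; simpl; ring |].
  rewrite zrange_S, IH, seq_S, fsum_app. unfold fsum at 3. cbn [map fold_right]. change (0 + N)%nat with N. ring.
Qed.

(** The range from [- (N + 1)] to [N] consists of the column [- (N + 1)], which tends to 0, the
    column 0, which is [zeta(2) / t^2], and symmetric pairs. The hypothesis is [S2_spec] at [- / t],
    while [t] is fixed in this section. *)
Lemma Q_limit : has_sum (fun m => Pc (RtoC (INR (S m)) * - / t)) (S2 (- / t)%C) ->
  tends eventually (fun N => fsum Q (zrange (S N)))
    (0 + (/ (t * t) * (PI * PI / 6) + (/ (t * t) * S2 (- / t) - PI * PI / 6)))%C.
Proof.
  intros HS. assert (EF : Filter eventually) by apply eventually_filter. pose proof (upper_neq_0 t Ht) as Hz.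
  apply tends_ext with (fun N => Q (- Z.of_nat (S N))%Z + (Q 0%Z + fsum (fun n => Q (Z.of_nat (S n)) + Q (- Z.of_nat (S n))%Z)%C (seq 0 N)))%C; auto.
  { exists 0%nat. intros N _. symmetry. apply Q_zrange. }
  destruct QV_bounds as [B [HB [B1 [_ B3]]]].
  apply tends_plus; auto; [| apply tends_plus; auto].
  - assert (E0 : csum (fun _ : nat => RtoC 0) = 0%C).
    { apply csum_has_sum. apply (has_sum_finite (fun _ : nat => RtoC 0) nil); auto. constructor. }
    rewrite <- E0. apply (tends_csum eventually (fun N m => / (x m (- Z.of_nat (S N)) * x m (- Z.of_nat (S N))))%C (fun _ => RtoC 0) (fun m => B * / (INR m + 1) ^ 2)).
    + apply summable_scal; auto. apply summable_inv_sq_nat.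
    + exists 0%nat. intros N _ m. apply B1.
    + intros m. apply tends_invN with B. intros N. eapply Rle_trans; [apply B3; lia |].
      rewrite opp_IZR, <- INR_IZR_INZ, S_INR. pose proof (pos_INR N). unfold Rdiv. apply Rmult_le_compat_l; auto.
      apply Rinv_le_contravar; [lra |]. nra.
  - apply tends_eq with (Q 0%Z); [apply tends_const; auto |].
    apply (has_sum_unique (fun m => / (x m 0 * x m 0))%C); [apply Q_spec |].
    pose proof (has_sum_scal (/ (t * t))%C _ _ zeta2) as H. revert H. apply has_sum_ext. intros m. unfold x.
    pose proof (pos_INR m). assert (HN : RtoC (INR (S m)) <> 0%C) by (intro E; apply RtoC_inj in E; rewrite S_INR in E; lra).
    replace (INR (S m) * t + IZR 0)%C with (INR (S m) * t)%C by ring. field. auto.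
  - apply tends_seq. apply has_sum_ext with (fun n => / (t * t) * Pc (RtoC (INR (S n)) * - / t) - / (INR (S n) * INR (S n)))%C.
    + intros n. symmetry. apply Q_pair.
    + apply has_sum_minus; [apply has_sum_scal; auto | apply zeta2].
Qed.

Lemma S2_inversion : has_sum (fun m => Pc (RtoC (INR (S m)) * - / t)) (S2 (- / t)%C) ->
  S2 t = (/ (t * t) * (PI * PI / 6) + / (t * t) * S2 (- / t) - PI * PI / 6 + PI * Ci / t)%C.
Proof.
  intros HS. assert (EF : Filter eventually) by apply eventually_filter. pose proof (upper_neq_0 t Ht) as Hz.
  apply (tends_unique eventually (fun N => fsum (fun d => Q d - V d)%C (zrange (S N)))).
  - intros [N HN]. apply (HN N). lia.
  - intros e He. destruct (QV_limit e He) as [N HN]. exists N. intros n Hn. apply HN. lia.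
  - apply tends_ext with (fun N => fsum Q (zrange (S N)) - fsum V (zrange (S N)))%C; auto.
    + exists 0%nat. intros N _. generalize (zrange (S N)). intros L. induction L as [| d L IH]; [unfold fsum; simpl; ring |].
      change (fsum Q (d :: L)) with (Q d + fsum Q L)%C. change (fsum V (d :: L)) with (V d + fsum V L)%C.
      change (fsum (fun d => Q d - V d)%C (d :: L)) with (Q d - V d + fsum (fun d => Q d - V d)%C L)%C. rewrite <- IH. ring.
    + eapply tends_eq; [apply tends_minus; [auto | apply Q_limit; auto | apply V_limit] |]. field. auto.
Qed.
End E2.

(** The derivative of the law wanted for [logeta]; equivalently, the quasi-modularity of E_2. *)
Lemma Lsum'_inversion (t : C) : upper t ->
  (/ (t * t) * (2 * PI * Ci / 24 + Lsum' (- / t)) = 2 * PI * Ci / 24 + Lsum' t + / 2 * / t)%C.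
Proof.
  intros Ht. pose proof (upper_neq_0 t Ht) as Hz. pose proof (upper_inv t Ht) as Hu. pose proof PI_RGT_0 as HP.
  assert (HPC : RtoC PI <> 0%C) by (intro E; apply RtoC_inj in E; lra).
  destruct (S2_spec t Ht) as [H1 _]. destruct (S2_spec (- / t)%C Hu) as [H2 _].
  pose proof (S2_inversion t Ht H2) as E.
  assert (L : forall s, upper s -> Lsum' s = (Ci / (2 * PI) * csum (fun m => Pc (RtoC (INR (S m)) * s)))%C).
  { intros s Hs. apply (has_sum_unique _ _ _ (lambert s Hs)). apply has_sum_scal. apply (S2_spec s Hs). }
  rewrite (L t Ht), (L _ Hu), E.
  transitivity (/ (t * t) * (2 * PI * Ci / 24 + Ci / (2 * PI) * csum (fun m => Pc (RtoC (INR (S m)) * - / t))) + (/ 2 * / t + / 2 * / t * (Ci * Ci)))%C.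
  - rewrite Ci_sq. field. auto.
  - field. auto.
Qed.

(** The difference [u] of the two sides has derivative 0 along the segment from [Ci], and it
    vanishes at [Ci], the fixed point of the inversion. *)
Lemma logeta_S (t : C) : upper t -> logeta (- / t) = (logeta t + / 2 * clog (- Ci * t))%C.
Proof.
  intros Ht.
  assert (Re_mI : forall s, Re (- Ci * s) = Im s) by (intros s; unfold Re, Im; simpl; ring).
  set (u := fun s => (logeta (- / s) - logeta s - / 2 * clog (- Ci * s))%C).
  assert (HI : upper Ci) by (unfold upper; simpl; lra).
  assert (E : u t = u Ci).
  { apply Cmod_sub_0. apply Rle_antisym; [| apply Cmod_ge_0]. rewrite <- (Rmult_0_l (Cmod (t - Ci))).
    apply (mean_value_ineq u (fun _ => RtoC 0)). intros r Hr. split; [| rewrite Cmod_0; lra].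
    set (s := (Ci + RtoC r * (t - Ci))%C).
    assert (Hs : upper s).
    { unfold upper in *. unfold s. rewrite Im_Cplus, Im_real_mult, Im_Cminus. change (Im Ci) with 1. nra. }
    pose proof (upper_neq_0 s Hs) as Hz. pose proof (upper_inv s Hs) as Hu.
    assert (HCi : Ci <> 0%C) by (apply upper_neq_0; auto).
    assert (Hm : (- Ci * s)%C <> 0%C).
    { apply Cmod_gt_0, Cmod_pos_Re. rewrite Re_mI. auto. }
    replace (RtoC 0) with ((2 * PI * Ci / 24 + Lsum' (- / s)) * (- - / (s * s)) - (2 * PI * Ci / 24 + Lsum' s) - / 2 * (/ (- Ci * s) * (- Ci * 1)))%C.
    - unfold u. apply Cd_minus; [apply Cd_minus |].
      + apply (Cd_comp (fun s => - / s)%C logeta); [apply Cd_opp, Cd_inv; auto | apply logeta_hol; auto].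
      + apply logeta_hol; auto.
      + apply Cd_scal. apply (Cd_comp (fun s => - Ci * s)%C clog); [apply Cd_scal, Cd_id | apply Cd_clog; rewrite Re_mI; auto].
    - replace ((2 * PI * Ci / 24 + Lsum' (- / s)) * - - / (s * s))%C with (/ (s * s) * (2 * PI * Ci / 24 + Lsum' (- / s)))%C by ring.
      rewrite (Lsum'_inversion s Hs). field. auto. }
  assert (E0 : u Ci = 0%C).
  { unfold u. assert (HCi : Ci <> 0%C) by (apply upper_neq_0; auto).
    replace (- / Ci)%C with Ci.
    2:{ transitivity (Ci * Ci / Ci)%C; [field; auto | rewrite Ci_sq; field; auto]. }
    replace (- Ci * Ci)%C with (RtoC 1) by (transitivity (- (Ci * Ci))%C; [rewrite Ci_sq |]; ring).
    rewrite clog_1. ring. }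
  rewrite E0 in E. unfold u in E.
  transitivity (logeta (- / t) - logeta t - / 2 * clog (- Ci * t) + (logeta t + / 2 * clog (- Ci * t)))%C; [ring |].
  rewrite E. ring.
Qed.

Lemma eta_law_SL2 (a b c d : Z) : (a * d - b * c = 1)%Z -> eta_law a b c d.
Proof. apply eta_transformation; [apply logeta_T | apply logeta_S]. Qed.

(** * Integral powers and roots of unity *)

Lemma cexp_2pi_Z (n : Z) : cexp (2 * PI * Ci * IZR n) = 1%C.
Proof. apply ee_IZR. Qed.

(** For an integral exponent the choice of logarithm is immaterial; this is the use made of [D k]
    being an integer. *)
Lemma cpowr_int_cexp (u : C) (n : Z) : cpowr (cexp u) (RtoC (IZR n)) = cexp (IZR n * u).
Proof.
  unfold cpowr. destruct (cexp_eq_1 (clog (cexp u) - u)) as [j Hj].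
  { rewrite cexp_minus, cexp_clog by apply cexp_neq_0. field. apply cexp_neq_0. }
  replace (IZR n * clog (cexp u))%C with (IZR n * u + 2 * PI * Ci * IZR (n * j))%C.
  - rewrite cexp_add, cexp_2pi_Z. ring.
  - replace (clog (cexp u)) with ((clog (cexp u) - u) + u)%C by ring. rewrite Hj, mult_IZR, RtoC_mult. ring.
Qed.

Lemma cpowr_int_mult (z w : C) (n : Z) : z <> 0%C -> w <> 0%C ->
  cpowr (z * w) (RtoC (IZR n)) = (cpowr z (RtoC (IZR n)) * cpowr w (RtoC (IZR n)))%C.
Proof.
  intros Hz Hw. rewrite <- (cexp_clog z Hz), <- (cexp_clog w Hw), <- cexp_add, !cpowr_int_cexp, <- cexp_add. f_equal. ring.
Qed.

Lemma cpowr_1 (r : C) : cpowr 1 r = 1%C.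
Proof. unfold cpowr. rewrite clog_1. replace (r * 0)%C with (RtoC 0) by ring. apply cexp_0. Qed.

Lemma Cpow_cexp (u : C) (n : nat) : (cexp u ^ n)%C = cexp (INR n * u).
Proof.
  induction n as [| n IH]; [simpl; replace (0 * u)%C with (RtoC 0) by ring; rewrite cexp_0; auto |].
  rewrite Cpow_S, IH, <- cexp_add, S_INR, RtoC_plus. f_equal. ring.
Qed.

Lemma root_of_unity (D : nat) (eps : C) : (1 <= D)%nat -> (eps ^ D)%C = 1%C ->
  exists j, (j < D)%nat /\ eps = ee (RtoC (INR j / INR D)).
Proof.
  intros HD H. assert (HDR : INR D <> 0) by (apply not_0_INR; lia).
  assert (HDC : RtoC (INR D) <> 0%C) by (intro E; apply RtoC_inj in E; auto).
  assert (Hn : eps <> 0%C).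
  { intros ->. destruct D as [| D]; [lia |]. rewrite Cpow_S, Cmult_0_l in H. apply RtoC_inj in H. lra. }
  rewrite <- (cexp_clog eps Hn), Cpow_cexp in H. apply cexp_eq_1 in H. destruct H as [n Hn2].
  assert (E : eps = ee (RtoC (IZR n / INR D))).
  { rewrite <- (cexp_clog eps Hn). unfold ee. f_equal. rewrite RtoC_div by auto.
    transitivity (INR D * clog eps / INR D)%C; [field; auto |]. rewrite Hn2. field. auto. }
  pose proof (Z.div_mod n (Z.of_nat D) ltac:(lia)) as Hd. pose proof (Z.mod_pos_bound n (Z.of_nat D) ltac:(lia)) as Hm.
  exists (Z.to_nat (n mod Z.of_nat D)). split; [lia |]. rewrite E. rewrite <- (ee_period (RtoC (INR _ / INR D)) (n / Z.of_nat D)).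
  f_equal. rewrite <- RtoC_plus. f_equal. rewrite (INR_IZR_INZ (Z.to_nat _)), Z2Nat.id by lia.
  rewrite Hd at 1. rewrite plus_IZR, mult_IZR, <- INR_IZR_INZ. field. auto.
Qed.

Lemma root_of_unity_inj (D i j : nat) : (i < D)%nat -> (j < D)%nat ->
  ee (RtoC (INR i / INR D)) = ee (RtoC (INR j / INR D)) -> i = j.
Proof.
  intros Hi Hj E. assert (HDR : 0 < INR D) by (apply lt_0_INR; lia).
  assert (E1 : cexp (2 * PI * Ci * RtoC ((INR i - INR j) / INR D)) = 1%C).
  { change (ee (RtoC ((INR i - INR j) / INR D)) = 1%C).
    replace (RtoC ((INR i - INR j) / INR D)) with (RtoC (INR i / INR D) - RtoC (INR j / INR D))%C by (rewrite <- RtoC_minus; f_equal; field; lra).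
    rewrite ee_minus, E. field. apply ee_neq_0. }
  apply cexp_eq_1 in E1. destruct E1 as [n Hn]. pose proof twoPiI_neq_0 as TP.
  assert (E2 : RtoC ((INR i - INR j) / INR D) = RtoC (IZR n)).
  { transitivity (2 * PI * Ci * RtoC ((INR i - INR j) / INR D) / (2 * PI * Ci))%C; [field; split; intro HH; apply TP; rewrite HH; ring |].
    rewrite Hn. field. split; intro HH; apply TP; rewrite HH; ring. }
  apply RtoC_inj in E2. assert (E3 : INR i - INR j = IZR n * INR D) by (rewrite <- E2; field; lra).
  rewrite !INR_IZR_INZ, <- minus_IZR, <- mult_IZR in E3. apply eq_IZR in E3.
  assert (n = 0)%Z by nia. subst n. lia.
Qed.

(** * The eta quotient *)

Definition LL (r2 r4 : Q) (t : C) : C :=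
  (r1R r2 r4 * logeta (RtoC 1 * t) + Q2R r2 * logeta (RtoC 2 * t) + Q2R r4 * logeta (RtoC 4 * t))%C.

Definition invf (r2 r4 : Q) (t : C) : C := cexp (- LL r2 r4 t).

Definition Psum (r2 r4 : Q) (a b c d : Z) : R :=
  / 24 * (r1R r2 r4 * Psi a b c d + Q2R r2 * Psi a (b * 2) (c / 2) d + Q2R r4 * Psi a (b * 4) (c / 4) d).

Lemma eta_quot_LL r2 r4 t : eta_quot r2 r4 t = cexp (LL r2 r4 t).
Proof. unfold eta_quot, etapow, LL. rewrite !cexp_add. auto. Qed.

Lemma invf_inv r2 r4 t : invf r2 r4 t = (/ eta_quot r2 r4 t)%C.
Proof. unfold invf. rewrite eta_quot_LL, cexp_opp. auto. Qed.

(** Scaling by [n] carries the matrix to [(a, b n; c / n, d)] acting on [n t], with the same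
    automorphy factor. *)
Lemma logeta_level (n c' a b c d : Z) (t : C) : (0 < n)%Z -> (c = n * c')%Z -> (a * d - b * c = 1)%Z -> upper t ->
  logeta (RtoC (IZR n) * mobius a b c d t) =
  (logeta (RtoC (IZR n) * t) + / 2 * clog (IZR c * t + IZR d) + 2 * PI * Ci / 24 * RtoC (Psi a (b * n) c' d))%C.
Proof.
  intros Hn Hc Hdet Ht.
  assert (Hu : upper (RtoC (IZR n) * t)).
  { unfold upper in *. rewrite Im_real_mult. apply Rmult_lt_0_compat; auto. apply IZR_lt; auto. }
  assert (E0 : (IZR c' * (RtoC (IZR n) * t) + IZR d)%C = (IZR c * t + IZR d)%C) by (rewrite Hc, mult_IZR, RtoC_mult; ring).
  replace (RtoC (IZR n) * mobius a b c d t)%C with (mobius a (b * n) c' d (RtoC (IZR n) * t)).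
  - rewrite (eta_law_SL2 a (b * n) c' d) by (auto; subst c; lia). rewrite E0. auto.
  - unfold mobius. rewrite E0, mult_IZR, RtoC_mult. pose proof (cz_neq_0 c d t Ht (det_row a b c d Hdet)). field. auto.
Qed.

Lemma LL_transform r2 r4 (a b c d : Z) (t : C) : (a * d - b * c = 1)%Z -> Z.divide 4 c -> upper t ->
  LL r2 r4 (mobius a b c d t) =
  (LL r2 r4 t + RtoC (k0R r2 r4) * clog (IZR c * t + IZR d) + 2 * PI * Ci * RtoC (Psum r2 r4 a b c d))%C.
Proof.
  intros Hdet [q Hq] Ht. unfold LL.
  rewrite (logeta_level 1 c a b c d), (logeta_level 2 (c / 2) a b c d), (logeta_level 4 (c / 4) a b c d); auto; try lia.
  - unfold Psum, k0R. rewrite Z.mul_1_r. rewrite !RtoC_mult, !RtoC_plus, !RtoC_mult, !RtoC_inv by lra. field.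
  - rewrite Hq. rewrite Z.div_mul by lia. ring.
  - rewrite Hq. replace (q * 4)%Z with (q * 2 * 2)%Z by ring. rewrite Z.div_mul by lia. ring.
Qed.

Lemma invf_hol r2 r4 : exists F', hol upper (invf r2 r4) F'.
Proof.
  assert (HL : forall n, 0 < n -> hol upper (fun t => logeta (RtoC n * t)) (fun t => (2 * PI * Ci / 24 + Lsum' (RtoC n * t)) * (RtoC n * 1))%C).
  { intros n Hn. apply (hol_comp upper upper logeta (fun t => 2 * PI * Ci / 24 + Lsum' t)%C (fun t => RtoC n * t)%C (fun _ => RtoC n * 1)%C).
    - intros z Hz. unfold upper in *. rewrite Im_real_mult. nra.
    - apply logeta_hol.
    - intros z Hz. split; [apply Cd_scal, Cd_id | ctac]. }
  eexists (fun t => (cexp (- LL r2 r4 t) * - (r1R r2 r4 * ((2 * PI * Ci / 24 + Lsum' (RtoC 1 * t)) * (RtoC 1 * 1))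
     + Q2R r2 * ((2 * PI * Ci / 24 + Lsum' (RtoC 2 * t)) * (RtoC 2 * 1)) + Q2R r4 * ((2 * PI * Ci / 24 + Lsum' (RtoC 4 * t)) * (RtoC 4 * 1))))%C).
  intros t Ht. destruct (HL 1 ltac:(lra) t Ht) as [A1 B1]. destruct (HL 2 ltac:(lra) t Ht) as [A2 B2]. destruct (HL 4 ltac:(lra) t Ht) as [A4 B4].
  assert (D : Cd (invf r2 r4) t (cexp (- LL r2 r4 t) * - (r1R r2 r4 * ((2 * PI * Ci / 24 + Lsum' (RtoC 1 * t)) * (RtoC 1 * 1))
     + Q2R r2 * ((2 * PI * Ci / 24 + Lsum' (RtoC 2 * t)) * (RtoC 2 * 1)) + Q2R r4 * ((2 * PI * Ci / 24 + Lsum' (RtoC 4 * t)) * (RtoC 4 * 1))))%C).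
  { unfold invf. apply (Cd_comp (fun t => - LL r2 r4 t)%C cexp); [| apply Cd_cexp]. apply Cd_opp. unfold LL.
    apply Cd_plus; [apply Cd_plus |]; apply Cd_scal; auto. }
  split; auto. apply tends_mult; [apply nearC_filter | exact (Cd_cts _ _ _ D) |].
  apply tends_opp; [apply nearC_filter |].
  apply tends_plus; [apply nearC_filter | apply tends_plus; [apply nearC_filter | |] |]; (apply tends_mult; [apply nearC_filter | apply tends_const, nearC_filter | auto]).
Qed.

Lemma Cmod_invf r2 r4 t : Cmod (invf r2 r4 t) = exp (- Re (LL r2 r4 t)).
Proof. unfold invf. rewrite Cmod_cexp. reflexivity. Qed.

Lemma Re_real_mult (r : R) (z : C) : Re (RtoC r * z) = r * Re z.
Proof. unfold Re; simpl. ring. Qed.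

Lemma Cmod_invf_mobius r2 r4 (a b c d : Z) (t : C) : (a * d - b * c = 1)%Z -> Z.divide 4 c -> upper t ->
  Cmod (invf r2 r4 (mobius a b c d t)) = Cmod (invf r2 r4 t) * Rpower (Cmod (IZR c * t + IZR d)) (- k0R r2 r4).
Proof.
  intros Hdet Hc Ht. rewrite !Cmod_invf, LL_transform by auto. unfold Rpower. rewrite <- exp_plus. f_equal.
  rewrite !Re_Cplus, Re_real_mult. change (Re (clog (IZR c * t + IZR d))) with (ln (Cmod (IZR c * t + IZR d))).
  replace (Re (2 * PI * Ci * RtoC (Psum r2 r4 a b c d))) with 0 by (unfold Re; simpl; ring). ring.
Qed.

(** The linear terms of the logarithms cancel, since the exponents satisfy [r1 + 2 r2 + 4 r4 = 0].
    Hence the eta quotient tends to 1 at infinity and has period 1. *)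
Lemma LL_expand r2 r4 t : upper t ->
  LL r2 r4 t = (r1R r2 r4 * Lsum (RtoC 1 * t) + Q2R r2 * Lsum (RtoC 2 * t) + Q2R r4 * Lsum (RtoC 4 * t))%C.
Proof.
  intros Ht. assert (Hu : forall n, 0 < n -> upper (RtoC n * t)) by (intros n Hn; unfold upper in *; rewrite Im_real_mult; nra).
  unfold LL. rewrite !logeta_Lsum by (apply Hu; lra). unfold r1R. rewrite RtoC_minus, !RtoC_mult. field.
Qed.

Lemma scale_up (F : C -> C) (r : R) (u : C) l : 0 < r -> tends upward F l -> tends upward (fun t => F (RtoC r * t + u)%C) l.
Proof.
  intros Hr H e He. destruct (H e He) as [Y HY]. exists ((Y - Im u) / r). intros w Hw. apply HY.
  rewrite Im_Cplus, Im_real_mult. apply (Rmult_lt_compat_l r) in Hw; auto.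
  replace (r * ((Y - Im u) / r)) with (Y - Im u) in Hw by (field; lra). lra.
Qed.

Lemma scale_up0 (F : C -> C) (r : R) l : 0 < r -> tends upward F l -> tends upward (fun t => F (RtoC r * t)%C) l.
Proof.
  intros Hr H. pose proof upward_filter as FU. apply tends_ext with (fun t => F (RtoC r * t + 0)%C); [auto | | apply scale_up; auto].
  exists 0. intros w _. f_equal. ring.
Qed.

Lemma invf_up r2 r4 : tends upward (invf r2 r4) 1%C.
Proof.
  pose proof upward_filter as FU. rewrite <- cexp_0. apply (tends_comp upward (fun t => - LL r2 r4 t)%C cexp 0%C); [| eapply Cd_cts, Cd_cexp].
  apply tends_ext with (fun t => - (r1R r2 r4 * Lsum (RtoC 1 * t) + Q2R r2 * Lsum (RtoC 2 * t) + Q2R r4 * Lsum (RtoC 4 * t)))%C; auto.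
  - exists 0. intros t Ht. rewrite LL_expand by auto. auto.
  - apply tends_eq with (- (r1R r2 r4 * 0 + Q2R r2 * 0 + Q2R r4 * 0))%C; [| ring]. apply tends_opp; auto.
    apply tends_plus; auto; [apply tends_plus; auto |]; (apply tends_mult; auto; [apply tends_const; auto | apply scale_up0; [lra | apply Lsum_up]]).
Qed.

Lemma invf_T r2 r4 (n : Z) t : upper t -> invf r2 r4 (t + IZR n) = invf r2 r4 t.
Proof.
  intros Ht. assert (Ht2 : upper (t + IZR n)) by (unfold upper; rewrite Im_Cplus; simpl; rewrite Rplus_0_r; auto).
  assert (P : forall (m : Z) s, upper s -> Lsum (s + IZR m) = Lsum s).
  { intros m s Hs. assert (Hs2 : upper (s + IZR m)) by (unfold upper; rewrite Im_Cplus; simpl; rewrite Rplus_0_r; auto).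
    pose proof (logeta_Tn logeta_T m s Hs) as E. rewrite !logeta_Lsum in E by auto.
    transitivity ((2 * PI * Ci * (s + IZR m) / 24 + Lsum (s + IZR m)) - 2 * PI * Ci * (s + IZR m) / 24)%C; [ring |]. rewrite E. field. }
  assert (Hu : forall m, 0 < m -> upper (RtoC m * t)) by (intros m Hm; unfold upper in *; rewrite Im_real_mult; nra).
  unfold invf. do 2 f_equal. rewrite !LL_expand by auto.
  replace (RtoC 1 * (t + IZR n))%C with (RtoC 1 * t + IZR (1 * n))%C by (rewrite mult_IZR, RtoC_mult; ring).
  replace (RtoC 2 * (t + IZR n))%C with (RtoC 2 * t + IZR (2 * n))%C by (rewrite mult_IZR, RtoC_mult; ring).
  replace (RtoC 4 * (t + IZR n))%C with (RtoC 4 * t + IZR (4 * n))%C by (rewrite mult_IZR, RtoC_mult; ring).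
  rewrite !P by (apply Hu; lra). auto.
Qed.

(** * The Eisenstein series divided by the eta quotient *)

Definition good (p : Z * Z) : Prop := Z.gcd (fst p) (snd p) = 1%Z /\ Z.divide 4 (fst p).

(** Some completion of a coprime row to a matrix of determinant 1; by [eterm_row] the terms do not
    depend on the choice. *)
Definition toprow (p : Z * Z) : Z * Z :=
  epsilon (inhabits (0, 0)%Z) (fun q => fst q * snd p - snd q * fst p = 1)%Z.

Lemma toprow_spec p : Z.gcd (fst p) (snd p) = 1%Z -> (fst (toprow p) * snd p - snd (toprow p) * fst p = 1)%Z.
Proof.
  intros H. unfold toprow. apply (epsilon_spec (inhabits (0, 0)%Z) (fun q => fst q * snd p - snd q * fst p = 1)%Z).
  destruct (Z.gcd_bezout _ _ _ H) as [u [v Huv]]. exists (v, (- u)%Z). simpl. lia.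
Qed.

(** Extended by 0 to all pairs of integers, on which a matrix acts by a bijection and the dominating
    series is a product. *)
Definition eterm (r2 r4 : Q) (p : Z * Z) (t : C) : C :=
  if excluded_middle_informative (good p)
  then invf r2 r4 (mobius (fst (toprow p)) (snd (toprow p)) (fst p) (snd p) t) else RtoC 0.

(** Two completions of a row differ by a power of [T] on the left, under which [invf] is
    invariant. *)
Lemma eterm_row r2 r4 (a b c d : Z) t : (a * d - b * c = 1)%Z -> Z.divide 4 c -> upper t ->
  eterm r2 r4 (c, d) t = invf r2 r4 (mobius a b c d t).
Proof.
  intros Hdet Hc Ht. assert (Hg : Z.gcd c d = 1%Z) by (apply Z.bezout_1_gcd; exists (- b)%Z, a; lia).
  unfold eterm. destruct (excluded_middle_informative (good (c, d))) as [_ | Hn]; [| exfalso; apply Hn; split; auto].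
  pose proof (toprow_spec (c, d) Hg) as Ht0. cbn [fst snd] in *. set (a0 := fst (toprow (c, d))) in *. set (b0 := snd (toprow (c, d))) in *.
  set (n := (a0 * (b - b0) - b0 * (a - a0))%Z).
  assert (Hx : ((a - a0) * d = (b - b0) * c)%Z) by lia.
  assert (Ea : a = (a0 + n * c)%Z).
  { assert ((n * c = (a - a0) * (a0 * d - b0 * c))%Z); [| rewrite Ht0 in H; lia].
    unfold n. transitivity (a0 * ((b - b0) * c) - b0 * (a - a0) * c)%Z; [ring | rewrite <- Hx; ring]. }
  assert (Eb : b = (b0 + n * d)%Z).
  { assert ((n * d = (b - b0) * (a0 * d - b0 * c))%Z); [| rewrite Ht0 in H; lia].
    unfold n. transitivity (a0 * (b - b0) * d - b0 * ((a - a0) * d))%Z; [ring | rewrite Hx; ring]. }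
  rewrite <- (invf_T r2 r4 n) by (apply upper_mobius; auto). f_equal. rewrite Ea, Eb.
  unfold mobius. pose proof (cz_neq_0 c d t Ht (det_row a b c d Hdet)). rewrite !plus_IZR, !mult_IZR, !RtoC_plus, !RtoC_mult. field. auto.
Qed.

Lemma eterm_bad r2 r4 p t : ~ good p -> eterm r2 r4 p t = 0%C.
Proof. intros H. unfold eterm. destruct (excluded_middle_informative (good p)); tauto. Qed.

Definition rmul (a b c d : Z) (p : Z * Z) : Z * Z := (fst p * a + snd p * c, fst p * b + snd p * d)%Z.

Lemma rmul_inv a b c d p : (a * d - b * c = 1)%Z -> rmul d (- b) (- c) a (rmul a b c d p) = p.
Proof. intros H. destruct p as [x y]. unfold rmul; cbn [fst snd].
  f_equal; [transitivity (x * (a * d - b * c))%Z | transitivity (y * (a * d - b * c))%Z]; solve [ring | rewrite H; ring].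
Qed.

Lemma good_rmul a b c d p : (a * d - b * c = 1)%Z -> Z.divide 4 c -> good p -> good (rmul a b c d p).
Proof.
  intros Hdet [q Hq] [Hg [r Hr]]. pose proof (toprow_spec p Hg) as Ht. destruct p as [x y]. cbn [fst snd] in *.
  set (a0 := fst (toprow (x, y))) in *. set (b0 := snd (toprow (x, y))) in *. split.
  - unfold rmul; cbn [fst snd]. apply Z.bezout_1_gcd. exists (- (a0 * b + b0 * d))%Z, (a0 * a + b0 * c)%Z.
    transitivity ((a0 * y - b0 * x) * (a * d - b * c))%Z; [ring | rewrite Ht, Hdet; auto].
  - unfold rmul; cbn [fst snd]. exists (r * a + y * q)%Z. subst. ring.
Qed.

Lemma eterm_mobius r2 r4 a b c d p t : (a * d - b * c = 1)%Z -> Z.divide 4 c -> upper t ->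
  eterm r2 r4 p (mobius a b c d t) = eterm r2 r4 (rmul a b c d p) t.
Proof.
  intros Hdet Hc Ht. destruct (classic (good p)) as [Hg | Hn].
  - pose proof (toprow_spec p (proj1 Hg)) as Hp. destruct p as [x y]. cbn [fst snd] in *.
    rewrite (eterm_row r2 r4 (fst (toprow (x, y))) (snd (toprow (x, y)))) by (auto; first [apply Hg | apply upper_mobius; auto]).
    rewrite mobius_comp by auto. symmetry. apply eterm_row; auto.
    + transitivity ((fst (toprow (x, y)) * y - snd (toprow (x, y)) * x) * (a * d - b * c))%Z; [ring | rewrite Hp, Hdet; auto].
    + apply (good_rmul a b c d (x, y) Hdet Hc Hg).
  (* If the moved row were good, the inverse matrix would carry it back to a good [p]. *)
  - rewrite !eterm_bad; auto. intros Hg. apply Hn. rewrite <- (rmul_inv a b c d p Hdet). apply good_rmul; auto; [lia |].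
    destruct Hc as [q Hq]. exists (- q)%Z. lia.
Qed.

Section Eisenstein.
Variables r2 r4 : Q.
Hypothesis Hx0 : 0 <= -2 * Q2R r2 - 5 * Q2R r4.
Hypothesis Hx8 : -2 * Q2R r2 - 5 * Q2R r4 < 8.
Hypothesis Hy0 : 0 <= - Q2R r4.
Hypothesis Hy8 : - Q2R r4 < 8.
Hypothesis Hxy : 8 < (-2 * Q2R r2 - 5 * Q2R r4) + (- Q2R r4).

Let k := k0R r2 r4.

Lemma k_gt_2 : 2 < k.
Proof. unfold k, k0R, r1R. lra. Qed.

(** [|m t + n|^2] dominates [(1 + |m|)(1 + |n|)], so [|m t + n|^(-k)] is bounded by a product of two
    series of exponent [k / 2 > 1]. *)
Definition pairbound (p : Z * Z) : R :=
  Rpower (INR (Z.abs_nat (fst p)) + 1) (- (k / 2)) * Rpower (INR (Z.abs_nat (snd p)) + 1) (- (k / 2)).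

Lemma pairbound_summable : summable pairbound.
Proof.
  pose proof k_gt_2. assert (S1 : summable (fun z : Z => Rpower (INR (Z.abs_nat z) + 1) (- (k / 2)))).
  { apply (summable_Z (fun n => Rpower (INR n + 1) (- (k / 2)))), summable_pseries. lra. }
  apply (summable_prod _ _ S1 S1).
Qed.

Lemma cz_power_bound (X Y : R) : 0 < Y -> exists B, 0 <= B /\ forall (t : C) (m n : Z),
  Rabs (Re t) <= X -> Y <= Im t -> (m <> 0 \/ n <> 0)%Z -> Rpower (Cmod (IZR m * t + IZR n)) (- k) <= B * pairbound (m, n).
Proof.
  intros HY. pose proof k_gt_2 as Hk. destruct (lattice_lower X Y HY) as [d [Hd HD]].
  exists (Rpower d (- (k / 2))). split; [left; apply exp_pos |]. intros t m n Hx Hy Hmn.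
  destruct (HD t m n Hx Hy Hmn) as [L _]. assert (Ht : upper t) by (unfold upper; lra).
  pose proof (cz_neq_0 m n t Ht Hmn) as Hn. apply Cmod_gt_0 in Hn.
  pose proof (Rabs_pos (IZR m)). pose proof (Rabs_pos (IZR n)).
  assert (E : forall z, INR (Z.abs_nat z) = Rabs (IZR z)) by (intros; rewrite INR_IZR_INZ, Zabs2Nat.id_abs, abs_IZR; auto).
  unfold pairbound. cbn [fst snd]. rewrite !E, !Rpower_mult_distr by nra.
  set (y := d * ((Rabs (IZR m) + 1) * (Rabs (IZR n) + 1))).
  assert (Hy2 : 0 < y) by (unfold y; apply Rmult_lt_0_compat; auto; nra).
  assert (E2 : Rpower (Cmod (IZR m * t + IZR n)) (- k) = Rpower (Cmod (IZR m * t + IZR n) ^ 2) (- (k / 2))).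
  { rewrite <- Rpower_pow, Rpower_mult by auto. f_equal. simpl. field. }
  rewrite E2, !Rpower_Ropp. apply Rinv_le_contravar; [apply exp_pos |]. apply Rle_Rpower_l; [lra |].
  split; auto. unfold y. rewrite (Rplus_comm (Rabs (IZR m))), (Rplus_comm (Rabs (IZR n))). auto.
Qed.

Lemma good_neq_0 p : good p -> (fst p <> 0 \/ snd p <> 0)%Z.
Proof. intros [Hg _]. destruct (Z.eq_dec (fst p) 0) as [E | E]; auto. right. intros E2. rewrite E, E2 in Hg. discriminate. Qed.

Lemma Cmod_eterm p t : good p -> upper t ->
  Cmod (eterm r2 r4 p t) = Cmod (invf r2 r4 t) * Rpower (Cmod (IZR (fst p) * t + IZR (snd p))) (- k).
Proof.
  intros Hg Ht. unfold eterm. destruct (excluded_middle_informative (good p)); [| tauto].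
  apply Cmod_invf_mobius; auto; [apply toprow_spec, Hg | apply Hg].
Qed.

Lemma eterm_bound (X Y : R) : 0 < Y -> exists B, 0 <= B /\ forall t p,
  Rabs (Re t) <= X -> Y <= Im t -> Cmod (eterm r2 r4 p t) <= Cmod (invf r2 r4 t) * B * pairbound p.
Proof.
  intros HY. destruct (cz_power_bound X Y HY) as [B [HB H]]. exists B. split; auto. intros t p Hx Hy.
  pose proof (Cmod_ge_0 (invf r2 r4 t)). assert (Hbb : 0 <= pairbound p) by apply pairbound_summable.
  destruct (classic (good p)) as [Hg | Hn].
  - rewrite Cmod_eterm by (auto; unfold upper; lra). rewrite Rmult_assoc. apply Rmult_le_compat_l; auto.
    destruct p as [m n]. apply H; auto. apply (good_neq_0 (m, n) Hg).
  - rewrite eterm_bad, Cmod_0 by auto. apply Rmult_le_pos; auto. apply Rmult_le_pos; auto.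
Qed.

(** The function [g] of the overview. *)
Definition eis_ratio (t : C) : C := csum (fun p => eterm r2 r4 p t).

Lemma eterm_dominated t : upper t -> exists b, summable b /\ forall p, Cmod (eterm r2 r4 p t) <= b p.
Proof.
  intros Ht. destruct (eterm_bound (Rabs (Re t)) (Im t) Ht) as [B [HB H]].
  exists (fun p => Cmod (invf r2 r4 t) * B * pairbound p). split.
  - apply summable_scal; [apply Rmult_le_pos; auto; apply Cmod_ge_0 | apply pairbound_summable].
  - intros p. apply H; lra.
Qed.

Lemma eis_ratio_spec t : upper t -> has_sum (fun p => eterm r2 r4 p t) (eis_ratio t).
Proof. intros Ht. destruct (eterm_dominated t Ht) as [b [Hb H]]. apply csum_spec with b; auto. Qed.

(** Right multiplication by the matrix permutes the rows, and the terms follow by [eterm_mobius]. *)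
Lemma eis_ratio_invariant a b c d t : (a * d - b * c = 1)%Z -> Z.divide 4 c -> upper t -> eis_ratio (mobius a b c d t) = eis_ratio t.
Proof.
  intros Hdet Hc Ht. unfold eis_ratio. rewrite (csum_ext _ (fun p => eterm r2 r4 (rmul a b c d p) t)) by (intros p; apply eterm_mobius; auto).
  destruct (eterm_dominated t Ht) as [bd [Hb H]].
  apply (csum_reindex (fun p => eterm r2 r4 p t) bd (rmul a b c d) (rmul d (- b) (- c) a)); auto.
  - intros p. apply rmul_inv; auto.
  - intros p. pose proof (rmul_inv d (- b) (- c) a p ltac:(lia)) as E. rewrite !Z.opp_involutive in E. auto.
Qed.

Lemma eis_ratio_hol : exists g', hol upper eis_ratio g'.
Proof.
  destruct (invf_hol r2 r4) as [F' HF].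
  set (T' := fun p t => if excluded_middle_informative (good p)
     then (F' (mobius (fst (toprow p)) (snd (toprow p)) (fst p) (snd p) t) * / ((IZR (fst p) * t + IZR (snd p)) * (IZR (fst p) * t + IZR (snd p))))%C else RtoC 0).
  assert (HT : forall p, hol upper (eterm r2 r4 p) (T' p)).
  { intros p. unfold eterm, T'. destruct (excluded_middle_informative (good p)) as [Hg | Hn].
    - pose proof (toprow_spec p (proj1 Hg)) as Hp.
      apply (hol_comp upper upper (invf r2 r4) F'); auto; [intros; apply upper_mobius; auto | apply hol_mobius; auto].
    - intros t _. split; [apply Cd_const | apply tends_const, nearC_filter]. }
  exists (fun t => csum (fun p => T' p t)). intros z0 Hz0. unfold upper in Hz0.
  destruct (eterm_bound (Rabs (Re z0) + Im z0) (Im z0 / 2) ltac:(lra)) as [B [HB H]].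
  destruct (tends_bounded (nearC z0) (invf r2 r4) _ (Cd_cts _ _ _ (proj1 (HF z0 Hz0)))) as [d1 [Hd1 HD1]].
  set (M := Cmod (invf r2 r4 z0) + 1) in *. assert (HM : 0 <= M) by (pose proof (Cmod_ge_0 (invf r2 r4 z0)); unfold M; lra).
  set (d := Rmin d1 (Im z0 / 2)). assert (Hd : 0 < d) by (apply Rmin_pos; lra).
  assert (HD : forall w, disc z0 d w -> Cmod (w - z0) < d1 /\ Rabs (Re w) <= Rabs (Re z0) + Im z0 /\ Im z0 / 2 <= Im w).
  { intros w Hw. unfold disc in Hw. pose proof (Rmin_l d1 (Im z0 / 2)). pose proof (Rmin_r d1 (Im z0 / 2)). fold d in H0, H1.
    pose proof (re_le_Cmod (w - z0)) as Q1. pose proof (Im_le_Cmod (w - z0)) as Q2. rewrite Re_Cminus in Q1. rewrite Im_Cminus in Q2.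
    apply Rabs_le_between in Q2. split; [lra | split; [| lra]].
    replace (Re w) with (Re z0 + (Re w - Re z0)) by ring. eapply Rle_trans; [apply Rabs_triang | lra]. }
  destruct (weierstrass (eterm r2 r4) T' (fun p => M * B * pairbound p) z0 d) as [W1 [W2 _]]; auto.
  - apply summable_scal; [apply Rmult_le_pos; auto | apply pairbound_summable].
  - intros p w Hw. apply HT. destruct (HD w Hw) as [_ [_ Q]]. unfold upper. lra.
  - intros p w Hw. destruct (HD w Hw) as [Q1 [Q2 Q3]]. eapply Rle_trans; [apply H; auto |].
    apply Rmult_le_compat_r; [apply pairbound_summable |]. apply Rmult_le_compat_r; auto.
Qed.

Lemma upward_strip (F : C -> C) l : tends upward F l -> tends strip F l.
Proof. intros H e He. destruct (H e He) as [Y HY]. exists Y. auto. Qed.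

Lemma eis_ratio_cusp_oo : tends strip eis_ratio 2%C.
Proof.
  pose proof k_gt_2 as Hk. pose proof strip_filter as FS. pose proof upward_filter as FU.
  set (g0 := fun p : Z * Z => if excluded_middle_informative (p = (0, 1)%Z \/ p = (0, -1)%Z) then RtoC 1 else RtoC 0).
  assert (E : csum g0 = 2%C).
  { apply csum_has_sum. replace (RtoC 2) with (fsum g0 ((0, 1)%Z :: (0, -1)%Z :: nil)).
    - apply has_sum_finite.
      + repeat constructor; simpl; intuition discriminate.
      + intros p Hp. unfold g0. destruct (excluded_middle_informative (p = (0, 1)%Z \/ p = (0, -1)%Z)) as [Ho | Ho]; auto.
        exfalso. apply Hp. simpl. destruct Ho; auto.
    - unfold fsum, g0; simpl. destruct (excluded_middle_informative _); [| tauto]. destruct (excluded_middle_informative _); [| tauto].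
      rewrite Cplus_0_r, <- RtoC_plus. f_equal; ring. }
  rewrite <- E. destruct (eterm_bound 1 1 ltac:(lra)) as [B [HB H]].
  destruct (tends_bounded upward (invf r2 r4) _ (invf_up r2 r4)) as [Y HY]. rewrite Cmod_1 in HY.
  apply (tends_csum strip (fun t p => eterm r2 r4 p t) g0 (fun p => 2 * B * pairbound p)).
  - apply summable_scal; [lra | apply pairbound_summable].
  - exists (Rmax Y 1). intros t Hr Hi p. pose proof (Rmax_l Y 1); pose proof (Rmax_r Y 1).
    eapply Rle_trans; [apply H; [rewrite Rabs_right; lra | lra] |]. apply Rmult_le_compat_r; [apply pairbound_summable |].
    apply Rmult_le_compat_r; auto. specialize (HY t ltac:(lra)). lra.
  - intros p. apply upward_strip. unfold g0. destruct (excluded_middle_informative (p = (0, 1)%Z \/ p = (0, -1)%Z)) as [Ho | Ho].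
    + apply tends_ext with (invf r2 r4); auto; [| apply invf_up]. exists 0. intros t Ht.
      destruct Ho as [-> | ->].
      * rewrite (eterm_row r2 r4 1 0 0 1) by (auto; exists 0%Z; auto). f_equal. unfold mobius. field.
      * rewrite (eterm_row r2 r4 (-1) 0 0 (-1)) by (auto; exists 0%Z; auto). f_equal. unfold mobius. field.
    + destruct (classic (good p)) as [Hg | Hn].
      * assert (Hc : fst p <> 0%Z).
        { intros E0. apply Ho. destruct p as [c d]. cbn [fst] in E0. subst c. destruct Hg as [Hg _]. cbn [fst snd] in Hg. rewrite Z.gcd_0_l in Hg.
          assert (d = 1 \/ d = -1)%Z as [-> | ->] by lia; auto. }
        intros e He. exists (Rmax (Rmax Y 1) (2 / e)). intros t Hi.
        pose proof (Rmax_l (Rmax Y 1) (2 / e)); pose proof (Rmax_r (Rmax Y 1) (2 / e)); pose proof (Rmax_l Y 1); pose proof (Rmax_r Y 1).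
        replace (eterm r2 r4 p t - RtoC 0)%C with (eterm r2 r4 p t) by ring. rewrite Cmod_eterm by (auto; unfold upper; lra).
        specialize (HY t ltac:(lra)).
        assert (Hc1 : 1 <= Rabs (IZR (fst p))) by (rewrite <- abs_IZR; apply IZR_le; lia).
        assert (Hlow : Im t <= Cmod (IZR (fst p) * t + IZR (snd p))).
        { pose proof (Im_le_Cmod (IZR (fst p) * t + IZR (snd p))%C) as Q. rewrite cz_Im, Rabs_mult, (Rabs_right (Im t)) in Q by lra. nra. }
        assert (Hp : Rpower (Cmod (IZR (fst p) * t + IZR (snd p))) (- k) <= / Im t).
        { rewrite Rpower_Ropp. apply Rinv_le_contravar; [lra |].
          apply Rle_trans with (Rpower (Im t) 1); [rewrite Rpower_1; lra |].
          apply Rle_trans with (Rpower (Im t) k); [apply Rle_Rpower; lra | apply Rle_Rpower_l; lra]. }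
        assert (Hpp : 0 < Rpower (Cmod (IZR (fst p) * t + IZR (snd p))) (- k)) by apply exp_pos.
        assert (Hlt : 2 * / Im t < e).
        { apply Rmult_lt_reg_r with (Im t); [lra |]. rewrite Rmult_assoc, Rinv_l by lra.
          assert (Q : 2 / e < Im t) by lra. apply (Rmult_lt_compat_l e) in Q; auto. replace (e * (2 / e)) with 2 in Q by (field; lra). lra. }
        pose proof (Cmod_ge_0 (invf r2 r4 t)). nra.
      * apply tends_ext with (fun _ => RtoC 0); auto; [| apply tends_const; auto]. exists 0. intros t _. rewrite eterm_bad; auto.
Qed.

Lemma rmul_inj a b c d p q : (a * d - b * c = 1)%Z -> rmul a b c d p = rmul a b c d q -> p = q.
Proof. intros H E. rewrite <- (rmul_inv a b c d p H), <- (rmul_inv a b c d q H), E. auto. Qed.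

(** The growth hypothesis bounds the logarithm of [|invf|] slashed by the matrix of a cusp, with
    [ee s] as local parameter. Every term is that factor times [|m t + n|^(-k)] for the row moved by
    the matrix, so the sum grows no faster, and [theta < 1] lets [ee s] win. *)
Lemma eis_ratio_growth (a b c d : Z) (w theta K Y : R) : (a * d - b * c = 1)%Z -> 0 < w -> theta < 1 ->
  (forall s, Y < Im s -> 0 < Im s -> k * ln (Cmod (IZR c * (RtoC w * s) + IZR d))
      - Re (LL r2 r4 (mobius a b c d (RtoC w * s))) <= K + 2 * PI * theta * Im s) ->
  tends strip (fun s => eis_ratio (mobius a b c d (RtoC w * s)) * ee s)%C 0%C.
Proof.
  intros Hdet Hw Hth HG. pose proof PI_RGT_0 as HPI.
  destruct (cz_power_bound w w Hw) as [B [HB H]].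
  destruct (proj2 (summable_inj pairbound (rmul a b c d) (fun p q => rmul_inj a b c d p q Hdet) pairbound_summable)) as [Z HZ].
  assert (HZ0 : 0 <= Z) by (apply Rle_trans with (2 := HZ nil (NoDup_nil _)); unfold rsum; simpl; lra).
  assert (Bd : forall s, 0 <= Re s <= 1 -> Rmax Y 1 < Im s ->
     Cmod (eis_ratio (mobius a b c d (RtoC w * s))) <= exp (K + 2 * PI * theta * Im s) * B * Z).
  { intros s Hr Hi. pose proof (Rmax_l Y 1); pose proof (Rmax_r Y 1).
    set (t := (RtoC w * s)%C).
    assert (Hti : Im t = w * Im s) by apply Im_real_mult. assert (Htr : Re t = w * Re s) by apply Re_real_mult.
    assert (Ht : upper t) by (unfold upper; rewrite Hti; nra).
    set (E := exp (K + 2 * PI * theta * Im s)). assert (HE : 0 < E) by apply exp_pos.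
    assert (Tb : forall p, Cmod (eterm r2 r4 p (mobius a b c d t)) <= E * B * pairbound (rmul a b c d p)).
    { intros p. assert (Hbb : 0 <= pairbound (rmul a b c d p)) by apply pairbound_summable.
      destruct (classic (good p)) as [Hg | Hn].
      2:{ rewrite eterm_bad, Cmod_0 by auto. apply Rmult_le_pos; auto. apply Rmult_le_pos; lra. }
      rewrite Cmod_eterm by (auto; apply upper_mobius; auto).
      rewrite cz_mobius by auto. pose proof (cz_neq_0 c d t Ht (det_row a b c d Hdet)) as N1.
      assert (Hne : (fst (rmul a b c d p) <> 0 \/ snd (rmul a b c d p) <> 0)%Z).
      { destruct (Z.eq_dec (fst (rmul a b c d p)) 0) as [E1 | E1]; auto. right. intros E2.
        apply (good_neq_0 p) in Hg as Hg0. rewrite <- (rmul_inv a b c d p Hdet) in Hg0.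
        unfold rmul at 1 3 in Hg0. cbn [fst snd] in Hg0. rewrite E1, E2 in Hg0. lia. }
      pose proof (cz_neq_0 _ _ t Ht Hne) as N2.
      rewrite Cmod_div by auto.
      change (fst p * a + snd p * c)%Z with (fst (rmul a b c d p)). change (fst p * b + snd p * d)%Z with (snd (rmul a b c d p)).
      set (u := Cmod (IZR (fst (rmul a b c d p)) * t + IZR (snd (rmul a b c d p)))) in *. set (v := Cmod (IZR c * t + IZR d)) in *.
      assert (Hu : 0 < u) by (apply Cmod_gt_0; auto). assert (Hv : 0 < v) by (apply Cmod_gt_0; auto).
      (* The cocycle relation: the factor of the row at the image point is that of the moved row
         divided by that of the cusp matrix. *)
      assert (Ediv : Rpower (u / v) (- k) = Rpower u (- k) * exp (k * ln v)).
      { unfold Rpower. rewrite <- exp_plus. f_equal. unfold Rdiv. rewrite ln_mult, ln_Rinv by (auto; apply Rinv_0_lt_compat; auto). ring. }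
      rewrite Ediv, Cmod_invf.
      replace (exp (- Re (LL r2 r4 (mobius a b c d t))) * (Rpower u (- k) * exp (k * ln v))) with
        (exp (k * ln v - Re (LL r2 r4 (mobius a b c d t))) * Rpower u (- k)) by (unfold Rminus; rewrite exp_plus; ring).
      rewrite Rmult_assoc. apply Rmult_le_compat; [left; apply exp_pos | left; apply exp_pos | |].
      - assert (L := HG s ltac:(lra) ltac:(lra)). fold t v in L. unfold E. destruct L as [L | L]; [left; apply exp_increasing; auto | rewrite L; lra].
      - destruct (rmul a b c d p) as [m n]. apply H; auto.
        + rewrite Htr, Rabs_right by nra. nra.
        + rewrite Hti. nra. }
    apply csum_bound with (fun p => E * B * pairbound (rmul a b c d p)).
    - apply summable_scal; [apply Rmult_le_pos; lra |].
      apply (summable_inj pairbound (rmul a b c d)); [intros p q; apply rmul_inj; auto | apply pairbound_summable].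
    - auto.
    - intros L HL. rewrite rsum_scal. apply Rmult_le_compat_l; [apply Rmult_le_pos; lra | auto]. }
  set (M := exp K * B * Z). assert (HM : 0 <= M) by (apply Rmult_le_pos; auto; apply Rmult_le_pos; auto; left; apply exp_pos).
  set (eta := 2 * PI * (1 - theta)). assert (Heta : 0 < eta) by (apply Rmult_lt_0_compat; lra).
  intros e He. exists (Rmax (Rmax Y 1) (M / (e * eta))). intros s Hr Hi.
  pose proof (Rmax_l (Rmax Y 1) (M / (e * eta))); pose proof (Rmax_r (Rmax Y 1) (M / (e * eta))). pose proof (Rmax_r Y 1).
  replace (eis_ratio (mobius a b c d (RtoC w * s)) * ee s - 0)%C with (eis_ratio (mobius a b c d (RtoC w * s)) * ee s)%C by ring.
  rewrite Cmod_mult, Cmod_ee. specialize (Bd s Hr ltac:(lra)).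
  assert (He0 : 0 < exp (- (2 * PI * Im s))) by apply exp_pos.
  apply Rle_lt_trans with (exp (K + 2 * PI * theta * Im s) * B * Z * exp (- (2 * PI * Im s))); [apply Rmult_le_compat_r; lra |].
  replace (exp (K + 2 * PI * theta * Im s) * B * Z * exp (- (2 * PI * Im s))) with (M * exp (- (eta * Im s))).
  2:{ unfold M, eta. replace (- (2 * PI * (1 - theta) * Im s)) with (2 * PI * theta * Im s + - (2 * PI * Im s)) by ring.
      rewrite !exp_plus. ring. }
  rewrite exp_Ropp. pose proof (exp_ineq1_le (eta * Im s)) as Q1.
  assert (Hes : 0 < e * eta) by (apply Rmult_lt_0_compat; auto).
  assert (Q2 : M < e * (eta * Im s)).
  { assert (Q : M / (e * eta) < Im s) by lra. apply (Rmult_lt_compat_l (e * eta)) in Q; auto.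
    replace (e * eta * (M / (e * eta))) with M in Q by (field; lra). lra. }
  assert (Hep : 0 < exp (eta * Im s)) by apply exp_pos.
  apply Rmult_lt_reg_r with (exp (eta * Im s)); auto. rewrite Rmult_assoc, Rinv_l by lra. nra.
Qed.

Lemma ln_Cmod_scale (r : R) (z : C) : 0 < r -> z <> 0%C -> ln (Cmod (RtoC r * z)) = ln r + ln (Cmod z).
Proof.
  intros Hr Hz. rewrite Cmod_mult, Cmod_R, Rabs_right by lra. apply ln_mult; auto. apply Cmod_gt_0; auto.
Qed.

Lemma Re_clog z : Re (clog z) = ln (Cmod z). Proof. reflexivity. Qed.

Lemma Re_logeta t : upper t -> Re (logeta t) = - (2 * PI * Im t / 24) + Re (Lsum t).
Proof.
  intros Ht. rewrite logeta_Lsum by auto. rewrite Re_Cplus. f_equal.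
  transitivity (Re (RtoC (/ 24) * (2 * PI * Ci * t))).
  - f_equal. rewrite RtoC_inv by lra. field.
  - unfold Re, Im; simpl. field.
Qed.

Lemma Lsum_bounded : exists Y, forall t, Y < Im t -> Rabs (Re (Lsum t)) <= 1.
Proof.
  destruct (Lsum_up 1 ltac:(lra)) as [Y HY]. exists Y. intros t Ht. specialize (HY t Ht).
  replace (Lsum t - 0)%C with (Lsum t) in HY by ring. pose proof (re_le_Cmod (Lsum t)). lra.
Qed.

Lemma combo_bound (a b : R) : Rabs b <= 1 -> a * b <= Rabs a.
Proof.
  intros H. eapply Rle_trans; [apply Rle_abs |]. rewrite Rabs_mult. pose proof (Rabs_pos a). nra.
Qed.

(** [theta] is the order of the eta quotient at the cusp 0: the exponent
    [(r1 + r2 / 2 + r4 / 4) / 24] in [t], times the width 4. *)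
Lemma eis_ratio_cusp_0 : tends strip (fun s => eis_ratio (mobius 0 (-1) 1 0 (RtoC 4 * s)) * ee s)%C 0%C.
Proof.
  destruct Lsum_bounded as [Y HY].
  set (R1 := r1R r2 r4). set (R2 := Q2R r2). set (R4 := Q2R r4).
  apply (eis_ratio_growth 0 (-1) 1 0 4 ((-2 * R2 - 5 * R4) / 8)
    (/ 2 * (R2 * ln 2 + R4 * ln 4) + (Rabs R1 + Rabs R2 + Rabs R4)) Y); auto; [lra | unfold R2, R4; lra |].
  intros s Hs Hp. set (t := (RtoC 4 * s)%C).
  assert (Hti : Im t = 4 * Im s) by apply Im_real_mult.
  assert (Ht : upper t) by (unfold upper; lra). pose proof (upper_neq_0 t Ht) as Hz.
  assert (Key : forall n, 1 <= n <= 4 -> Re (logeta (RtoC n * mobius 0 (-1) 1 0 t)) =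
     - (2 * PI * (Im t / n) / 24) + Re (Lsum (RtoC (/ n) * t)) + / 2 * (ln (Cmod t) - ln n)).
  { intros n Hn. assert (Hu : upper (RtoC (/ n) * t)).
    { unfold upper in *. rewrite Im_real_mult. apply Rmult_lt_0_compat; auto. apply Rinv_0_lt_compat; lra. }
    assert (Hnc : RtoC n <> 0%C) by (intro E; apply RtoC_inj in E; lra).
    replace (RtoC n * mobius 0 (-1) 1 0 t)%C with (- / (RtoC (/ n) * t))%C by (unfold mobius; rewrite RtoC_inv by lra; field; auto).
    rewrite logeta_S by auto. rewrite Re_Cplus, Re_logeta by auto.
    replace (/ 2 * clog (- Ci * (RtoC (/ n) * t)))%C with (RtoC (/ 2) * clog (- Ci * (RtoC (/ n) * t)))%C by (rewrite RtoC_inv by lra; auto).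
    rewrite Re_real_mult, Re_clog, Cmod_mult, Cmod_opp, Cmod_Ci, Rmult_1_l, ln_Cmod_scale by (auto; apply Rinv_0_lt_compat; lra).
    rewrite ln_Rinv, Im_real_mult by lra. unfold Rdiv. ring. }
  assert (B1 := HY (RtoC (/ 1) * t)%C ltac:(rewrite Im_real_mult, Hti; lra)).
  assert (B2 := HY (RtoC (/ 2) * t)%C ltac:(rewrite Im_real_mult, Hti; lra)).
  assert (B4 := HY (RtoC (/ 4) * t)%C ltac:(rewrite Im_real_mult, Hti; lra)).
  unfold LL. rewrite !Re_Cplus, !Re_real_mult, !Key by lra.
  replace (IZR 1 * t + IZR 0)%C with t by ring. rewrite ln_1.
  rewrite <- Rabs_Ropp in B1, B2, B4.
  pose proof (combo_bound R1 _ B1) as C1. pose proof (combo_bound R2 _ B2) as C2. pose proof (combo_bound R4 _ B4) as C4.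
  rewrite Hti. fold R1 R2 R4. unfold k, k0R. fold R1 R2 R4.
  assert (ER : R1 = -2 * R2 - 4 * R4) by reflexivity.
  set (L1 := Re (Lsum (RtoC (/ 1) * t))) in *. set (L2 := Re (Lsum (RtoC (/ 2) * t))) in *. set (L4 := Re (Lsum (RtoC (/ 4) * t))) in *.
  set (lt0 := ln (Cmod t)). set (y := Im s) in *.
  assert (Id : / 2 * (R1 + R2 + R4) * lt0 - (R1 * (- (2 * PI * (4 * y / 1) / 24) + L1 + / 2 * (lt0 - 0)) +
     R2 * (- (2 * PI * (4 * y / 2) / 24) + L2 + / 2 * (lt0 - ln 2)) + R4 * (- (2 * PI * (4 * y / 4) / 24) + L4 + / 2 * (lt0 - ln 4)))
     = / 2 * (R2 * ln 2 + R4 * ln 4) + (R1 * - L1 + R2 * - L2 + R4 * - L4) + 2 * PI * ((-2 * R2 - 5 * R4) / 8) * y).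
  { rewrite ER. field. }
  rewrite Id. lra.
Qed.

(** [theta] is the order [(r1 + 2 r2 + r4) / 24] of the eta quotient at the cusp 1/2, of width 1. *)
Lemma eis_ratio_cusp_half : tends strip (fun s => eis_ratio (mobius 1 0 2 1 (RtoC 1 * s)) * ee s)%C 0%C.
Proof.
  destruct Lsum_bounded as [Y HY].
  set (R1 := r1R r2 r4). set (R2 := Q2R r2). set (R4 := Q2R r4).
  apply (eis_ratio_growth 1 0 2 1 1 (- R4 / 8) (/ 2 * (R4 * ln 2) + (Rabs R1 + Rabs R2 + Rabs R4)) Y); auto; [lra | unfold R4; lra |].
  intros s Hs Hp. set (t := (RtoC 1 * s)%C).
  assert (Hti : Im t = Im s) by (unfold t; rewrite Im_real_mult; ring).
  assert (Ht : upper t) by (unfold upper; lra).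
  pose proof (cz_neq_0 2 1 t Ht ltac:(lia)) as Hz.
  assert (Ht2 : upper (RtoC 2 * t)) by (unfold upper in *; rewrite Im_real_mult; lra).
  assert (Hth : upper (t + RtoC (/ 2))) by (unfold upper in *; rewrite Im_Cplus; change (Im (RtoC (/ 2))) with 0; lra).
  assert (Law : forall a b c d u, (a * d - b * c = 1)%Z -> upper u ->
     Re (logeta (mobius a b c d u)) = - (2 * PI * Im u / 24) + Re (Lsum u) + / 2 * ln (Cmod (IZR c * u + IZR d))).
  { intros a b c d u Hdet Hu. rewrite (eta_law_SL2 a b c d Hdet u Hu). rewrite !Re_Cplus, Re_logeta by auto.
    replace (/ 2 * clog (IZR c * u + IZR d))%C with (RtoC (/ 2) * clog (IZR c * u + IZR d))%C by (rewrite RtoC_inv by lra; auto).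
    rewrite Re_real_mult, Re_clog.
    replace (Re (2 * PI * Ci / 24 * RtoC (Psi a b c d))) with 0; [ring |].
    replace (2 * PI * Ci / 24 * RtoC (Psi a b c d))%C with (RtoC (2 * PI * / 24 * Psi a b c d) * Ci)%C.
    - rewrite Re_real_mult. simpl. ring.
    - rewrite !RtoC_mult, RtoC_inv by lra. field. }
  assert (E1 : (RtoC 1 * mobius 1 0 2 1 t)%C = mobius 1 0 2 1 t) by ring.
  (* Scaling after the cusp matrix is factored as an element of SL_2(Z) after an upper triangular
     map, which is [2 t] for level 2 and [t + 1/2] for level 4. *)
  assert (E2 : (RtoC 2 * mobius 1 0 2 1 t)%C = mobius 1 0 1 1 (RtoC 2 * t)).
  { unfold mobius. field. replace (2 * t + 1)%C with (IZR 2 * t + IZR 1)%C by ring. auto. }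
  assert (E4 : (RtoC 4 * mobius 1 0 2 1 t)%C = mobius 2 (-1) 1 0 (t + RtoC (/ 2))).
  { unfold mobius. rewrite RtoC_inv by lra. field. intro HE; apply Hz; rewrite <- HE; ring. }
  unfold LL. rewrite !Re_Cplus, !Re_real_mult, E1, E2, E4, !Law by auto.
  replace (IZR 1 * (RtoC 2 * t) + IZR 1)%C with (IZR 2 * t + IZR 1)%C by ring.
  assert (E5 : ln (Cmod (IZR 1 * (t + RtoC (/ 2)) + IZR 0)) = ln (Cmod (IZR 2 * t + IZR 1)) - ln 2).
  { replace (IZR 1 * (t + RtoC (/ 2)) + IZR 0)%C with (RtoC (/ 2) * (IZR 2 * t + IZR 1))%C by (rewrite RtoC_inv by lra; field).
    rewrite ln_Cmod_scale, ln_Rinv by (auto; lra). ring. }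
  rewrite E5.
  assert (B1 := HY t ltac:(lra)). assert (B2 := HY (RtoC 2 * t)%C ltac:(rewrite Im_real_mult; lra)).
  assert (B4 := HY (t + RtoC (/ 2))%C ltac:(rewrite Im_Cplus; change (Im (RtoC (/ 2))) with 0; lra)).
  rewrite <- Rabs_Ropp in B1, B2, B4.
  pose proof (combo_bound R1 _ B1) as C1. pose proof (combo_bound R2 _ B2) as C2. pose proof (combo_bound R4 _ B4) as C4.
  rewrite Im_real_mult. replace (Im (t + RtoC (/ 2))) with (Im t) by (rewrite Im_Cplus; change (Im (RtoC (/ 2))) with 0; ring). rewrite Hti.
  fold R1 R2 R4. unfold k, k0R. fold R1 R2 R4.
  assert (ER : R1 = -2 * R2 - 4 * R4) by reflexivity.
  set (L1 := Re (Lsum t)) in *. set (L2 := Re (Lsum (RtoC 2 * t))) in *. set (L4 := Re (Lsum (t + RtoC (/ 2)))) in *.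
  set (lv := ln (Cmod (IZR 2 * t + IZR 1))). set (y := Im s) in *.
  assert (Id : / 2 * (R1 + R2 + R4) * lv - (R1 * (- (2 * PI * y / 24) + L1 + / 2 * lv) +
     R2 * (- (2 * PI * (2 * y) / 24) + L2 + / 2 * lv) + R4 * (- (2 * PI * y / 24) + L4 + / 2 * (lv - ln 2)))
     = / 2 * (R4 * ln 2) + (R1 * - L1 + R2 * - L2 + R4 * - L4) + 2 * PI * (- R4 / 8) * y).
  { rewrite ER. field. }
  rewrite Id. lra.
Qed.

Lemma eis_ratio_eq_2 t : upper t -> eis_ratio t = 2%C.
Proof.
  destruct eis_ratio_hol as [g' Hg]. apply (liouville_gamma04 eis_ratio g' 2%C Hg).
  - intros; apply eis_ratio_invariant; auto.
  - apply eis_ratio_cusp_oo.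
  - apply eis_ratio_cusp_0.
  - apply eis_ratio_cusp_half.
Qed.
End Eisenstein.

(** * Cosets *)

Section Cosets.
Variable D : nat.
Hypothesis HD : (1 <= D)%nat.

Lemma inGt_eps g : inGt D g -> exists eps, (eps ^ D)%C = 1%C /\ eps <> 0%C /\ eps_of D g = eps /\
  forall tau, upper tau -> gphi g tau = (eps * cpowr (IZR (gc g) * tau + IZR (gd g)) (RtoC (/ INR D)))%C.
Proof.
  intros [Hdet [_ [eps [He Hphi]]]]. exists eps. split; auto. split; [| split; auto].
  - intros ->. destruct D as [| D']; [lia |]. rewrite Cpow_S, Cmult_0_l in He. apply RtoC_inj in He. lra.
  - unfold eps_of. rewrite Hphi by (unfold upper; simpl; lra). field. apply cexp_neq_0.
Qed.

(** The root of unity occurs to the power [- D k] both in the character and in the slash action, and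
    cancels; it can be split off because [D k] is an integer. What is left depends on the bottom row
    alone. *)
Lemma eis_term_eterm r2 r4 (M : Z) g t : INR D * k0R r2 r4 = IZR M -> inGt D g -> upper t ->
  eis_term D r2 r4 g t = (eta_quot r2 r4 t * eterm r2 r4 (gc g, gd g) t)%C.
Proof.
  intros HM Hg Ht. destruct (inGt_eps g Hg) as [eps [_ [Hn [He Hphi]]]]. destruct Hg as [Hdet [Hc _]].
  assert (HDR : INR D <> 0) by (apply not_0_INR; lia).
  unfold eis_term, chi, slash1. cbv zeta. rewrite He, (Hphi t Ht).
  replace (/ 2 * (- Q2R r2 - 3 * Q2R r4)) with (k0R r2 r4) by (unfold k0R, r1R; field).
  rewrite HM, <- opp_IZR. unfold cpowr at 3. rewrite cpowr_int_mult by (auto; apply cexp_neq_0). rewrite cpowr_int_cexp.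
  fold (Psum r2 r4 (ga g) (gb g) (gc g) (gd g)).
  rewrite (eterm_row r2 r4 (ga g) (gb g) (gc g) (gd g)) by auto. rewrite invf_inv, !eta_quot_LL, LL_transform by auto.
  rewrite !cexp_add. fold (ee (RtoC (Psum r2 r4 (ga g) (gb g) (gc g) (gd g)))).
  set (cz := clog (IZR (gc g) * t + IZR (gd g))).
  assert (E : (IZR (- M) * (RtoC (/ INR D) * cz))%C = (- (RtoC (k0R r2 r4) * cz))%C).
  { rewrite opp_IZR, <- HM, RtoC_opp, RtoC_mult, RtoC_inv by auto. field. intro HE; apply RtoC_inj in HE; auto. }
  rewrite E, cexp_opp. field. repeat split; try apply cexp_neq_0; apply ee_neq_0.
Qed.

Definition rootidx (g : GElt) : nat := epsilon (inhabits 0%nat) (fun j => (j < D)%nat /\ eps_of D g = ee (RtoC (INR j / INR D))).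

Lemma rootidx_spec g : inGt D g -> (rootidx g < D)%nat /\ eps_of D g = ee (RtoC (INR (rootidx g) / INR D)).
Proof.
  intros Hg. unfold rootidx. apply (epsilon_spec (inhabits 0%nat) (fun j => (j < D)%nat /\ eps_of D g = ee (RtoC (INR j / INR D)))).
  destruct (inGt_eps g Hg) as [eps [H1 [_ [-> _]]]]. apply root_of_unity; auto.
Qed.

(** A complete invariant of the coset: left multiplication by a power of the lift of [T] preserves
    the bottom row and the root of unity. *)
Definition key (g : GElt) : (Z * Z) * nat := ((gc g, gd g), rootidx g).

Lemma key_same_coset g h : inGt D g -> inGt D h -> key g = key h -> same_coset D g h.
Proof.
  intros Hg Hh E. unfold key in E. injection E as Ec Ed Ej.
  destruct (rootidx_spec g Hg) as [_ Eg]. destruct (rootidx_spec h Hh) as [_ Eh].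
  destruct (inGt_eps g Hg) as [eg [_ [_ [Eg2 Pg]]]]. destruct (inGt_eps h Hh) as [eh [_ [_ [Eh2 Ph]]]].
  assert (Ee : eg = eh) by congruence. destruct Hg as [Dg _]. destruct Hh as [Dh _].
  rewrite <- Ec, <- Ed in Dh. set (n := (ga g * (gb h - gb g) - gb g * (ga h - ga g))%Z).
  assert (Hx : ((ga h - ga g) * gd g = (gb h - gb g) * gc g)%Z) by lia.
  assert (Ea : ga h = (ga g + n * gc g)%Z).
  { assert ((n * gc g = (ga h - ga g) * (ga g * gd g - gb g * gc g))%Z); [| rewrite Dg in H; lia].
    unfold n. transitivity (ga g * ((gb h - gb g) * gc g) - gb g * (ga h - ga g) * gc g)%Z; [ring | rewrite <- Hx; ring]. }
  assert (Eb : gb h = (gb g + n * gd g)%Z).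
  { assert ((n * gd g = (gb h - gb g) * (ga g * gd g - gb g * gc g))%Z); [| rewrite Dg in H; lia].
    unfold n. transitivity (ga g * (gb h - gb g) * gd g - gb g * ((ga h - ga g) * gd g))%Z; [ring | rewrite Hx; ring]. }
  exists n. unfold geq, gmul, Tpow, gtilde. cbn [ga gb gc gd gphi].
  split; [lia |]. split; [lia |]. split; [lia |]. split; [lia |].
  intros t Ht. replace (IZR 0 * mobius (ga g) (gb g) (gc g) (gd g) t + IZR 1)%C with (RtoC 1) by ring.
  rewrite cpowr_1, Pg, Ph, Ee, Ec, Ed by auto. ring.
Qed.

Lemma key_surj (S : GElt -> Prop) p j : coset_reps D S -> good p -> (j < D)%nat -> exists g, S g /\ key g = (p, j).
Proof.
  intros [HS1 [HS2 _]] Hg Hj. pose proof (toprow_spec p (proj1 Hg)) as Hp. assert (HDR : INR D <> 0) by (apply not_0_INR; lia).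
  set (e := ee (RtoC (INR j / INR D))).
  set (g0 := mkG (fst (toprow p)) (snd (toprow p)) (fst p) (snd p)
     (fun tau => (e * cpowr (IZR (fst p) * tau + IZR (snd p)) (RtoC (/ INR D)))%C)).
  assert (Hg0 : inGt D g0).
  { split; [exact Hp |]. split; [apply Hg |]. exists e. split; auto.
    unfold e, ee. rewrite Cpow_cexp. replace (INR D * (2 * PI * Ci * RtoC (INR j / INR D)))%C with (2 * PI * Ci * IZR (Z.of_nat j))%C.
    - apply cexp_2pi_Z.
    - rewrite <- INR_IZR_INZ, RtoC_div by auto. field. intro HE; apply RtoC_inj in HE; auto. }
  destruct (HS2 g0 Hg0) as [h [Sh [n [E1 [E2 [E3 [E4 E5]]]]]]]. exists h. split; auto.
  unfold gmul, Tpow, gtilde in *. cbn [ga gb gc gd gphi] in *.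
  assert (Ec : gc h = fst p) by (rewrite E3; unfold g0; cbn [ga gb gc gd]; ring). assert (Ed : gd h = snd p) by (rewrite E4; unfold g0; cbn [ga gb gc gd]; ring).
  unfold key. rewrite Ec, Ed. f_equal; [destruct p; auto |].
  pose proof (HS1 h Sh) as Hh. destruct (rootidx_spec h Hh) as [L1 L2].
  apply (root_of_unity_inj D); auto. rewrite <- L2. unfold eps_of. rewrite E5 by (unfold upper; simpl; lra).
  replace (IZR 0 * mobius (ga g0) (gb g0) (gc g0) (gd g0) Ci + IZR 1)%C with (RtoC 1) by ring.
  rewrite cpowr_1, Ec, Ed. unfold g0. cbn [gphi]. fold e. field. apply cexp_neq_0.
Qed.
End Cosets.

(** Keys that no element of [S] has carry the value 0, so a finite list of keys can be traded for a
    finite list of elements of [S]. *)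
Lemma is_usum_transfer {K} (S : GElt -> Prop) (F : GElt -> C) (F' : K -> C) (phi : GElt -> K) l :
  (forall g, S g -> F g = F' (phi g)) -> (forall g h, S g -> S h -> phi g = phi h -> g = h) ->
  (forall q, F' q <> 0%C -> exists g, S g /\ phi g = q) -> has_sum F' l -> is_usum S F l.
Proof.
  intros HF Hinj Hsurj H e He. destruct (H e He) as [M0 HM0].
  assert (Pre : forall M, NoDup M -> exists L, NoDup L /\ (forall g, In g L -> S g /\ In (phi g) M) /\
     forall q, In q M -> (exists g, S g /\ phi g = q) -> exists g, In g L /\ phi g = q).
  { induction M as [| q M IH]; intros HN.
    - exists nil. split; [constructor |]. split; simpl; tauto.
    - apply NoDup_cons_iff in HN. destruct HN as [Hq HN]. destruct (IH HN) as [L [L1 [L2 L3]]].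
      destruct (classic (exists g, S g /\ phi g = q)) as [[g [Sg Eg]] | Hn].
      + exists (g :: L). split; [| split].
        * constructor; auto. intros Hi. apply L2 in Hi. destruct Hi as [_ Hi]. rewrite Eg in Hi. tauto.
        * intros h [<- | Hh]; [split; [auto | left; auto] |]. destruct (L2 h Hh). split; [auto | right; auto].
        * intros q' [<- | Hq'] Hex; [exists g; split; [left |]; auto |]. destruct (L3 q' Hq' Hex) as [h [Hh Eh]]. exists h. split; [right |]; auto.
      + exists L. split; auto. split.
        * intros h Hh. destruct (L2 h Hh). split; [auto | right; auto].
        * intros q' [<- | Hq'] Hex; [tauto | auto]. }
  destruct (Pre (nodup eq_dec M0) (NoDup_nodup _ _)) as [L0 [N0 [S0 C0]]].
  exists L0. split; auto. split; [intros g Hg; apply S0; auto |]. intros L NL SL HI.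
  (* The keys of [M0] missed by [L]. Adding them makes the list contain [M0] and costs nothing,
     since [F'] vanishes on them. *)
  set (N := filter (fun q => if in_dec eq_dec q (map phi L) then false else true) (nodup eq_dec M0)).
  assert (Nz : forall q, In q N -> F' q = 0%C).
  { intros q Hq. apply filter_In in Hq. destruct Hq as [H1 H2]. destruct (in_dec eq_dec q (map phi L)) as [Hi | Hi]; [discriminate |].
    apply NNPP. intros Hne. destruct (C0 q H1 (Hsurj q Hne)) as [g [Hg Eg]]. apply Hi. rewrite <- Eg. apply in_map, HI; auto. }
  specialize (HM0 (map phi L ++ N)).
  assert (E : fsum F' (map phi L ++ N) = lsum F L).
  { rewrite fsum_app, fsum_map.
    assert (E0 : fsum F' N = 0%C).
    { clear - Nz. induction N as [| q N IH]; [reflexivity |]. unfold fsum in *; simpl. rewrite IH by (intros; apply Nz; simpl; auto).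
      rewrite Nz by (simpl; auto). ring. }
    rewrite E0, Cplus_0_r. unfold fsum, lsum. f_equal. apply map_ext_in. intros g Hg. symmetry. apply HF; auto. }
  rewrite <- E. apply HM0.
  - apply NoDup_app; [apply NoDup_map_inj; auto; intros; apply Hinj; auto | apply NoDup_filter, NoDup_nodup |].
    intros q Hq1 Hq2. apply filter_In in Hq2. destruct Hq2 as [_ Hq2]. destruct (in_dec eq_dec q (map phi L)); [discriminate | tauto].
  - intros q Hq. apply in_app_iff. destruct (in_dec eq_dec q (map phi L)) as [Hi | Hi]; [left; auto | right].
    apply filter_In. split; [apply nodup_In; auto |]. destruct (in_dec eq_dec q (map phi L)); tauto.
Qed.

Lemma Q2R_inject_Z (z : Z) : Q2R (inject_Z z) = IZR z.
Proof. unfold Q2R, inject_Z. simpl. field. Qed.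

Theorem theorem8p4 (r2 r4 : Q) (D : nat)
  (h1 : (0 <= -2 * r2 - 5 * r4)%Q) (h2 : (-2 * r2 - 5 * r4 < 8)%Q)
  (h3 : (0 <= - r4)%Q) (h4 : (- r4 < 8)%Q)
  (h5 : (8 < (-2 * r2 - 5 * r4) + (- r4))%Q)
  (hD : (1 <= D)%nat)
  (hD2 : exists m : Z, (inject_Z (Z.of_nat D) * r2 == inject_Z (2 * m))%Q)
  (hD4 : exists m : Z, (inject_Z (Z.of_nat D) * r4 == inject_Z (2 * m))%Q) :
  forall (S : GElt -> Prop), coset_reps D S ->
  forall tau : C, upper tau ->
  exists E : C,
    is_usum S (fun g => eis_term D r2 r4 g tau) E /\
    eta_quot r2 r4 tau = (/ (2 * INR D) * E)%C.
Proof.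
  intros S HS tau Ht.
  assert (QI : forall n : Z, Q2R (n # 1) = IZR n) by (intros; unfold Q2R; simpl; field).
  apply Qle_Rle in h1, h3. apply Qlt_Rlt in h2, h4, h5.
  rewrite ?Q2R_plus, ?Q2R_minus, ?Q2R_opp, ?Q2R_mult, ?QI in *.
  destruct hD2 as [m2 H2]. destruct hD4 as [m4 H4]. apply Qeq_eqR in H2, H4.
  rewrite Q2R_mult, !Q2R_inject_Z, <- INR_IZR_INZ, mult_IZR in H2, H4.
  (* As [k = - (r2 + 3 r4) / 2], the evenness of [D r2] and [D r4] makes [D k] an integer. *)
  assert (HM : INR D * k0R r2 r4 = IZR (- m2 - 3 * m4)).
  { unfold k0R, r1R. rewrite minus_IZR, opp_IZR, mult_IZR. lra. }
  assert (HDR : INR D <> 0) by (apply not_0_INR; lia).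
  assert (HDC : RtoC (INR D) <> 0%C) by (intro HE; apply RtoC_inj in HE; auto).
  set (f := eta_quot r2 r4 tau).
  (* The second component of a key runs over all natural numbers; the cut-off keeps the [D] roots of
     unity. *)
  set (ind := fun j : nat => if Nat.ltb j D then RtoC 1 else RtoC 0).
  set (F' := fun q : (Z * Z) * nat => (f * eterm r2 r4 (fst q) tau * ind (snd q))%C).
  (* Every row occurs with [D] roots of unity, and [eis_ratio] is 2. *)
  exists (INR D * (f * 2))%C. split; [| field; auto].
  apply (is_usum_transfer S _ F' (key D)).
  - intros g Sg. pose proof (proj1 HS g Sg) as Hg. rewrite (eis_term_eterm D hD r2 r4 _ g tau HM Hg Ht).
    unfold F', key, ind. cbn [fst snd]. destruct (rootidx_spec D hD g Hg) as [Hj _]. apply Nat.ltb_lt in Hj. rewrite Hj. fold f. ring.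
  - intros g h Sg Sh E. apply (proj2 (proj2 HS)); auto. apply key_same_coset; auto; apply HS; auto.
  - intros [p j] Hne. unfold F', ind in Hne. cbn [fst snd] in Hne. apply (key_surj D hD S p j); auto.
    + apply NNPP. intros Hn. apply Hne. rewrite eterm_bad by auto. ring.
    + destruct (Nat.ltb_spec j D); auto. exfalso. apply Hne. ring.
  - destruct (eterm_dominated r2 r4 h1 h2 h5 tau Ht) as [b [Hb HB]].
    assert (Sb : summable (fun q : (Z * Z) * nat => Cmod f * (b (fst q) * (if Nat.ltb (snd q) D then 1 else 0)))).
    { apply summable_scal; [apply Cmod_ge_0 |]. apply (summable_prod b (fun j => if Nat.ltb j D then 1 else 0)); auto.
      split; [intros j; destruct (Nat.ltb j D); lra |]. exists (INR D). intros L HL.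
      apply Rle_trans with (rsum (fun j => if Nat.ltb j D then 1 else 0) (seq 0 D ++ filter (fun j => negb (Nat.ltb j D)) L)).
      - apply rsum_incl; auto; [intros j; destruct (Nat.ltb j D); lra |]. intros j Hj. apply in_app_iff.
        destruct (Nat.ltb_spec j D); [left; apply in_seq; lia | right]. apply filter_In. split; auto.
        apply Bool.negb_true_iff, Nat.ltb_ge. auto.
      - rewrite rsum_app.
        assert (E1 : forall n, (n <= D)%nat -> rsum (fun j => if Nat.ltb j D then 1 else 0) (seq 0 n) = INR n).
        { induction n as [| n IH]; intros Hn; [reflexivity |]. rewrite seq_S, rsum_app, IH, S_INR by lia. unfold rsum; cbn [map fold_right].
          change (0 + n)%nat with n. destruct (Nat.ltb_spec n D); [ring | lia]. }
        rewrite E1 by lia. assert (E2 : rsum (fun j => if Nat.ltb j D then 1 else 0) (filter (fun j => negb (Nat.ltb j D)) L) = 0).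
        { clear. induction L as [| j L IH]; [reflexivity |]. simpl. destruct (Nat.ltb j D) eqn:Ej; simpl; auto.
          unfold rsum in *. simpl. rewrite Ej, IH. ring. }
        lra. }
    assert (FB : forall q, Cmod (F' q) <= Cmod f * (b (fst q) * (if Nat.ltb (snd q) D then 1 else 0))).
    { intros [p j]. unfold F', ind. cbn [fst snd]. rewrite !Cmod_mult, Rmult_assoc. apply Rmult_le_compat_l; [apply Cmod_ge_0 |].
      destruct (Nat.ltb j D); rewrite ?Cmod_1, ?Cmod_0; [rewrite !Rmult_1_r; auto | lra]. }
    pose proof (csum_spec F' _ Sb FB) as HF.
    assert (HG : has_sum (fun p => INR D * f * eterm r2 r4 p tau)%C (csum F')).
    { apply fubini with F'; auto. intros p.
      assert (Hind : has_sum ind (RtoC (INR D))).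
      { replace (RtoC (INR D)) with (fsum ind (seq 0 D)).
        - apply has_sum_finite; [apply seq_NoDup |]. intros j Hj. unfold ind. destruct (Nat.ltb_spec j D); auto. exfalso. apply Hj, in_seq. lia.
        - assert (E1 : forall n, (n <= D)%nat -> fsum ind (seq 0 n) = RtoC (INR n)).
          { induction n as [| n IH]; intros Hn; [reflexivity |]. rewrite seq_S, fsum_app, IH, S_INR, RtoC_plus by lia. unfold fsum, ind; cbn [map fold_right].
            change (0 + n)%nat with n. destruct (Nat.ltb_spec n D); [ring | lia]. }
          apply E1; lia. }
      replace (INR D * f * eterm r2 r4 p tau)%C with (f * eterm r2 r4 p tau * INR D)%C by ring.
      apply (has_sum_scal (f * eterm r2 r4 p tau)%C) in Hind. exact Hind. }
    assert (E : csum F' = (INR D * (f * 2))%C).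
    { apply (has_sum_unique _ _ _ HG). replace (INR D * (f * 2))%C with (INR D * f * eis_ratio r2 r4 tau)%C.
      - apply has_sum_scal. apply eis_ratio_spec; auto.
      - rewrite eis_ratio_eq_2 by auto. ring. }
    rewrite <- E. auto.
Qed.
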